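(* The index $\mu_{\mathrm{Rab}}$ depends only on the hypersurface $\Sigma=H^{-1}(k)$ and not on the Hamiltonian defining it. That is: let $H$ be a Tonelli Hamiltonian on $T^*M$ with regular value $k$, $\Sigma=H^{-1}(k)$, and let $F\in C^\infty(T^*M,\mathbb{R})$ be another Hamiltonian with $F^{-1}(k)=\Sigma$ such that $X_H|_\Sigma=fX_F|_\Sigma$ for some positive function $f\in C^\infty(\Sigma,\mathbb{R}^+)$. Let $(x,\eta)$, $\eta\neq0$, be a critical point of the Rabinowitz action functional of $H$ and let $(x',\eta')$ be the corresponding critical point of the Rabinowitz action functional of $F$ (the same closed characteristic, reparametrized). If both $(x,\eta)$ and $(x',\eta')$ admit non-degenerate orbit cylinders (for $H$ and for $F$ respectively), then $$\mu_{\mathrm{Rab}}(x,\eta)=\mu_{\mathrm{Rab}}(x',\eta').$$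
   Context: Setting. $(M,g)$ is a closed connected orientable Riemannian manifold of dimension $n$, $\pi:T^*M\to M$, $\omega_0=d\lambda_0=dp\wedge dq$, $\sigma\in\Omega^2(M)$ a closed $2$-form whose lift to the universal cover has a bounded primitive, $\omega=\omega_0+\pi^*\sigma$. For a Hamiltonian $H$, $X_H$ is defined by $\omega(\cdot,X_H)=dH$ and $\phi^H_t$ is its flow. $H$ is Tonelli if its fibrewise Hessian is positive definite and $H(q,p)/|p|\to\infty$ as $|p|\to\infty$ uniformly in $q$. Critical points of the Rabinowitz action functional $\mathcal{A}_k(x,\eta)=\int_{S^1}x^*\lambda_0+\int_{S^1\times[0,1]}\bar q^*\sigma-\eta\int_{S^1}(H(x)-k)dt$ ($q=\pi\circ x$, $\bar q$ a homotopy from $q$ to a fixed reference loop in its free homotopy class) on $\Lambda T^*M\times\mathbb{R}$ ($\Lambda T^*M$ the $W^{1,2}$ loops $S^1=\mathbb{R}/\mathbb{Z}\to T^*M$) are the pairs $(x,\eta)$ with $x$ smooth, $\dot x=\eta X_H(x)$, $x(S^1)\subseteq\Sigma$; similarly for $F$. Corresponding critical points: if $X_H|_\Sigma=fX_F|_\Sigma$ with $f>0$ and $y:\mathbb{R}/T\mathbb{Z}\to\Sigma$ is a closed orbit of $X_H$, set $\alpha(t)=\int_0^tf(y(s))ds$; then $z(t)=y(\alpha^{-1}(t))$, $z:\mathbb{R}/\alpha(T)\mathbb{Z}\to\Sigma$, is the corresponding closed orbit of $X_F$. If $(x,\eta)$ is a critical point for $H$, the corresponding one for $F$ is obtained by applying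 this to the underlying $X_H$-orbit $t\mapsto x(t/\eta)$ of period $|\eta|$, and keeping the sign of $\eta$. Orbit cylinders and correction term. A closed orbit $y:\mathbb{R}/T\mathbb{Z}\to\Sigma$ of $X_H$ admits an orbit cylinder if there is a family $(y_{k+s})_{s\in(-\varepsilon,\varepsilon)}$, smooth in $s$, of closed orbits $y_{k+s}:\mathbb{R}/T(k+s)\mathbb{Z}\to T^*M$ of $X_H$ with $H(y_{k+s})\equiv k+s$, $y_k=y$; it is non-degenerate if $T'(k)\neq0$, and then $\chi(y)=\mathrm{sign}(-T'(k))$. For a critical point $(x,\eta)$ with $\eta\ne0$ put $y(t)=x(t/|\eta|)$, $y:\mathbb{R}/|\eta|\mathbb{Z}\to\Sigma$ (an $X_H$-orbit, traversed backwards if $\eta<0$); $(x,\eta)$ admits a non-degenerate orbit cylinder if the underlying $X_H$-orbit does, and $\chi(x,\eta)=\mathrm{sign}(\eta)\chi(y)$, with $\chi(y)$ the correction term of the underlying $X_H$-orbit. Index. $\mu_{\mathrm{Rab}}(x,\eta):=\mu_{\mathrm{CZ}}(y)-\frac12\chi(x,\eta)$, where $\mu_{\mathrm{CZ}}(y)=\mu_{\mathrm{Ma}}(\mathrm{graph}(\lambda),\Delta_{\mathbb{R}^{2n}})$ is the Conley–Zehnder index (Robbin–Salamon relative Maslov index with respect to the diagonal) of the path $\lambda(t)=\Omega(t)^{-1}\circ d_{y(0)}\phi^H_{\mathrm{sign}(\eta)t}\circ\Omega(0)\in\mathrm{Sp}(2n)$, $t\in[0,|\eta|]$, for any symplectic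 trivialization $\Omega$ of $y^*TT^*M$ over $\mathbb{R}/|\eta|\mathbb{Z}$ mapping $(0)\times\mathbb{R}^n$ onto the vertical spaces $\ker d_{y(t)}\pi$ (the index does not depend on $\Omega$). The sign is normalized so that flows of positive definite quadratic Hamiltonians have positive index (with $\omega_0=dp\wedge dq$, $\dot q=\partial_pH$, $\dot p=-\partial_qH$); e.g. $(q,p)\mapsto(q+tp,p)$, $t\in[0,1]$, has index $+\frac12$. The same definitions apply to $F$. *)

(* Defs.v *)
From HB Require Import structures.
From mathcomp Require Import all_boot all_order all_algebra.
From mathcomp Require Import all_classical all_reals all_analysis.

Set Implicit Arguments.
Unset Strict Implicit.
Unset Printing Implicit Defensive.

Import Order.TTheory GRing.Theory Num.Theory.
Import numFieldNormedType.Exports.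

Local Open Scope classical_set_scope.
Local Open Scope ring_scope.

(* Linear maps act on row vectors on the right, as in 'J (derive.v): the       *)
(* differential of f at a is v |-> v *m 'J f a.                                *)

Section Smooth.
Context {R : realType} {E F : normedModType R}.

(* Meant for open A and finite-dimensional E, where continuity of all
   directional derivatives is continuity of the differential. *)
Fixpoint Ck (k : nat) (A : set E) (f : E -> F) : Prop :=
  (forall a, A a -> {for a, continuous f}) /\
  if k is k'.+1 then
    forall v, (forall a, A a -> derivable f a v) /\ Ck k' A (fun a => 'D_v f a)
  else True.

Definition smooth (A : set E) (f : E -> F) : Prop := forall k, Ck k A f.

(* f read through the injection phi : A -> E, i.e. f o phi^-1 on phi(A). *)
Definition rep_on (X : Type) (A : set X) (phi : X -> E) (f : X -> F) : E -> F :=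
  fun e => xget 0 [set v | exists a, [/\ A a, phi a = e & f a = v]].

End Smooth.

Record charts (R : realType) (m : nat) (X : Type) := Charts {
  idx : Type;
  dom : idx -> set X;
  crd : idx -> X -> 'rV[R]_m }.

Section Charts.
Context {R : realType} {m : nat} {X : Type} (C : charts R m X).

Definition rep (F : normedModType R) (i : idx C) (f : X -> F) :
    'rV[R]_m -> F :=
  rep_on (dom i) (crd i) f.

Definition tjac (i j : idx C) (x : X) : 'M[R]_m :=
  'J (rep i (crd j)) (crd i x).

Definition smooth_fun (f : X -> R) : Prop :=
  forall i : idx C, smooth (crd i @` dom i) (rep i f).

Definition smooth_into (E : normedModType R) (A : set E) (u : E -> X) : Prop :=
  forall (a : E) (i : idx C), A a -> dom i (u a) ->
    exists B : set E, [/\ open B, B a, (forall b, B b -> dom i (u b)) &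
                          smooth B (crd i \o u)].

Definition smooth_on_subset (S : set X) (f : X -> R) : Prop :=
  forall (x : X) (i : idx C), S x -> dom i x ->
    exists (B : set 'rV[R]_m) (h : 'rV[R]_m -> R),
      [/\ open B, B (crd i x), smooth B h &
          forall y, S y -> dom i y -> B (crd i y) -> f y = h (crd i y)].

End Charts.

Record manifold (R : realType) (n : nat) := Manifold {
  carrier :> topologicalType;
  atlas : charts R n carrier;
  manifold_hausdorff : hausdorff_space carrier;
  manifold_second_countable : @second_countable carrier;
  dom_cover : forall x, exists i : idx atlas, dom i x;
  dom_open : forall i : idx atlas, open (dom i);
  crd_inj : forall (i : idx atlas) x y,
    dom i x -> dom i y -> crd i x = crd i y -> x = y;
  crd_continuous : forall (i : idx atlas) x,
    dom i x -> {for x, continuous (crd i)};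
  crd_open : forall (i : idx atlas) (V : set carrier),
    open V -> V `<=` dom i -> open (crd i @` V);
  trans_smooth : forall i j : idx atlas,
    smooth (crd i @` (dom i `&` dom j)) (rep i (crd j)) }.

Section Geometry.
Context {R : realType} {n : nat} (M : manifold R n).
Local Notation I := (idx (atlas M)).

(* eps i x tells whether the chart i is positively oriented at x. *)
Definition orientable : Prop :=
  exists eps : I -> M -> bool,
    (forall i x, dom i x -> \forall y \near x, eps i y = eps i x) /\
    (forall i j x, dom i x -> dom j x ->
       0 < (-1) ^+ (eps i x (+) eps j x) * \det (tjac i j x)).

(* A covariant 2-tensor T is given by its matrices T x i in the charts i
   around x; T x i is irrelevant when x is not in the domain of i. *)
Definition tensor2 := M -> I -> 'M[R]_n.

Definition is_tensor2 (T : tensor2) : Prop :=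
  (forall i j x, dom i x -> dom j x ->
     T x i = tjac i j x *m T x j *m (tjac i j x)^T) /\
  (forall i, smooth (crd i @` dom i) (rep i (T ^~ i))).

Definition riemannian_metric (g : tensor2) : Prop :=
  is_tensor2 g /\
  forall x i, dom i x ->
    (g x i)^T = g x i /\
    forall v : 'rV[R]_n, v != 0 -> 0 < (v *m g x i *m v^T) 0 0.

(* sigma x i a b = sigma_x (e_a, e_b) *)
Definition closed_2form (sigma : tensor2) : Prop :=
  [/\ is_tensor2 sigma,
      (forall x i, dom i x -> (sigma x i)^T = - sigma x i) &
      forall x i (a b c : 'I_n), dom i x ->
        let s := rep i (sigma ^~ i) in
        let D (l : 'I_n) := 'D_(delta_mx 0 l) s (crd i x) in
        D a b c + D b c a + D c a b = 0].

Definition covering_map (N : topologicalType) (p : N -> M) : Prop :=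
  [/\ continuous p, p @` setT = setT &
      forall q : M, exists (V : set M) (S : set (set N)),
        [/\ open V, V q, trivIset S id, p @^-1` V = \bigcup_(U in S) U &
            forall U, S U ->
              [/\ open U, p @` U = V,
                  (forall x y, U x -> U y -> p x = p y -> x = y) &
                  forall W, open W -> W `<=` U -> open (p @` W)]]].

Definition simply_connected (N : topologicalType) : Prop :=
  (forall x y : N, exists c : R -> N, [/\ continuous c, c 0 = x & c 1 = y]) /\
  (forall c : R -> N, continuous c -> c 0 = c 1 ->
     exists h : R * R -> N,
       [/\ continuous h,
           (forall t, 0 <= t <= 1 -> h (0, t) = c t),
           (forall t, 0 <= t <= 1 -> h (1, t) = c 0) &
           (forall s, 0 <= s <= 1 -> h (s, 0) = c 0 /\ h (s, 1) = c 0)]).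

(* A 1-form theta on N is given by its components theta x i in the coordinates
   crd i \o p near x. *)
Definition bounded_primitive (g sigma : tensor2) (N : topologicalType)
    (p : N -> M) (theta : N -> I -> 'rV[R]_n) : Prop :=
  [/\ (forall i j x, dom i (p x) -> dom j (p x) ->
         theta x i = theta x j *m (tjac i j (p x))^T),
      (forall (i : I) (V : set N), open V -> V `<=` p @^-1` dom i ->
         (forall x y, V x -> V y -> p x = p y -> x = y) ->
         let th := rep_on V (crd i \o p) (theta ^~ i) in
         smooth ((crd i \o p) @` V) th /\
         forall x (a b : 'I_n), V x ->
           'D_(delta_mx 0 a) th (crd i (p x)) 0 b
             - 'D_(delta_mx 0 b) th (crd i (p x)) 0 a = sigma (p x) i a b) &
      exists C : R, forall x i, dom i (p x) ->
        (theta x i *m invmx (g (p x) i) *m (theta x i)^T) 0 0 <= C].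

Definition lift_has_bounded_primitive (g sigma : tensor2) : Prop :=
  exists (N : topologicalType) (p : N -> M) (theta : N -> I -> 'rV[R]_n),
    [/\ simply_connected N, covering_map p &
        bounded_primitive g sigma p theta].

(* A covector is the family of its components in the charts around its base
   point, normalized to 0 in the other charts, so that equality is the equality
   of T^*M. *)
Record cotangent := Cotangent {
  base : M;
  mom : I -> 'rV[R]_n;
  mom_trans : forall i j, dom i base -> dom j base ->
    mom i = mom j *m (tjac i j base)^T;
  mom_out : forall i, ~ dom i base -> mom i = 0 }.

HB.instance Definition _ := gen_eqMixin cotangent.
HB.instance Definition _ := gen_choiceMixin cotangent.

(* Canonical coordinates (q, p). *)
Definition cotangent_charts : charts R (n + n) cotangent :=
  @Charts R (n + n) cotangent I
    (fun i z => dom i (base z))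
    (fun i z => row_mx (crd i (base z)) (mom z i)).
Local Notation CT := cotangent_charts.
Local Notation J := (idx CT).

Definition tonelli (g : tensor2) (H : cotangent -> R) : Prop :=
  [/\ smooth_fun CT H,
      (forall (z : cotangent) (i : J) (v : 'rV[R]_n), dom i z -> v != 0 ->
         let w : 'rV[R]_(n + n) := row_mx 0 v in
         0 < 'D_w (fun u => 'D_w (rep i H) u) (crd i z)) &
      forall A : R, exists r : R, forall (z : cotangent) (i : I),
        dom i (base z) ->
        let norm_z :=
          Num.sqrt ((mom z i *m invmx (g (base z) i) *m (mom z i)^T) 0 0) in
        r <= norm_z -> A * norm_z <= H z].

Definition level (H : cotangent -> R) (k : R) : set cotangent :=
  [set z | H z = k].

Definition regular_value (H : cotangent -> R) (k : R) : Prop :=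
  forall (z : cotangent) (i : J), level H k z -> dom i z ->
    exists v, 'D_v (rep i H) (crd i z) != 0.

Section Dynamics.
Variable sigma : tensor2.

(* Matrix in coordinates (q, p) of dp /\ dq + s, that is of
   (u, v) |-> u_p . v_q - u_q . v_p + s(u_q, v_q). *)
Definition twisted_mx (s : 'M[R]_n) : 'M[R]_(n + n) :=
  block_mx s (- 1%:M) 1%:M 0.

Definition omega0 : 'M[R]_(n + n) := twisted_mx 0.

Definition omega (i : J) (z : cotangent) : 'M[R]_(n + n) :=
  twisted_mx (sigma (base z) i).

(* X = X_H(z) in the chart i: omega(., X) = dH. *)
Definition is_ham_vector (H : cotangent -> R) (i : J) (z : cotangent)
    (X : 'rV[R]_(n + n)) : Prop :=
  forall v : 'rV[R]_(n + n),
    (v *m omega i z *m X^T) 0 0 = 'D_v (rep i H) (crd i z).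

(* c' = eta X_H(c) on the open set A. *)
Definition integral_curve (H : cotangent -> R) (eta : R) (A : set R)
    (c : R -> cotangent) : Prop :=
  forall (t : R) (i : J), A t -> dom i (c t) ->
    (\forall s \near t, dom i (c s)) /\
    exists2 X, is_ham_vector H i (c t) X &
               is_derive t 1 (crd i \o c) (eta *: X).

(* The value z is a dummy when the maximal integral curve through z is not
   defined at time t. *)
Definition flow (H : cotangent -> R) (t : R) (z : cotangent) : cotangent :=
  xget z [set z' | exists (a b : R) (c : R -> cotangent),
    [/\ a < 0 < b, a < t < b, integral_curve H 1 `]a, b[%classic c, c 0 = z &
        c t = z']].

(* d_z phi^H_t from the chart i around z to the chart j around phi^H_t(z). *)
Definition dflow (H : cotangent -> R) (t : R) (z : cotangent) (i j : J) :
    'M[R]_(n + n) :=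
  'J (rep i (crd j \o flow H t)) (crd i z).

Definition rabinowitz_critical (H : cotangent -> R) (k : R)
    (x : R -> cotangent) (eta : R) : Prop :=
  [/\ (forall t, x (t + 1) = x t),
      smooth_into CT [set: R] x,
      integral_curve H eta [set: R] x &
      forall t, level H k (x t)].

Definition proportional_on (S : set cotangent) (H F f : cotangent -> R) :
    Prop :=
  forall (z : cotangent) (i : J) X, S z -> dom i z ->
    is_ham_vector F i z X -> is_ham_vector H i z (f z *: X).

(* The Hamiltonian orbit, of period |eta|, underlying (x, eta). *)
Definition underlying (x : R -> cotangent) (eta : R) : R -> cotangent :=
  fun t => x (t / eta).

Definition corresponding (f : cotangent -> R) (x : R -> cotangent) (eta : R)
    (x' : R -> cotangent) (eta' : R) : Prop :=
  let y := underlying x eta in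
  let alpha (t : R) :=
    Rintegral lebesgue_measure `[0, t]%classic (fun s : R => f (y s)) in
  eta' = Num.sg eta * alpha `|eta| /\
  forall t, 0 <= t <= `|eta| -> underlying x' eta' (alpha t) = y t.

Definition orbit_cylinder (H : cotangent -> R) (k : R) (y : R -> cotangent)
    (tau eps : R) (Y : R -> R -> cotangent) (T : R -> R) : Prop :=
  [/\ 0 < eps,
      smooth `]k - eps, k + eps[%classic T,
      smooth_into CT [set st : R * R | - eps < st.1 < eps]
        (fun st => Y st.1 st.2),
      Y 0 = y /\ T k = tau &
      forall s, - eps < s < eps ->
        [/\ 0 < T (k + s),
            (forall t, Y s (t + T (k + s)) = Y s t),
            integral_curve H 1 [set: R] (Y s) &
            forall t, H (Y s t) = k + s]].

(* c = chi(y) for some non-degenerate orbit cylinder of y. *)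
Definition is_correction (H : cotangent -> R) (k : R) (y : R -> cotangent)
    (tau c : R) : Prop :=
  exists eps Y T, [/\ orbit_cylinder H k y tau eps Y T,
                      derive1 T k != 0 & c = Num.sg (- derive1 T k)].

Definition nondegenerate_cylinder (H : cotangent -> R) (k : R)
    (x : R -> cotangent) (eta : R) : Prop :=
  exists c, is_correction H k (underlying x eta) `|eta| c.

Definition correction (H : cotangent -> R) (k : R)
    (x : R -> cotangent) (eta : R) : R :=
  Num.sg eta * xget 0 (is_correction H k (underlying x eta) `|eta|).

(* Omega(t) : R^2n -> T_{y(t)} T^*M is v |-> v *m Om t i in the chart i. *)
Definition vertical_trivialization (y : R -> cotangent) (tau : R)
    (Om : R -> J -> 'M[R]_(n + n)) : Prop :=
  let vert : 'M[R]_(n, n + n) := row_mx 0 1%:M in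
  [/\ (forall t i j, dom i (y t) -> dom j (y t) ->
         Om t j = Om t i *m tjac i j (y t)),
      (forall t i, dom i (y t) -> {for t, continuous (Om ^~ i)}),
      (forall t i, dom i (y t) -> Om (t + tau) i = Om t i),
      (forall t i, dom i (y t) ->
         Om t i *m omega i (y t) *m (Om t i)^T = omega0) &
      (forall t i, dom i (y t) -> (vert *m Om t i == vert)%MS)].

Definition linearized_path (H : cotangent -> R) (e : R) (y : R -> cotangent)
    (tau : R) (Om : R -> J -> 'M[R]_(n + n)) (lam : R -> 'M[R]_(n + n)) :
    Prop :=
  forall t (i j : J), 0 <= t <= tau -> dom i (y 0) -> dom j (y t) ->
    lam t = Om 0 i *m dflow H (e * t) (y 0) i j *m invmx (Om t j).

End Dynamics.

End Geometry.

Section Maslov.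
Context {R : realType} {m : nat}.

(* A Lagrangian subspace of (R^2m, B) is the row space of a frame L. *)
Definition lagrangian (B : 'M[R]_(m + m)) (L : 'M[R]_(m, m + m)) : Prop :=
  row_free L /\ L *m B *m L^T = 0.

(* The quadratic form u |-> u Q u^T is non-degenerate on the row space of K,
   with signature s. *)
Definition has_signature (K Q : 'M[R]_m) (s : int) : Prop :=
  exists P N : 'M[R]_m,
    [/\ (P + N == K)%MS, (P :&: N)%MS = 0,
        (forall u : 'rV[R]_m, (u <= P)%MS -> u != 0 -> 0 < (u *m Q *m u^T) 0 0),
        (forall u : 'rV[R]_m, (u <= N)%MS -> u != 0 -> (u *m Q *m u^T) 0 0 < 0) &
        s = (\rank P)%:Z - (\rank N)%:Z].

(* The crossing form on L(t) /\ V, in the frame L: if u *m L t is in V,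
   u |-> B(u *m L t, u *m L'(t)). *)
Definition crossing_space (V : 'M[R]_(m, m + m)) (L : R -> 'M[R]_(m, m + m))
    (t : R) : 'M[R]_m :=
  kermx (L t *m cokermx V).

Definition crossing_form (B : 'M[R]_(m + m)) (L : R -> 'M[R]_(m, m + m))
    (t : R) : 'M[R]_m :=
  L t *m B *m (derive1 L t)^T.

(* mu is the index on [a, b] of the C^1 path L, all of whose crossings with V
   are regular (hence isolated: the sum is finite). *)
Definition regular_index (B : 'M[R]_(m + m)) (V : 'M[R]_(m, m + m)) (a b : R)
    (L : R -> 'M[R]_(m, m + m)) (mu : R) : Prop :=
  Ck 1 setT L /\
  exists s : R -> int,
    (forall t, a <= t <= b ->
       has_signature (crossing_space V L t) (crossing_form B L t) (s t)) /\
    mu = \sum_(t \in `[a, b]%classic)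
           ((if (t == a) || (t == b) then 2^-1 else 1) : R) * (s t)%:~R.

(* General paths: homotope, with fixed end points and through Lagrangian paths,
   to a path with regular crossings. *)
Definition is_maslov_index (B : 'M[R]_(m + m)) (V : 'M[R]_(m, m + m)) (a b : R)
    (L : R -> 'M[R]_(m, m + m)) (mu : R) : Prop :=
  exists h : R * R -> 'M[R]_(m, m + m),
    [/\ continuous h,
        (forall s t, 0 <= s <= 1 -> a <= t <= b -> lagrangian B (h (s, t))),
        (forall t, a <= t <= b -> (h (0%R, t) == L t)%MS),
        (forall s, 0 <= s <= 1 ->
           (h (s, a) == L a)%MS /\ (h (s, b) == L b)%MS) &
        regular_index B V a b (fun t => h (1, t)) mu].

Definition maslov_index (B : 'M[R]_(m + m)) (V : 'M[R]_(m, m + m)) (a b : R)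
    (L : R -> 'M[R]_(m, m + m)) : R :=
  xget 0 (is_maslov_index B V a b L).

End Maslov.

Section Index.
Context {R : realType} {n : nat} (M : manifold R n).
Local Notation J := (idx (cotangent_charts M)).

(* mu_Ma(graph(lam), diagonal) on [0, tau], in R^2n x R^2n with (-w0) + w0.
   With w0 = dp /\ dq the crossing form is w0(u, u lam'(t)), which is positive
   definite for flows of positive definite quadratic Hamiltonians. *)
Definition conley_zehnder_path (tau : R) (lam : R -> 'M[R]_(n + n)) : R :=
  maslov_index
    (block_mx (- omega0) 0 0 omega0 : 'M[R]_((n + n) + (n + n)))
    (row_mx 1%:M 1%:M) 0 tau (fun t => row_mx 1%:M (lam t)).

Definition conley_zehnder (sigma : tensor2 M) (H : cotangent M -> R)
    (x : R -> cotangent M) (eta : R) : R :=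
  let y : R -> cotangent M := fun t => x (t / `|eta|) in
  xget 0 [set mu | exists (Om : R -> J -> 'M[R]_(n + n))
                          (lam : R -> 'M[R]_(n + n)),
    [/\ vertical_trivialization sigma y `|eta| Om,
        linearized_path sigma H (Num.sg eta) y `|eta| Om lam &
        mu = conley_zehnder_path `|eta| lam]].

Definition mu_rab (sigma : tensor2 M) (H : cotangent M -> R) (k : R)
    (x : R -> cotangent M) (eta : R) : R :=
  conley_zehnder sigma H x eta - 2^-1 * correction sigma H k x eta.

End Index.

(* Main.v *)
(* Read in one moving vertical-preserving frame, the linearized flows of H and F
   along the common characteristic are paths lam(t) and A(t) lam(t) of symplectic
   matrices. With xi = X_H, the matrix A(t) fixes the line of xi, induces the
   identity on xi^perp / xi (xi^perp is the tangent space of the hypersurface) and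
   satisfies w(y A(t), xi) > 0 for y with w(y, xi) = 1. Such a matrix is determined
   by yA, which ranges over a half space, so deforming A to the identity changes
   the index only through the end point. There lam and A lam restrict to the same
   map of xi^perp / xi, and y is sent to y + c xi, respectively to y2 + c2 xi for
   another y2 with w(y2, xi) = 1; up to conjugation the end path is a path of
   transvections from c to c2, of index (sign c2 - sign c) / 2. Differentiating
   the closing condition of an orbit cylinder of period T gives c = - T'(k) (up to
   the orientation and a positive factor), so the difference of the indices is
   that of the correction terms.

   The Maslov index is computed from a potential: relative to a complement C of
   the reference Lagrangian V, the index between two nearby times is half the
   difference of the signatures of the quadratic forms obtained by describing the
   Lagrangians in the splitting C + V. *)

Require Import Defs.
From HB Require Import structures.
From mathcomp Require Import all_boot all_order all_algebra.
From mathcomp Require Import all_classical all_reals all_analysis.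
From mathcomp Require Import zify ring lra.

Set Implicit Arguments.
Unset Strict Implicit.
Unset Printing Implicit Defensive.

Import Order.TTheory GRing.Theory Num.Theory.
Import numFieldNormedType.Exports.

Local Open Scope classical_set_scope.
Local Open Scope ring_scope.

(** The obstacle is that [X_H = f X_F] holds on the hypersurface only. Its derivative is therefore
    available only in tangent directions and modulo the field, and of the image of a transverse
    vector only a sign is controlled; this loss is what the end point term records. [maslov_index],
    [conley_zehnder] and [correction] pick their values by choice. For the first two, existence and
    uniqueness have to be shown: every continuous Lagrangian path is deformed to a [C^1] path with
    regular crossings, and a periodic vertical-preserving frame is built along the orbit, which is
    where orientability enters. For the third, the monodromy formula holds for every cylinder, hence
    for the chosen one. The frame is immaterial because a loop of vertical-preserving symplectic
    maps has index 0: it deforms to a block diagonal loop, which an antisymplectic reflection leaves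
    unchanged while reversing the index. The cotangent bundle is given as a set with charts.
    Symplecticity of the transition maps, differentiability of the flow and uniqueness of orbits are
    proved in charts and carried along the orbit by a sup argument. *)

Section MatrixLimits.
Context {R : realType} {T : Type}.
Implicit Types F : set_system T.

Lemma cvg_mxP F {FF : Filter F} m n (M : T -> 'M[R]_(m, n)) (L : 'M[R]_(m, n)) :
  M x @[x --> F] --> L <-> forall i j, M x i j @[x --> F] --> L i j.
Proof.
split=> [ML i j|ML].
  exact: (@cvg_comp _ _ _ M (fun N : 'M[R]_(m, n) => N i j) F (nbhs L) _ ML
    (@coord_continuous R m n i j L)).
apply/cvgrPdist_le => /= e e0; near=> x.
rewrite /Num.Def.normr/= mx_normrE (bigmax_le _ (ltW e0))//= => i _.
rewrite !mxE; move: i; near: x; apply: filter_forall => /= i.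
by have /cvgrPdist_le := ML i.1 i.2; apply.
Unshelve. all: by end_near. Qed.

Lemma cvg_bigsum (I : Type) (r : seq I) (P : pred I) F {FF : Filter F}
    (f : I -> T -> R) (l : I -> R) :
  (forall i, P i -> f i x @[x --> F] --> l i) ->
  \sum_(i <- r | P i) f i x @[x --> F] --> \sum_(i <- r | P i) l i.
Proof.
move=> fl; elim: r => [|i r IH].
  by rewrite big_nil; under eq_fun do rewrite big_nil; exact: cvg_cst.
rewrite big_cons; under eq_fun do rewrite big_cons.
by case: ifPn => // Pi; apply: cvgD => //; exact: fl.
Qed.

Lemma cvg_mulmx F {FF : Filter F} m n p (A : T -> 'M[R]_(m, n))
    (B : T -> 'M[R]_(n, p)) (a : 'M[R]_(m, n)) (b : 'M[R]_(n, p)) :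
  A x @[x --> F] --> a -> B x @[x --> F] --> b ->
  A x *m B x @[x --> F] --> a *m b.
Proof.
move=> /cvg_mxP Aa /cvg_mxP Bb; apply/cvg_mxP => i j.
under eq_fun do rewrite mxE; rewrite mxE.
by apply: cvg_bigsum => k _; apply: cvgM.
Qed.

Lemma cvg_trmx F {FF : Filter F} m n (A : T -> 'M[R]_(m, n)) (a : 'M[R]_(m, n)) :
  A x @[x --> F] --> a -> (A x)^T @[x --> F] --> a^T.
Proof.
move=> /cvg_mxP Aa; apply/cvg_mxP => i j; rewrite mxE.
by under eq_fun do rewrite mxE; exact: Aa.
Qed.

Lemma cvg_row_mx F {FF : Filter F} m n1 n2 (A : T -> 'M[R]_(m, n1))
    (B : T -> 'M[R]_(m, n2)) (a : 'M[R]_(m, n1)) (b : 'M[R]_(m, n2)) :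
  A x @[x --> F] --> a -> B x @[x --> F] --> b ->
  row_mx (A x) (B x) @[x --> F] --> row_mx a b.
Proof.
move=> /cvg_mxP Aa /cvg_mxP Bb; apply/cvg_mxP => i j.
under eq_fun do rewrite mxE; rewrite mxE.
by case: (fintype.split j) => k; [exact: Aa | exact: Bb].
Qed.

Lemma cvg_col_mx F {FF : Filter F} m1 m2 n (A : T -> 'M[R]_(m1, n))
    (B : T -> 'M[R]_(m2, n)) (a : 'M[R]_(m1, n)) (b : 'M[R]_(m2, n)) :
  A x @[x --> F] --> a -> B x @[x --> F] --> b ->
  col_mx (A x) (B x) @[x --> F] --> col_mx a b.
Proof.
move=> /cvg_mxP Aa /cvg_mxP Bb; apply/cvg_mxP => i j.
under eq_fun do rewrite mxE; rewrite mxE.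
by case: (fintype.split i) => k; [exact: Aa | exact: Bb].
Qed.

Lemma cvg_lsubmx F {FF : Filter F} m n1 n2 (A : T -> 'M[R]_(m, n1 + n2))
    (a : 'M[R]_(m, n1 + n2)) :
  A x @[x --> F] --> a -> lsubmx (A x) @[x --> F] --> lsubmx a.
Proof.
move=> /cvg_mxP Aa; apply/cvg_mxP => i j; rewrite mxE.
by under eq_fun do rewrite mxE; exact: Aa.
Qed.

Lemma cvg_rsubmx F {FF : Filter F} m n1 n2 (A : T -> 'M[R]_(m, n1 + n2))
    (a : 'M[R]_(m, n1 + n2)) :
  A x @[x --> F] --> a -> rsubmx (A x) @[x --> F] --> rsubmx a.
Proof.
move=> /cvg_mxP Aa; apply/cvg_mxP => i j; rewrite mxE.
by under eq_fun do rewrite mxE; exact: Aa.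
Qed.

Lemma cvg_prod (I : Type) (r : seq I) (P : pred I) F {FF : Filter F}
    (f : I -> T -> R) (l : I -> R) :
  (forall i, P i -> f i x @[x --> F] --> l i) ->
  \prod_(i <- r | P i) f i x @[x --> F] --> \prod_(i <- r | P i) l i.
Proof.
move=> fl; elim: r => [|i r IH].
  by rewrite big_nil; under eq_fun do rewrite big_nil; exact: cvg_cst.
rewrite big_cons; under eq_fun do rewrite big_cons.
by case: ifPn => // Pi; apply: cvgM => //; exact: fl.
Qed.

Lemma cvg_det F {FF : Filter F} n (A : T -> 'M[R]_n) (a : 'M[R]_n) :
  A x @[x --> F] --> a -> \det (A x) @[x --> F] --> \det a.
Proof.
move=> /cvg_mxP Aa; apply: cvg_bigsum => s _; apply: cvgM; first exact: cvg_cst.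
by apply: cvg_prod => i _; exact: Aa.
Qed.

Lemma cvg_adj F {FF : Filter F} n (A : T -> 'M[R]_n) (a : 'M[R]_n) :
  A x @[x --> F] --> a -> \adj (A x) @[x --> F] --> \adj a.
Proof.
move=> /cvg_mxP Aa; apply/cvg_mxP => i j; rewrite mxE.
under eq_fun do rewrite mxE; apply: cvgM; first exact: cvg_cst.
apply: cvg_det; apply/cvg_mxP => k l; rewrite !mxE.
by under eq_fun do rewrite !mxE; exact: Aa.
Qed.

Lemma near_unitmx F {FF : Filter F} n (A : T -> 'M[R]_n) (a : 'M[R]_n) :
  A x @[x --> F] --> a -> a \in unitmx -> \forall x \near F, A x \in unitmx.
Proof.
rewrite unitmxE unitfE => /cvg_det Aa a0.
near=> x; rewrite unitmxE unitfE; near: x.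
exact: (cvgr_neq0 _ Aa a0).
Unshelve. all: by end_near. Qed.

Lemma cvg_invmx F {FF : Filter F} n (A : T -> 'M[R]_n) (a : 'M[R]_n) :
  A x @[x --> F] --> a -> a \in unitmx ->
  invmx (A x) @[x --> F] --> invmx a.
Proof.
move=> Aa ua.
have -> : invmx a = (\det a)^-1 *: \adj a by rewrite /invmx ua.
have : (\det (A x))^-1 *: \adj (A x) @[x --> F] --> (\det a)^-1 *: \adj a; last first.
  apply: cvg_trans; apply: near_eq_cvg; near=> x.
  by rewrite /invmx ifT //; near: x; exact: near_unitmx ua.
apply: cvgZ; last exact: cvg_adj.
by apply: cvgV; [move: ua; rewrite unitmxE unitfE | exact: cvg_det].
Unshelve. all: by end_near. Qed.

End MatrixLimits.

(* Sup argument: a property of intervals that holds locally and is closed under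
   concatenation holds on every interval. *)
Lemma interval_glue (R : realType) (Q : R -> R -> Prop) (a b : R) : a <= b ->
  (forall t, a <= t <= b -> exists2 d, 0 < d & forall u v,
     a <= u -> u <= v -> v <= b -> t - d < u -> v < t + d -> Q u v) ->
  (forall u v w, a <= u -> u <= v -> v <= w -> w <= b ->
     Q u v -> Q v w -> Q u w) ->
  Q a b.
Proof.
move=> ab loc glue.
pose S := [set t | a <= t <= b /\ Q a t].
have Sa : S a.
  split; first by rewrite lexx.
  have [|d d0 Qd] := loc a; first by rewrite lexx.
  by apply: Qd => //; [rewrite ltrBlDr ltrDl | rewrite ltrDl].
have Sub : has_ubound S by exists b => t [/andP[]].
have hS : has_sup S by split; first by exists a.
have as_ : a <= sup S by exact: ub_le_sup.
have sb : sup S <= b by apply: ge_sup => [|t [/andP[]]//]; exists a.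
have [|d d0 Qd] := loc (sup S); first by rewrite as_.
have [t [/andP[at_ tb] Qat] dt] := sup_adherent d0 hS.
have ts : t <= sup S by apply: ub_le_sup => //; split => //; rewrite at_.
pose v := Num.min (sup S + d / 2) b.
have sv : sup S <= v by rewrite le_min sb andbT lerDl ltW ?divr_gt0.
have vb : v <= b by rewrite ge_min lexx orbT.
have Qav : Q a v.
  apply: (glue a t v) => //; first exact: le_trans ts sv.
  apply: Qd => //; first exact: le_trans ts sv.
  rewrite gt_min; apply/orP; left; lra.
have : v <= sup S.
  apply: ub_le_sup => //; split => //.
  by rewrite vb andbT (le_trans as_).
rewrite ge_min; case/orP => [|bs]; first by move=> ?; exfalso; lra.
by have -> : b = v by rewrite /v min_r //; apply: (le_trans bs); lra.
Qed.

(** * Signatures of symmetric matrices *)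

Section Signature.
Context {R : realType}.

Definition qf m (Q : 'M[R]_m) (u : 'rV[R]_m) : R := (u *m Q *m u^T) 0 0.

Definition pos_on k m (P : 'M[R]_(k, m)) (Q : 'M[R]_m) : Prop :=
  forall u : 'rV[R]_m, (u <= P)%MS -> u != 0 -> 0 < qf Q u.

(** The positive index of inertia, defined through subspaces rather than by diagonalization: lower
    semicontinuity then reduces to the fact that positive definiteness is an open condition. *)
Definition npos m (Q : 'M[R]_m) : nat :=
  \max_(r < m.+1 | `[< exists P : 'M[R]_m, \rank P = r /\ pos_on P Q >]) r.

Definition nneg m (Q : 'M[R]_m) : nat := npos (- Q).

Definition sgn m (Q : 'M[R]_m) : int := (npos Q)%:Z - (nneg Q)%:Z.

Lemma qfN m (Q : 'M[R]_m) u : qf (- Q) u = - qf Q u.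
Proof. by rewrite /qf mulmxN mulNmx mxE. Qed.

Lemma qfZ m (Q : 'M[R]_m) u (a : R) : qf Q (a *: u) = a ^+ 2 * qf Q u.
Proof.
by rewrite /qf -!scalemxAl linearZ /= -scalemxAr !mxE mulrA expr2.
Qed.

Lemma qf_congr k m (B : 'M[R]_(k, m)) (Q : 'M[R]_m) u :
  qf (B *m Q *m B^T) u = qf Q (u *m B).
Proof. by rewrite /qf trmx_mul !mulmxA. Qed.

Lemma pos_on_sub k l m (P : 'M[R]_(k, m)) (P' : 'M[R]_(l, m)) Q :
  (P' <= P)%MS -> pos_on P Q -> pos_on P' Q.
Proof. by move=> PP PQ u uP; apply: PQ; apply: submx_trans PP. Qed.

Lemma npos_ge k m (P : 'M[R]_(k, m)) (Q : 'M[R]_m) :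
  pos_on P Q -> (\rank P <= npos Q)%N.
Proof.
move=> PQ; have rm : (\rank P < m.+1)%N by rewrite ltnS rank_leq_col.
apply: (@leq_bigmax_cond _ _ (fun r : 'I_m.+1 => r : nat) (Ordinal rm)).
apply/asboolP; exists <<P>>%MS; split; first by rewrite mxrank_gen.
by apply: pos_on_sub PQ; rewrite genmxE.
Qed.

Lemma npos_ex m (Q : 'M[R]_m) :
  exists P : 'M[R]_m, \rank P = npos Q /\ pos_on P Q.
Proof.
rewrite /npos; apply: (big_ind (fun r => exists P : 'M[R]_m, \rank P = r /\ pos_on P Q)).
- exists 0; split; first by rewrite mxrank0.
  by move=> u /submx0null ->; rewrite eqxx.
- by move=> a b [P HP] [P' HP']; case: (leqP a b) => ab; [exists P'|exists P].
- by move=> r /asboolP.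
Qed.

(** The pulled back form vanishes on [kermx B], so a positive subspace [P] meets that kernel
    trivially and [P *m B] is a positive subspace of the same rank. As [B] may be rectangular, this
    also covers restriction to a subspace. *)
Lemma npos_congr_le k m (B : 'M[R]_(k, m)) (Q : 'M[R]_m) :
  (npos (B *m Q *m B^T) <= npos Q)%N.
Proof.
have [P [<- PQ]] := npos_ex (B *m Q *m B^T).
have inj : (P :&: kermx B)%MS = 0.
  apply/eqP; rewrite -submx0; apply/row_subP => i; set u := row i _.
  have : (u <= P :&: kermx B)%MS by exact: row_sub.
  rewrite sub_capmx => /andP[uP /sub_kermxP uB].
  have [->|u0] := eqVneq u 0; first by rewrite sub0mx.
  by have := PQ u uP u0; rewrite qf_congr /qf uB !mul0mx mxE ltxx.
have -> : \rank P = \rank (P *m B).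
  by rewrite -(mxrank_mul_ker P B) inj mxrank0 addn0.
apply: npos_ge => u /submxP[D ->] u0; rewrite mulmxA -qf_congr.
apply: PQ; first exact: submxMl.
by apply: contraNneq u0; rewrite mulmxA => ->; rewrite mul0mx.
Qed.

Lemma npos_congr m (G Q : 'M[R]_m) : G \in unitmx ->
  npos (G *m Q *m G^T) = npos Q.
Proof.
move=> uG; apply/eqP; rewrite eqn_leq npos_congr_le /=.
have {1}-> : Q = invmx G *m (G *m Q *m G^T) *m (invmx G)^T.
  rewrite !mulmxA mulVmx // mul1mx -mulmxA -trmx_mul mulVmx //.
  by rewrite trmx1 mulmx1.
exact: npos_congr_le.
Qed.

Lemma sgn_congr m (G Q : 'M[R]_m) : G \in unitmx ->
  sgn (G *m Q *m G^T) = sgn Q.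
Proof. by move=> uG; rewrite /sgn /nneg -mulNmx -mulmxN !npos_congr. Qed.

Lemma sgnN m (Q : 'M[R]_m) : sgn (- Q) = - sgn Q.
Proof. by rewrite /sgn /nneg opprK opprB. Qed.

Lemma sym_qf m (Q : 'M[R]_m) (u v : 'rV[R]_m) : Q^T = Q ->
  (u *m Q *m v^T) 0 0 = (v *m Q *m u^T) 0 0.
Proof.
move=> sQ; rewrite -[in RHS](trmxK (v *m Q *m u^T)).
by rewrite [RHS]mxE !trmx_mul trmxK sQ mulmxA.
Qed.

Lemma qfD m (Q : 'M[R]_m) (u v : 'rV[R]_m) : Q^T = Q ->
  qf Q (u + v) = qf Q u + 2 * (u *m Q *m v^T) 0 0 + qf Q v.
Proof.
move=> sQ; rewrite /qf linearD /= mulmxDl mulmxDl !mulmxDr.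
rewrite mxE [X in X + _]mxE [X in _ + X]mxE (sym_qf v u sQ).
by ring.
Qed.

(** A maximal positive subspace, a maximal negative one and the kernel are independent, since the
    form is nonpositive on the sum of the last two. *)
Lemma npos_nneg_le m (Q : 'M[R]_m) : Q^T = Q ->
  (npos Q + nneg Q <= \rank Q)%N.
Proof.
rewrite /nneg => sQ; have [P [<- PQ]] := npos_ex Q; have [N [rN NQ]] := npos_ex (- Q).
have NK : (N :&: kermx Q)%MS = 0.
  apply/eqP; rewrite -submx0; apply/row_subP => i; set u := row i _.
  have : (u <= N :&: kermx Q)%MS by exact: row_sub.
  rewrite sub_capmx => /andP[uN /sub_kermxP uK].
  have [->|u0] := eqVneq u 0; first by rewrite sub0mx.
  by have := NQ u uN u0; rewrite qfN /qf uK mul0mx mxE oppr0 ltxx.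
have PNK : (P :&: (N + kermx Q))%MS = 0.
  apply/eqP; rewrite -submx0; apply/row_subP => i; set u := row i _.
  have : (u <= P :&: (N + kermx Q))%MS by exact: row_sub.
  rewrite sub_capmx => /andP[uP /sub_addsmxP[[a b] /= uab]].
  have [->|u0] := eqVneq u 0; first by rewrite sub0mx.
  have bK : b *m kermx Q *m Q = 0 by rewrite -mulmxA mulmx_ker mulmx0.
  have := PQ u uP u0; rewrite uab qfD // [X in _ + X]/qf bK mul0mx.
  rewrite sym_qf // bK mul0mx mxE mulr0 !addr0.
  have [->|n0] := eqVneq (a *m N) 0; first by rewrite /qf !mul0mx mxE ltxx.
  have := NQ (a *m N) (submxMl _ _) n0; rewrite qfN oppr_gt0 => lt0 gt0.
  by have := lt_trans lt0 gt0; rewrite ltxx.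
have := mxrank_sum_cap N (kermx Q); rewrite NK mxrank0 addn0 => rNK.
have := mxrank_sum_cap P (N + kermx Q)%MS; rewrite PNK mxrank0 addn0 => rPNK.
have := rank_leq_col (P + (N + kermx Q))%MS; rewrite rPNK rNK.
have := rank_leq_col Q.
rewrite mxrank_ker -rN => h1 h2; lia.
Qed.

(** Sylvester's law without eigenvectors. Let [W] be the [Q]-orthogonal of a maximal positive
    subspace [P]. Maximality makes [Q] nonpositive on [W], isotropic vectors of [W] then lie in the
    kernel, and a complement of the kernel in [W] is negative definite of the required dimension. *)
Lemma npos_nneg_ge m (Q : 'M[R]_m) : Q^T = Q ->
  (\rank Q <= npos Q + nneg Q)%N.
Proof.
move=> sQ; have [P [rP PQ]] := npos_ex Q.
pose W := kermx (Q *m P^T).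
have rW : (m - \rank P <= \rank W)%N.
  rewrite mxrank_ker leq_sub2l // (leq_trans (mxrankM_maxr _ _)) //.
  by rewrite mxrank_tr.
have WP (w p : 'rV[R]_m) : (w <= W)%MS -> (p <= P)%MS -> (w *m Q *m p^T) = 0.
  move=> /sub_kermxP wW /submxP[D ->].
  by rewrite trmx_mul mulmxA -(mulmxA w) wW mul0mx.
have Wle (w : 'rV[R]_m) : (w <= W)%MS -> qf Q w <= 0.
  move=> wW; rewrite leNgt; apply/negP => w0.
  have wP : ~~ (w <= P)%MS.
    apply/negP => wP; move: w0; rewrite /qf WP //.
    by rewrite mxE ltxx.
  have : pos_on (P + w)%MS Q.
    move=> u /sub_addsmxP[[a b] /= ->] u0; rewrite qfD //.
    set p := a *m P; have pP : (p <= P)%MS by exact: submxMl.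
    have bw : (b *m w <= W)%MS by rewrite (submx_trans (submxMl _ _)).
    rewrite sym_qf // WP // mxE mulr0 addr0.
    have -> : b *m w = (b 0 0) *: w by rewrite [b in LHS]mx11_scalar mul_scalar_mx.
    rewrite qfZ; have [p0|p0] := eqVneq p 0.
      rewrite p0 {1}/qf !mul0mx mxE add0r mulr_gt0 // exprn_even_gt0 //=.
      apply: contraNneq u0 => b0; rewrite -/p p0 add0r.
      by rewrite [b]mx11_scalar b0 mul_scalar_mx scale0r.
    apply: ltr_wpDr; last exact: PQ.
    by rewrite mulr_ge0 ?sqr_ge0 // ltW.
  move/npos_ge; rewrite -rP => h.
  have := mxrank_leqif_sup (addsmxSl P w); rewrite addsmx_sub submx_refl /=.
  by move=> [_]; rewrite (negbTE wP) => /eqP; apply; apply/eqP;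
     rewrite eqn_leq h mxrankS ?addsmxSl.
have PW : (1%:M <= P + W)%MS.
  have cap0 : (P :&: W)%MS = 0.
    apply/eqP; rewrite -submx0; apply/row_subP => i; set u := row i _.
    have : (u <= P :&: W)%MS by exact: row_sub.
    rewrite sub_capmx => /andP[uP uW].
    have [->|u0] := eqVneq u 0; first by rewrite sub0mx.
    by have := PQ u uP u0; rewrite /qf WP // mxE ltxx.
  rewrite sub1mx -col_leq_rank.
  have := mxrank_sum_cap P W; rewrite cap0 mxrank0 addn0 => ->.
  by rewrite -leq_subLR.
have KW : (kermx Q <= W)%MS.
  by apply/sub_kermxP; rewrite mulmxA mulmx_ker mul0mx.
have isoK (u : 'rV[R]_m) : (u <= W)%MS -> qf Q u = 0 -> (u <= kermx Q)%MS.
  move=> uW u0; apply/sub_kermxP.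
  have orth (w : 'rV[R]_m) : (w <= W)%MS -> (u *m Q *m w^T) 0 0 = 0.
    move=> wW; set c := (_ *m _) 0 0.
    (* As a function of [s] this would be positive for small [s] of the sign of [c]; the value
       [s = c / (|q(w)| + 1)] is small enough, so [c = 0]. *)
    have le (s : R) : 2 * s * c + s ^+ 2 * qf Q w <= 0.
      have := Wle (u + s *: w); rewrite qfD // u0 add0r qfZ.
      rewrite linearZ /= -scalemxAr mxE mulrA; apply.
      by rewrite addmx_sub // scalemx_sub.
    apply/eqP/negP => /negP c0.
    have d : 0 < `|qf Q w| + 1 by rewrite ltr_wpDl.
    have := le (c / (`|qf Q w| + 1)).
    have -> : 2 * (c / (`|qf Q w| + 1)) * c + (c / (`|qf Q w| + 1)) ^+ 2 * qf Q w
      = (c / (`|qf Q w| + 1)) ^+ 2 * (2 * (`|qf Q w| + 1) + qf Q w).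
      by field; rewrite gt_eqF.
    apply/negP; rewrite -ltNge mulr_gt0 //.
      by rewrite exprn_even_gt0 //= mulf_neq0 // invr_eq0 gt_eqF.
    by have := ler_norm (- qf Q w); rewrite normrN; lra.
  apply/rowP => j; rewrite [RHS]mxE.
  have /sub_addsmxP[[a b] /= ab] := submx_trans (submx1 (delta_mx 0 j : 'rV_m)) PW.
  have -> : (u *m Q) 0 j = (u *m Q *m (delta_mx 0 j : 'rV_m)^T) 0 0.
    by rewrite trmx_delta -colE !mxE.
  by rewrite ab linearD /= mulmxDr WP ?submxMl // add0r orth ?submxMl.
have negN : pos_on (W :\: kermx Q)%MS (- Q).
  move=> u uN u0; rewrite qfN oppr_gt0 lt_neqAle.
  have uW : (u <= W)%MS by rewrite (submx_trans uN) // diffmxSl.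
  rewrite Wle // andbT; apply: contraNneq u0 => u0.
  have uK := isoK u uW u0.
  have : (u <= (W :\: kermx Q) :&: kermx Q)%MS by rewrite sub_capmx uN.
  by rewrite capmx_diff submx0.
have := npos_ge negN; rewrite -/(nneg Q).
have := mxrank_cap_compl W (kermx Q).
have -> : \rank (W :&: kermx Q)%MS = \rank (kermx Q).
  by rewrite (capmx_idPr KW).
have := rank_leq_col Q; have := rank_leq_col P.
rewrite mxrank_ker -rP; move: rW.
by move: (\rank P) (\rank W) (\rank Q) (nneg Q) (\rank _) => p w q n x; lia.
Qed.

Lemma npos_nneg_rank m (Q : 'M[R]_m) : Q^T = Q ->
  (npos Q + nneg Q)%N = \rank Q.
Proof. by move=> sQ; apply/eqP; rewrite eqn_leq npos_nneg_le ?npos_nneg_ge. Qed.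

Lemma bilin_bound m : exists2 C : R, 0 < C &
  forall (D : 'M[R]_m) (u v : 'rV[R]_m),
    `|(u *m D *m v^T) 0 0| <= C * `|D| * `|u| * `|v|.
Proof.
exists (1 + m%:R * m%:R) => [|D u v]; first by rewrite ltr_pwDl // mulr_ge0.
have eb k l (A : 'M[R]_(k, l)) i j : `|A i j| <= `|A|.
  by rewrite [leRHS]/Num.Def.normr/= mx_normrE (le_bigmax _ _ (i, j)).
rewrite mxE; under eq_bigr do rewrite mxE mulr_suml.
apply: le_trans (ler_norm_sum _ _ _) _.
apply: (@le_trans _ _ (\sum_(i < m) \sum_(j < m) `|D| * `|u| * `|v|)).
  apply: ler_sum => i _; apply: le_trans (ler_norm_sum _ _ _) _.
  apply: ler_sum => j _; rewrite !normrM mxE [`|D| * _]mulrC.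
  by rewrite !ler_pM // ?mulr_ge0.
rewrite !sumr_const !card_ord -!mulrnA -!mulrA -[leLHS]mulr_natl natrM.
by rewrite ler_wpM2r ?mulr_ge0 // ler_wpDl.
Qed.

Lemma cvg_qf (T : Type) (F : set_system T) {FF : Filter F} m
    (Q : T -> 'M[R]_m) (Q0 : 'M[R]_m) (u : T -> 'rV[R]_m) (u0 : 'rV[R]_m) :
  Q x @[x --> F] --> Q0 -> u x @[x --> F] --> u0 ->
  qf (Q x) (u x) @[x --> F] --> qf Q0 u0.
Proof.
move=> QQ uu; have : u x *m Q x *m (u x)^T @[x --> F] --> u0 *m Q0 *m u0^T.
  by apply: cvg_mulmx; [exact: cvg_mulmx | exact: cvg_trmx].
by move/cvg_mxP; exact.
Qed.

Lemma qf_continuous m (Q : 'M[R]_m) : continuous (fun u : 'rV[R]_m => qf Q u).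
Proof.
move=> u; apply: (cvg_qf (F := nbhs u) (Q := fun=> Q) (u := id)).
  exact: cvg_cst.
exact: cvg_id.
Qed.

(** The constant is the minimum of the form on the compact unit sphere; homogeneity does the rest.
    The sphere is empty when [m = 0], whence the separate case. *)
Lemma pos_on_coercive m (Q : 'M[R]_m) : pos_on 1%:M Q ->
  exists2 c : R, 0 < c & forall u : 'rV[R]_m, c * `|u| ^+ 2 <= qf Q u.
Proof.
move=> PQ; pose A := [set u : 'rV[R]_m | `|u| = 1].
have cA : closed A.
  have -> : A = (fun u : 'rV[R]_m => `|u|) @^-1` [set 1] by [].
  by apply: closed_comp => [u _|]; [exact: norm_continuous | exact: closed_eq].
have compA : compact A.
  apply: bounded_closed_compact => //.
  by exists 1; split; [exact: num_real | move=> M M1 u /= ->; exact: ltW].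
have norm1 (u : 'rV[R]_m) : u != 0 -> A (`|u|^-1 *: u).
  move=> u0; rewrite /A /= normrZ normfV normr_id mulVf ?normr_eq0 //.
have [A0|/set0P/negP/negPn/eqP A0] := pselect (A !=set0); last first.
  exists 1 => // u; have [->|u0] := eqVneq u 0.
    by rewrite normr0 expr0n mulr0 /qf !mul0mx mxE.
  by have := norm1 u u0; rewrite A0.
have [|v] := EVT_min_rV A0 compA (f := qf Q).
  by apply: continuous_subspaceT; exact: qf_continuous.
rewrite inE => Av minv.
have v0 : v != 0 by rewrite -normr_gt0 Av.
exists (qf Q v); first by apply: PQ; rewrite ?submx1.
move=> u; have [->|u0] := eqVneq u 0.
  by rewrite normr0 expr0n mulr0 /qf !mul0mx mxE.
have := minv (`|u|^-1 *: u); rewrite inE => /(_ (norm1 u u0)).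
by rewrite qfZ exprVn mulrC ler_pdivlMr // exprn_gt0 // normr_gt0.
Qed.

Lemma pos_on_open (T : Type) (F : set_system T) {FF : Filter F} m
    (Q : T -> 'M[R]_m) (Q0 : 'M[R]_m) :
  Q x @[x --> F] --> Q0 -> pos_on 1%:M Q0 ->
  \forall x \near F, pos_on 1%:M (Q x).
Proof.
move=> QQ0 /pos_on_coercive[c c0 cQ].
have [C C0 CP] := bilin_bound m.
have e0 : 0 < c / (2 * C) by rewrite divr_gt0 // mulr_gt0.
near=> x => u _ u0.
have xQ : `|Q0 - Q x| <= c / (2 * C).
  by near: x; move/cvgrPdist_le : QQ0; apply.
have := CP (Q0 - Q x) u u.
rewrite mulmxBr mulmxBl mxE [X in _ + X]mxE -/(qf Q0 u) -/(qf (Q x) u) => h.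
have n0 : 0 < `|u| by rewrite normr_gt0.
have h2 : C * `|Q0 - Q x| * `|u| * `|u| <= c / 2 * `|u| ^+ 2.
  rewrite -mulrA -expr2 ler_wpM2r ?sqr_ge0 //.
  rewrite mulrC -ler_pdivlMr //; apply: le_trans xQ _.
  by rewrite le_eqVlt; apply/orP; left; apply/eqP; field; rewrite gt_eqF.
have := cQ u; have := ler_norm (qf Q0 u - qf (Q x) u).
have : 0 < c / 2 * `|u| ^+ 2 by rewrite mulr_gt0 ?divr_gt0 // exprn_gt0.
move: h h2; set z := `|u| ^+ 2; set w := _ * _ * _ * _; set y := `|_ - _|; lra.
Unshelve. all: by end_near. Qed.

(** On a basis of a maximal positive subspace of the limit, positive definiteness survives small
    perturbations. *)
Lemma npos_lsc (T : Type) (F : set_system T) {FF : Filter F} m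
    (Q : T -> 'M[R]_m) (Q0 : 'M[R]_m) :
  Q x @[x --> F] --> Q0 -> \forall x \near F, (npos Q0 <= npos (Q x))%N.
Proof.
move=> QQ0; have [P [<- PQ]] := npos_ex Q0.
pose B := row_base P.
have cB : B *m Q x *m B^T @[x --> F] --> B *m Q0 *m B^T.
  by apply: cvg_mulmx; [apply: cvg_mulmx => //; exact: cvg_cst | exact: cvg_cst].
have : pos_on 1%:M (B *m Q0 *m B^T).
  move=> u _ u0; rewrite qf_congr; apply: PQ.
    by rewrite (submx_trans (submxMl _ _)) // eq_row_base.
  by apply: contraNneq u0 => /eqP; rewrite mulmx_free_eq0 // row_base_free.
move=> /(pos_on_open cB) near1; near=> x.
apply: leq_trans (npos_congr_le B (Q x)).
have : pos_on 1%:M (B *m Q x *m B^T) by near: x; exact: near1.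
by move/npos_ge; rewrite mxrank1.
Unshelve. all: by end_near. Qed.

Lemma nneg_lsc (T : Type) (F : set_system T) {FF : Filter F} m
    (Q : T -> 'M[R]_m) (Q0 : 'M[R]_m) :
  Q x @[x --> F] --> Q0 -> \forall x \near F, (nneg Q0 <= nneg (Q x))%N.
Proof. by move=> QQ0; apply: npos_lsc; exact: cvgN. Qed.

(** Near the limit neither [npos] nor [nneg] can drop, and their sum is the rank. If the rank keeps
    its value, both do. *)
Lemma near_sgn_const (T : Type) (F : set_system T) {FF : Filter F} m
    (Q : T -> 'M[R]_m) (Q0 : 'M[R]_m) :
  Q x @[x --> F] --> Q0 -> Q0^T = Q0 ->
  \forall x \near F, (Q x)^T = Q x -> \rank (Q x) = \rank Q0 ->
    sgn (Q x) = sgn Q0.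
Proof.
move=> QQ0 sQ0; near=> x => sQ rQ.
have p : (npos Q0 <= npos (Q x))%N by near: x; exact: npos_lsc.
have n : (nneg Q0 <= nneg (Q x))%N by near: x; exact: nneg_lsc.
have := npos_nneg_rank sQ; have := npos_nneg_rank sQ0.
rewrite /sgn rQ; move: p n.
by move: (npos _) (nneg _) (npos _) (nneg _) (\rank _) => a b c d r; lia.
Unshelve. all: by end_near. Qed.

Lemma qf_block m1 m2 (A : 'M[R]_m1) (D : 'M[R]_m2) (u : 'rV[R]_m1)
    (v : 'rV[R]_m2) :
  qf (block_mx A 0 0 D) (row_mx u v) = qf A u + qf D v.
Proof.
rewrite /qf mul_row_block !mulmx0 addr0 add0r tr_row_mx mul_row_col.
by rewrite mxE.
Qed.

Lemma npos_block_ge m1 m2 (A : 'M[R]_m1) (D : 'M[R]_m2) :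
  (npos A + npos D <= npos (block_mx A 0 0 D))%N.
Proof.
have [P [<- PA]] := npos_ex A; have [N [<- ND]] := npos_ex D.
rewrite -rank_diag_block_mx; apply: npos_ge => u /submxP[w ->].
rewrite -[w]hsubmxK mul_row_block !mulmx0 addr0 add0r.
set p := _ *m P; set q := _ *m N.
have pA : p != 0 -> 0 < qf A p by apply: PA; exact: submxMl.
have qD : q != 0 -> 0 < qf D q by apply: ND; exact: submxMl.
have q0 m (Q : 'M[R]_m) : qf Q 0 = 0 by rewrite /qf !mul0mx mxE.
rewrite qf_block; have [->|p0] := eqVneq p 0.
  rewrite q0 add0r => w0; apply: qD.
  by apply: contraNneq w0 => ->; rewrite row_mx0.
have [->|n0] := eqVneq q 0; first by rewrite q0 addr0 => _; exact: pA.
by move=> _; rewrite addr_gt0 ?pA ?qD.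
Qed.

(** The inequalities of [npos_block_ge] for the form and for its opposite add up to an equality of
    ranks, so each of them is an equality. *)
Lemma sgn_block m1 m2 (A : 'M[R]_m1) (D : 'M[R]_m2) : A^T = A -> D^T = D ->
  sgn (block_mx A 0 0 D) = sgn A + sgn D.
Proof.
move=> sA sD; have sB : (block_mx A 0 0 D)^T = block_mx A 0 0 D.
  by rewrite tr_block_mx !trmx0 sA sD.
have := npos_nneg_rank sB; rewrite rank_diag_block_mx.
rewrite -(npos_nneg_rank sA) -(npos_nneg_rank sD).
have := npos_block_ge A D; have := npos_block_ge (- A) (- D).
have -> : block_mx (- A) 0 0 (- D) = - block_mx A 0 0 D.
  by rewrite opp_block_mx !oppr0.
rewrite /sgn /nneg; move: (npos _) (npos _) (npos _) (npos _) (npos _) (npos _).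
by move=> a b c d e f; lia.
Qed.

(* Rescaling the P1-part of the form by (t - t0)^(-1/2) turns the statement
   into semicontinuity of npos. *)
Lemma npos_jump k m (A : R -> 'M[R]_m) (A' : 'M[R]_m) (t0 : R)
    (P1 : 'M[R]_(k, m)) :
  (A t0)^T = A t0 -> is_derive t0 (1 : R) A A' ->
  (P1 <= kermx (A t0))%MS -> pos_on P1 A' ->
  \forall h \near (0 : R)^'+, (npos (A t0) + \rank P1 <= npos (A (t0 + h)%R))%N.
Proof.
move=> sA dA /sub_kermxP P1A P1pos.
have [P0 [<- P0pos]] := npos_ex (A t0).
pose B0 := row_base P0; pose B1 := row_base P1.
have B1A : B1 *m A t0 = 0.
  have /submxP[D ->] : (B1 <= P1)%MS by rewrite eq_row_base.
  by rewrite -mulmxA P1A mulmx0.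
have AB1 : A t0 *m B1^T = 0 by rewrite -sA -trmx_mul B1A trmx0.
pose D (h : R) := h^-1 *: (A (t0 + h) - A t0).
have DA' : D h @[h --> (0 : R)^'+] --> A'.
  have [cv <-] := dA; apply: cvg_dnbhs_at_right.
  have : D = fun h => h^-1 *: ((A \o shift t0) (h *: (1 : R)) - A t0).
    apply/funext => h; rewrite /D /=; congr (_ *: (A _ - _)).
    by rewrite addrC; congr (_ + _); rewrite -[LHS]mulr1.
  by move=> ->; exact: cv.
have AE (h : R) : h != 0 -> A (t0 + h) = A t0 + h *: D h.
  by move=> h0; rewrite /D scalerA divff // scale1r [RHS]addrC subrK.
have s0 : Num.sqrt h @[h --> (0 : R)^'+] --> (0 : R).
  rewrite -[X in _ --> X]sqrtr0.
  by apply: cvg_within_filter; exact: sqrt_continuous.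
have A0 : A (t0 + h) @[h --> (0 : R)^'+] --> A t0.
  have : A t0 + h *: D h @[h --> (0 : R)^'+] --> A t0 + 0 *: A'.
    apply: cvgD; first exact: cvg_cst.
    by apply: cvgZ => //; apply: cvg_within_filter; exact: cvg_id.
  rewrite scale0r addr0; apply: cvg_trans; apply: near_eq_cvg.
  by near=> h; rewrite AE.
(* Gram matrix of [A (t0 + h)] on [B0] and on [B1] divided by [sqrt h]. As [A t0] kills [B1], the
   mixed blocks keep a factor [sqrt h], and the limit is block diagonal with two positive definite
   blocks. *)
pose M (h : R) := block_mx (B0 *m A (t0 + h) *m B0^T) (Num.sqrt h *: (B0 *m D h *m B1^T))
  (Num.sqrt h *: (B1 *m D h *m B0^T)) (B1 *m D h *m B1^T).
have MC : M h @[h --> (0 : R)^'+] -->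
    block_mx (B0 *m A t0 *m B0^T) (0 *: (B0 *m A' *m B1^T))
      (0 *: (B1 *m A' *m B0^T)) (B1 *m A' *m B1^T).
  have cB (r s : nat) (U : 'M[R]_(r, m)) (V : 'M[R]_(s, m)) (E : R -> 'M[R]_m) E0 :
      E h @[h --> (0 : R)^'+] --> E0 ->
      U *m E h *m V^T @[h --> (0 : R)^'+] --> U *m E0 *m V^T.
    move=> EE; apply: cvg_mulmx; last exact: cvg_cst.
    by apply: cvg_mulmx => //; exact: cvg_cst.
  apply: cvg_col_mx; apply: cvg_row_mx.
  - exact: cB.
  - by apply: cvgZ; [exact: s0 | exact: cB].
  - by apply: cvgZ; [exact: s0 | exact: cB].
  - exact: cB.
have := npos_lsc MC; rewrite !scale0r => near_npos.
have pos_base (l : nat) (P : 'M[R]_(l, m)) Q : pos_on P Q ->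
    (\rank P <= npos (row_base P *m Q *m (row_base P)^T))%N.
  move=> PQ; have : pos_on 1%:M (row_base P *m Q *m (row_base P)^T).
    move=> u _ u0; rewrite qf_congr; apply: PQ.
      by rewrite (submx_trans (submxMl _ _)) // eq_row_base.
    by apply: contraNneq u0 => /eqP; rewrite mulmx_free_eq0 // row_base_free.
  by move/npos_ge; rewrite mxrank1.
near=> h.
have h0 : 0 < h by near: h; exact: nbhs_right_gt.
have sh : Num.sqrt h != 0 by rewrite gt_eqF // sqrtr_gt0.
pose G := col_mx B0 ((Num.sqrt h)^-1 *: B1).
have ME : G *m A (t0 + h) *m G^T = M h.
  rewrite /G tr_col_mx mul_col_mx mul_col_row /M; congr block_mx.
  - rewrite linearZ /= -scalemxAr AE ?gt_eqF // mulmxDr mulmxDl.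
    rewrite -(mulmxA B0 (A t0)) AB1 mulmx0 add0r.
    rewrite -scalemxAr -scalemxAl scalerA; congr (_ *: _).
    by rewrite -{2}(sqr_sqrtr (ltW h0)) expr2 mulrA mulVf // mul1r.
  - rewrite -!scalemxAl AE ?gt_eqF // mulmxDr mulmxDl B1A mul0mx add0r.
    rewrite -scalemxAr -scalemxAl scalerA; congr (_ *: _).
    by rewrite -{2}(sqr_sqrtr (ltW h0)) expr2 mulrA mulVf // mul1r.
  - rewrite linearZ /= -!scalemxAl -scalemxAr scalerA AE ?gt_eqF //.
    rewrite mulmxDr mulmxDl B1A mul0mx add0r -scalemxAr -scalemxAl scalerA.
    by rewrite -invfM -expr2 sqr_sqrtr ?ltW // mulVf ?gt_eqF // scale1r.
apply: leq_trans (npos_congr_le G (A (t0 + h))); rewrite ME.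
apply: leq_trans (_ : npos _ <= _)%N; last by near: h; exact: near_npos.
apply: leq_trans (npos_block_ge _ _).
by rewrite leq_add // pos_base.
Unshelve. all: by end_near. Qed.

End Signature.

#[global] Opaque npos.

(** * The Maslov index from signatures *)

(* A Lagrangian frame is written [X Y] in a splitting of the symplectic space
   into the reference Lagrangian V (second factor Y = 0) and a Lagrangian
   complement; C parametrizes the Lagrangian complements of V. *)
Section LagrangianFrames.
Context {R : realType} {m : nat}.
Implicit Types X Y C G : 'M[R]_m.

Definition lagr X Y : Prop := X *m Y^T = Y *m X^T /\ row_free (row_mx X Y).

(** Transversality of the Lagrangian to the complement of [V] formed by the vectors [(w C, w)]. *)
Definition good C X Y : Prop := X - Y *m C \in unitmx.

(** In the splitting defined by [C] the Lagrangian is the graph over [V] of [A = G^-1 Y] with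
    [G = X - Y C]. For symmetric [C] this matrix is [G A G^T]: it has the signature of [A] and is
    written without an inverse. *)
Definition chart_form C X Y : 'M[R]_m := (X - Y *m C) *m Y^T.

(** At a regular crossing of signature [s] the signature of the chart form changes by [s] on arrival
    and by [s] again on departure; the factor one half turns this into [s] in the interior and
    [s / 2] at an end point. *)
Definition pot C X Y : R := 2^-1 * (sgn (chart_form C X Y))%:~R.

Lemma potE C X Y : pot C X Y = 2^-1 * (sgn (chart_form C X Y))%:~R.
Proof. by []. Qed.

Lemma chart_form_sym C X Y : C^T = C -> lagr X Y ->
  (chart_form C X Y)^T = chart_form C X Y.
Proof.
move=> sC [XY _]; rewrite /chart_form trmx_mul trmxK linearB /= trmx_mul sC.
by rewrite mulmxBr mulmxBl XY !mulmxA.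
Qed.

Lemma rank_chart_form C X Y : good C X Y -> \rank (chart_form C X Y) = \rank Y.
Proof.
move=> g; rewrite /chart_form -mxrank_tr trmx_mul trmxK mxrankMfree //.
by rewrite row_free_unit unitmx_tr.
Qed.

Lemma potG C X Y G : G \in unitmx -> pot C (G *m X) (G *m Y) = pot C X Y.
Proof.
move=> uG; rewrite /pot -[in RHS](sgn_congr _ uG) /chart_form.
by rewrite trmx_mul -mulmxA -mulmxBr !mulmxA.
Qed.

Lemma goodG C X Y G : G \in unitmx -> good C X Y -> good C (G *m X) (G *m Y).
Proof. by rewrite /good -mulmxA -mulmxBr unitmx_mul => ->. Qed.

Lemma lagrG X Y G : G \in unitmx -> lagr X Y -> lagr (G *m X) (G *m Y).
Proof.
move=> uG [XY rf]; split.
  by rewrite !trmx_mul !mulmxA -(mulmxA G X) XY !mulmxA.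
by rewrite -mul_mx_row /row_free mxrankMfree // -/(row_free G) row_free_unit.
Qed.

Lemma fin_roots (p : {poly R}) : p != 0 ->
  exists s : seq R, forall x, x \notin s -> ~~ root p x.
Proof.
have [n] := ubnP (size p); elim: n p => // n IH p; rewrite ltnS => sp p0.
have [[a ra]|nr] := pselect (exists a, root p a); last first.
  by exists [::] => x _; apply/negP => rx; apply: nr; exists x.
have [q pq] := factor_theorem _ _ ra.
have q0 : q != 0 by apply: contraNneq p0 => q0; rewrite pq q0 mul0r.
have [|s Hs] := IH q _ q0.
  rewrite (leq_trans _ sp) // pq size_Mmonic ?monicXsubC // size_XsubC addn2 /=.
  exact: leqnn.
exists (a :: s) => x; rewrite inE negb_or => /andP[xa xs].
by rewrite pq rootM negb_or Hs //= root_XsubC.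
Qed.

(** The determinant of the pencil is a polynomial in the parameter, and it is nonzero because it has
    a nonroot. *)
Lemma fin_singular (A B : 'M[R]_m) : (exists z : R, A - z *: B \in unitmx) ->
  exists s : seq R, forall c, c \notin s -> A - c *: B \in unitmx.
Proof.
move=> [z uz].
pose p := \det (map_mx polyC A - 'X *: map_mx polyC B).
have pE c : p.[c] = \det (A - c *: B).
  rewrite -horner_evalE -det_map_mx; congr (\det _); apply/matrixP => i j.
  by rewrite !mxE /= horner_evalE !hornerE.
have p0 : p != 0.
  apply/eqP => p0; move: uz; rewrite unitmxE unitfE -pE p0 horner0 eqxx //.
have [s Hs] := fin_roots p0; exists s => c /Hs.
by rewrite /root pE unitmxE unitfE.
Qed.

Lemma notin_ex (s : seq R) : exists c : R, c \notin s.
Proof.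
exists (1 + \sum_(x <- s) `|x|); apply/negP => cs.
have : 1 + \sum_(x <- s) `|x| <= \sum_(x <- s) `|x|.
  rewrite {2}(big_rem _ cs) /= ler_wpDr ?sumr_ge0 // ler_norm //.
by rewrite -subr_ge0 opprD addrCA subrr addr0 oppr_ge0 ler10.
Qed.

Lemma posdef_unit (A : 'M[R]_m) : pos_on 1%:M A -> A \in unitmx.
Proof.
move=> pA; rewrite -row_free_unit -kermx_eq0; apply/eqP/row_matrixP => i.
rewrite row0; apply/eqP; apply: contraT => r0.
have := pA (row i (kermx A)) (submx1 _) r0.
have /sub_kermxP : (row i (kermx A) <= kermx A)%MS by exact: row_sub.
by rewrite /qf => ->; rewrite mul0mx mxE ltxx.
Qed.

Lemma dotmx_ge0 k (u : 'rV[R]_k) : 0 <= (u *m u^T) 0 0.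
Proof. by rewrite mxE sumr_ge0 // => i _; rewrite mxE -expr2 sqr_ge0. Qed.

Lemma dotmx_eq0 k (u : 'rV[R]_k) : ((u *m u^T) 0 0 == 0) = (u == 0).
Proof.
apply/eqP/eqP => [|->]; last by rewrite mul0mx mxE.
rewrite mxE => /eqP; rewrite psumr_eq0 => [|i _]; last by rewrite mxE -expr2 sqr_ge0.
move=> /allP h; apply/rowP => i; rewrite mxE.
by have := h i (mem_index_enum _); rewrite mxE mulf_eq0 orbb => /eqP.
Qed.

(* (X - cY)(X + cY)^T = XX^T - c^2 YY^T, whose determinant is a polynomial in
   c^2 that does not vanish at -1. *)
Lemma good_scalar X Y : lagr X Y ->
  exists s : seq R, forall c, c \notin s -> good c%:M X Y.
Proof.
move=> [XY rf].
suff [z uz] : exists z : R, X - z *: Y \in unitmx.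
  have [s Hs] := fin_singular (ex_intro _ z uz); exists s => c /Hs.
  by rewrite /good mul_mx_scalar.
have [|s Hs] := @fin_singular (X *m X^T) (Y *m Y^T).
  exists (-1); rewrite scaleN1r opprK; apply: posdef_unit => u _ u0.
  rewrite /qf mulmxDr mulmxDl !mulmxA -!(mulmxA _ _ u^T) -!trmx_mul mxE.
  rewrite lt_neqAle addr_ge0 ?dotmx_ge0 // andbT eq_sym.
  rewrite paddr_eq0 ?dotmx_ge0 // !dotmx_eq0; apply: contra u0 => /andP[/eqP uX /eqP uY].
  by rewrite -(mulmx_free_eq0 _ rf) mul_mx_row uX uY row_mx0.
pose p : {poly R} := \prod_(x <- s) ('X^2 - x%:P).
have p0 : p != 0.
  rewrite /p prodf_seq_neq0; apply/allP => x _ /=.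
  by rewrite -size_poly_eq0 size_polyDl ?size_polyXn // size_polyN size_polyC; case: (x != 0).
have [r Hr] := fin_roots p0; have [c /Hr] := notin_ex r.
rewrite /root horner_prod prodf_seq_neq0 => /allP nc.
exists c; have : X *m X^T - c ^+ 2 *: (Y *m Y^T) \in unitmx.
  apply: Hs; apply/negP => /nc; by rewrite !hornerE subrr eqxx.
have -> : X *m X^T - c ^+ 2 *: (Y *m Y^T) = (X - c *: Y) *m (X + c *: Y)^T.
  have cY : (c *: Y)^T = c *: Y^T by rewrite linearZ.
  rewrite linearD /= cY mulmxDr !mulmxBl.
  rewrite -!scalemxAl -!scalemxAr XY.
  by rewrite scalerA -expr2 addrA subrK.
by rewrite unitmx_mul => /andP[].
Qed.

Lemma sub_scalar_unit C : exists s : seq R, forall c, c \notin s ->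
  c%:M - C \in unitmx.
Proof.
have [s Hs] := fin_roots (monic_neq0 (char_poly_monic C)).
exists s => c /Hs; rewrite /root /char_poly -horner_evalE -det_map_mx.
rewrite unitmxE unitfE; congr (\det _ != 0); apply/matrixP => i j.
by rewrite !mxE /= horner_evalE !hornerE hornerMn hornerX.
Qed.

(** Put [k = C' - C]. The two chart forms are congruent to [A] and to [A - A k A], which are
    compared by a Schur complement. What matters is that the difference involves only the
    nondegenerate forms [K - A] and [K], whose signatures are locally constant along a path. *)
Lemma pot_change C C' X Y : C^T = C -> C'^T = C' -> C' - C \in unitmx ->
  lagr X Y -> good C X Y -> good C' X Y ->
  let A := invmx (X - Y *m C) *m Y in let K := invmx (C' - C) in
  [/\ K - A \in unitmx, (K - A)^T = K - A &
  pot C' X Y - pot C X Y = 2^-1 * (sgn (K - A) - sgn K)%:~R].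
Proof.
move=> sC sC' uk lXY g g'; set k := C' - C in uk *.
set G := X - Y *m C => A K.
have uG : G \in unitmx by [].
have GA : G *m A = Y by rewrite mulKVmx.
have sk : k^T = k by rewrite /k linearB /= sC sC'.
have sK : K^T = K by rewrite /K trmx_inv sk.
have sA : A^T = A.
  have : G *m (A^T) *m G^T = G *m A *m G^T.
    rewrite -mulmxA -trmx_mul GA; have := chart_form_sym sC lXY.
    by rewrite /chart_form -/G trmx_mul trmxK => ->.
  move=> /(congr1 (fun M => invmx G *m M *m invmx G^T)).
  by rewrite !mulmxA mulVmx // !mul1mx -!mulmxA mulmxV ?unitmx_tr // !mulmx1.
have kK : k *m K = 1%:M by rewrite mulmxV.
have Kk : K *m k = 1%:M by rewrite mulVmx.
have G'E : X - Y *m C' = G *m (1%:M - A *m k).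
  rewrite mulmxBr mulmx1 mulmxA GA /k mulmxBr /G.
  by rewrite opprB addrA subrK.
clearbody k.
have u1 : 1%:M - A *m k \in unitmx.
  by move: g'; rewrite /good G'E unitmx_mul => /andP[].
have KAE : K - A = (1%:M - A *m k) *m K.
  by rewrite mulmxBl mul1mx -mulmxA kK mulmx1.
have uKA : K - A \in unitmx by rewrite KAE unitmx_mul u1 unitmx_inv.
have sKA : (K - A)^T = K - A by rewrite linearB /= sK sA.
split => //.
have YT : Y^T = A *m G^T by rewrite -GA trmx_mul sA.
have QE : chart_form C X Y = G *m A *m G^T.
  by rewrite /chart_form YT mulmxA.
have Q'E : chart_form C' X Y = G *m (A - A *m k *m A) *m G^T.
  by rewrite /chart_form YT G'E !mulmxBr mulmx1 !mulmxBl !mulmxA.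
clearbody A K G.
have sAkA : (A - A *m k *m A)^T = A - A *m k *m A.
  by rewrite linearB /= !trmx_mul sA sk mulmxA.
rewrite /pot QE Q'E !sgn_congr // -mulrBr; congr (_ * _).
rewrite -intrB; congr (_%:~R).
(* Eliminating one diagonal block or the other of this matrix gives [sgn A + sgn (K - A) = sgn (A -
   A k A) + sgn K]. *)
pose M : 'M[R]_(m + m) := block_mx A A A K.
have uT (B : 'M[R]_m) : block_mx 1%:M 0 B 1%:M \in unitmx.
  by rewrite unitmxE det_lblock !det1 mulr1 unitr1.
have uT' (B : 'M[R]_m) : block_mx 1%:M B 0 1%:M \in unitmx.
  by rewrite unitmxE det_ublock !det1 mulr1 unitr1.
have e1 : sgn M = sgn A + sgn (K - A).
  rewrite -(sgn_congr M (uT (- 1%:M))) -sgn_block //; congr sgn.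
  rewrite /M tr_block_mx !mulmx_block !trmx1 !trmx0 linearN /= trmx1.
  rewrite !(mulmxN, mulNmx, mulmx1, mul1mx, mulmx0, mul0mx, addr0, add0r).
  by rewrite !addNr !oppr0 add0r addrC.
have e2 : sgn M = sgn (A - A *m k *m A) + sgn K.
  rewrite -(sgn_congr M (uT' (- (A *m k)))) -sgn_block //; congr sgn.
  rewrite /M tr_block_mx !mulmx_block !trmx1 !trmx0 linearN /= trmx_mul sA sk.
  rewrite !(mulmx1, mul1mx, mulmx0, mul0mx, addr0, add0r) !mulNmx.
  by rewrite -(mulmxA A k K) kK mulmx1 subrr mul0mx addr0 mulmxN mulmxA Kk mul1mx subrr.
move: e2; rewrite e1; move: (sgn A) (sgn K) (sgn (K - A)) (sgn _) => a b c d; lia.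
Qed.

End LagrangianFrames.

#[global] Opaque pot.

Section Potentials.
Context {R : realType} {m : nat}.

Lemma near_sub_trans (T : Type) (F : set_system T) {FF : Filter F}
    (a b c : T -> R) (a0 b0 c0 : R) :
  (\forall x \near F, a x - b x = a0 - b0) ->
  (\forall x \near F, b x - c x = b0 - c0) ->
  \forall x \near F, a x - c x = a0 - c0.
Proof.
move=> n1 n2; near=> x.
have e1 : a x - b x = a0 - b0 by near: x.
have e2 : b x - c x = b0 - c0 by near: x.
by move: e1 e2; lra.
Unshelve. all: by end_near. Qed.

Lemma near_sub_sym (T : Type) (F : set_system T) {FF : Filter F}
    (a b : T -> R) (a0 b0 : R) :
  (\forall x \near F, a x - b x = a0 - b0) ->
  \forall x \near F, b x - a x = b0 - a0.
Proof.
move=> n1; near=> x; have e1 : a x - b x = a0 - b0 by near: x.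
by move: e1; lra.
Unshelve. all: by end_near. Qed.

(** The potentials of two complements differ by a locally constant function, because the form
    [K - A] of [pot_change] stays nondegenerate. This is what makes the index independent of the
    complement. *)
Lemma pot_change_near (T : Type) (F : set_system T) {FF : Filter F}
    (X Y : T -> 'M[R]_m) (X0 Y0 C C' : 'M[R]_m) :
  C^T = C -> C'^T = C' ->
  X x @[x --> F] --> X0 -> Y x @[x --> F] --> Y0 ->
  (\forall x \near F, lagr (X x) (Y x)) -> lagr X0 Y0 ->
  good C X0 Y0 -> good C' X0 Y0 ->
  \forall x \near F,
    pot C' (X x) (Y x) - pot C (X x) (Y x) = pot C' X0 Y0 - pot C X0 Y0.
Proof.
move=> sC sC' XX YY lXY l0 g g'.
have cg (D : 'M[R]_m) : X x - Y x *m D @[x --> F] --> X0 - Y0 *m D.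
  by apply: cvgB => //; apply: cvg_mulmx => //; exact: cvg_cst.
have ng (D : 'M[R]_m) : good D X0 Y0 -> \forall x \near F, good D (X x) (Y x).
  by move=> gD; exact: near_unitmx (cg D) gD.
have main (D D' : 'M[R]_m) : D^T = D -> D'^T = D' -> D' - D \in unitmx ->
    good D X0 Y0 -> good D' X0 Y0 -> \forall x \near F,
    pot D' (X x) (Y x) - pot D (X x) (Y x) = pot D' X0 Y0 - pot D X0 Y0.
  move=> sD sD' uD gD gD'.
  have [u0 s0 ->] := pot_change sD sD' uD l0 gD gD'.
  have cA : invmx (D' - D) - invmx (X x - Y x *m D) *m Y x @[x --> F] -->
       invmx (D' - D) - invmx (X0 - Y0 *m D) *m Y0.
    apply: cvgB; first exact: cvg_cst.
    by apply: cvg_mulmx => //; exact: cvg_invmx (cg D) gD.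
  have nsgn := near_sgn_const cA s0.
  have nD := ng D gD; have nD' := ng D' gD'.
  near=> x.
  have lx : lagr (X x) (Y x) by near: x.
  have gx : good D (X x) (Y x) by near: x; exact: nD.
  have gx' : good D' (X x) (Y x) by near: x; exact: nD'.
  have [ux sx ->] := pot_change sD sD' uD lx gx gx'.
  have -> // : sgn (invmx (D' - D) - invmx (X x - Y x *m D) *m Y x) =
    sgn (invmx (D' - D) - invmx (X0 - Y0 *m D) *m Y0).
  move: sx (etrans (mxrank_unit ux) (esym (mxrank_unit u0))); near: x.
  exact: nsgn.
(* When [C' - C] is singular, both complements are compared with a scalar one, chosen outside
   finitely many bad values. *)
have [s Hs] := good_scalar l0.
have [s1 H1] := sub_scalar_unit C; have [s2 H2] := sub_scalar_unit C'.
have [c] := notin_ex (s ++ s1 ++ s2).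
rewrite !mem_cat !negb_or => /and3P[/Hs gc /H1 u1 /H2 u2].
have sc : (c%:M : 'M[R]_m)^T = c%:M by rewrite tr_scalar_mx.
have u2' : C' - c%:M \in unitmx by rewrite -opprB -scaleN1r unitmxZ ?unitrN1.
exact: near_sub_trans (main _ _ sc sC' u2' gc g') (main _ _ sC sc u1 g gc).
Unshelve. all: by end_near. Qed.

Section OnSpace.
Context {T : topologicalType}.
Implicit Types (D : set T) (X Y : T -> 'M[R]_m) (phi : T -> R).

Definition cont_on (V : topologicalType) D (f : T -> V) : Prop :=
  forall p, D p -> f q @[q --> within D (nbhs p)] --> f p.

Definition lagr_on D X Y : Prop :=
  [/\ cont_on D X, cont_on D Y & forall p, D p -> lagr (X p) (Y p)].

(** The analogue of a primitive of a closed 1-form: each [pot C] is a local primitive where [C] is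
    transverse to the Lagrangians, and by [pot_change_near] the choice of [C] only matters up to
    local constants. Increments of [phi] are Maslov indices. *)
Definition is_pot D X Y phi : Prop := forall p, D p -> exists C : 'M[R]_m,
  [/\ C^T = C, good C (X p) (Y p) & \forall q \near within D (nbhs p),
    phi q - pot C (X q) (Y q) = phi p - pot C (X p) (Y p)].

Lemma near_within D (P : T -> Prop) (p : T) :
  (\forall q \near p, P q) -> \forall q \near within D (nbhs p), P q.
Proof. by apply: (@filterS _ (nbhs p)) => q. Qed.

Lemma near_within_sub D D' (P : T -> Prop) (p : T) : D' `<=` D ->
  (\forall q \near within D (nbhs p), P q) ->
  \forall q \near within D' (nbhs p), P q.
Proof.
by move=> DD; apply: (@filterS _ (nbhs p)) => q /= h /DD; exact: h.
Qed.

Lemma cont_on_sub (V : topologicalType) D D' (f : T -> V) :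
  D' `<=` D -> cont_on D f -> cont_on D' f.
Proof.
move=> DD fD p pD'; apply: cvg_trans (fD p (DD _ pD')).
by apply: cvg_app; apply: within_subset => //; exact: nbhs_filter.
Qed.

Lemma lagr_on_sub D D' X Y : D' `<=` D -> lagr_on D X Y -> lagr_on D' X Y.
Proof.
move=> DD [XD YD l]; split; [exact: cont_on_sub XD|exact: cont_on_sub YD|].
by move=> p /DD; exact: l.
Qed.

Lemma lagr_on_near D X Y p : lagr_on D X Y -> D p ->
  \forall q \near within D (nbhs p), lagr (X q) (Y q).
Proof. by move=> [_ _ l] Dp; near=> q; apply: l; near: q; exact: withinT. Unshelve. all: by end_near. Qed.

Lemma is_pot_unique D X Y phi psi : lagr_on D X Y ->
  is_pot D X Y phi -> is_pot D X Y psi ->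
  forall p, D p -> \forall q \near within D (nbhs p), phi q - psi q = phi p - psi p.
Proof.
move=> l h1 h2 p Dp; have [C [sC g n]] := h1 p Dp.
have [C' [sC' g' n']] := h2 p Dp.
have [XD YD lp] := l.
have nc := pot_change_near sC sC' (XD p Dp) (YD p Dp) (lagr_on_near l Dp) (lp p Dp) g g'.
apply: near_sub_trans n _; apply: near_sub_trans (near_sub_sym n').
exact: near_sub_sym (nc _).
Qed.

Lemma is_potD D X Y phi c : is_pot D X Y phi -> is_pot D X Y (fun q => phi q + c).
Proof.
move=> h p Dp; have [C [sC g n]] := h p Dp; exists C; split => //.
by apply: (@filterS _ (nbhs p)) n => q /= e Dq; move: (e Dq); lra.
Qed.

(** At a common point the two potentials are compared in one chart through [pot_change_near]; at a
    point of one set only, closedness keeps the other set away. *)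
Lemma is_pot_glue D1 D2 X Y phi1 phi2 : closed D1 -> closed D2 ->
  lagr_on (D1 `|` D2) X Y ->
  is_pot D1 X Y phi1 -> is_pot D2 X Y phi2 ->
  (forall p, D1 p -> D2 p -> phi1 p = phi2 p) ->
  is_pot (D1 `|` D2) X Y (fun p => if p \in D1 then phi1 p else phi2 p).
Proof.
move=> c1 c2 l h1 h2 e p Dp.
have away D : closed D -> ~ D p -> \forall q \near p, ~ D q.
  move=> cD nD; have : open (~` D) by exact: closed_openC.
  by rewrite openE => /(_ p nD).
have [D1p|nD1] := pselect (D1 p); last first.
  have D2p : D2 p by case: Dp.
  have [C [sC g n]] := h2 p D2p; exists C; split => //.
  have na := away _ c1 nD1.
  near=> q; rewrite (memNset nD1); have nq : ~ D1 q by near: q; exact: near_within na.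
  have Dq : (D1 `|` D2) q by near: q; exact: withinT.
  have D2q : D2 q by case: Dq.
  by rewrite (memNset nq); move: D2q; near: q; exact: near_within n.
rewrite (mem_set D1p).
have [C [sC g n]] := h1 p D1p; exists C; split => //.
have [D2p|nD2] := pselect (D2 p); last first.
  have na := away _ c2 nD2.
  near=> q; have nq : ~ D2 q by near: q; exact: near_within na.
  have Dq : (D1 `|` D2) q by near: q; exact: withinT.
  have D1q : D1 q by case: Dq.
  by rewrite (mem_set D1q); move: D1q; near: q; exact: near_within n.
have [C' [sC' g' n']] := h2 p D2p.
have [XD YD lp] := l.
have nc := pot_change_near sC sC' (XD p Dp) (YD p Dp) (lagr_on_near l Dp) (lp p Dp) g g'.
have n2 : \forall q \near within D2 (nbhs p),
    phi2 q - pot C (X q) (Y q) = phi1 p - pot C (X p) (Y p).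
  rewrite (e p D1p D2p); apply: near_sub_trans n' _.
  by apply: near_within_sub (nc _) => q; right.
near=> q; have Dq : (D1 `|` D2) q by near: q; exact: withinT.
have [D1q|nD1q] := pselect (D1 q).
  by rewrite (mem_set D1q); move: D1q; near: q; exact: near_within n.
have D2q : D2 q by case: Dq.
by rewrite (memNset nD1q); move: D2q; near: q; exact: near_within n2.
Unshelve. all: by end_near. Qed.

Lemma is_pot_loc D X Y p : lagr_on D X Y -> D p ->
  exists2 C : 'M[R]_m, C^T = C &
    (\forall q \near within D (nbhs p), good C (X q) (Y q)).
Proof.
move=> [XD YD l] Dp; have [s Hs] := good_scalar (l p Dp).
have [c /Hs gc] := notin_ex s; exists c%:M; first by rewrite tr_scalar_mx.
apply: (near_unitmx _ gc); apply: cvgB; first exact: XD.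
by apply: cvg_mulmx; [exact: YD | exact: cvg_cst].
Qed.

Lemma is_pot_chart D X Y (C : 'M[R]_m) : C^T = C ->
  (forall p, D p -> good C (X p) (Y p)) ->
  is_pot D X Y (fun q => pot C (X q) (Y q)).
Proof.
move=> sC g p Dp; exists C; split => //; first exact: g.
by near=> q; rewrite !subrr.
Unshelve. all: by end_near. Qed.

End OnSpace.

Lemma is_pot_comp (T T' : topologicalType) (D : set T) (D' : set T')
    (X Y : T -> 'M[R]_m) phi (g : T' -> T) :
  cont_on D' g -> (forall q, D' q -> D (g q)) ->
  is_pot D X Y phi -> is_pot D' (X \o g) (Y \o g) (phi \o g).
Proof.
move=> cg gD h p D'p; have [C [sC gC n]] := h (g p) (gD p D'p).
exists C; split => //.
have /= := cg p D'p _ n; apply: (@filterS _ (nbhs p)) => q /= hq D'q.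
by apply: hq => //; exact: gD.
Qed.

Lemma cont_on_comp (T T' V : topologicalType) (D : set T) (D' : set T')
    (f : T -> V) (g : T' -> T) :
  cont_on D' g -> (forall q, D' q -> D (g q)) -> cont_on D f ->
  cont_on D' (f \o g).
Proof.
move=> cg gD cf p D'p A nA; have /= n := cf (g p) (gD p D'p) A nA.
have /= := cg p D'p _ n; apply: (@filterS _ (nbhs p)) => q /= hq D'q.
by apply: hq => //; exact: gD.
Qed.

Lemma lagr_on_comp (T T' : topologicalType) (D : set T) (D' : set T')
    (X Y : T -> 'M[R]_m) (g : T' -> T) :
  cont_on D' g -> (forall q, D' q -> D (g q)) ->
  lagr_on D X Y -> lagr_on D' (X \o g) (Y \o g).
Proof.
move=> cg gD [cX cY l]; split; [exact: cont_on_comp cX|exact: cont_on_comp cY|].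
by move=> p /gD; exact: l.
Qed.

End Potentials.

Section MaslovFunction.
Context {R : realType} {m : nat}.

Definition itv (a b : R) : set R := [set t | a <= t <= b].

Definition rect (s0 s1 t0 t1 : R) : set (R * R) :=
  [set p | s0 <= p.1 <= s1 /\ t0 <= p.2 <= t1].

Lemma closed_itv a b : closed (itv a b).
Proof.
have -> : itv a b = [set t | a <= t] `&` [set t | t <= b].
  apply/seteqP; split => t; first by move=> /andP[].
  by move=> [? ?]; apply/andP; split.
by apply: closedI; [exact: closed_ge | exact: closed_le].
Qed.

Lemma closed_rect s0 s1 t0 t1 : closed (rect s0 s1 t0 t1).
Proof.
have -> : rect s0 s1 t0 t1 =
    (@fst R R) @^-1` itv s0 s1 `&` (@snd R R) @^-1` itv t0 t1.
  by apply/seteqP; split.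
by apply: closedI; apply: closed_comp;
   [move=> p _; exact: cvg_fst | exact: closed_itv
   |move=> p _; exact: cvg_snd | exact: closed_itv].
Qed.

Lemma locally_const (V : Type) (f : R -> V) a b : a <= b ->
  (forall t, itv a b t -> \forall q \near within (itv a b) (nbhs t), f q = f t) ->
  forall t, itv a b t -> f t = f a.
Proof.
move=> ab loc t /andP[at_ tb].
pose Q u v := f v = f u.
apply: (@interval_glue R Q a t at_) => [s /andP[as_ st]|u v w _ _ _ _]; last first.
  by rewrite /Q => -> ->.
have [|d /= d0 Hd] := loc s; first by rewrite /itv /= as_ (le_trans st tb).
exists d => // u v au uv vt su vs.
have H (x : R) : a <= x -> x <= t -> s - d < x -> x < s + d -> f x = f s.
  move=> ax xt sx xs; apply: Hd; last by rewrite /itv /= ax (le_trans xt tb).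
  by rewrite /ball_ /= ltr_distlC sx xs.
rewrite /Q (H v) ?(H u) //; first exact: le_trans uv vt.
- exact: le_lt_trans uv vs.
- exact: le_trans au uv.
- exact: lt_le_trans su uv.
Qed.

Implicit Types X Y : R -> 'M[R]_m.

Definition mas_is (a b : R) X Y (mu : R) : Prop :=
  exists2 phi, is_pot (itv a b) X Y phi & mu = phi b - phi a.

Lemma is_pot_itv_unique a b X Y phi psi : a <= b -> lagr_on (itv a b) X Y ->
  is_pot (itv a b) X Y phi -> is_pot (itv a b) X Y psi ->
  forall t, itv a b t -> phi t - psi t = phi a - psi a.
Proof.
move=> ab l h1 h2; apply: (locally_const (f := fun t => phi t - psi t)) => //.
by move=> t tab; exact: is_pot_unique h1 h2 t tab.
Qed.

Lemma mas_unique a b X Y mu nu : a <= b -> lagr_on (itv a b) X Y ->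
  mas_is a b X Y mu -> mas_is a b X Y nu -> mu = nu.
Proof.
move=> ab l [phi h1 ->] [psi h2 ->].
have := is_pot_itv_unique ab l h1 h2 (t := b).
by rewrite /itv /= ab lexx => /(_ isT); lra.
Qed.

Lemma edge_const (T : topologicalType) (D1 D2 : set T) (U W : T -> 'M[R]_m)
    phi1 phi2 (g : R -> T) u v : u <= v ->
  lagr_on D1 U W -> is_pot D1 U W phi1 -> is_pot D2 U W phi2 ->
  cont_on (itv u v) g -> (forall t, itv u v t -> D1 (g t)) ->
  (forall t, itv u v t -> D2 (g t)) ->
  forall t, itv u v t -> phi1 (g t) = phi2 (g t) + (phi1 (g u) - phi2 (g u)).
Proof.
move=> uv l h1 h2 cg g1 g2 t tuv.
have := is_pot_itv_unique uv (lagr_on_comp cg g1 l) (is_pot_comp cg g1 h1)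
  (is_pot_comp cg g2 h2) tuv.
by rewrite /=; lra.
Qed.

Lemma cont_on_cst (T V : topologicalType) (D : set T) (c : V) :
  cont_on D (fun=> c).
Proof. by move=> p _; exact: cvg_cst. Qed.

Lemma cont_on_continuous (T V : topologicalType) (D : set T) (f : T -> V) :
  continuous f -> cont_on D f.
Proof.
move=> cf p _; apply: cvg_trans (cf p).
by apply: cvg_app; exact: cvg_within.
Qed.

Lemma continuous_pairl (c : R) : continuous (fun t : R => (c, t)).
Proof. by move=> t; apply: (@cvg_pair _ _ _ (nbhs t) (nbhs c) (nbhs t) _ _ _ (fun=> c) id);
  [exact: cvg_cst | exact: cvg_id]. Qed.

Lemma continuous_pairr (c : R) : continuous (fun t : R => (t, c)).
Proof. by move=> t; apply: (@cvg_pair _ _ _ (nbhs t) (nbhs t) (nbhs c) _ _ _ id (fun=> c));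
  [exact: cvg_id | exact: cvg_cst]. Qed.

(** Simple connectedness of a rectangle: a single chart serves a small rectangle, and two rectangles
    sharing an edge can be glued because their potentials differ by a constant along that connected
    edge. *)
Lemma rect_pot (X Y : R * R -> 'M[R]_m) s0 s1 t0 t1 : s0 <= s1 -> t0 <= t1 ->
  lagr_on (rect s0 s1 t0 t1) X Y ->
  exists phi, is_pot (rect s0 s1 t0 t1) X Y phi.
Proof.
move=> s01 t01 l.
pose Good u0 u1 v0 v1 := exists phi, is_pot (rect u0 u1 v0 v1) X Y phi.
have sub u0 u1 v0 v1 : s0 <= u0 -> u1 <= s1 -> t0 <= v0 -> v1 <= t1 ->
    rect u0 u1 v0 v1 `<=` rect s0 s1 t0 t1.
  move=> h1 h2 h3 h4 p /= [/andP[a1 a2] /andP[a3 a4]].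
  by split; apply/andP; split;
    [exact: le_trans h1 a1 | exact: le_trans a2 h2
    |exact: le_trans h3 a3 | exact: le_trans a4 h4].
have glueT u0 u1 v0 v1 v2 : s0 <= u0 -> u0 <= u1 -> u1 <= s1 -> t0 <= v0 ->
    v0 <= v1 -> v1 <= v2 -> v2 <= t1 ->
    Good u0 u1 v0 v1 -> Good u0 u1 v1 v2 -> Good u0 u1 v0 v2.
  move=> su uu us tv vv vv' vt [phi1 h1] [phi2 h2].
  have e12 : rect u0 u1 v0 v2 = rect u0 u1 v0 v1 `|` rect u0 u1 v1 v2.
    apply/seteqP; split => [p /= [pu /andP[pv pv']]|p /= [] [pu /andP[pv pv']]].
    - by case: (leP p.2 v1) => h; [left | right]; split; rewrite // ?pv ?pv' ?h // ltW.
    - by split => //; rewrite pv (le_trans pv').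
    - by split => //; rewrite pv' andbT (le_trans vv).
  have l1 := lagr_on_sub (sub u0 u1 v0 v1 su us tv (le_trans vv' vt)) l.
  have l12 := lagr_on_sub (sub u0 u1 v0 v2 su us tv vt) l.
  rewrite e12 in l12.
  pose c := phi1 (u0, v1) - phi2 (u0, v1).
  have ec := edge_const uu l1 h1 h2 (cont_on_continuous (D := itv u0 u1) (@continuous_pairr v1)).
  have eq p : rect u0 u1 v0 v1 p -> rect u0 u1 v1 v2 p -> phi1 p = phi2 p + c.
    case: p => [p q] /= [pu /andP[_ qv]] [_ /andP[vq _]].
    have -> : q = v1 by apply/eqP; rewrite eq_le; apply/andP; split.
    by apply: ec => //= t tu; split => //=; rewrite lexx ?vv ?vv'.
  have := is_pot_glue (@closed_rect _ _ _ _) (@closed_rect _ _ _ _) l12 h1 (is_potD c h2) eq.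
  by rewrite -e12 => h; eexists; exact: h.
have glueS u0 u1 u2 v0 v1 : t0 <= v0 -> v0 <= v1 -> v1 <= t1 -> s0 <= u0 ->
    u0 <= u1 -> u1 <= u2 -> u2 <= s1 ->
    Good u0 u1 v0 v1 -> Good u1 u2 v0 v1 -> Good u0 u2 v0 v1.
  move=> su uu us tv vv vv' vt [phi1 h1] [phi2 h2].
  have e12 : rect u0 u2 v0 v1 = rect u0 u1 v0 v1 `|` rect u1 u2 v0 v1.
    apply/seteqP; split => [p /= [/andP[pv pv'] pu]|p /= [] [/andP[pv pv'] pu]].
    - by case: (leP p.1 u1) => h; [left | right]; split; rewrite // ?pv ?pv' ?h // ltW.
    - by split => //; rewrite pv (le_trans pv').
    - by split => //; rewrite pv' andbT (le_trans vv).
  have l1 := lagr_on_sub (sub u0 u1 v0 v1 tv (le_trans vv' vt) su us) l.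
  have l12 := lagr_on_sub (sub u0 u2 v0 v1 tv vt su us) l.
  rewrite e12 in l12.
  pose c := phi1 (u1, v0) - phi2 (u1, v0).
  have ec := edge_const uu l1 h1 h2 (cont_on_continuous (D := itv v0 v1) (@continuous_pairl u1)).
  have eq p : rect u0 u1 v0 v1 p -> rect u1 u2 v0 v1 p -> phi1 p = phi2 p + c.
    case: p => [q p] /= [/andP[_ qv] pu] [/andP[vq _] _].
    have -> : q = u1 by apply/eqP; rewrite eq_le; apply/andP; split.
    by apply: ec => //= t tu; split => //=; rewrite lexx ?vv ?vv'.
  have := is_pot_glue (@closed_rect _ _ _ _) (@closed_rect _ _ _ _) l12 h1 (is_potD c h2) eq.
  by rewrite -e12 => h; eexists; exact: h.
(* A strip of full height around [s] needs one width [d] for all heights; it is obtained by gluing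
   in the second variable. The strips are then glued in the first one. *)
pose Col s v0 v1 := exists2 d : R, 0 < d & forall u0 u1, s0 <= u0 -> u0 <= u1 ->
  u1 <= s1 -> s - d < u0 -> u1 < s + d -> Good u0 u1 v0 v1.
have locp s t : s0 <= s <= s1 -> t0 <= t <= t1 -> exists2 d : R, 0 < d &
   forall u0 u1 v0 v1, s0 <= u0 -> u1 <= s1 -> s - d < u0 -> u1 < s + d ->
    t0 <= v0 -> v1 <= t1 -> t - d < v0 -> v1 < t + d -> Good u0 u1 v0 v1.
  move=> hs ht; have Dp : rect s0 s1 t0 t1 (s, t) by split.
  have [C sC nC] := is_pot_loc l Dp.
  have [d /= d0 Hd] := (nbhs_ballP _ _).1 nC.
  exists d => // u0 u1 v0 v1 h1 h2 h3 h4 h5 h6 h7 h8.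
  exists (fun q => pot C (X q) (Y q)); apply: is_pot_chart => // p pr.
  apply: Hd; last exact: sub pr.
  case: p pr => [p q] /= [/andP[a1 a2] /andP[a3 a4]].
  split; rewrite /ball /= ltr_distlC.
    by rewrite (lt_le_trans h3 a1) (le_lt_trans a2 h4).
  by rewrite (lt_le_trans h7 a3) (le_lt_trans a4 h8).
have col s : s0 <= s <= s1 -> Col s t0 t1.
  move=> hs; apply: (@interval_glue R (Col s)) => // [t ht|u v w tu uv vw wt].
    have [d d0 Hd] := locp s t hs ht; exists d => // v0 v1 h1 h2 h3 h4 h5.
    by exists d => // u0 u1 a1 a2 a3 a4 a5; exact: Hd.
  move=> [d d0 Hd] [d' d0' Hd']; exists (Num.min d d') => [|u0 u1 a1 a2 a3 a4 a5].
    by rewrite lt_min d0.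
  have [m1 m2] : Num.min d d' <= d /\ Num.min d d' <= d' by rewrite !ge_min !lexx orbT.
  by apply: (glueT _ _ _ v) => //; [apply: Hd | apply: Hd'] => //; lra.
apply: (@interval_glue R (fun u v => Good u v t0 t1)) => // u v w su uv vw ws.
by apply: glueS.
Qed.

Lemma mas_exists a b X Y : a <= b -> lagr_on (itv a b) X Y ->
  exists mu, mas_is a b X Y mu.
Proof.
move=> ab l.
(* The interval is treated as a rectangle of width 0. *)
have c2 : cont_on (rect 0 0 a b) (@snd R R) by apply: cont_on_continuous => p; exact: cvg_snd.
have i2 p : rect 0 0 a b p -> itv a b p.2 by move=> [].
have [phi hphi] := rect_pot (lexx 0) ab (lagr_on_comp c2 i2 l).
exists (phi (0, b) - phi (0, a)); exists (fun t => phi (0, t)) => //.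
have := is_pot_comp (cont_on_continuous (D := itv a b) (@continuous_pairl 0)) _ hphi.
by apply=> t tab; split => //=; rewrite lexx.
Qed.

(** Both sides are the increment of one potential between opposite corners. All homotopy arguments
    below rest on this identity. *)
Lemma mas_square (X Y : R * R -> 'M[R]_m) s0 s1 t0 t1 bot top left right :
  s0 <= s1 -> t0 <= t1 -> lagr_on (rect s0 s1 t0 t1) X Y ->
  mas_is t0 t1 (fun t => X (s0, t)) (fun t => Y (s0, t)) bot ->
  mas_is t0 t1 (fun t => X (s1, t)) (fun t => Y (s1, t)) top ->
  mas_is s0 s1 (fun s => X (s, t0)) (fun s => Y (s, t0)) left ->
  mas_is s0 s1 (fun s => X (s, t1)) (fun s => Y (s, t1)) right ->
  bot + right = left + top.
Proof.
move=> s01 t01 l hb ht hl hr.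
have [phi hphi] := rect_pot s01 t01 l.
have vert s mu : s0 <= s <= s1 ->
    mas_is t0 t1 (fun t => X (s, t)) (fun t => Y (s, t)) mu ->
    mu = phi (s, t1) - phi (s, t0).
  move=> hs hm; apply: (mas_unique _ _ hm) => //.
    apply: (lagr_on_comp _ _ l) => [|t tt]; last by split.
    exact: cont_on_continuous (@continuous_pairl s).
  exists (fun t => phi (s, t)) => //; apply: (is_pot_comp _ _ hphi) => [|t tt]; last by split.
  exact: cont_on_continuous (@continuous_pairl s).
have hori t mu : t0 <= t <= t1 ->
    mas_is s0 s1 (fun s => X (s, t)) (fun s => Y (s, t)) mu ->
    mu = phi (s1, t) - phi (s0, t).
  move=> hs hm; apply: (mas_unique _ _ hm) => //.
    apply: (lagr_on_comp _ _ l) => [|s ss]; last by split.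
    exact: cont_on_continuous (@continuous_pairr t).
  exists (fun s => phi (s, t)) => //; apply: (is_pot_comp _ _ hphi) => [|s ss]; last by split.
  exact: cont_on_continuous (@continuous_pairr t).
rewrite (vert s0 bot) ?lexx ?s01 // (vert s1 top) ?lexx ?s01 //.
by rewrite (hori t0 left) ?lexx ?t01 // (hori t1 right) ?lexx ?t01 //; lra.
Qed.

(** By [rank_chart_form], the rank of [Y] is that of every chart form. While it is constant the
    signature cannot change, so nothing accumulates. *)
Lemma is_pot_const_rank (T : topologicalType) (D : set T) (X Y : T -> 'M[R]_m) :
  lagr_on D X Y -> (forall p q, D p -> D q -> \rank (Y p) = \rank (Y q)) ->
  is_pot D X Y (fun=> 0).
Proof.
move=> l rk p Dp; have [C sC nC] := is_pot_loc l Dp.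
have [cX cY lp] := l; have Fp := within_filter D (nbhs_filter p).
have gp : good C (X p) (Y p) by exact: (nbhs_singleton nC).
exists C; split => //.
have cQ : chart_form C (X q) (Y q) @[q --> within D (nbhs p)] -->
    chart_form C (X p) (Y p).
  apply: cvg_mulmx; last by apply: cvg_trmx; exact: cY.
  apply: cvgB; first exact: cX.
  by apply: cvg_mulmx; [exact: cY | exact: cvg_cst].
have n1 := near_sgn_const cQ (chart_form_sym sC (lp p Dp)).
near=> q; have Dq : D q by near: q; exact: withinT.
have gq : good C (X q) (Y q) by near: q.
have sq := chart_form_sym sC (lp q Dq).
have rq : \rank (chart_form C (X q) (Y q)) = \rank (chart_form C (X p) (Y p)).
  by rewrite !rank_chart_form //; exact: rk.
have eq : sgn (chart_form C (X q) (Y q)) = sgn (chart_form C (X p) (Y p)).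
  by move: sq rq; near: q; exact: n1.
by rewrite !potE eq.
Unshelve. all: by end_near. Qed.

Lemma mas_const_rank a b X Y : lagr_on (itv a b) X Y ->
  (forall s t, itv a b s -> itv a b t -> \rank (Y s) = \rank (Y t)) ->
  mas_is a b X Y 0.
Proof. by move=> l rk; exists (fun=> 0); [exact: is_pot_const_rank | rewrite subrr]. Qed.

(** At each time [good] and [pot] depend on the row space only, so the change of frame is arbitrary
    in [t] and may jump. *)
Lemma mas_frame a b X Y X' Y' (G : R -> 'M[R]_m) mu :
  (forall t, itv a b t -> [/\ G t \in unitmx, X' t = G t *m X t & Y' t = G t *m Y t]) ->
  mas_is a b X Y mu -> mas_is a b X' Y' mu.
Proof.
move=> HG [phi h ->]; exists phi => // t tab.
have [C [sC g n]] := h t tab; have [ut Xt Yt] := HG t tab.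
exists C; split; [exact: sC|by rewrite Xt Yt; exact: (goodG ut g)|].
apply: (@filterS _ (nbhs t)) n => q /= hq qab.
have [uq -> ->] := HG q qab; rewrite Xt Yt (potG _ _ _ ut) (potG _ _ _ uq).
exact: (hq qab).
Qed.

Lemma mas_change a b X Y (A : 'M[R]_m) mu : A \in unitmx ->
  mas_is a b X Y mu ->
  mas_is a b (fun t => X t *m A) (fun t => Y t *m (invmx A)^T) mu.
Proof.
move=> uA [phi h ->]; exists phi => // t tab.
have [C [sC g n]] := h t tab.
have e s : X s *m A - Y s *m (invmx A)^T *m (A^T *m C *m A) = (X s - Y s *m C) *m A.
  rewrite mulmxBl -!mulmxA; congr (_ - _ *m _).
  by rewrite [LHS]mulmxA -trmx_mul mulmxV // trmx1 mul1mx.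
have eq s : chart_form (A^T *m C *m A) (X s *m A) (Y s *m (invmx A)^T) =
    chart_form C (X s) (Y s).
  rewrite /chart_form e trmx_mul trmxK -mulmxA (mulmxA A) mulmxV //.
  by rewrite mul1mx.
exists (A^T *m C *m A); split.
- by rewrite !trmx_mul trmxK sC mulmxA.
- by rewrite /good e unitmx_mul uA andbT.
- apply: (@filterS _ (nbhs t)) n => q /= hq qab.
  by rewrite !potE !eq -!potE; exact: hq.
Qed.

(** The reflection [(x, y) |-> (x, - y)] is antisymplectic; it replaces [C] by [- C] and negates
    every chart form. *)
Lemma mas_oppY a b X Y mu : mas_is a b X Y mu ->
  mas_is a b X (fun t => - Y t) (- mu).
Proof.
move=> [phi h ->]; exists (fun t => - phi t); last by rewrite opprB addrC opprK.
move=> t tab; have [C [sC g n]] := h t tab.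
have e s : X s - (- Y s) *m (- C) = X s - Y s *m C by rewrite mulmxN mulNmx opprK.
have eq s : pot (- C) (X s) (- Y s) = - pot C (X s) (Y s).
  by rewrite !potE /chart_form e linearN /= mulmxN sgnN rmorphN mulrN.
exists (- C); split.
- by rewrite linearN /= sC.
- by rewrite /good e.
- apply: (@filterS _ (nbhs t)) n => q /= hq qab.
  by rewrite !eq -!opprD hq.
Qed.

Lemma mas_reparam a b a' b' X Y mu (beta : R -> R) : cont_on (itv a' b') beta ->
  (forall t, itv a' b' t -> itv a b (beta t)) -> beta a' = a -> beta b' = b ->
  mas_is a b X Y mu -> mas_is a' b' (X \o beta) (Y \o beta) mu.
Proof.
move=> cb ib ba bb [phi h ->]; exists (phi \o beta); last by rewrite /= ba bb.
exact: is_pot_comp h.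
Qed.

End MaslovFunction.

Section MatrixDerivatives.
Context {R : realType} {V : normedModType R}.

Lemma is_derive_mxP m n (M : V -> 'M[R]_(m, n)) (D : 'M[R]_(m, n)) (t v : V) :
  is_derive t v M D <-> forall i j, is_derive t v (fun x => M x i j) (D i j).
Proof.
split=> [[dM <-] i j|H].
  have dMij := (derivable_mxP M t v).1 dM i j.
  by apply: DeriveDef => //; rewrite derive_mx // mxE.
have dM : derivable M t v by apply/derivable_mxP => i j; have [] := H i j.
by apply: DeriveDef => //; rewrite derive_mx //; apply/matrixP => i j;
   rewrite mxE; have [] := H i j.
Qed.

Lemma is_derive_bigsum (I : Type) (r : seq I) (f : I -> V -> R) (df : I -> R)
    (t v : V) : (forall i, is_derive t v (f i) (df i)) ->
  is_derive t v (fun x => \sum_(i <- r) f i x) (\sum_(i <- r) df i).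
Proof.
move=> H; elim: r => [|i r IH].
  rewrite big_nil; under eq_fun do rewrite big_nil.
  exact: is_derive_cst.
rewrite big_cons; under eq_fun do rewrite big_cons.
exact: is_deriveD.
Qed.

Lemma is_derive_mulmx m n p (A : V -> 'M[R]_(m, n)) (B : V -> 'M[R]_(n, p))
    A' B' (t v : V) : is_derive t v A A' -> is_derive t v B B' ->
  is_derive t v (fun x => A x *m B x) (A' *m B t + A t *m B').
Proof.
move=> /is_derive_mxP dA /is_derive_mxP dB; apply/is_derive_mxP => i j.
under eq_fun do rewrite mxE; rewrite !mxE -big_split /=.
apply: is_derive_bigsum => k.
have := is_deriveM (dA i k) (dB k j) => /is_derive_eq; apply.
by rewrite addrC; congr (_ + _); exact: mulrC.
Qed.

Lemma is_derive_trmx m n (A : V -> 'M[R]_(m, n)) A' (t v : V) :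
  is_derive t v A A' -> is_derive t v (fun x => (A x)^T) A'^T.
Proof.
move=> /is_derive_mxP dA; apply/is_derive_mxP => i j.
by under eq_fun do rewrite mxE; rewrite mxE.
Qed.

Lemma is_derive_mulmxl m n p (A : 'M[R]_(m, n)) (B : V -> 'M[R]_(n, p))
    B' (t v : V) : is_derive t v B B' ->
  is_derive t v (fun x => A *m B x) (A *m B').
Proof.
move=> dB; have := is_derive_mulmx (is_derive_cst A t v) dB.
by rewrite mul0mx add0r.
Qed.

Lemma is_derive_mulmxr m n p (A : V -> 'M[R]_(m, n)) (B : 'M[R]_(n, p))
    A' (t v : V) : is_derive t v A A' ->
  is_derive t v (fun x => A x *m B) (A' *m B).
Proof.
move=> dA; have := is_derive_mulmx dA (is_derive_cst B t v).
by rewrite mulmx0 addr0.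
Qed.

Lemma is_derive_row_mx m n1 n2 (A : V -> 'M[R]_(m, n1)) (B : V -> 'M[R]_(m, n2))
    A' B' (t v : V) : is_derive t v A A' -> is_derive t v B B' ->
  is_derive t v (fun x => row_mx (A x) (B x)) (row_mx A' B').
Proof.
move=> /is_derive_mxP dA /is_derive_mxP dB; apply/is_derive_mxP => i j.
under eq_fun do rewrite mxE; rewrite !mxE.
by case: (fintype.split j) => k.
Qed.

End MatrixDerivatives.

Section CurveDerivatives.
Context {R : realType} {V : normedModType R}.

Lemma is_derive_continuous (f : R -> V) (t : R) (d : V) :
  is_derive t (1 : R) f d -> {for t, continuous f}.
Proof. by move=> [df _]; apply: differentiable_continuous; exact/derivable1_diffP. Qed.

End CurveDerivatives.

(** With [e = -1] this turns the left-hand side of [t0] into the right-hand side of 0, where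
    [npos_jump] applies. *)
Lemma is_derive_affine (R : realType) m n (f : R -> 'M[R]_(m, n)) (t0 e : R) d :
  is_derive t0 (1 : R) f d ->
  is_derive (0 : R) (1 : R) (fun h => f (t0 + e * h)) (e *: d).
Proof.
move=> /is_derive_mxP df; apply/is_derive_mxP => i j; rewrite mxE.
have dg : is_derive (0 : R) (1 : R) (fun h : R => t0 + e * h) (0 + e *: (1 : R)).
  apply: is_deriveD; exact: is_deriveZ.
have df' : is_derive (t0 + e * 0) (1 : R) (fun x => f x i j) (d i j).
  by rewrite mulr0 addr0.
have := @is_derive1_comp _ (fun x => f x i j) (fun h : R => t0 + e * h) 0 _ _ df' dg => /is_derive_eq; apply.
by rewrite add0r [e *: _]mulr1 [LHS]mulrC.
Qed.

(** * Regular crossings *)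

Section Crossings.
Context {R : realType} {m : nat}.
Implicit Types X Y : R -> 'M[R]_m.

Lemma unit_rank (A : 'M[R]_m) : (m <= \rank A)%N -> A \in unitmx.
Proof. by move=> h; rewrite -row_full_unit -col_leq_rank. Qed.

(** On the kernel of [Y 0] the derivative of the chart form is the crossing form, so [npos] and
    [nneg] rise by at least the ranks of [P] and [N]. Added to the rank of [Y 0] these bounds reach
    [m]; hence they are sharp and [Y h] is invertible. *)
Lemma pot_jump (X Y : R -> 'M[R]_m) (X' Y' K Q C : 'M[R]_m) (s : int) :
  is_derive (0 : R) (1 : R) X X' -> is_derive (0 : R) (1 : R) Y Y' ->
  lagr (X 0) (Y 0) -> C^T = C -> good C (X 0) (Y 0) ->
  (forall u : 'rV[R]_m, (u <= K)%MS -> u *m Y 0 = 0) ->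
  (\rank K + \rank (Y 0%R) = m)%N ->
  (forall u : 'rV[R]_m, u *m Y 0 = 0 -> qf Q u = qf (X 0 *m Y'^T) u) ->
  has_signature K Q s ->
  \forall h \near (0 : R)^'+, lagr (X h) (Y h) ->
    Y h \in unitmx /\ pot C (X h) (Y h) - pot C (X 0) (Y 0) = 2^-1 * s%:~R.
Proof.
move=> dX dY l0 sC gC KY rK Qcr [P [N [PNK PN0 Ppos Nneg ->]]].
have dA : is_derive (0 : R) (1 : R) (fun h => chart_form C (X h) (Y h))
    ((X' - Y' *m C) *m (Y 0)^T + (X 0 - Y 0 *m C) *m Y'^T).
  apply: is_derive_mulmx; last exact: is_derive_trmx.
  by apply: is_deriveB; exact: is_derive_mulmxr.
set D := (X' - Y' *m C) *m (Y 0)^T + _ in dA.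
have sQ0 := chart_form_sym sC l0.
have crossE u : u *m Y 0 = 0 -> qf D u = qf Q u.
  move=> uY; rewrite Qcr // /qf /D mulmxDr mulmxDl.
  have Yu : (Y 0)^T *m u^T = 0 by rewrite -trmx_mul uY trmx0.
  rewrite -(mulmxA _ _ u^T) -(mulmxA _ (Y 0)^T) Yu !mulmx0 add0r.
  by rewrite mulmxBl mulmxBr !mulmxA uY !mul0mx subr0.
have PK : (P <= K)%MS by rewrite (submx_trans (addsmxSl P N)) // (andP PNK).1.
have NK : (N <= K)%MS by rewrite (submx_trans (addsmxSr P N)) // (andP PNK).1.
have kerQ (A : 'M[R]_m) : (A <= K)%MS -> (A <= kermx (chart_form C (X 0) (Y 0)))%MS.
  move=> AK; apply/row_subP => i; apply/sub_kermxP.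
  rewrite -sQ0 /chart_form trmx_mul trmxK mulmxA KY ?mul0mx //.
  by rewrite (submx_trans (row_sub _ _)).
have pP : pos_on P D.
  move=> u uP u0; rewrite crossE; first exact: Ppos.
  by apply: KY; exact: submx_trans uP PK.
have pN : pos_on N (- D).
  move=> u uN u0; rewrite qfN crossE ?oppr_gt0; first exact: Nneg.
  by apply: KY; exact: submx_trans uN NK.
have nP := npos_jump sQ0 dA (kerQ P PK) pP.
have nN : \forall h \near (0 : R)^'+, (nneg (chart_form C (X 0%R) (Y 0%R)) + \rank N <=
    nneg (chart_form C (X (0 + h)%R) (Y (0 + h)%R)))%N.
  apply: (npos_jump (A := fun h => - chart_form C (X h) (Y h)) _ _ _ pN).
  - by rewrite linearN /= sQ0.
  - by apply/sub_kermxP; rewrite mulmxN; have /sub_kermxP -> := kerQ N NK; rewrite oppr0.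
have rPN : (\rank P + \rank N)%N = \rank K.
  by have := mxrank_sum_cap P N; rewrite PN0 mxrank0 addn0 (eqmx_rank PNK).
have cg : X h - Y h *m C @[h --> (0 : R)^'+] --> X 0 - Y 0 *m C.
  have cX := is_derive_continuous dX; have cY := is_derive_continuous dY.
  apply: cvgB; first by apply: cvg_within_filter; exact: cX.
  by apply: cvg_mulmx; [apply: cvg_within_filter; exact: cY | exact: cvg_cst].
have ng := near_unitmx cg gC.
near=> h => lh.
have gh : good C (X h) (Y h) by near: h; exact: ng.
have : (npos (chart_form C (X 0%R) (Y 0%R)) + \rank P <=
    npos (chart_form C (X (0 + h)%R) (Y (0 + h)%R)))%N by near: h; exact: nP.
have : (nneg (chart_form C (X 0%R) (Y 0%R)) + \rank N <=
    nneg (chart_form C (X (0 + h)%R) (Y (0 + h)%R)))%N by near: h; exact: nN.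
rewrite add0r => h2 h1.
have := npos_nneg_rank sQ0; have := npos_nneg_rank (chart_form_sym sC lh).
rewrite !rank_chart_form //.
have := rank_leq_col (Y h).
rewrite !potE /sgn; move: h1 h2 rK rPN.
move: (npos _) (nneg _) (npos _) (nneg _) => p0 n0 p n h1 h2 rK rPN r1 r2 r3.
split; first by apply: unit_rank; lia.
rewrite -mulrBr -intrB; congr (_ * _%:~R); lia.
Unshelve. all: by end_near. Qed.

(** The form [Q] is prescribed on the kernel of [Y t] only, so that crossing forms given by other
    formulas fit. A time without intersection qualifies with signature 0. *)
Definition crossing X Y (t : R) (s : int) : Prop :=
  exists (X' Y' K Q : 'M[R]_m),
    [/\ is_derive t (1 : R) X X', is_derive t (1 : R) Y Y',
        forall u : 'rV[R]_m, (u <= K)%MS = (u *m Y t == 0),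
        forall u : 'rV[R]_m, u *m Y t = 0 -> qf Q u = qf (X t *m Y'^T) u &
        has_signature K Q s].

Lemma rank_crossing_space (K A : 'M[R]_m) :
  (forall u : 'rV[R]_m, (u <= K)%MS = (u *m A == 0)) ->
  (\rank K + \rank A = m)%N.
Proof.
move=> H; have -> : \rank K = \rank (kermx A).
  apply: eqmx_rank; apply/andP; split; apply/row_subP => i.
    by apply/sub_kermxP/eqP; rewrite -H row_sub.
  by rewrite H; apply/eqP/sub_kermxP; rewrite row_sub.
by rewrite mxrank_ker subnK // rank_leq_row.
Qed.

Lemma has_signatureN (K Q : 'M[R]_m) s : has_signature K Q s ->
  has_signature K (- Q) (- s).
Proof.
move=> [P [N [h1 h2 h3 h4 ->]]]; exists N, P; split.
- by rewrite addsmxC.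
- by rewrite capmxC.
- move=> u uN u0; rewrite mulmxN mulNmx mxE oppr_gt0; exact: h4.
- move=> u uP u0; rewrite mulmxN mulNmx mxE oppr_lt0; exact: h3.
- by rewrite opprB.
Qed.

Lemma crossing_unit X Y t s : crossing X Y t s -> Y t \in unitmx -> s = 0.
Proof.
move=> [X' [Y' [K [Q [_ _ HK _ [P [N [PNK PN0 _ _ ->]]]]]]]] uY.
have := rank_crossing_space HK; rewrite (mxrank_unit uY) -(eqmx_rank PNK).
have := mxrank_sum_cap P N; rewrite PN0 mxrank0; lia.
Qed.

Lemma crossing_near X Y t0 s (C : 'M[R]_m) : crossing X Y t0 s ->
  lagr (X t0) (Y t0) -> C^T = C -> good C (X t0) (Y t0) ->
  exists2 d : R, 0 < d & forall t, t0 - d < t -> t < t0 + d -> t != t0 ->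
    lagr (X t) (Y t) -> Y t \in unitmx /\
    pot C (X t) (Y t) - pot C (X t0) (Y t0) =
      2^-1 * (if t0 < t then s%:~R else - s%:~R).
Proof.
move=> [X' [Y' [K [Q [dX dY HK Qcr sg]]]]] l0 sC gC.
have rK := rank_crossing_space HK.
have KY (u : 'rV[R]_m) : (u <= K)%MS -> u *m Y t0 = 0 by rewrite HK => /eqP.
have side (e : R) (Q' : 'M[R]_m) s' : has_signature K Q' s' ->
    (forall u : 'rV[R]_m, u *m Y t0 = 0 -> qf Q' u = qf (X t0 *m (e *: Y')^T) u) ->
    exists2 d : R, 0 < d & forall h : R, 0 < h -> h < d ->
      lagr (X (t0 + e * h)) (Y (t0 + e * h)) -> Y (t0 + e * h) \in unitmx /\
      pot C (X (t0 + e * h)) (Y (t0 + e * h)) - pot C (X t0) (Y t0) = 2^-1 * s'%:~R.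
  move=> sg' Qcr'.
  have := @pot_jump (fun h => X (t0 + e * h)) (fun h => Y (t0 + e * h))
     (e *: X') (e *: Y') K Q' C s' (is_derive_affine e dX) (is_derive_affine e dY).
  rewrite mulr0 addr0 => /(_ l0 sC gC KY rK Qcr' sg')[d /= d0 Hd].
  exists d => // h h0 hd; apply: (Hd h) => //.
  by rewrite /ball_ /= sub0r normrN gtr0_norm.
have [|d1 d10 H1] := side 1 Q s sg.
  by move=> u uY; rewrite scale1r; exact: Qcr.
have [|d2 d20 H2] := side (-1) (- Q) (- s) (has_signatureN sg).
  move=> u uY; rewrite qfN Qcr // scaleN1r linearN /= /qf !mulmxN mulNmx.
  by rewrite [RHS]mxE.
exists (Num.min d1 d2) => [|t h1 h2 tt0]; first by rewrite lt_min d10.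
have [m1 m2] : Num.min d1 d2 <= d1 /\ Num.min d1 d2 <= d2 by rewrite !ge_min !lexx orbT.
case: (ltgtP t0 t) => [t0t|t0t|e0] lt; last by rewrite e0 eqxx in tt0.
  have e : t0 + 1 * (t - t0) = t by ring.
  have H := H1 (t - t0); rewrite e in H.
  by apply: H => //; [rewrite subr_gt0 | lra].
have e : t0 + -1 * (t0 - t) = t by ring.
have H := H2 (t0 - t); rewrite e in H.
rewrite -rmorphN; apply: H => //; first by rewrite subr_gt0.
lra.
Qed.

Lemma crossing_mas (a b : R) X Y (s : R -> int) : a < b -> lagr_on (itv a b) X Y ->
  (forall t, itv a b t -> crossing X Y t (s t)) ->
  exists l : seq R, [/\ uniq l, {in l, forall t, itv a b t},
    (forall t, itv a b t -> s t != 0 -> t \in l) &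
    mas_is a b X Y (\sum_(t <- l)
      (if (t == a) || (t == b) then 2^-1 else 1) * (s t)%:~R)].
Proof.
move=> ab l cr; have [_ _ lp] := l.
have locC t : itv a b t -> exists C : 'M[R]_m, C^T = C /\ good C (X t) (Y t).
  move=> tab; have [r Hr] := good_scalar (lp t tab).
  by have [c /Hr gc] := notin_ex r; exists c%:M; rewrite tr_scalar_mx.
(* Regular crossings are isolated, hence finitely many on a compact interval. *)
have [r0 Hr0] : exists r : seq R, forall t, a <= t -> t <= b -> s t != 0 -> t \in r.
  apply: (@interval_glue R (fun u v => exists r : seq R, forall t, u <= t -> t <= v ->
    s t != 0 -> t \in r)) => [|t tab|u v w _ _ _ _ [r Hr] [r' Hr']]; first exact: ltW.
    have [C [sC gC]] := locC t tab.
    have [d d0 Hd] := crossing_near (cr t tab) (lp t tab) sC gC.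
    exists d => // u v au uv vb tu vt; exists [:: t] => q uq qv; apply: contraNT.
    rewrite inE => qt; apply/eqP.
    have qab : itv a b q by rewrite /itv /= (le_trans au uq) (le_trans qv vb).
    apply: (crossing_unit (cr q qab)).
    by have [] := Hd q (lt_le_trans tu uq) (le_lt_trans qv vt) qt (lp q qab).
  exists (r ++ r') => t ut tw st; rewrite mem_cat.
  by case: (leP t v) => h; [rewrite Hr | rewrite Hr' ?orbT // ltW].
pose r := undup [seq t <- r0 | a <= t <= b].
have rP t : (t \in r) = (t \in r0) && (a <= t <= b).
  by rewrite mem_undup mem_filter andbC.
have ur : uniq r by exact: undup_uniq.
exists r; split => //.
- by move=> t; rewrite rP => /andP[].
- by move=> t /[dup] tab /andP[at_ tb] st; rewrite rP Hr0.
(* A unit step at [q] that takes the value one half at [q] itself. Its increment over [[a, b]] is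
   the weight of the crossing: one half at an end, one inside. *)
pose w (t q : R) : R := 2^-1 * ((q < t)%R%:R + (q <= t)%R%:R).
pose phi t : R := \sum_(q <- r) w t q * (s q)%:~R.
exists phi; last first.
  rewrite /phi -sumrB; apply: eq_big_seq => q; rewrite rP => /andP[_ /andP[aq qb]].
  rewrite -mulrBl; congr (_ * _); rewrite /w.
  rewrite qb (lt_neqAle q b) qb andbT (ltNge q a) aq /=.
  have -> : (q <= a) = (q == a) by rewrite eq_le aq andbT.
  have [->|qa] := eqVneq q a; first by rewrite lt_eqF //= !mulr1n; field.
  by case: eqVneq => _ /=; rewrite ?mulr1n ?mulr0n; field.
move=> t tab; have [C [sC gC]] := locC t tab; exists C; split => //.
have [d d0 Hd] := crossing_near (cr t tab) (lp t tab) sC gC.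
exists d => //= q; rewrite /ball_ /= ltr_distlC => /andP[dq qd] qab.
have [->|qt] := eqVneq q t; first by [].
have [uq ->] : Y q \in unitmx /\ pot C (X q) (Y q) = pot C (X t) (Y t) +
    2^-1 * (if t < q then (s t)%:~R else - (s t)%:~R).
  have [? h] := Hd q dq qd qt (lp q qab); split => //.
  by rewrite -h addrC subrK.
suff -> : phi q = phi t + 2^-1 * (if t < q then (s t)%:~R else - (s t)%:~R).
  by rewrite opprD addrACA subrr addr0.
have s0 p : a <= p <= b -> t - d < p -> p < t + d -> p != t -> s p = 0.
  move=> pab h1 h2 h3; apply: (crossing_unit (cr p pab)).
  by have [] := Hd p h1 h2 h3 (lp p pab).
have dphi p : p \in r -> (w q p - w t p) * (s p)%:~R =
    if p == t then 2^-1 * (if t < q then (s t)%:~R else - (s t)%:~R) else 0 :> R.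
  rewrite rP => /andP[_ pab]; case: (eqVneq p t) => [->|pt].
    rewrite /w ltxx lexx.
    by case: (ltgtP t q) qt => // tq _ /=; rewrite ?mulr1n ?mulr0n; field.
  have [p1|p1] := leP p (t - d).
    have e1 : p < t by apply: le_lt_trans p1 _; rewrite ltrBlDr ltrDl.
    have e2 : p < q by exact: le_lt_trans p1 dq.
    by rewrite /w e1 e2 (ltW e1) (ltW e2) subrr mul0r.
  have [p2|p2] := leP (t + d) p.
    have e1 : t < p by apply: lt_le_trans p2; rewrite ltrDl.
    have e2 : q < p by exact: lt_le_trans qd p2.
    by rewrite /w (lt_gtF e1) (lt_gtF e2) (lt_geF e1) (lt_geF e2) subrr mul0r.
  by rewrite (s0 p) // mulr0.
apply/eqP; rewrite addrC -subr_eq /phi -sumrB; apply/eqP.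
under eq_bigr do rewrite -mulrBl.
rewrite (eq_big_seq _ dphi) -big_mkcond /=.
have [tr|tr] := boolP (t \in r).
  by rewrite -big_filter filter_pred1_uniq // big_seq1.
have st0 : s t = 0.
  apply/eqP; apply: contraNT tr => st; rewrite rP; move: (tab) => /andP[at_ tb].
  by rewrite Hr0.
by rewrite big_hasC ?st0; [case: ifP; rewrite ?oppr0 mulr0 | rewrite has_pred1].
Qed.

End Crossings.

(** * Deforming a Lagrangian path to one with regular crossings *)

Section RegularRepresentatives.
Context {R : realType}.

Lemma cont_on_glue (T V : topologicalType) (D1 D2 : set T) (f g : T -> V) :
  closed D1 -> closed D2 -> cont_on D1 f -> cont_on D2 g ->
  (forall p, D1 p -> D2 p -> f p = g p) ->
  cont_on (D1 `|` D2) (fun p => if p \in D1 then f p else g p).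
Proof.
move=> c1 c2 cf cg e p Dp A /= nA.
have away D : closed D -> ~ D p -> \forall q \near p, ~ D q.
  move=> cD nD; have : open (~` D) by exact: closed_openC.
  by rewrite openE => /(_ p nD).
have n1 : \forall q \near p, D1 q -> A (f q).
  have [D1p|nD1] := pselect (D1 p).
    by move: nA; rewrite (mem_set D1p) => nA; exact: (cf p D1p A nA).
  by apply: filterS (away _ c1 nD1) => q.
have n2 : \forall q \near p, D2 q -> A (g q).
  have [D2p|nD2] := pselect (D2 p); last by apply: filterS (away _ c2 nD2) => q.
  apply: (cg p D2p A); move: nA.
  by case: (boolP (p \in D1)) => //; rewrite inE => D1p; rewrite (e p D1p D2p).
apply: (filterS2 _ _ n1 n2) => q /= h1 h2 Dq.
case: (boolP (q \in D1)) => [|]; rewrite ?inE ?notin_setE => h; first exact: h1.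
by case: Dq => // D2q; exact: h2.
Qed.

Lemma row_free_inj m n (A : 'M[R]_(m, n)) :
  row_free A <-> forall u : 'rV[R]_m, u *m A = 0 -> u = 0.
Proof.
split=> [rf u uA|H]; first by apply/eqP; rewrite -(mulmx_free_eq0 u rf) uA.
rewrite -kermx_eq0; apply/eqP/row_matrixP => i; rewrite row0; apply: H.
by apply/sub_kermxP; exact: row_sub.
Qed.

Context {m : nat}.
Local Notation frame := 'M[R]_(m, m + m).
Implicit Types F : R -> frame.

Definition lagF (F : frame) : Prop := lagr (lsubmx F) (rsubmx F).
(** Shears move every intersection with the reference Lagrangian in one definite direction. They
    serve to reach a transverse position and to make crossings regular. *)
Definition shear (F : frame) (c : R) : frame :=
  row_mx (lsubmx F) (rsubmx F + c *: lsubmx F).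

Lemma lagr_swap (X Y : 'M[R]_m) : lagr X Y -> lagr Y X.
Proof.
move=> [XY rf]; split; first exact: esym.
apply/row_free_inj => u; rewrite mul_mx_row => /eqP; rewrite -row_mx0.
move=> /eqP/eq_row_mx[uY uX]; apply: (row_free_inj _).1 rf _ _.
by rewrite mul_mx_row uX uY row_mx0.
Qed.

Lemma lagF_shear (F : frame) c : lagF F -> lagF (shear F c).
Proof.
rewrite /lagF /shear row_mxKl row_mxKr; set X := lsubmx F; set Y := rsubmx F.
move=> [XY rf]; split.
  by rewrite linearD /= mulmxDr mulmxDl XY linearZ /= -scalemxAr -scalemxAl.
apply/row_free_inj => u; rewrite mul_mx_row => /eqP; rewrite -row_mx0.
move=> /eqP/eq_row_mx[uX uY]; apply: (row_free_inj _).1 rf _ _.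
move: uY; rewrite mulmxDr -scalemxAr uX scaler0 addr0 => uY.
by rewrite mul_mx_row uX uY row_mx0.
Qed.

Lemma lagFG (G : 'M[R]_m) (F : frame) : G \in unitmx -> lagF F -> lagF (G *m F).
Proof. by move=> uG l; rewrite /lagF -(hsubmxK F) mul_mx_row row_mxKl row_mxKr; exact: lagrG. Qed.

Lemma shear_unit (F : frame) : lagF F -> exists c : R, rsubmx (shear F c) \in unitmx.
Proof.
move=> /lagr_swap/good_scalar[s Hs]; have [c /Hs gc] := notin_ex s.
exists (- c); rewrite row_mxKr scaleNr; move: gc.
by rewrite /good mul_mx_scalar.
Qed.

Definition crossD (F D : frame) (s : int) : Prop := exists K Q : 'M[R]_m,
  [/\ forall u : 'rV[R]_m, (u <= K)%MS = (u *m rsubmx F == 0),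
      forall u : 'rV[R]_m, u *m rsubmx F = 0 ->
        qf Q u = qf (lsubmx F *m (rsubmx D)^T) u &
      has_signature K Q s].

Lemma has_signatureG (K Q A : 'M[R]_m) s : A \in unitmx ->
  has_signature K Q s -> has_signature (K *m invmx A) (A *m Q *m A^T) s.
Proof.
move=> uA [P [N [PNK PN0 hP hN ->]]].
have inP (P' : 'M[R]_m) (u : 'rV[R]_m) : (u <= P' *m invmx A)%MS -> (u *m A <= P')%MS.
  by move=> /(submxMr A); rewrite mulmxKV.
have n0 (u : 'rV[R]_m) : u != 0 -> u *m A != 0.
  by apply: contraNneq => uA0; rewrite -(mulmxK uA u) uA0 mul0mx.
have rfA : row_free (invmx A) by rewrite row_free_unit unitmx_inv.
exists (P *m invmx A), (N *m invmx A); split.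
- have [/andP h1 h2] : (P + N <= K)%MS && (K <= P + N)%MS /\ True by [].
  apply/andP; split.
    by rewrite -addsmxMr submxMr //; case: h1.
  by rewrite -addsmxMr submxMr //; case: h1.
- apply/eqP; rewrite -submx0; apply/row_subP => i; set u := row i _.
  have : (u <= (P *m invmx A) :&: (N *m invmx A))%MS by exact: row_sub.
  rewrite sub_capmx => /andP[/inP uP /inP uN].
  have : (u *m A <= P :&: N)%MS by rewrite sub_capmx uP.
  by rewrite PN0 submx0 => /eqP uA0; rewrite -(mulmxK uA u) uA0 mul0mx sub0mx.
- move=> u /inP uP u0; rewrite -[_ 0 0]/(qf (A *m Q *m A^T) u) qf_congr.
  by apply: hP => //; exact: n0.
- move=> u /inP uN u0; rewrite -[_ 0 0]/(qf (A *m Q *m A^T) u) qf_congr.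
  by apply: hN => //; exact: n0.
- by rewrite !mxrankMfree.
Qed.

Lemma crossDG (F D : frame) (A : 'M[R]_m) s : A \in unitmx -> crossD F D s ->
  crossD (A *m F) (A *m D) s.
Proof.
move=> uA [K [Q [HK HQ sg]]].
have rG (E : frame) : rsubmx (A *m E) = A *m rsubmx E.
  by rewrite -{1}(hsubmxK E) mul_mx_row row_mxKr.
have lG (E : frame) : lsubmx (A *m E) = A *m lsubmx E.
  by rewrite -{1}(hsubmxK E) mul_mx_row row_mxKl.
exists (K *m invmx A), (A *m Q *m A^T); split.
- move=> u; rewrite rG mulmxA -HK; apply/idP/idP => [/(submxMr A)|/(submxMr (invmx A))].
    by rewrite mulmxKV.
  by rewrite mulmxK.
- move=> u; rewrite !rG !lG mulmxA => uF; rewrite qf_congr HQ // -qf_congr.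
  by rewrite trmx_mul !mulmxA.
- exact: has_signatureG.
Qed.

Lemma crossD_unit (F D : frame) : rsubmx F \in unitmx -> crossD F D 0.
Proof.
move=> uF; exists 0, 0; split.
- move=> u; rewrite submx0; apply/idP/idP => [/eqP ->|/eqP uF0]; first by rewrite mul0mx.
  by rewrite -(mulmxK uF u) uF0 mul0mx.
- by move=> u uF0; rewrite -(mulmxK uF u) uF0 mul0mx /qf !mul0mx.
- exists 0, 0; split; rewrite ?mxrank0 //.
  + by apply/andP; split; rewrite ?addsmx_sub ?sub0mx.
  + by apply/eqP; rewrite -submx0 capmxSr.
  + by move=> u /submx0null ->; rewrite eqxx.
  + by move=> u /submx0null ->; rewrite eqxx.
Qed.

(* h is a homotopy with fixed end Lagrangians from F to the C^1 path f, which
   has regular crossings and is stationary at the ends that are not crossings. *)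
Definition rrep (a b : R) F : Prop :=
  exists (h : R * R -> frame) (f d : R -> frame) (G : R -> 'M[R]_m),
  [/\ cont_on (rect 0 1 a b) h /\ (forall p, rect 0 1 a b p -> lagF (h p)),
      cont_on (itv a b) G /\ (forall t, itv a b t -> G t \in unitmx /\ h (0, t) = G t *m F t),
      (forall s, itv 0 1 s -> exists A B : 'M[R]_m,
         [/\ A \in unitmx, B \in unitmx, h (s, a) = A *m F a & h (s, b) = B *m F b]),
      [/\ forall t, itv a b t -> h (1, t) = f t,
          forall t, is_derive t (1 : R) f (d t), continuous d &
          forall t, itv a b t -> exists s, crossD (f t) (d t) s] &
      (rsubmx (F a) \in unitmx -> d a = 0) /\ (rsubmx (F b) \in unitmx -> d b = 0)].

Lemma rrep_eq a b F F' : a <= b -> (forall t, itv a b t -> F t = F' t) ->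
  rrep a b F -> rrep a b F'.
Proof.
move=> ab e [h [f [d [G [h1 [cG h2] h3 h4 h5]]]]]; exists h, f, d, G.
have ea : F a = F' a by apply: e; rewrite /itv /= lexx.
have eb : F b = F' b by apply: e; rewrite /itv /= lexx ab.
split => //.
- by split => // t tab; have [u ->] := h2 t tab; rewrite e.
- by move=> s s01; have [A [B]] := h3 s s01; rewrite ea eb; exists A, B.
- by rewrite -ea -eb.
Qed.

(** The homotopy [k] is run first and the one for [F] second. Their frames differ by [G] at the
    junction, so the first half is multiplied by [G]. *)
Lemma rrep_homotopic a b F F' (k : R * R -> frame) : a <= b ->
  cont_on (rect 0 1 a b) k -> (forall p, rect 0 1 a b p -> lagF (k p)) ->
  (forall t, itv a b t -> k (0, t) = F' t) ->
  (forall t, itv a b t -> k (1, t) = F t) ->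
  (forall s, itv 0 1 s -> k (s, a) = F' a /\ k (s, b) = F' b) ->
  rrep a b F -> rrep a b F'.
Proof.
move=> ab ck lk k0 k1 ks [h [f [d [G [[ch lh] [cG hG] h3 [h41 h42 h43 h44] h5]]]]].
have aab : itv a b a by rewrite /itv /= lexx.
have bab : itv a b b by rewrite /itv /= lexx ab.
have i0 : itv 0 1 (0 : R) by rewrite /itv /= lexx ler01.
have i1 : itv 0 1 (1 : R) by rewrite /itv /= lexx ler01.
have ea : F a = F' a by rewrite -k1 //; have [] := ks 1 i1.
have eb : F b = F' b by rewrite -k1 //; have [] := ks 1 i1.
pose D1 := rect 0 2^-1 a b; pose D2 := rect 2^-1 1 a b.
have e2 : 2 * 2^-1 = 1 :> R by field.
have D12 : rect 0 1 a b = D1 `|` D2.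
  rewrite /D1 /D2 /rect; apply/seteqP.
  split => [[s t] /= [/andP[s0 s1] tab]|[s t] /= [] [/andP[s0 s1] tab]].
  - by case: (leP s 2^-1) => hs; [left|right]; split => //=; rewrite ?s0 ?hs ?s1 ?(ltW hs).
  - by split => //=; rewrite s0 /=; lra.
  - by split => //=; rewrite s1 andbT; lra.
pose g1 (p : R * R) := (2 * p.1, p.2); pose g2 (p : R * R) := (2 * p.1 - 1, p.2).
have c1 : continuous g1.
  move=> p; apply: (@cvg_pair _ _ _ _ (nbhs (2 * p.1)) (nbhs p.2)); last exact: cvg_snd.
  by apply: cvgM; [exact: cvg_cst | exact: cvg_fst].
have c2 : continuous g2.
  move=> p; apply: (@cvg_pair _ _ _ _ (nbhs (2 * p.1 - 1)) (nbhs p.2)); last exact: cvg_snd.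
  by apply: cvgB; [apply: cvgM; [exact: cvg_cst | exact: cvg_fst] | exact: cvg_cst].
have m1 p : D1 p -> rect 0 1 a b (g1 p).
  move=> [/andP[s0 s1] tab]; split => //; apply/andP; rewrite /g1 /=; split; lra.
have m2 p : D2 p -> rect 0 1 a b (g2 p).
  move=> [/andP[s0 s1] tab]; split => //; apply/andP; rewrite /g2 /=; split; lra.
have cG2 : cont_on D1 (fun p => G p.2).
  apply: (cont_on_comp _ _ cG) => [|p []//].
  by apply: cont_on_continuous => p; exact: cvg_snd.
pose h' p := if p \in D1 then G p.2 *m k (g1 p) else h (g2 p).
have hl s t : s <= 2^-1 -> rect 0 1 a b (s, t) -> h' (s, t) = G t *m k (2 * s, t).
  move=> s2 [/andP[s0 _] tt]; rewrite /h' ifT // inE; split => //=.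
  by rewrite (s0 : 0 <= s).
have hr s t : 2^-1 < s -> rect 0 1 a b (s, t) -> h' (s, t) = h (2 * s - 1, t).
  move=> s2 [/andP[s0 _] tt]; rewrite /h' ifF //; apply/negbTE; rewrite notin_setE.
  by move=> [/andP[_ /=]]; rewrite leNgt s2.
exists h', f, d, G; split.
- split.
    rewrite D12; apply: cont_on_glue; [exact: closed_rect|exact: closed_rect| | |].
    + move=> p Dp; apply: cvg_mulmx; first exact: (cG2 p Dp).
      exact: (cont_on_comp (cont_on_continuous c1) m1 ck).
    + exact: (cont_on_comp (cont_on_continuous c2) m2 ch).
    + move=> [s t] /= [/andP[/= s0 s1] tab] [/andP[/= s0' s1'] _].
      have -> : s = 2^-1 by apply/eqP; rewrite eq_le s1.
      rewrite /g1 /g2 /= e2 subrr k1 //; have [_ ->] := hG t tab; by [].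
  move=> [s t] /[dup] stab [/andP[/= s0 s1] tab]; have [s2|s2] := leP s 2^-1.
    rewrite hl //; apply: lagFG; first by have [] := hG t tab.
    by apply: lk; split => //=; apply/andP; split; lra.
  by rewrite hr //; apply: lh; split => //=; apply/andP; split; lra.
- split => // t tab; have [uG _] := hG t tab; split => //.
  rewrite hl; [by rewrite mulr0 k0 | by rewrite invr_ge0 | by split; rewrite /= ?lexx ?ler01].
- move=> s s01; have [s2|s2] := leP s 2^-1.
    have [uGa _] := hG a aab; have [uGb _] := hG b bab.
    exists (G a), (G b); rewrite !hl //; try by split.
    have [|ka kb] := ks (2 * s).
      by move: s01; rewrite /itv /= => /andP[? ?]; apply/andP; split; lra.
    by rewrite ka kb.
  rewrite !hr //; try by split.
  rewrite -ea -eb; apply: h3.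
  by move: s01; rewrite /itv /= => /andP[? ?]; apply/andP; split; lra.
- split => // t tab; rewrite hr; last by split => //=; rewrite lexx ler01.
    by rewrite mulr1 [2 - 1](_ : _ = 1) ?h41 //; ring.
  by lra.
- by rewrite -ea -eb.
Qed.

Lemma cvg_if (T : Type) (Fl : set_system T) (FF : Filter Fl) (U : topologicalType)
    (P : T -> bool) (p q : T -> U) (l : U) : p x @[x --> Fl] --> l ->
  q x @[x --> Fl] --> l -> (if P x then p x else q x) @[x --> Fl] --> l.
Proof.
move=> pl ql A nA; have /= n1 := pl A nA; have /= n2 := ql A nA.
apply: (@filterS2 _ Fl FF _ _ _ _ n1 n2) => x /= h1 h2.
by case: (P x).
Qed.

Lemma glue_derive m1 n1 (f g d e : R -> 'M[R]_(m1, n1)) (b : R) :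
  (forall t, is_derive t (1 : R) f (d t)) -> continuous d ->
  (forall t, is_derive t (1 : R) g (e t)) -> continuous e ->
  f b = g b -> d b = e b ->
  let h t := if t <= b then f t else g t in
  let k t := if t <= b then d t else e t in
  (forall t, is_derive t (1 : R) h (k t)) /\ continuous k.
Proof.
move=> df cd dg ce fg de h k.
have near_lt (t : R) : t < b -> \forall q \near t, q < b.
  by move=> tb; exact: lt_nbhsl.
have near_gt (t : R) : b < t -> \forall q \near t, b < q.
  by move=> tb; exact: lt_nbhsr.
have piece (V' : Type) (p q : R -> V') (t : R) :
    (t < b -> \forall s \near t, (if s <= b then p s else q s) = p s) /\
    (b < t -> \forall s \near t, (if s <= b then p s else q s) = q s).
  split=> tb.
    by apply: filterS (near_lt t tb) => s sb; rewrite (ltW sb).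
  by apply: filterS (near_gt t tb) => s sb; rewrite leNgt sb.
split=> t.
  case: (ltgtP t b) => [tb|tb|->].
  - rewrite /k (ltW tb); apply: near_eq_is_derive (df t).
    by apply: filterS ((piece _ f g t).1 tb) => s e'; rewrite /h e'.
  - rewrite /k leNgt tb /=; apply: near_eq_is_derive (dg t).
    by apply: filterS ((piece _ f g t).2 tb) => s e'; rewrite /h e'.
  - have [cf ef] := df b; have [cg eg] := dg b.
    have cf' : s^-1 *: ((f \o shift b) (s *: (1 : R)) - f b) @[s --> (0 : R)^'] --> d b.
      by rewrite -ef; exact: cf.
    have cg' : s^-1 *: ((g \o shift b) (s *: (1 : R)) - g b) @[s --> (0 : R)^'] --> d b.
      by rewrite de -eg; exact: cg.
    have cv : s^-1 *: ((h \o shift b) (s *: (1 : R)) - h b) @[s --> (0 : R)^'] --> d b.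
      have -> : (fun s : R => s^-1 *: ((h \o shift b) (s *: (1 : R)) - h b)) = fun s =>
         if s *: (1 : R) + b <= b then s^-1 *: ((f \o shift b) (s *: (1 : R)) - f b)
         else s^-1 *: ((g \o shift b) (s *: (1 : R)) - g b).
        by apply/funext => s; rewrite /h /= lexx; case: ifP => // _; rewrite -fg.
      exact: cvg_if.
    rewrite /k lexx; apply: DeriveDef; first by apply/cvg_ex; exists (d b).
    exact: cvg_lim cv.
rewrite /continuous_at /k; case: (ltgtP t b) => [tb|tb|->].
- apply: cvg_trans (cd t); apply: near_eq_cvg.
  by apply: filterS ((piece _ d e t).1 tb) => s /= ->.
- apply: cvg_trans (ce t); apply: near_eq_cvg.
  by apply: filterS ((piece _ d e t).2 tb) => s /= ->.
- by apply: cvg_if; [exact: cd | rewrite de; exact: ce].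
Qed.

(** Transversality at [b] makes both representatives stationary there, so their derivatives match at
    the junction whatever the frames are. *)
Lemma rrep_cat a b c F : a <= b -> b <= c -> lagF (F b) ->
  rsubmx (F b) \in unitmx -> rrep a b F -> rrep b c F -> rrep a c F.
Proof.
move=> ab bc lb ub.
move=> [h [f [d [G [[ch lh] [cG hG] h3 [h41 h42 h43 h44] [h5 h5']]]]]].
move=> [k [g [e [K [[ck lk] [cK hK] k3 [k41 k42 k43 k44] [k5 k5']]]]]].
have bab : itv a b b by rewrite /itv /= lexx ab.
have bbc : itv b c b by rewrite /itv /= lexx bc.
have i0 : itv 0 1 (0 : R) by rewrite /itv /= lexx ler01.
have i1 : itv 0 1 (1 : R) by rewrite /itv /= lexx ler01.
have rG (A : 'M[R]_m) (E : frame) : rsubmx (A *m E) = A *m rsubmx E.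
  by rewrite -{1}(hsubmxK E) mul_mx_row row_mxKr.
pose Y1 s := rsubmx (h (s, b)); pose Y2 s := rsubmx (k (s, b)).
have HA s : itv 0 1 s -> exists2 A, A \in unitmx & h (s, b) = A *m F b.
  by move=> /h3[_ [A [_ uA _ ->]]]; exists A.
have HB s : itv 0 1 s -> exists2 A, A \in unitmx & k (s, b) = A *m F b.
  by move=> /k3[A [_ [uA _ -> _]]]; exists A.
have u1 s : itv 0 1 s -> Y1 s \in unitmx.
  by move=> /HA[A uA e1]; rewrite /Y1 e1 rG unitmx_mul uA.
have u2 s : itv 0 1 s -> Y2 s \in unitmx.
  by move=> /HB[A uA e1]; rewrite /Y2 e1 rG unitmx_mul uA.
(* At time [b] both homotopies stay on the Lagrangian of [F b], in different frames; the change of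
   frame is read off the [Y]-blocks, which are invertible there. *)
pose Q s := Y1 s *m invmx (Y2 s).
have uQ s : itv 0 1 s -> Q s \in unitmx.
  by move=> s01; rewrite unitmx_mul u1 // unitmx_inv u2.
have Qk s : itv 0 1 s -> Q s *m k (s, b) = h (s, b).
  move=> s01; rewrite /Q /Y1 /Y2; have [A uA ->] := HA s s01.
  have [B uB ->] := HB s s01; rewrite !rG.
  have uW : B *m rsubmx (F b) \in unitmx by rewrite unitmx_mul uB.
  have eB : B = (B *m rsubmx (F b)) *m invmx (rsubmx (F b)) by rewrite mulmxK.
  move: uW eB; move: (B *m rsubmx (F b)) => W uW ->.
  by rewrite !mulmxA mulmxKV // mulmxK.
have cQ : cont_on (itv 0 1) Q.
  have cE : continuous (fun s : R => (s, b)) by exact: continuous_pairr.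
  have c1 : cont_on (itv 0 1) Y1.
    move=> s s01; apply: cvg_rsubmx.
    by apply: (cont_on_comp (cont_on_continuous cE) _ ch) s01 => r r01; split.
  have c2 : cont_on (itv 0 1) Y2.
    move=> s s01; apply: cvg_rsubmx.
    by apply: (cont_on_comp (cont_on_continuous cE) _ ck) s01 => r r01; split.
  move=> s s01; apply: cvg_mulmx; first exact: c1.
  by apply: cvg_invmx; [exact: c2 | exact: u2].
have D12 : rect 0 1 a c = rect 0 1 a b `|` rect 0 1 b c.
  rewrite /rect; apply/seteqP.
  split => [[s t] /= [s01 /andP[t0 t1]]|[s t] /= [] [s01 /andP[t0 t1]]].
  - by case: (leP t b) => hs; [left|right]; split; rewrite // ?t0 ?t1 ?hs ?(ltW hs).
  - by split; rewrite // t0 (le_trans t1).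
  - by split; rewrite // t1 andbT (le_trans ab).
have I12 : itv a c = itv a b `|` itv b c.
  rewrite /itv; apply/seteqP; split => [t /= /andP[t0 t1]|t /= [] /andP[t0 t1]].
  - by case: (leP t b) => hs; [left|right]; rewrite // ?t0 ?t1 ?hs ?(ltW hs).
  - by rewrite t0 (le_trans t1).
  - by rewrite t1 andbT (le_trans ab).
have inI t : a <= t -> (t \in itv a b) = (t <= b).
  by move=> at_; apply/idP/idP; rewrite inE /itv /= at_.
have inR s t : itv 0 1 s -> a <= t -> ((s, t) \in rect 0 1 a b) = (t <= b).
  move=> s01 at_; apply/idP/idP; rewrite inE /rect /= at_; first by case.
  by move=> tb; split.
pose h' (p : R * R) := if p \in rect 0 1 a b then h p else Q p.1 *m k p.
pose G' t := if t \in itv a b then G t else Q 0 *m K t.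
pose f' t := if t <= b then f t else Q 1 *m g t.
pose d' t := if t <= b then d t else Q 1 *m e t.
have fgb : f b = Q 1 *m g b by rewrite -h41 // -k41 // Qk.
have de : d b = Q 1 *m e b by rewrite h5' // k5 // mulmx0.
have [df' cd'] : (forall t, is_derive t (1 : R) f' (d' t)) /\ continuous d'.
  apply: (glue_derive h42 h43 (g := fun t => Q 1 *m g t) (e := fun t => Q 1 *m e t)) => // t.
    exact: is_derive_mulmxl.
  by apply: cvg_mulmx; [exact: cvg_cst | exact: k43].
have hE s t : itv 0 1 s -> itv a c t -> h' (s, t) = if t <= b then h (s, t) else Q s *m k (s, t).
  by move=> s01 /andP[at_ tc]; rewrite /h' inR.
exists h', f', d', G'; split.
- split.
    rewrite D12; apply: cont_on_glue; [exact: closed_rect|exact: closed_rect|exact: ch| |].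
      move=> p Dp; apply: cvg_mulmx; last exact: ck.
      apply: (cont_on_comp (cont_on_continuous (f := @fst R R) _) _ cQ Dp) => [q|q []//].
      exact: cvg_fst.
    move=> [s t] /= [s01 /andP[/= _ tb]] [_ /andP[/= bt _]].
    have -> : t = b by apply/eqP; rewrite eq_le tb.
    by rewrite Qk.
  move=> [s t] [s01 tac]; rewrite hE //; move: tac => /= /andP[at_ tc].
  case: leP => tb; first by apply: lh; split => //=; rewrite at_.
  by apply: lagFG; [exact: uQ | apply: lk; split => //=; rewrite ltW].
- split.
    rewrite I12; apply: cont_on_glue; [exact: closed_itv|exact: closed_itv|exact: cG| |].
      by move=> t bt; apply: cvg_mulmx; [exact: cvg_cst | exact: cK].
    move=> t /andP[_ tb] /andP[bt _].
    have -> : t = b by apply/eqP; rewrite eq_le tb.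
    have [uK Kb] := hK b bbc; have [uG Gb] := hG b bab.
    have : Q 0 *m K b *m rsubmx (F b) = G b *m rsubmx (F b).
      by rewrite -!rG -mulmxA -Kb Qk // Gb.
    by move=> /(congr1 (mulmx^~ (invmx (rsubmx (F b))))); rewrite !mulmxK.
  move=> t tac; rewrite hE // /G'; move: (tac) => /andP[at_ tc]; rewrite inI //.
  case: leP => tb; first by apply: hG; rewrite /itv /= at_.
  have [|uK ->] := hK t; first by rewrite /itv /= ltW.
  by rewrite mulmxA unitmx_mul uQ.
- move=> s s01; have [A [_ [uA _ eA _]]] := h3 s s01; have [_ [B [_ uB _ eB]]] := k3 s s01.
  rewrite !hE ?/itv /= ?lexx ?(le_trans ab bc) // ab; case: leP => cb.
    have cb' : c = b by apply/eqP; rewrite eq_le cb.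
    by have [C uC eC] := HA s s01; exists A, C; split => //; rewrite cb'.
  by exists A, (Q s *m B); rewrite unitmx_mul uQ // -mulmxA -eB.
- split => // t /[dup] tac /andP[at_ tc].
    rewrite hE // /f'; case: leP => tb; first by rewrite h41 // /itv /= at_.
    by rewrite k41 // /itv /= ltW.
  rewrite /f' /d'; case: leP => tb; first by apply: h44; rewrite /itv /= at_.
  have [|s cs] := k44 t; first by rewrite /itv /= ltW.
  by exists s; apply: crossDG => //; exact: uQ.
- rewrite /d' ab; split => // uc; case: leP => cb; last by rewrite k5' // mulmx0.
  have cb' : c = b by apply/eqP; rewrite eq_le cb.
  by rewrite cb' h5'.
Qed.

(* Along a shear path the crossing form is +- X X^T, hence definite. *)
Lemma crossD_shear (F : frame) (c c' : R) : lagF F -> c' != 0 ->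
  exists s, crossD (shear F c) (row_mx 0 (c' *: lsubmx F)) s.
Proof.
move=> lF c0; have := lagF_shear c lF; rewrite /lagF /crossD /shear.
rewrite !row_mxKl !row_mxKr; set X := lsubmx F; set Y := rsubmx F + _ => -[_ rf].
have pos (u : 'rV[R]_m) : u *m Y = 0 -> u != 0 -> 0 < qf (X *m X^T) u.
  move=> uY u0; rewrite /qf mulmxA -mulmxA -trmx_mul lt_neqAle dotmx_ge0 andbT eq_sym.
  rewrite dotmx_eq0; apply: contra u0 => /eqP uX.
  by apply/eqP/((row_free_inj _).1 rf); rewrite mul_mx_row uX uY row_mx0.
have ker (u : 'rV[R]_m) : (u <= kermx Y)%MS = (u *m Y == 0).
  by apply/idP/idP => [/sub_kermxP ->|/eqP/sub_kermxP].
have qZ (u : 'rV[R]_m) : qf (X *m (c' *: X)^T) u = c' * qf (X *m X^T) u.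
  by rewrite linearZ /= /qf -scalemxAr -scalemxAr -scalemxAl [LHS]mxE.
have cap0 : capmx (kermx Y) (0 : 'M[R]_m) = 0 by apply/eqP; rewrite -submx0 capmxSr.
case: (ltgtP c' 0) c0 => // c0 _.
- exists (0 - (\rank (kermx Y))%:Z), (kermx Y), (X *m (c' *: X)^T); split => //.
  exists 0, (kermx Y); split.
  + by apply/andP; split; rewrite ?addsmx_sub ?submx_refl ?sub0mx // addsmxSr.
  + by rewrite capmxC.
  + by move=> u /submx0null ->; rewrite eqxx.
  + move=> u; rewrite ker => /eqP uY u0; rewrite -[_ 0 0]/(qf _ u) qZ.
    by rewrite nmulr_rlt0 // pos.
  + by rewrite mxrank0.
- exists ((\rank (kermx Y))%:Z - 0), (kermx Y), (X *m (c' *: X)^T); split => //.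
  exists (kermx Y), 0; split.
  + by apply/andP; split; rewrite ?addsmx_sub ?submx_refl ?sub0mx // addsmxSl.
  + by [].
  + move=> u; rewrite ker => /eqP uY u0; rewrite -[_ 0 0]/(qf _ u) qZ.
    by rewrite mulr_gt0 // pos.
  + by move=> u /submx0null ->; rewrite eqxx.
  + by rewrite mxrank0.
Qed.

Lemma cont_shear (T : topologicalType) (D : set T) (F : T -> frame) (c : T -> R) :
  cont_on D F -> cont_on D c -> cont_on D (fun p => shear (F p) (c p)).
Proof.
move=> cF cc p Dp.
have cl : lsubmx (F q) @[q --> within D (nbhs p)] --> lsubmx (F p).
  by apply: cvg_lsubmx; exact: cF.
have cr : rsubmx (F q) @[q --> within D (nbhs p)] --> rsubmx (F p).
  by apply: cvg_rsubmx; exact: cF.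
apply: cvg_row_mx; first exact: cl.
apply: cvgD; first exact: cr.
by apply: cvgZ; [exact: cc | exact: cl].
Qed.

(** Crossings on a segment of shears are definite as long as the speed is nonzero, so the speed may
    vanish only at transverse times. Since at least one end is transverse, three speed profiles
    cover all cases. *)
Lemma rrep_shear (a b : R) (F : frame) (c : R -> R) : a < b -> lagF F ->
  cont_on (itv a b) c ->
  rsubmx (shear F (c a)) \in unitmx \/ rsubmx (shear F (c b)) \in unitmx ->
  rrep a b (fun t => shear F (c t)).
Proof.
move=> ab lF cc ends.
pose x t := (t - a) / (b - a).
have ba : b - a != 0 by rewrite subr_eq0 gt_eqF.
have ba0 : 0 < b - a by rewrite subr_gt0.
have dx t : is_derive t (1 : R) x (b - a)^-1.
  have := is_deriveM (is_deriveB (is_derive_id t (1 : R)) (is_derive_cst a t (1 : R)))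
    (is_derive_cst (b - a)^-1 t (1 : R)).
  by move=> /is_derive_eq; apply; rewrite subr0 scaler0 add0r [_ *: _]mulr1.
have xa : x a = 0 by rewrite /x subrr mul0r.
have xb : x b = 1 by rewrite /x divff.
have cX t : continuous_at t x by exact: (is_derive_continuous (dx t)).
(* the profile rises from 0 to 1, flat exactly at the non-crossing ends *)
have [p [dp [Hp cdp [p0 p1] dpos [flat0 flat1]]]] : exists p dp : R -> R,
    [/\ forall y, is_derive y (1 : R) p (dp y), continuous dp, p 0 = 0 /\ p 1 = 1,
     forall y, 0 <= y <= 1 -> (dp y == 0) ->
        (y = 0 /\ rsubmx (shear F (c a)) \in unitmx) \/
        (y = 1 /\ rsubmx (shear F (c b)) \in unitmx) &
     (rsubmx (shear F (c a)) \in unitmx -> dp 0 = 0) /\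
     (rsubmx (shear F (c b)) \in unitmx -> dp 1 = 0)].
  have poly (q : {poly R}) : (forall y, is_derive y (1 : R) (horner q) (horner q^`() y))
     /\ continuous (horner q^`()).
    by split=> [y|]; [exact: is_derive_poly | exact: continuous_horner].
  have [ua|ua] := boolP (rsubmx (shear F (c a)) \in unitmx).
    have [ub|ub] := boolP (rsubmx (shear F (c b)) \in unitmx).
      have [h1 h2] := poly (3%:P * 'X^2 - 2%:P * 'X^3).
      eexists; eexists; split; [exact: h1|exact: h2| | |].
      - by rewrite !hornerE /=; split; ring.
      - move=> y /andP[y0 y1]; rewrite !poly.derivE !hornerE /= => /eqP h.
        have : y * (1 - y) = 0 by move: h; lra.
        by move/eqP; rewrite mulf_eq0 subr_eq0 => /orP[/eqP ->|/eqP <-]; [left|right].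
      - by rewrite !poly.derivE !hornerE /=; split=> _; ring.
    have [h1 h2] := poly 'X^2.
    eexists; eexists; split; [exact: h1|exact: h2| | |].
    - by rewrite !hornerE /=; split; ring.
    - by move=> y /andP[y0 y1]; rewrite !poly.derivE !hornerE /= => /eqP h; left; split => //; lra.
    - by rewrite !poly.derivE !hornerE /=; split=> // _; ring.
  have ub : rsubmx (shear F (c b)) \in unitmx by case: ends ua => [->|].
  have [h1 h2] := poly (2%:P * 'X - 'X^2).
  eexists; eexists; split; [exact: h1|exact: h2| | |].
  - by rewrite !hornerE /=; split; ring.
  - by move=> y /andP[y0 y1]; rewrite !poly.derivE !hornerE /= => /eqP h; right; split => //; lra.
  - by rewrite !poly.derivE !hornerE /=; split=> // _; ring.
pose th t := c a + (c b - c a) * p (x t).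
pose dth t := (c b - c a) * (dp (x t) * (b - a)^-1).
have dthE t : is_derive t (1 : R) th (dth t).
  have dpx : is_derive t (1 : R) (p \o x) (dp (x t) * (b - a)^-1).
    exact: is_derive1_comp.
  have := is_deriveD (is_derive_cst (c a) t (1 : R)) (is_deriveZ (c b - c a) dpx).
  by rewrite add0r.
have tha : th a = c a by rewrite /th xa p0 mulr0 addr0.
have thb : th b = c b by rewrite /th xb p1 mulr1 addrC subrK.
have dE t : is_derive t (1 : R) (fun t => shear F (th t)) (row_mx 0 (dth t *: lsubmx F)).
  have dz : is_derive t (1 : R) (fun t => th t *: lsubmx F) (dth t *: lsubmx F).
    apply/is_derive_mxP => i j; rewrite mxE; under eq_fun do rewrite mxE.
    have := is_deriveM (dthE t) (is_derive_cst (lsubmx F i j) t (1 : R)).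
    by move=> /is_derive_eq; apply; rewrite scaler0 add0r; exact: mulrC.
  have := is_deriveD (is_derive_cst (rsubmx F) t (1 : R)) dz; rewrite add0r.
  exact: is_derive_row_mx (is_derive_cst (lsubmx F) t (1 : R)).
have cth : continuous th by move=> t; exact: is_derive_continuous.
have cdth : continuous dth.
  move=> t; apply: cvgM; first exact: cvg_cst.
  apply: cvgM; last exact: cvg_cst.
  by apply: (@cvg_comp _ _ _ x dp _ (nbhs (x t))); [exact: cX | exact: cdp].
exists (fun q => shear F ((1 - q.1) * c q.2 + q.1 * th q.2)),
  (fun t => shear F (th t)), (fun t => row_mx 0 (dth t *: lsubmx F)), (fun=> 1%:M).
split.
- split; last by move=> q _; exact: lagF_shear.
  apply: cont_shear; first exact: cont_on_cst.
  move=> q [q1 q2]; apply: cvgD; apply: cvgM.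
  + by apply: cvgB; [exact: cvg_cst | apply: cvg_within_filter; exact: cvg_fst].
  + apply: (cont_on_comp (cont_on_continuous (f := @snd R R) _) _ cc (p := q)) => //.
      by move=> z; exact: cvg_snd.
    by move=> z [].
  + by apply: cvg_within_filter; exact: cvg_fst.
  + apply: cvg_within_filter; apply: (@cvg_comp _ _ _ snd th _ (nbhs q.2)).
      exact: cvg_snd.
    exact: cth.
- split; first exact: cont_on_cst.
  by move=> t _; rewrite unitmx1 mul1mx subr0 mul1r mul0r addr0.
- move=> s _; exists 1%:M, 1%:M; rewrite unitmx1 !mul1mx /=; split => //.
    by rewrite tha -mulrDl subrK mul1r.
  by rewrite thb -mulrDl subrK mul1r.
- split => //.
  + by move=> t _; rewrite /= subrr mul0r add0r mul1r.
  + move=> t; apply: cvg_row_mx; first exact: cvg_cst.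
    by apply: cvgZ; [exact: cdth | exact: cvg_cst].
  + move=> t /andP[at_ tb]; have [d0|d0] := eqVneq (dth t) 0; last exact: crossD_shear.
    have ut : rsubmx (shear F (th t)) \in unitmx.
      have xt : 0 <= x t <= 1.
        by rewrite /x divr_ge0 ?subr_ge0 ?(ltW ab) // ler_pdivrMr // mul1r lerD2r.
      move/eqP: d0; rewrite /dth !mulf_eq0 invr_eq0 (negbTE ba) orbF.
      case/orP => [|/(dpos _ xt)[[x0 u]|[x1 u]]].
      * rewrite subr_eq0 => /eqP cab; rewrite /th cab subrr mul0r addr0.
        by case: ends; rewrite ?cab.
      * by rewrite /th x0 p0 mulr0 addr0.
      * by rewrite /th x1 p1 mulr1 addrC subrK.
    by exists 0; exact: crossD_unit.
- rewrite /= /dth xa xb; split => u.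
    by rewrite flat0 // mul0r mulr0 scale0r row_mx0.
  by rewrite flat1 // mul0r mulr0 scale0r row_mx0.
Qed.

(** Lagrangians transverse to the reference one correspond to symmetric matrices [Y^-1 X]. These
    form a vector space, in which the path is replaced by the segment between its ends, with speed 0
    at both. *)
Lemma rrep_transverse (a b : R) (F : R -> frame) : a < b -> cont_on (itv a b) F ->
  (forall t, itv a b t -> lagF (F t)) ->
  (forall t, itv a b t -> rsubmx (F t) \in unitmx) -> rrep a b F.
Proof.
move=> ab cF lF uF.
have aab : itv a b a by rewrite /itv /= lexx ltW.
have bab : itv a b b by rewrite /itv /= lexx ltW.
pose S t := invmx (rsubmx (F t)) *m lsubmx (F t).
have sS t : itv a b t -> (S t)^T = S t.
  move=> tab; have [XY _] := lF t tab; have u := uF t tab.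
  rewrite /S trmx_mul trmx_inv; apply: (can_inj (mulKmx u)); rewrite mulKVmx //.
  have u' : (rsubmx (F t))^T \in unitmx by rewrite unitmx_tr.
  by apply: (can_inj (mulmxK u')); rewrite !mulmxA mulmxKV // XY mulmxK.
have cS : cont_on (itv a b) S.
  move=> t tab; apply: cvg_mulmx; last by apply: cvg_lsubmx; exact: cF.
  by apply: cvg_invmx; [apply: cvg_rsubmx; exact: cF | exact: uF].
have lagS (A : 'M[R]_m) : A^T = A -> lagF (row_mx A 1%:M).
  move=> sA; rewrite /lagF row_mxKl row_mxKr; split.
    by rewrite trmx1 mulmx1 mul1mx.
  by apply/row_free_inj => u; rewrite mul_mx_row -row_mx0 => /eq_row_mx[_]; rewrite mulmx1.
pose x t := (t - a) / (b - a).
have ba : b - a != 0 by rewrite subr_eq0 gt_eqF.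
pose q : {poly R} := 3%:P * 'X^2 - 2%:P * 'X^3.
have dx t : is_derive t (1 : R) x (b - a)^-1.
  have := is_deriveM (is_deriveB (is_derive_id t (1 : R)) (is_derive_cst a t (1 : R)))
    (is_derive_cst (b - a)^-1 t (1 : R)).
  by move=> /is_derive_eq; apply; rewrite subr0 scaler0 add0r [_ *: _]mulr1.
have xa : x a = 0 by rewrite /x subrr mul0r.
have xb : x b = 1 by rewrite /x divff.
pose p t := q.[x t]; pose dp t := q^`().[x t] * (b - a)^-1.
have dpE t : is_derive t (1 : R) p (dp t) by exact: is_derive1_comp.
have cp : continuous p by move=> t; exact: is_derive_continuous.
have cdp : continuous dp.
  move=> t; apply: cvgM; last exact: cvg_cst.
  apply: (@cvg_comp _ _ _ x (horner q^`()) _ (nbhs (x t))); last exact: continuous_horner.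
  exact: (is_derive_continuous (dx t)).
have [pa pb] : p a = 0 /\ p b = 1 by rewrite /p xa xb /q !hornerE /=; split; ring.
have [dpa dpb] : dp a = 0 /\ dp b = 0.
  by rewrite /dp xa xb /q !poly.derivE !hornerE /=; split; ring.
pose N t := S a + p t *: (S b - S a).
have sN t : (N t)^T = N t by rewrite /N linearD /= linearZ /= linearB /= !sS.
have cN : continuous N.
  move=> t; apply: cvgD; first exact: cvg_cst.
  by apply: cvgZ; [exact: cp | exact: cvg_cst].
exists (fun r => row_mx ((1 - r.1) *: S r.2 + r.1 *: N r.2) 1%:M),
  (fun t => row_mx (N t) 1%:M), (fun t => row_mx (dp t *: (S b - S a)) 0),
  (fun t => invmx (rsubmx (F t))).
split.
- split.
    move=> r [r1 r2]; apply: cvg_row_mx; last exact: cvg_cst.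
    apply: cvgD; apply: cvgZ.
    + by apply: cvgB; [exact: cvg_cst | apply: cvg_within_filter; exact: cvg_fst].
    + apply: (cont_on_comp (cont_on_continuous (f := @snd R R) _) _ cS (p := r)) => //.
        by move=> z; exact: cvg_snd.
      by move=> z [].
    + by apply: cvg_within_filter; exact: cvg_fst.
    + apply: cvg_within_filter; apply: (@cvg_comp _ _ _ snd N _ (nbhs r.2)).
        exact: cvg_snd.
      exact: cN.
  by move=> r [r1 r2]; apply: lagS; rewrite linearD /= !linearZ /= sN sS.
- split.
    by move=> t tab; apply: cvg_invmx; [apply: cvg_rsubmx; exact: cF | exact: uF].
  move=> t tab; rewrite unitmx_inv uF //; split => //=.
  rewrite subr0 scale1r scale0r addr0 -{2}(hsubmxK (F t)) mul_mx_row.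
  by rewrite mulVmx // uF.
- move=> s _; exists (invmx (rsubmx (F a))), (invmx (rsubmx (F b))).
  rewrite !unitmx_inv !uF //; split => //=.
    rewrite /N pa scale0r addr0 -scalerDl subrK scale1r.
    by rewrite -{2}(hsubmxK (F a)) mul_mx_row mulVmx // uF.
  rewrite /N pb scale1r [S a + _]addrC subrK -scalerDl subrK scale1r.
  by rewrite -{2}(hsubmxK (F b)) mul_mx_row mulVmx // uF.
- split.
  + by move=> t _; rewrite /= subrr scale0r add0r scale1r.
  + move=> t; have dz : is_derive t (1 : R) (fun t => p t *: (S b - S a)) (dp t *: (S b - S a)).
      apply/is_derive_mxP => i j; rewrite mxE; under eq_fun do rewrite mxE.
      have := is_deriveM (dpE t) (is_derive_cst ((S b - S a) i j) t (1 : R)).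
      by move=> /is_derive_eq; apply; rewrite scaler0 add0r; exact: mulrC.
    have dN := is_deriveD (is_derive_cst (S a) t (1 : R)) dz; rewrite add0r in dN.
    exact: is_derive_row_mx dN (is_derive_cst 1%:M t (1 : R)).
  + move=> t; apply: cvg_row_mx; last exact: cvg_cst.
    by apply: cvgZ; [exact: cdp | exact: cvg_cst].
  + by move=> t _; exists 0; apply: crossD_unit; rewrite row_mxKr unitmx1.
- by rewrite /= dpa dpb scale0r row_mx0.
Qed.

Definition clamp01 (x : R) : R := Num.max 0 (Num.min 1 x).

Lemma clamp01_continuous : continuous clamp01.
Proof.
move=> x; rewrite /continuous_at /clamp01; apply: continuous_max; first exact: cvg_cst.
by apply: continuous_min; [exact: cvg_cst | exact: cvg_id].
Qed.

Lemma clamp01_itv x : 0 <= clamp01 x <= 1.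
Proof. by rewrite /clamp01 le_max lexx /= ge_max ler01 ge_min lexx. Qed.

Lemma clamp01_le0 x : x <= 0 -> clamp01 x = 0.
Proof.
move=> x0; rewrite /clamp01 min_r ?max_l //.
by rewrite (le_trans x0) // ler01.
Qed.

Lemma clamp01_ge1 x : 1 <= x -> clamp01 x = 1.
Proof. by move=> x1; rewrite /clamp01 min_l // max_r // ler01. Qed.

Lemma itv_conv (u v s x y : R) : itv 0 1 s -> itv u v x -> itv u v y ->
  itv u v ((1 - s) * x + s * y).
Proof.
rewrite /itv /= => /andP[s0 s1] /andP[x0 x1] /andP[y0 y1].
have s1' : 0 <= 1 - s by rewrite subr_ge0.
have h1 := ler_wpM2l s1' x0; have h2 := ler_wpM2l s0 y0.
have h3 := ler_wpM2l s1' x1; have h4 := ler_wpM2l s0 y1.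
apply/andP; split; lra.
Qed.

(** The Lagrangians [shear (F s) c] are parametrized by a convex strip of pairs [(s, c)], in which
    two paths with the same ends are joined by segments. *)
Lemma rrep_plane (u v : R) (F : R -> frame) (g1 g2 th : R -> R) : u <= v ->
  cont_on (itv u v) F -> (forall t, itv u v t -> lagF (F t)) ->
  continuous g1 -> continuous g2 -> continuous th ->
  (forall t, itv u v t -> itv u v (g1 t)) ->
  g1 u = u -> g1 v = v -> g2 u = th u -> g2 v = th v ->
  rrep u v (fun t => shear (F (g1 t)) (g2 t)) ->
  rrep u v (fun t => shear (F t) (th t)).
Proof.
move=> uv cF lF c1 c2 cth ig g1u g1v g2u g2v.
have ct (f : R -> R) : continuous f -> continuous (fun q : R * R => f q.2).
  move=> cf q; apply: (@cvg_comp _ _ _ snd f _ (nbhs q.2)); first exact: cvg_snd.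
  exact: cf.
have cc (f g : R -> R) : continuous f -> continuous g ->
    cont_on (rect 0 1 u v) (fun q : R * R => (1 - q.1) * f q.2 + q.1 * g q.2).
  move=> cf cg; apply: cont_on_continuous => q; apply: cvgD; apply: cvgM.
  - by apply: cvgB; [exact: cvg_cst | exact: cvg_fst].
  - exact: ct.
  - exact: cvg_fst.
  - exact: ct.
apply: (rrep_homotopic uv
  (k := fun q => shear (F ((1 - q.1) * q.2 + q.1 * g1 q.2)) ((1 - q.1) * th q.2 + q.1 * g2 q.2))).
- apply: cont_shear; last exact: cc.
  apply: (cont_on_comp _ _ cF); first by apply: (cc id) => // t; exact: cvg_id.
  by move=> q [q1 q2]; apply: itv_conv => //; exact: ig.
- by move=> q [q1 q2]; apply/lagF_shear/lF/itv_conv => //; exact: ig.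
- by move=> t _ /=; rewrite !subr0 !mul1r !mul0r !addr0.
- by move=> t _ /=; rewrite !subrr !mul1r !mul0r !add0r.
- by move=> s _ /=; rewrite g1u g1v g2u g2v -!mulrDl !subrK !mul1r.
Qed.

Lemma rrep_local (u v c : R) (F : R -> frame) (th : R -> R) : u < v ->
  cont_on (itv u v) F -> (forall t, itv u v t -> lagF (F t)) ->
  (forall t, itv u v t -> rsubmx (shear (F t) c) \in unitmx) ->
  continuous th -> rrep u v (fun t => shear (F t) (th t)).
Proof.
move=> uv cF lF uF cth.
have uab : itv u v u by rewrite /itv /= lexx ltW.
have vab : itv u v v by rewrite /itv /= lexx ltW.
pose l := (v - u) / 3; have l0 : 0 < l by rewrite divr_gt0 // subr_gt0.
have lE : v = u + 3 * l by rewrite /l; field.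
(* A detour in three thirds: shear at the fixed time [u] until the amount is [c], cross from [u] to
   [v] at the constant transverse amount [c], then shear at the fixed time [v] from [c] to
   [th v]. *)
pose g1 t := u + 3 * l * clamp01 ((t - u - l) / l).
pose w t := clamp01 (1 - (t - u) / l) + clamp01 (1 - (v - t) / l).
pose g2 t := c + (th t - c) * w t.
have caff (f : R -> R) : continuous f -> continuous (clamp01 \o f).
  move=> cf t; apply: (@cvg_comp _ _ _ f clamp01 _ (nbhs (f t))); first exact: cf.
  exact: clamp01_continuous.
have cg1 : continuous g1.
  move=> t; apply: cvgD; first exact: cvg_cst.
  apply: cvgM; first exact: cvg_cst.
  apply: (caff (fun t => (t - u - l) / l)) => {}t.
  apply: cvgM; last exact: cvg_cst.
  by do 2 (apply: cvgB; last exact: cvg_cst); exact: cvg_id.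
have cg2 : continuous g2.
  move=> t; apply: cvgD; first exact: cvg_cst.
  apply: cvgM; first by apply: cvgB; [exact: cth | exact: cvg_cst].
  apply: cvgD.
    apply: (caff (fun t => 1 - (t - u) / l)) => {}t.
    apply: cvgB; first exact: cvg_cst.
    by apply: cvgM; [apply: cvgB; [exact: cvg_id | exact: cvg_cst] | exact: cvg_cst].
  apply: (caff (fun t => 1 - (v - t) / l)) => {}t.
  apply: cvgB; first exact: cvg_cst.
  by apply: cvgM; [apply: cvgB; [exact: cvg_cst | exact: cvg_id] | exact: cvg_cst].
have ig1 t : itv u v (g1 t).
  have /andP[h0 h1] := clamp01_itv ((t - u - l) / l).
  have h2 := ler_wpM2l (ltW l0) h0; have h3 := ler_wpM2l (ltW l0) h1.
  rewrite /itv /g1 /= lE; apply/andP; split; lra.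
have g1L t : t <= u + l -> g1 t = u.
  move=> h; rewrite /g1 clamp01_le0 ?mulr0 ?addr0 //.
  by rewrite ler_pdivrMr // mul0r; lra.
have g1R t : v - l <= t -> g1 t = v.
  move=> h; rewrite /g1 clamp01_ge1 ?mulr1 ?lE //.
  by rewrite ler_pdivlMr // mul1r; lra.
have wM t : u + l <= t -> t <= v - l -> w t = 0.
  move=> h1 h2; rewrite /w !clamp01_le0 ?addr0 // subr_le0 ler_pdivlMr // mul1r; lra.
have wu : w u = 1.
  rewrite /w subrr mul0r subr0 clamp01_ge1 // clamp01_le0 ?addr0 //.
  by rewrite subr_le0 ler_pdivlMr // mul1r; lra.
have wv : w v = 1.
  rewrite /w subrr mul0r subr0 (clamp01_ge1 (lexx 1)) clamp01_le0 ?add0r //.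
  by rewrite subr_le0 ler_pdivlMr // mul1r; lra.
have g2u : g2 u = th u by rewrite /g2 wu mulr1 addrC subrK.
have g2v : g2 v = th v by rewrite /g2 wv mulr1 addrC subrK.
have g2M t : u + l <= t -> t <= v - l -> g2 t = c by move=> h1 h2; rewrite /g2 wM // mulr0 addr0.
apply: (rrep_plane (ltW uv) cF lF cg1 cg2 cth) => //; [by apply: g1L; lra | by apply: g1R; lra|].
have h1 : u + l <= v - l by lra.
have m1 : g2 (u + l) = c by apply: g2M; lra.
have m2 : g2 (v - l) = c by apply: g2M; lra.
have e1 : g1 (u + l) = u by apply: g1L.
have e2 : g1 (v - l) = v by apply: g1R.
apply: (rrep_cat (b := u + l)); [lra | lra | exact/lagF_shear/lF | by rewrite e1 m1; exact: uF| |].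
  apply: (rrep_eq (F := fun t => shear (F u) (g2 t))); first lra.
    by move=> t /andP[_ tl]; rewrite g1L.
  apply: rrep_shear; [lra | exact: lF | exact: cont_on_continuous|].
  by right; rewrite m1; exact: uF.
apply: (rrep_cat (b := v - l)); [lra | lra | exact/lagF_shear/lF | by rewrite e2 m2; exact: uF| |].
  apply: (rrep_eq (F := fun t => shear (F (g1 t)) c)); first lra.
    by move=> t /andP[tl tv]; rewrite g2M.
  apply: rrep_transverse; first lra.
  - apply: cont_shear; last exact: cont_on_cst.
    by apply: (cont_on_comp (cont_on_continuous cg1) _ cF).
  - by move=> t _; exact/lagF_shear/lF.
  - by move=> t _; exact: uF.
apply: (rrep_eq (F := fun t => shear (F v) (g2 t))); first lra.
  by move=> t /andP[tl _]; rewrite g1R.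
apply: rrep_shear; [lra | exact: lF | exact: cont_on_continuous|].
by left; rewrite m2; exact: uF.
Qed.

Theorem rrep_exists (a b : R) (F : R -> frame) : a < b -> cont_on (itv a b) F ->
  (forall t, itv a b t -> lagF (F t)) -> rrep a b F.
Proof.
move=> ab cF lF.
(* Allowing every shear profile [th] makes the property stable under concatenation, since the
   profile can be altered at the junction. *)
pose Q u v := u < v -> forall th, continuous th -> rrep u v (fun t => shear (F t) (th t)).
have sub u v : a <= u -> v <= b -> itv u v `<=` itv a b.
  by move=> au vb t /andP[ut tv]; rewrite /itv /= (le_trans au ut) (le_trans tv vb).
suff : Q a b.
  move=> /(_ ab (fun=> 0) (fun=> cvg_cst _)); apply: rrep_eq; first exact: ltW.
  by move=> t _; rewrite /shear scale0r addr0 hsubmxK.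
apply: (@interval_glue R Q) => [|t tab|u v w au uv vw wb Quv Qvw].
- exact: ltW.
- have [c uc] := shear_unit (lF t tab).
  have cs : cont_on (itv a b) (fun t => shear (F t) c).
    by apply: cont_shear => //; exact: cont_on_cst.
  have := near_unitmx (cvg_rsubmx (cs t tab)) uc.
  move=> /(_ _)[d /= d0 Hd]; exists d => // u v au uv vb tu vt uv' th cth.
  have suv := sub u v au vb.
  apply: (rrep_local uv' (cont_on_sub suv cF) _ _ cth (c := c)) => [s /suv|s suv']; first exact: lF.
  apply: Hd; last exact: suv.
  move: suv' => /andP[us sv]; rewrite /ball_ /= ltr_distlC.
  by rewrite (lt_le_trans tu us) (le_lt_trans sv vt).
- move=> uw th cth.
  move: uv; rewrite le_eqVlt => /predU1P[e|uv]; first by rewrite e in uw *; exact: Qvw.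
  move: vw; rewrite le_eqVlt => /predU1P[e|vw]; first by rewrite -e; exact: Quv.
  have vab : itv a b v by rewrite /itv /= (le_trans au (ltW uv)) (le_trans (ltW vw) wb).
  have [c uc] := shear_unit (lF v vab).
  (* A parabola vanishing at [u] and [w] is added to [th] so that its value at [v] becomes the
     transverse amount [c]. *)
  pose k := (c - th v) / ((v - u) * (w - v)).
  have d0 : (v - u) * (w - v) != 0 by rewrite mulf_neq0 // subr_eq0 gt_eqF.
  pose th' t := th t + k * ((t - u) * (w - t)).
  have cth' : continuous th'.
    move=> t; apply: cvgD; first exact: cth.
    apply: cvgM; first exact: cvg_cst.
    apply: cvgM; first by apply: cvgB; [exact: cvg_id | exact: cvg_cst].
    by apply: cvgB; [exact: cvg_cst | exact: cvg_id].
  have th'v : th' v = c by rewrite /th' /k divfK // addrC subrK.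
  have suw := sub u w au wb.
  apply: (rrep_plane (ltW uw) (cont_on_sub suw cF) _ (g1 := id) (g2 := th')) => //.
  + by move=> t /suw; exact: lF.
  + by move=> t; exact: cvg_id.
  + by rewrite /th' subrr mul0r mulr0 addr0.
  + by rewrite /th' subrr !mulr0 addr0.
  apply: (rrep_cat (ltW uv) (ltW vw)); [exact/lagF_shear/lF | by rewrite th'v| |].
    exact: Quv.
  exact: Qvw.
Qed.

End RegularRepresentatives.

(** * The Maslov index of the definitions as an increment of a potential *)

Section MaslovIndex.
Context {R : realType} {m : nat}.
Variables (B : 'M[R]_(m + m)) (V W : 'M[R]_(m, m + m)).
Hypotheses (Bskew : B^T = - B) (VV : V *m B *m V^T = 0)
  (WW : W *m B *m W^T = 0) (VW : V *m B *m W^T = 1%:M).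
Local Notation frame := 'M[R]_(m, m + m).

(** [Xof] and [Yof] are the coordinates of a frame in the splitting into [V] and a Lagrangian
    complement [W] dual to it. *)
Definition Xof (L : frame) : 'M[R]_m := L *m (B *m W^T).
Definition Yof (L : frame) : 'M[R]_m := - (L *m (B *m V^T)).

Lemma WVB : W *m B *m V^T = - 1%:M.
Proof.
have := congr1 trmx VW; rewrite !trmx_mul trmxK Bskew mulNmx mulmxN trmx1 mulmxA.
by move=> <-; rewrite opprK.
Qed.

Lemma Xof_comb (X Y : 'M[R]_m) : Xof (X *m V + Y *m W) = X.
Proof. by rewrite /Xof mulmxDl -!mulmxA !(mulmxA _ B) VW WW mulmx1 mulmx0 addr0. Qed.

Lemma Yof_comb (X Y : 'M[R]_m) : Yof (X *m V + Y *m W) = Y.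
Proof.
by rewrite /Yof mulmxDl -!mulmxA !(mulmxA _ B) WVB VV mulmx0 add0r mulmxN mulmx1 opprK.
Qed.

Lemma frame_comb k (L : 'M[R]_(k, m + m)) :
  L = L *m (B *m W^T) *m V - L *m (B *m V^T) *m W.
Proof.
pose T := col_mx V W; pose T' := row_mx (B *m W^T) (- (B *m V^T)).
have TT' : T *m T' = 1%:M.
  rewrite /T /T' mul_col_row !mulmxN !mulmxA VW VV WW WVB opprK oppr0.
  by rewrite -scalar_mx_block.
have T'T : T' *m T = 1%:M by exact: mulmx1C.
rewrite -{1}(mulmx1 L) -T'T /T' /T mul_row_col mulmxDr !mulmxA.
by rewrite mulmxN mulNmx !mulmxA.
Qed.

Lemma XYofK (L : frame) : Xof L *m V + Yof L *m W = L.
Proof. by rewrite [RHS]frame_comb /Xof /Yof mulNmx. Qed.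

Lemma lagrangianP (L : frame) : lagrangian B L <-> lagr (Xof L) (Yof L).
Proof.
have e : L *m B *m L^T = Xof L *m (Yof L)^T - Yof L *m (Xof L)^T.
  rewrite -{1 2}(XYofK L); set X := Xof L; set Y := Yof L; clearbody X Y.
  rewrite linearD /= !trmx_mul !mulmxDl !mulmxDr.
  rewrite -!(mulmxA _ B) -!(mulmxA _ V) -!(mulmxA _ W) !(mulmxA B) !(mulmxA V) !(mulmxA W).
  rewrite VV VW WVB WW !mul0mx !mulmx0 !add0r !addr0.
  by rewrite mul1mx mulNmx mul1mx mulmxN.
have rfE : row_free L <-> row_free (row_mx (Xof L) (Yof L)).
  split=> /row_free_inj h; apply/row_free_inj => u.
    rewrite mul_mx_row -row_mx0 => /eq_row_mx[uX uY]; apply: h.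
    by rewrite -(XYofK L) mulmxDr (mulmxA u (Xof L)) (mulmxA u (Yof L)) uX uY !mul0mx addr0.
  move=> uL; apply: h; rewrite mul_mx_row /Xof /Yof mulmxN !mulmxA uL !mul0mx oppr0.
  by rewrite row_mx0.
rewrite /lagrangian e; split=> [[rf]|[XY rf]].
  by move/eqP; rewrite subr_eq0 => /eqP XY; split => //; exact/rfE.
by split; [exact/rfE | rewrite XY subrr].
Qed.

Lemma crossing_spaceP (L : R -> frame) t (u : 'rV[R]_m) :
  (u <= crossing_space V L t)%MS = (u *m Yof (L t) == 0).
Proof.
rewrite /crossing_space; apply/idP/idP => [/sub_kermxP|/eqP uY].
  rewrite mulmxA => /eqP; rewrite -submxE => /submxP[c uL]; apply/eqP; rewrite /Yof mulmxN !mulmxA uL.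
  by rewrite -mulmxA -mulmxA (mulmxA V) VV mulmx0 oppr0.
apply/sub_kermxP; rewrite mulmxA; apply/eqP; rewrite -submxE.
rewrite -(XYofK (L t)) mulmxDr !mulmxA uY mul0mx addr0.
exact: submxMl.
Qed.

Lemma crossing_formP (L D : frame) (u : 'rV[R]_m) : u *m Yof L = 0 ->
  qf (L *m B *m D^T) u = qf (Xof L *m (Yof D)^T) u.
Proof.
move=> uY; rewrite /qf; congr ((_ *m _) 0 0).
have -> : u *m (L *m B *m D^T) = u *m Xof L *m (V *m B *m D^T).
  rewrite -{1}(XYofK L) mulmxDl mulmxDl mulmxDr !mulmxA uY !mul0mx addr0.
  by [].
have -> : V *m B *m D^T = (Yof D)^T.
  by rewrite /Yof linearN /= !trmx_mul trmxK Bskew mulmxN mulNmx opprK.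
by rewrite !mulmxA.
Qed.

Lemma has_signature_eq (K K' Q Q' : 'M[R]_m) s : (K == K')%MS ->
  (forall u : 'rV[R]_m, (u <= K)%MS -> qf Q u = qf Q' u) ->
  has_signature K Q s -> has_signature K' Q' s.
Proof.
move=> KK' e [P [N [PNK h0 h1 h2 ->]]].
have PK : (P <= K)%MS by rewrite (submx_trans (addsmxSl P N)) // (andP PNK).1.
have NK : (N <= K)%MS by rewrite (submx_trans (addsmxSr P N)) // (andP PNK).1.
exists P, N; split => //.
- move/andP: PNK => [a b]; move/andP: KK' => [c d].
  by apply/andP; split; [exact: submx_trans a c | exact: submx_trans d b].
- by move=> u uP u0; rewrite -[_ 0 0]/(qf Q' u) -e ?(submx_trans uP) //; exact: h1.
- by move=> u uN u0; rewrite -[_ 0 0]/(qf Q' u) -e ?(submx_trans uN) //; exact: h2.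
Qed.

Lemma cvg_Xof (T : Type) (F : set_system T) (FF : Filter F) (L : T -> frame) l :
  L x @[x --> F] --> l -> Xof (L x) @[x --> F] --> Xof l.
Proof. by move=> Ll; apply: cvg_mulmx => //; exact: cvg_cst. Qed.

Lemma cvg_Yof (T : Type) (F : set_system T) (FF : Filter F) (L : T -> frame) l :
  L x @[x --> F] --> l -> Yof (L x) @[x --> F] --> Yof l.
Proof. by move=> Ll; apply: cvgN; apply: cvg_mulmx => //; exact: cvg_cst. Qed.

Lemma eqmx_frame (L L' : frame) : row_free L -> row_free L' -> (L == L')%MS ->
  exists2 G : 'M[R]_m, G \in unitmx & L = G *m L'.
Proof.
move=> rL rL' /andP[/submxP[G LG] _]; exists G => //.
rewrite -row_free_unit /row_free -(mxrankMfree G rL') -LG.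
exact: rL.
Qed.

Lemma Xof_mul (G : 'M[R]_m) L : Xof (G *m L) = G *m Xof L.
Proof. by rewrite /Xof -mulmxA. Qed.

Lemma Yof_mul (G : 'M[R]_m) L : Yof (G *m L) = G *m Yof L.
Proof. by rewrite /Yof mulmxN -mulmxA. Qed.

Lemma derive1_Ck1 n1 (f : R -> 'M[R]_(n1, m + m)) t : Ck 1 setT f ->
  is_derive t (1 : R) f (derive1 f t).
Proof.
move=> [_ /(_ 1)[d _]]; rewrite derive1E; apply: DeriveDef => //; exact: d.
Qed.

Lemma regular_index_mas (a b : R) (L : R -> frame) mu : a < b ->
  (forall t, a <= t <= b -> lagrangian B (L t)) ->
  regular_index B V a b L mu ->
  mas_is a b (fun t => Xof (L t)) (fun t => Yof (L t)) mu.
Proof.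
move=> ab lL [cL [s [Hs ->]]].
have dL t := derive1_Ck1 t cL.
have cont t : L q @[q --> t] --> L t by exact: (is_derive_continuous (dL t)).
have lon : lagr_on (itv a b) (fun t => Xof (L t)) (fun t => Yof (L t)).
  split => [t _|t _|t tab]; last exact/lagrangianP/lL.
    by apply: cvg_Xof; apply: cvg_within_filter; exact: cont.
  by apply: cvg_Yof; apply: cvg_within_filter; exact: cont.
have cr t : itv a b t -> crossing (fun t => Xof (L t)) (fun t => Yof (L t)) t (s t).
  move=> tab; exists (Xof (derive1 L t)), (Yof (derive1 L t)),
    (crossing_space V L t), (crossing_form B L t); split.
  - exact: is_derive_mulmxr.
  - by apply: is_deriveN; exact: is_derive_mulmxr.
  - exact: crossing_spaceP.
  - by move=> u; exact: crossing_formP.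
  - exact: Hs.
have [l [ul lab ls lmas]] := crossing_mas ab lon cr.
have <- // : \sum_(t <- l) (if (t == a) || (t == b) then 2^-1 else 1) * (s t)%:~R =
  \sum_(t \in `[a, b]%classic)
     ((if (t == a) || (t == b) then 2^-1 else 1) : R) * (s t)%:~R.
rewrite (fsbigE l) //=.
- rewrite [RHS]big_seq_cond [LHS]big_seq; apply: eq_bigl => t.
  apply/idP/andP => [tl|[]//]; split=> //; rewrite inE /= in_itv /=; exact: lab.

- move=> t; rewrite /= in_itv /= => tab tl.
  have [->|st] := eqVneq (s t) 0; first by rewrite mulr0.
  by move: tl; rewrite ls.
Qed.

Lemma is_maslov_index_mas (a b : R) (L : R -> frame) mu : a < b ->
  (forall t, itv a b t -> lagrangian B (L t)) ->
  is_maslov_index B V a b L mu ->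
  mas_is a b (fun t => Xof (L t)) (fun t => Yof (L t)) mu.
Proof.
move=> ab lL [h [ch lh h0 hs hreg]].
have h1 := regular_index_mas ab _ hreg.
have lon : lagr_on (rect 0 1 a b) (fun p => Xof (h p)) (fun p => Yof (h p)).
  split => [p _|p _|[s t] [st tab]]; last exact/lagrangianP/lh.
    by apply: cvg_Xof; apply: cvg_within_filter; exact: ch.
  by apply: cvg_Yof; apply: cvg_within_filter; exact: ch.
have i0 : itv 0 1 (0 : R) by rewrite /itv /= lexx ler01.
have i1 : itv 0 1 (1 : R) by rewrite /itv /= lexx ler01.
have line s : itv 0 1 s -> lagr_on (itv a b) (fun t => Xof (h (s, t))) (fun t => Yof (h (s, t))).
  move=> s01; apply: (lagr_on_comp (g := fun t => (s, t)) _ _ lon) => [|t tab]; last by split.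
  exact: cont_on_continuous (@continuous_pairl R s).
have edge t : itv a b t -> (forall s, itv 0 1 s -> (h (s, t) == L t)%MS) ->
    mas_is 0 1 (fun s => Xof (h (s, t))) (fun s => Yof (h (s, t))) 0.
  move=> tab e; apply: mas_const_rank.
    apply: (lagr_on_comp (g := fun s => (s, t)) _ _ lon) => [|s s01]; last by split.
    exact: cont_on_continuous (@continuous_pairr R t).
  suff rk s : itv 0 1 s -> \rank (Yof (h (s, t))) = \rank (Yof (L t)).
    by move=> s s' hs1 hs2; rewrite !rk.
  move=> s01; have [rf _] := lh s t s01 tab; have [rf' _] := lL t tab.
  have [G uG ->] := eqmx_frame rf rf' (e s s01).
  by rewrite Yof_mul (eqmxMfull (Yof (L t))) // row_full_unit.
have bot : mas_is a b (fun t => Xof (L t)) (fun t => Yof (L t)) mu <->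
    mas_is a b (fun t => Xof (h (0, t))) (fun t => Yof (h (0, t))) mu.
  (* Only the row spaces at [s = 0] are prescribed, so the frames are matched time by time, possibly
     discontinuously; [mas_frame] allows this. *)
  have HG t : itv a b t -> exists2 G : 'M[R]_m, G \in unitmx & h (0, t) = G *m L t.
    move=> tab; have [rf _] := lh 0 t i0 tab; have [rf' _] := lL t tab.
    by apply: eqmx_frame => //; exact: h0.
  pose G t := if pselect (itv a b t) is left tab then s2val (cid2 (HG t tab)) else 1%:M.
  have GP t : itv a b t -> G t \in unitmx /\ h (0, t) = G t *m L t.
    by move=> tab; rewrite /G; case: pselect => // H; case: cid2.
  split; [apply: (mas_frame (G := G))|apply: (mas_frame (G := fun t => invmx (G t)))] => t tab.
    by have [uG e] := GP t tab; split=> //; rewrite e ?Xof_mul ?Yof_mul.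
  have [uG e] := GP t tab; rewrite unitmx_inv e Xof_mul Yof_mul.
  by split=> //; rewrite mulKmx.
apply/bot.
have [mu0 m0] := mas_exists (ltW ab) (line 0 i0).
have ia : itv a b a by rewrite /itv /= lexx ltW.
have ib : itv a b b by rewrite /itv /= lexx ltW.
have e := mas_square ler01 (ltW ab) lon m0 (h1 _)
  (edge a ia (fun s hs' => (hs s hs').1)) (edge b ib (fun s hs' => (hs s hs').2)).
rewrite addr0 add0r in e.
rewrite -e //.
by move=> t tab; exact: lh.
Qed.

Lemma derive_curve (E : normedModType R) (f : R -> E) (d : E) (t v : R) :
  is_derive t (1 : R) f d -> is_derive t v f (v *: d).
Proof.
move=> [df <-]; have Df := (@derivable1_diffP _ _ f t).1 df.
apply: DeriveDef; first exact: diff_derivable.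
by rewrite !deriveE // -[v in LHS]mulr1 -[v * 1]/(v *: (1 : R)) linearZ.
Qed.

Lemma Ck0_derive (E : normedModType R) (f d : R -> E) :
  (forall t, is_derive t (1 : R) f (d t)) -> continuous d ->
  forall v : R, (forall t, setT t -> derivable f t v) /\
    Ck 0 setT (fun t => 'D_v f t).
Proof.
move=> df cd v; have dv t := derive_curve v (df t).
split=> [t _|]; first exact: ex_derive.
split=> // t _; rewrite (_ : (fun t => 'D_v f t) = fun t => v *: d t).
  by apply: cvgZr; exact: cd.
by apply/funext => q; apply: derive_val.
Qed.

Definition back (F : frame) : frame := F *m col_mx V W.

Lemma Xof_back F : Xof (back F) = lsubmx F.
Proof. by rewrite /back -{1}(hsubmxK F) mul_row_col Xof_comb. Qed.

Lemma Yof_back F : Yof (back F) = rsubmx F.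
Proof. by rewrite /back -{1}(hsubmxK F) mul_row_col Yof_comb. Qed.

Lemma back_frame L : back (row_mx (Xof L) (Yof L)) = L.
Proof. by rewrite /back mul_row_col XYofK. Qed.

Lemma is_maslov_index_exists (a b : R) (L : R -> frame) : a < b ->
  cont_on (itv a b) L -> (forall t, itv a b t -> lagrangian B (L t)) ->
  exists mu, is_maslov_index B V a b L mu.
Proof.
move=> ab cL lL.
pose F t := row_mx (Xof (L t)) (Yof (L t)).
have cF : cont_on (itv a b) F.
  move=> t tab; apply: cvg_row_mx; first by apply: cvg_Xof; exact: cL.
  by apply: cvg_Yof; exact: cL.
have lF t : itv a b t -> lagF (F t).
  by move=> tab; rewrite /lagF row_mxKl row_mxKr; exact/lagrangianP/lL.
have [h [f [d [G [[ch lh] [cG hG] hs [hf df cd cr] _]]]]] := rrep_exists ab cF lF.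
pose cl t := Num.max a (Num.min b t).
have ccl : continuous cl.
  move=> t; apply: (@continuous_max _ _ (fun=> a) (Num.min b)); first exact: cvg_cst.
  by apply: (@continuous_min _ _ (fun=> b) id); [exact: cvg_cst|exact: cvg_id].
have clab t : itv a b (cl t).
  by rewrite /itv /cl /= le_max lexx /= ge_max (ltW ab) /= ge_min lexx.
have clid t : itv a b t -> cl t = t.
  by move=> /andP[h1 h2]; rewrite /cl (min_idPr h2) (max_idPr h1).
have ia : itv a b a by rewrite /itv /= lexx ltW.
have ib : itv a b b by rewrite /itv /= lexx ltW.
have cf : continuous f by move=> t; exact: (is_derive_continuous (df t)).
(* The definition requires continuity on the whole plane and a path at [s = 1] that is [C^1] for all
   times. Both variables are clamped, and the correction [f t - f (cl t)], zero on [[a, b]], makes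
   the path at [s = 1] equal to [f] everywhere. *)
pose h' (p : R * R) := back (h (clamp01 p.1, cl p.2) + (f p.2 - f (cl p.2))).
have h'E s t : itv 0 1 s -> itv a b t -> h' (s, t) = back (h (s, t)).
  move=> /andP[s0 s1] tab; rewrite /h' /= (clid t tab) subrr addr0 /clamp01.
  by rewrite (min_idPr s1) (max_idPr s0).
have h'1 t : h' (1, t) = back (f t).
  rewrite /h' /= clamp01_ge1 // hf //.
  by rewrite addrC subrK.
have rk t : itv a b t -> row_free (L t) by move=> /lL[].
have lB (u : frame) : lagF u -> lagrangian B (back u).
  by move=> lu; apply/lagrangianP; rewrite Xof_back Yof_back.
have eqm (A : 'M[R]_m) t : A \in unitmx -> (back (A *m F t) == L t)%MS.
  move=> uA; rewrite /back -mulmxA -/(back (F t)) back_frame.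
  by apply/eqmxP; apply: eqmxMfull; rewrite row_full_unit.
have dbf t : is_derive t (1 : R) (fun t => h' (1, t)) (back (d t)).
  rewrite (_ : (fun t => h' (1, t)) = fun t => back (f t)); last exact/funext.
  exact: is_derive_mulmxr.
have i0 : itv 0 1 (0 : R) by rewrite /itv /= lexx ler01.
have crs t : exists s : int, a <= t <= b ->
    has_signature (crossing_space V (fun t => h' (1, t)) t)
      (crossing_form B (fun t => h' (1, t)) t) s.
  have [tab|ntab] := pselect (itv a b t); last by exists 0.
  have [s [K [Q [hK hQ hsg]]]] := cr t tab; exists s => _.
  have YE : Yof (h' (1, t)) = rsubmx (f t) by rewrite h'1 Yof_back.
  have XE : Xof (h' (1, t)) = lsubmx (f t) by rewrite h'1 Xof_back.
  apply: has_signature_eq hsg.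
    apply/andP; split; apply/row_subP => i.
      by rewrite crossing_spaceP YE -hK row_sub.
    by rewrite hK -YE -(crossing_spaceP (fun t => h' (1, t))) row_sub.
  move=> u; rewrite hK => /eqP uY; rewrite hQ // /crossing_form.
  rewrite crossing_formP ?YE // XE derive1E.
  have -> : 'D_1 (fun t => h' (1, t)) t = back (d t) by apply: derive_val.
  by rewrite Yof_back.
have [s hsg] := choice crs.
exists (\sum_(t \in `[a, b]%classic)
   ((if (t == a) || (t == b) then 2^-1 else 1) : R) * (s t)%:~R).
exists h'; split.
- move=> p; apply: cvg_mulmx; last exact: cvg_cst.
  have c2 : (fun q : R * R => cl q.2) @ nbhs p --> cl p.2.
    by apply: (@cvg_comp _ _ _ snd cl _ (nbhs p.2)); [exact: cvg_snd|exact: ccl].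
  have c1 : (fun q : R * R => clamp01 q.1) @ nbhs p --> clamp01 p.1.
    by apply: (@cvg_comp _ _ _ fst clamp01 _ (nbhs p.1)); [exact: cvg_fst|exact: clamp01_continuous].
  apply: cvgD; last apply: cvgB.
  + pose g (q : R * R) := (clamp01 q.1, cl q.2).
    have cg : cont_on setT g.
      move=> q _; apply: cvg_within_filter.
      apply: (@cvg_pair _ _ _ (nbhs q) (nbhs (clamp01 q.1)) (nbhs (cl q.2)) _ _ _ (fun q => clamp01 q.1) (fun q => cl q.2)).
        by apply: (@cvg_comp _ _ _ fst clamp01 _ (nbhs q.1)); [exact: cvg_fst|exact: clamp01_continuous].
      by apply: (@cvg_comp _ _ _ snd cl _ (nbhs q.2)); [exact: cvg_snd|exact: ccl].
    have gr q : setT q -> rect 0 1 a b (g q).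
      by move=> _; split; [exact: clamp01_itv|exact: clab].
    have := @cont_on_comp _ _ _ (rect 0 1 a b) setT h g cg gr ch p I.
    by apply: cvg_trans; apply: cvg_app => P /= hP; exact: (filterS (fun q hq => hq I) hP).
  + by apply: (@cvg_comp _ _ _ snd f _ (nbhs p.2)); [exact: cvg_snd|exact: cf].
  + by apply: (@cvg_comp _ _ _ (fun q => cl q.2) f _ (nbhs (cl p.2))); [exact: c2|exact: cf].
- by move=> s' t s01 tab; rewrite h'E //; apply: lB; exact: lh.
- move=> t tab; rewrite h'E //; have [uG ->] := hG t tab; exact: eqm.
- move=> s' s01; have [A [A' [uA uA' eA eA']]] := hs s' s01.
  by rewrite !h'E // eA eA'; split; exact: eqm.
- split; last by exists s; split.
  split=> [t _|v]; first exact: (is_derive_continuous (dbf t)).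
  by apply: (Ck0_derive dbf) => t; apply: cvg_mulmx; [exact: cd|exact: cvg_cst].
Qed.

End MaslovIndex.

(** * The Conley-Zehnder index *)

Section ConleyZehnder.
Context {R : realType} {N : nat}.
Variable J : 'M[R]_N.
Hypotheses (Jskew : J^T = - J) (JJ : J *m J^T = 1%:M).

Definition sp (A : 'M[R]_N) : Prop := A *m J *m A^T = J.

(** [czX] and [czY] are the coordinates of the graph of [A] along the diagonal and along a
    Lagrangian complement, as [graph_frame] confirms. The kernel of [czY A] is the space of fixed
    vectors of [A]. *)
Definition czX (A : 'M[R]_N) : 'M[R]_N := 2^-1 *: (1%:M + A).
Definition czY (A : 'M[R]_N) : 'M[R]_N := (1%:M - A) *m J.

Definition cz (a b : R) (lam : R -> 'M[R]_N) (mu : R) : Prop :=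
  mas_is a b (fun t => czX (lam t)) (fun t => czY (lam t)) mu.

Lemma J_unit : J \in unitmx.
Proof. by have [] := mulmx1_unit JJ. Qed.

Lemma sp_unit A : sp A -> A \in unitmx.
Proof.
move=> sA; have : A *m (J *m A^T *m J^T) = 1%:M by rewrite !mulmxA sA JJ.
by case/mulmx1_unit.
Qed.

Lemma sp_inv A : sp A -> invmx A *m J = J *m A^T.
Proof.
move=> sA; have uA := sp_unit sA.
by rewrite -{1}sA -mulmxA mulKmx.
Qed.

Lemma sp1 : sp 1%:M.
Proof. by rewrite /sp mul1mx trmx1 mulmx1. Qed.

Lemma spM A B : sp A -> sp B -> sp (A *m B).
Proof. by move=> sA sB; rewrite /sp trmx_mul -(mulmxA A) -(mulmxA A) !mulmxA -(mulmxA A) -(mulmxA A) sB sA. Qed.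

Lemma spV A : sp A -> sp (invmx A).
Proof.
move=> sA; rewrite /sp sp_inv // -mulmxA -trmx_mul mulVmx ?sp_unit //.
by rewrite trmx1 mulmx1.
Qed.

Lemma sp_lagr A : sp A -> lagr (czX A) (czY A).
Proof.
move=> sA; split.
  rewrite /czX /czY -scalemxAl linearZ /= -scalemxAr; congr (_ *: _).
  rewrite trmx_mul !linearB !linearD /= trmx1 Jskew.
  rewrite !(mulmxDl, mulNmx, mulmxN, mulmx1, mul1mx) mulmxA sA opprB opprK.
  by rewrite addrACA addNr [_ *m _ - J]addrC [RHS]addrACA subrr.
apply/row_free_inj => u; rewrite mul_mx_row -row_mx0 => /eq_row_mx[].
rewrite /czX /czY -scalemxAr mulmxA => /eqP; rewrite scaler_eq0 invr_eq0.
rewrite pnatr_eq0 /= => /eqP uX uY.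
have {}uY : u *m (1%:M - A) = 0.
  by rewrite -[LHS](mulmxK J_unit) uY mul0mx.
have := congr1 (fun v => 2^-1 *: v) (congr2 +%R uX uY).
rewrite -mulmxDr addr0 scaler0 addrACA subrr addr0 mulmxDr mulmx1.
by rewrite -(mulr2n u) -(scaler_nat 2 u) scalerA mulVf ?scale1r // pnatr_eq0.
Qed.

Lemma cvg_czX (T : Type) (F : set_system T) (FF : Filter F) (L : T -> 'M[R]_N) l :
  L x @[x --> F] --> l -> czX (L x) @[x --> F] --> czX l.
Proof. by move=> Ll; apply: cvgZr; apply: cvgD => //; exact: cvg_cst. Qed.

Lemma cvg_czY (T : Type) (F : set_system T) (FF : Filter F) (L : T -> 'M[R]_N) l :
  L x @[x --> F] --> l -> czY (L x) @[x --> F] --> czY l.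
Proof.
move=> Ll; apply: cvg_mulmx; last exact: cvg_cst.
by apply: cvgB => //; exact: cvg_cst.
Qed.

Definition sp_on (T : topologicalType) (D : set T) (lam : T -> 'M[R]_N) : Prop :=
  cont_on D lam /\ forall t, D t -> sp (lam t).

Lemma sp_on_lagr (T : topologicalType) (D : set T) lam : sp_on D lam ->
  lagr_on D (fun t => czX (lam t)) (fun t => czY (lam t)).
Proof.
move=> [c s]; split=> t Dt; last exact/sp_lagr/s.
  by apply: cvg_czX; exact: c.
by apply: cvg_czY; exact: c.
Qed.

Lemma cz_unique a b lam mu nu : a <= b -> sp_on (itv a b) lam ->
  cz a b lam mu -> cz a b lam nu -> mu = nu.
Proof. by move=> ab /sp_on_lagr l; exact: mas_unique. Qed.

Lemma cz_exists a b lam : a <= b -> sp_on (itv a b) lam ->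
  exists mu, cz a b lam mu.
Proof. by move=> ab /sp_on_lagr; exact: mas_exists. Qed.

Lemma cz_eq a b lam lam' mu : (forall t, itv a b t -> lam t = lam' t) ->
  cz a b lam mu -> cz a b lam' mu.
Proof.
move=> e; apply: (mas_frame (G := fun=> 1%:M)) => t tab.
by rewrite unitmx1 !mul1mx e.
Qed.

Lemma cz_const_rank a b lam : sp_on (itv a b) lam ->
  (forall s t, itv a b s -> itv a b t ->
     \rank (1%:M - lam s) = \rank (1%:M - lam t)) ->
  cz a b lam 0.
Proof.
move=> /sp_on_lagr l rk; apply: mas_const_rank => // s t sab tab.
by rewrite /czY !mxrankMfree ?row_free_unit ?J_unit //; exact: rk.
Qed.

Lemma cz_square (h : R * R -> 'M[R]_N) s0 s1 t0 t1 bot top left right :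
  s0 <= s1 -> t0 <= t1 -> sp_on (rect s0 s1 t0 t1) h ->
  cz t0 t1 (fun t => h (s0, t)) bot -> cz t0 t1 (fun t => h (s1, t)) top ->
  cz s0 s1 (fun s => h (s, t0)) left -> cz s0 s1 (fun s => h (s, t1)) right ->
  bot + right = left + top.
Proof. by move=> s01 t01 /sp_on_lagr l; exact: (mas_square s01 t01 l). Qed.

Lemma sp_on_line1 (h : R * R -> 'M[R]_N) s0 s1 t0 t1 s : itv s0 s1 s -> sp_on (rect s0 s1 t0 t1) h ->
  sp_on (itv t0 t1) (fun t => h (s, t)).
Proof.
move=> si [c sh]; split=> [|t ti]; last by apply: sh; split.
apply: (cont_on_comp (g := fun t => (s, t)) _ _ c) => [|t ti]; last by split.
exact: cont_on_continuous (@continuous_pairl R s).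
Qed.

Lemma sp_on_line2 (h : R * R -> 'M[R]_N) s0 s1 t0 t1 t : itv t0 t1 t -> sp_on (rect s0 s1 t0 t1) h ->
  sp_on (itv s0 s1) (fun s => h (s, t)).
Proof.
move=> ti [c sh]; split=> [|s si]; last by apply: sh; split.
apply: (cont_on_comp (g := fun s => (s, t)) _ _ c) => [|s si]; last by split.
exact: cont_on_continuous (@continuous_pairr R t).
Qed.

(** The ends may move as long as the dimension of their fixed spaces is constant, since the side
    edges of the square then have index 0. *)
Lemma cz_homotopy (h : R * R -> 'M[R]_N) a b mu : a <= b ->
  sp_on (rect 0 1 a b) h ->
  (forall s, itv 0 1 s -> \rank (1%:M - h (s, a)) = \rank (1%:M - h (0, a)) /\
     \rank (1%:M - h (s, b)) = \rank (1%:M - h (0, b))) ->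
  cz a b (fun t => h (0, t)) mu -> cz a b (fun t => h (1, t)) mu.
Proof.
move=> ab sh rk h0.
have ia : itv a b a by rewrite /itv /= lexx.
have ib : itv a b b by rewrite /itv /= lexx ab.
have i1 : itv 0 1 (1 : R) by rewrite /itv /= lexx ler01.
have [nu h1] := cz_exists ab (sp_on_line1 i1 sh).
have hl : cz 0 1 (fun s => h (s, a)) 0.
  apply: cz_const_rank; first exact: sp_on_line2 sh.
  by move=> s t /rk[-> _] /rk[-> _].
have hr : cz 0 1 (fun s => h (s, b)) 0.
  apply: cz_const_rank; first exact: sp_on_line2 sh.
  by move=> s t /rk[_ ->] /rk[_ ->].
have := cz_square ler01 ab sh h0 h1 hl hr.
by rewrite addr0 add0r => ->.
Qed.

Lemma cz_conj a b lam G mu : sp G -> cz a b lam mu ->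
  cz a b (fun t => G *m lam t *m invmx G) mu.
Proof.
move=> sG cl; have uG := sp_unit sG.
have uG' : invmx G \in unitmx by rewrite unitmx_inv.
apply: (mas_frame (G := fun=> G)) (mas_change uG' cl) => t _; split=> //.
  rewrite /czX -scalemxAl -scalemxAr; congr (_ *: _).
  by rewrite mulmxDl mul1mx mulmxDr mulmxV // mulmxA.
rewrite /czY invmxK -[_ *m J *m G^T]mulmxA -sp_inv // !mulmxA; congr (_ *m _).
by rewrite mulmxBr mulmx1 mulmxBl mulmxV.
Qed.

(** Conjugation by an antisymplectic map acts on the coordinates of the graph as a change of basis
    followed by the reflection of [mas_oppY]. *)
Lemma cz_anticonj a b lam K mu : K *m J *m K^T = - J -> cz a b lam mu ->
  cz a b (fun t => K *m lam t *m invmx K) (- mu).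
Proof.
move=> sK cl.
have uK : K \in unitmx.
  have : K *m (J *m K^T *m (- J^T)) = 1%:M by rewrite !mulmxA sK mulmxN mulNmx opprK JJ.
  by case/mulmx1_unit.
have KJ : invmx K *m J = - (J *m K^T).
  by rewrite -[J in LHS]opprK -sK mulmxN -mulmxA mulKmx.
have uK' : invmx K \in unitmx by rewrite unitmx_inv.
apply: (mas_frame (G := fun=> K)) (mas_oppY (mas_change uK' cl)) => t _; split=> //.
  rewrite /czX -scalemxAl -scalemxAr; congr (_ *: _).
  by rewrite mulmxDl mul1mx mulmxDr mulmxV // mulmxA.
rewrite /czY invmxK -[_ *m J *m K^T]mulmxA -mulmxN -mulmxN -KJ !mulmxA; congr (_ *m _).
by rewrite mulmxBr mulmx1 mulmxBl mulmxV // mulmxN.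
Qed.

Lemma cz_reparam a b a' b' lam mu (beta : R -> R) : cont_on (itv a' b') beta ->
  (forall t, itv a' b' t -> itv a b (beta t)) -> beta a' = a -> beta b' = b ->
  cz a b lam mu -> cz a' b' (lam \o beta) mu.
Proof. exact: mas_reparam. Qed.

Lemma cz_diag (h : R * R -> 'M[R]_N) a b bot right : a <= b ->
  sp_on (rect a b a b) h ->
  cz a b (fun t => h (a, t)) bot -> cz a b (fun s => h (s, b)) right ->
  cz a b (fun t => h (t, t)) (bot + right).
Proof.
move=> ab sh h0 h1; have lh := sp_on_lagr sh.
have [phi hphi] := rect_pot ab ab lh.
have ia : itv a b a by rewrite /itv /= lexx.
have ib : itv a b b by rewrite /itv /= lexx ab.
have g1 : cont_on (itv a b) (fun t : R => (a, t)) by exact: cont_on_continuous (@continuous_pairl R a).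
have g2 : cont_on (itv a b) (fun t : R => (t, b)) by exact: cont_on_continuous (@continuous_pairr R b).
have g3 : cont_on (itv a b) (fun t : R => (t, t)).
  apply: cont_on_continuous => t.
  exact: (@cvg_pair _ _ _ (nbhs t) (nbhs t) (nbhs t) _ _ _ id id).
have p1 : cz a b (fun t => h (a, t)) (phi (a, b) - phi (a, a)).
  by exists (fun t => phi (a, t)) => //; apply: (is_pot_comp g1 _ hphi) => t ti; split.
have p2 : cz a b (fun t => h (t, b)) (phi (b, b) - phi (a, b)).
  by exists (fun t => phi (t, b)) => //; apply: (is_pot_comp g2 _ hphi) => t ti; split.
rewrite (cz_unique ab (sp_on_line1 ia sh) h0 p1) (cz_unique ab (sp_on_line2 ib sh) h1 p2).
exists (fun t => phi (t, t)); last by lra.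
by apply: (is_pot_comp g3 _ hphi) => t ti; split.
Qed.

(** On the square [(s, t) |-> lam s C t] the diagonal has the same index as two consecutive edges;
    as [lam a] and [C b] are the identity, these are [C] and then [lam]. *)
Lemma cz_prod a b lam C mu nu : a <= b -> sp_on (itv a b) lam ->
  sp_on (itv a b) C -> lam a = 1%:M -> C b = 1%:M ->
  cz a b lam mu -> cz a b C nu -> cz a b (fun t => lam t *m C t) (nu + mu).
Proof.
move=> ab [cl sl] [cC sC] la Cb hl hC.
pose h (p : R * R) := lam p.1 *m C p.2.
have sh : sp_on (rect a b a b) h.
  split=> [p [p1 p2]|p [p1 p2]]; last by apply: spM; [exact: sl|exact: sC].
  apply: cvg_mulmx.
    by apply: (cont_on_comp (D := itv a b) (g := fst) _ _ cl) => //;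
       [apply: cont_on_continuous => q; exact: cvg_fst | move=> q []].
  by apply: (cont_on_comp (D := itv a b) (g := snd) _ _ cC) => //;
       [apply: cont_on_continuous => q; exact: cvg_snd | move=> q []].
have h0 : cz a b (fun t => h (a, t)) nu.
  by apply: cz_eq hC => t _; rewrite /h /= la mul1mx.
have h1 : cz a b (fun s => h (s, b)) mu.
  by apply: cz_eq hl => t _; rewrite /h /= Cb mulmx1.
exact: (cz_diag ab sh h0 h1).
Qed.

End ConleyZehnder.

Lemma cvg_usubmx {R : realType} (T : Type) (F : set_system T) {FF : Filter F} m1 m2 n
    (A : T -> 'M[R]_(m1 + m2, n)) (a : 'M[R]_(m1 + m2, n)) :
  A x @[x --> F] --> a -> usubmx (A x) @[x --> F] --> usubmx a.
Proof.
move=> /cvg_mxP Aa; apply/cvg_mxP => i j.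
by under eq_fun do rewrite mxE; rewrite mxE; exact: Aa.
Qed.

Lemma cvg_dsubmx {R : realType} (T : Type) (F : set_system T) {FF : Filter F} m1 m2 n
    (A : T -> 'M[R]_(m1 + m2, n)) (a : 'M[R]_(m1 + m2, n)) :
  A x @[x --> F] --> a -> dsubmx (A x) @[x --> F] --> dsubmx a.
Proof.
move=> /cvg_mxP Aa; apply/cvg_mxP => i j.
by under eq_fun do rewrite mxE; rewrite mxE; exact: Aa.
Qed.

(** * Evaluation of the chosen index and independence of the trivialization *)

Section ConleyZehnderPath.
Context {R : realType} {n : nat}.
Local Notation w0 := (@omega0 R n).

Lemma twisted_skew (s : 'M[R]_n) : s^T = - s -> (twisted_mx s)^T = - twisted_mx s.
Proof.
move=> ss; rewrite /twisted_mx tr_block_mx opp_block_mx ss linearN /= !trmx1 trmx0.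
by rewrite opprK oppr0.
Qed.

Lemma omega0_skew : w0^T = - w0.
Proof. by apply: twisted_skew; rewrite trmx0 oppr0. Qed.

Lemma omega0K : w0 *m w0^T = 1%:M.
Proof.
rewrite omega0_skew mulmxN /omega0 /twisted_mx mulmx_block.
rewrite !(mul0mx, mulmx0, mulmx1, mul1mx, add0r, addr0).
by rewrite opp_block_mx opprK oppr0 -scalar_mx_block.
Qed.

Let B : 'M[R]_((n + n) + (n + n)) := block_mx (- w0) 0 0 w0.
Let V : 'M[R]_(n + n, (n + n) + (n + n)) := row_mx 1%:M 1%:M.
Let W : 'M[R]_(n + n, (n + n) + (n + n)) :=
  row_mx (- (2^-1 *: w0)) (2^-1 *: w0).

Lemma graph_form_skew : B^T = - B.
Proof.
rewrite /B tr_block_mx opp_block_mx linearN /= omega0_skew.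
by rewrite opprK !trmx0 oppr0.
Qed.

Lemma row_graphE (a b : 'M[R]_(n + n)) : row_mx a b *m B = row_mx (- (a *m w0)) (b *m w0).
Proof. by rewrite /B mul_row_block !mulmx0 addr0 add0r mulmxN. Qed.

Lemma diag_isotropic : V *m B *m V^T = 0.
Proof.
rewrite {1}/V row_graphE /V tr_row_mx mul_row_col trmx1 !mulmx1 mul1mx.
by rewrite addrC subrr.
Qed.

Lemma codiag_isotropic : W *m B *m W^T = 0.
Proof.
rewrite {1}/W row_graphE /W tr_row_mx mul_row_col linearN /= linearZ /=.
rewrite scalerN !mulNmx opprK mulmxN.
by rewrite addrC subrr.
Qed.

Lemma diag_codiag : V *m B *m W^T = 1%:M.
Proof.
rewrite {1}/V row_graphE /W tr_row_mx mul_row_col linearN /= linearZ /=.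
rewrite !mul1mx mulNmx mulmxN opprK -!scalemxAr omega0K -scalerDl.
by rewrite (_ : 2^-1 + 2^-1 = 1) ?scale1r //; lra.
Qed.

Lemma graph_frame (A : 'M[R]_(n + n)) :
  Xof B W (row_mx 1%:M A) = czX A /\ Yof B V (row_mx 1%:M A) = czY w0 A.
Proof.
split; last first.
  rewrite /Yof mulmxA row_graphE /V tr_row_mx mul_row_col trmx1 !mulmx1 mul1mx.
  by rewrite /czY mulmxBl mul1mx opprD opprK.
rewrite /Xof mulmxA row_graphE /W tr_row_mx mul_row_col linearN /= linearZ /=.
rewrite mul1mx mulNmx mulmxN opprK -!scalemxAr -mulmxA omega0K mulmx1.
by rewrite /czX scalerDr.
Qed.

Lemma graph_lagrangian A : sp w0 A -> lagrangian B (row_mx 1%:M A).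
Proof.
move=> sA; apply/(lagrangianP graph_form_skew diag_isotropic codiag_isotropic diag_codiag).
have [-> ->] := graph_frame A.
exact: (sp_lagr omega0_skew omega0K).
Qed.

(** The choice in [maslov_index] is resolved here: a value exists by deformation to regular
    crossings, and every value is an increment of a potential. *)
Lemma conley_zehnder_path_cz (tau : R) lam mu : 0 < tau ->
  sp_on w0 (itv 0 tau) lam -> cz w0 0 tau lam mu ->
  conley_zehnder_path tau lam = mu.
Proof.
move=> t0 [cl sl] hmu; rewrite /conley_zehnder_path /maslov_index.
set S := is_maslov_index _ _ _ _ _.
have Slam x : S x -> cz w0 0 tau lam x.
  move=> /(is_maslov_index_mas graph_form_skew diag_isotropic codiag_isotropic diag_codiag t0 _) h.
  rewrite /cz; have {}h := h (fun t ti => graph_lagrangian (sl t ti)).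
  apply: (mas_frame (G := fun=> 1%:M)) h => t _.
  by have [-> ->] := graph_frame (lam t); rewrite unitmx1 !mul1mx.
have cL : cont_on (itv 0 tau) (fun t => row_mx (1%:M : 'M[R]_(n + n)) (lam t)).
  by move=> t ti; apply: cvg_row_mx; [exact: cvg_cst|exact: cl].
have [nu hnu] := is_maslov_index_exists graph_form_skew diag_isotropic codiag_isotropic
  diag_codiag t0 cL (fun t ti => graph_lagrangian (sl t ti)).
have SS : S (xget 0 S) by exact: (xgetPex 0 (ex_intro _ nu hnu)).
exact: (cz_unique omega0_skew omega0K (ltW t0) (conj cl sl) (Slam _ SS) hmu).
Qed.

(** The structure group of vertical-preserving symplectic frames. Vectors are rows, so preserving
    the momentum subspace means a vanishing lower left block. *)
Definition vp (G : 'M[R]_(n + n)) : Prop := sp w0 G /\ dlsubmx G = 0.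

Lemma vp_block (G : 'M[R]_(n + n)) : vp G ->
  [/\ G = block_mx (ulsubmx G) (ursubmx G) 0 (drsubmx G),
      ulsubmx G *m (drsubmx G)^T = 1%:M &
      ursubmx G *m (ulsubmx G)^T = ulsubmx G *m (ursubmx G)^T].
Proof.
move=> [sG G0]; have e : G = block_mx (ulsubmx G) (ursubmx G) 0 (drsubmx G).
  by rewrite -G0 submxK.
move: sG; rewrite {1 2}e /sp; move: (ulsubmx _) (ursubmx _) (drsubmx _) e => A S D e.
rewrite /omega0 /twisted_mx mulmx_block tr_block_mx !trmx0 mulmx_block.
rewrite !(mul0mx, mulmx0, mulmx1, mul1mx, add0r, addr0, mulmxN, mulNmx).
move=> /eq_block_mx[h1 /oppr_inj h2 _ _]; split => //.
by apply/eqP; rewrite -subr_eq0 h1.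
Qed.

Lemma block_vp (A S D : 'M[R]_n) : A *m D^T = 1%:M -> S *m A^T = A *m S^T ->
  vp (block_mx A S 0 D).
Proof.
move=> AD SA; split; last by rewrite block_mxKdl.
have DA : D *m A^T = 1%:M by rewrite -[D]trmxK -trmx_mul AD trmx1.
rewrite /sp /omega0 /twisted_mx mulmx_block tr_block_mx !trmx0 mulmx_block.
rewrite !(mul0mx, mulmx0, mulmx1, mul1mx, add0r, addr0, mulmxN, mulNmx).
by rewrite SA subrr AD DA.
Qed.

(* The loop is first deformed to a block diagonal one, which is then conjugate
   to itself under the antisymplectic map (q, p) |-> (-q, p). *)
Lemma cz_vertical_loop (tau : R) (C : R -> 'M[R]_(n + n)) : 0 <= tau ->
  cont_on (itv 0 tau) C -> (forall t, itv 0 tau t -> vp (C t)) ->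
  C 0 = 1%:M -> C tau = 1%:M -> cz w0 0 tau C 0.
Proof.
move=> t0 cC vC C0 C1.
have i0 : itv 0 tau 0 by rewrite /itv /= lexx t0.
have i1 : itv 0 tau tau by rewrite /itv /= lexx t0.
have i01 : itv 0 1 (1 : R) by rewrite /itv /= lexx ler01.
pose h (p : R * R) : 'M[R]_(n + n) :=
  block_mx (ulsubmx (C p.2)) ((1 - p.1) *: ursubmx (C p.2)) 0 (drsubmx (C p.2)).
have sh : sp_on w0 (rect 0 1 0 tau) h.
  split=> [p [p1 p2]|p [p1 p2]]; last first.
    have [_ h1 h2] := vp_block (vC _ p2).
    have [//] : vp (h p); apply: block_vp => //.
    by rewrite -scalemxAl h2 linearZ /= -scalemxAr.
  have cc : C q.2 @[q --> within (rect 0 1 0 tau) (nbhs p)] --> C p.2.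
    apply: (cont_on_comp (D := itv 0 tau) (D' := rect 0 1 0 tau) (g := snd) _ _ cC) => //.
      by apply: cont_on_continuous => q; exact: cvg_snd.
    by move=> q [].
  have cs : 1 - q.1 @[q --> within (rect 0 1 0 tau) (nbhs p)] --> 1 - p.1.
    apply: cvgB; first exact: cvg_cst.
    by apply: cvg_within_filter; exact: cvg_fst.
  rewrite /h /block_mx; apply: cvg_col_mx; apply: cvg_row_mx.
  - by apply: cvg_lsubmx; exact: cvg_usubmx.
  - by apply: cvgZ => //; apply: cvg_rsubmx; exact: cvg_usubmx.
  - exact: cvg_cst.
  - by apply: cvg_rsubmx; exact: cvg_dsubmx.
have h0E t : itv 0 tau t -> C t = h (0, t).
  by move=> ti; rewrite /h /= subr0 scale1r; have [] := vp_block (vC t ti).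
have hend s : h (s, 0) = 1%:M /\ h (s, tau) = 1%:M.
  rewrite /h /= C0 C1; have e : (1%:M : 'M[R]_(n + n)) = block_mx 1%:M 0 0 1%:M.
    exact: scalar_mx_block.
  by rewrite e block_mxKul block_mxKur block_mxKdr scaler0.
have [mu hmu] := cz_exists omega0_skew omega0K t0 (sp_on_line1 i01 sh).
have e1 : cz w0 0 tau C mu.
  have [nu hnu] := cz_exists omega0_skew omega0K t0 (conj cC (fun t ti => (vC t ti).1)).
  have h0 : cz w0 0 tau (fun t => h (0, t)) nu by apply: cz_eq hnu => t; exact: h0E.
  have rk s : itv 0 1 s -> \rank (1%:M - h (s, 0)) = \rank (1%:M - h (0, 0)) /\
      \rank (1%:M - h (s, tau)) = \rank (1%:M - h (0, tau)).
    by move=> _; have [-> ->] := hend s; have [-> ->] := hend 0.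
  have hh := cz_homotopy omega0_skew omega0K t0 sh rk h0.
  have -> : mu = nu by exact: (cz_unique omega0_skew omega0K t0 (sp_on_line1 i01 sh) hmu hh).
  exact: hnu.
pose K : 'M[R]_(n + n) := block_mx (- 1%:M) 0 0 1%:M.
have sK : K *m w0 *m K^T = - w0.
  rewrite /K /omega0 /twisted_mx mulmx_block tr_block_mx !trmx0 mulmx_block.
  rewrite linearN /= trmx1.
  rewrite !(mul0mx, mulmx0, mulmx1, mul1mx, add0r, addr0, mulmxN, mulNmx).
  by rewrite opp_block_mx !opprK oppr0.
have KK : K *m K = 1%:M.
  rewrite /K mulmx_block !(mul0mx, mulmx0, mulmx1, mul1mx, add0r, addr0, mulmxN, mulNmx).
  by rewrite opprK -scalar_mx_block.
have KV : invmx K = K.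
  have uK : K \in unitmx by have [] := mulmx1_unit KK.
  by rewrite -[LHS]mulmx1 -KK mulKmx.
have e2 : cz w0 0 tau (fun t => h (1, t)) (- mu).
  apply: cz_eq (cz_anticonj omega0K sK hmu) => t _.
  rewrite KV /K /h /= subrr scale0r !mulmx_block.
  by rewrite !(mul0mx, mulmx0, mulmx1, mul1mx, add0r, addr0, mulmxN, mulNmx, oppr0, opprK).
have e3 := cz_unique omega0_skew omega0K t0 (sp_on_line1 i01 sh) hmu e2.
by move: e1; rewrite (_ : mu = 0); last by lra.
Qed.

Lemma vpM G G' : vp G -> vp G' -> vp (G *m G').
Proof.
move=> vG vG'; split; first by apply: spM; [exact: vG.1|exact: vG'.1].
have [-> _ _] := vp_block vG; have [-> _ _] := vp_block vG'.
by rewrite mulmx_block block_mxKdl mul0mx mulmx0 addr0.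
Qed.

Lemma vpV G : vp G -> vp (invmx G).
Proof.
move=> vG; have [e h1 h2] := vp_block vG.
move: (ulsubmx G) (ursubmx G) (drsubmx G) e h1 h2 => A S D e h1 h2.
have uG := sp_unit omega0K vG.1.
split; first exact: spV omega0K _ vG.1.
have DA : A^T *m D = 1%:M by apply: mulmx1C; rewrite -[D]trmxK -trmx_mul h1 trmx1.
have DA' : D^T *m A = 1%:M by exact: mulmx1C.
have -> : invmx G = block_mx D^T (- (D^T *m S *m A^T)) 0 A^T.
  rewrite -[RHS](mulmxK uG) [X in _ *m X *m _]e mulmx_block !(mul0mx, mulmx0, add0r, addr0) DA' DA.
  by rewrite mulNmx -(mulmxA _ A^T D) DA mulmx1 subrr -scalar_mx_block mul1mx.
by rewrite block_mxKdl.
Qed.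

(* Changing the trivialization by a loop [G] of vertical-preserving maps turns
   [lam] into [G(0) lam G^-1], conjugate to the product of [lam] by a loop. *)
Lemma cz_trivialization (tau : R) (lam G : R -> 'M[R]_(n + n)) mu : 0 <= tau ->
  sp_on w0 (itv 0 tau) lam -> cont_on (itv 0 tau) G ->
  (forall t, itv 0 tau t -> vp (G t)) -> G tau = G 0 -> lam 0 = 1%:M ->
  cz w0 0 tau lam mu -> cz w0 0 tau (fun t => G 0 *m lam t *m invmx (G t)) mu.
Proof.
move=> t0 sl cG vG Gp l0 hl.
have i0 : itv 0 tau 0 by rewrite /itv /= lexx t0.
have i1 : itv 0 tau tau by rewrite /itv /= lexx t0.
have uG t : itv 0 tau t -> G t \in unitmx by move=> /vG[/(sp_unit omega0K)].
pose C t := invmx (G t) *m G 0.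
have vC t : itv 0 tau t -> vp (C t) by move=> ti; apply: vpM; [exact/vpV/vG|exact: vG].
have cC : cont_on (itv 0 tau) C.
  move=> t ti; apply: cvg_mulmx; last exact: cvg_cst.
  by apply: cvg_invmx; [exact: cG|exact: uG].
have C0 : C 0 = 1%:M by rewrite /C mulVmx ?uG.
have C1 : C tau = 1%:M by rewrite /C Gp mulVmx ?uG.
have hC := cz_vertical_loop t0 cC vC C0 C1.
have hp := cz_prod omega0_skew omega0K t0 sl (conj cC (fun t ti => (vC t ti).1)) l0 C1 hl hC.
rewrite add0r in hp.
apply: cz_eq (cz_conj omega0K (vG 0 i0).1 hp) => t ti.
by rewrite /C !mulmxA mulmxK ?uG.
Qed.

End ConleyZehnderPath.

(** * Index change under reparametrization *)

Lemma is_derive_line {R : realType} m n (A B : 'M[R]_(m, n)) (t : R) :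
  is_derive t (1 : R) (fun s => A + s *: B) B.
Proof.
apply/is_derive_mxP => i j; under eq_fun do rewrite !mxE.
have h : is_derive t (1 : R) (fun s : R => A i j + s * B i j) (0 + (t *: 0 + B i j *: 1)).
  by apply: is_deriveD; exact: is_deriveM.
by apply: (is_derive_eq h); rewrite add0r scaler0 add0r [_ *: _]mulr1.
Qed.

Section ReparametrizedEnds.
Context {R : realType} {N : nat}.
Variable J : 'M[R]_N.
Hypotheses (Jskew : J^T = - J) (JJ : J *m J^T = 1%:M).

Definition sform (u v : 'rV[R]_N) : R := (u *m J *m v^T) 0 0.

Lemma sformC u v : sform u v = - sform v u.
Proof.
have -> : sform u v = ((u *m J *m v^T)^T) 0 0 by rewrite mxE.
by rewrite !trmx_mul trmxK Jskew mulNmx mulmxN mulmxA mxE.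
Qed.

Lemma sformDl u u' v : sform (u + u') v = sform u v + sform u' v.
Proof. by rewrite /sform !mulmxDl mxE. Qed.

Lemma sformDr u v v' : sform u (v + v') = sform u v + sform u v'.
Proof. by rewrite /sform linearD mulmxDr mxE. Qed.

Lemma sformZl a u v : sform (a *: u) v = a * sform u v.
Proof. by rewrite /sform -!scalemxAl mxE. Qed.

Lemma sformZr a u v : sform u (a *: v) = a * sform u v.
Proof. by rewrite /sform linearZ -scalemxAr mxE. Qed.

Lemma sformNl u v : sform (- u) v = - sform u v.
Proof. by rewrite -scaleN1r sformZl mulN1r. Qed.

Lemma sformNr u v : sform u (- v) = - sform u v.
Proof. by rewrite -scaleN1r sformZr mulN1r. Qed.

Lemma sform_self u : sform u u = 0.
Proof. by have := sformC u u; lra. Qed.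

Lemma sform_col u v : u *m (J *m v^T) = (sform u v)%:M.
Proof. by rewrite mulmxA [LHS]mx11_scalar. Qed.

Lemma spP A : sp J A <-> forall u v, sform (u *m A) (v *m A) = sform u v.
Proof.
rewrite /sp /sform; split=> [sA u v|h].
  by rewrite trmx_mul -!mulmxA (mulmxA J) (mulmxA A) (mulmxA A) sA.
have ent (M : 'M[R]_N) i j : ((delta_mx 0 i : 'rV[R]_N) *m M *m (delta_mx 0 j : 'rV[R]_N)^T) 0 0 = M i j.
  by rewrite -rowE trmx_delta -colE !mxE.
apply/matrixP => i j; rewrite -(ent J) -h -ent.
by rewrite trmx_mul !mulmxA.
Qed.

Variables (xi y : 'rV[R]_N).
Hypothesis yxi : sform y xi = 1.

(* The symplectic map which is the identity modulo [xi] on the complement of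
   [xi] and sends [y] to [w]. *)
Definition umap (w : 'rV[R]_N) : 'M[R]_N :=
  (J *m xi^T) *m w + (1%:M - J *m xi^T *m y) *m
    (1%:M + (sform w xi)^-1 *: (J *m (w - y)^T *m xi)).

Lemma umapE w u : let u' := u - sform u xi *: y in
  u *m umap w = sform u xi *: w + u' + ((sform w xi)^-1 * sform u' (w - y)) *: xi.
Proof.
move=> u'; rewrite /umap.
have e : u *m (1%:M - J *m xi^T *m y) = u'.
  by rewrite mulmxBr mulmx1 mulmxA sform_col mul_scalar_mx.
rewrite mulmxDr mulmxA sform_col mul_scalar_mx mulmxA e mulmxDr mulmx1 -scalemxAr.
by rewrite mulmxA sform_col mul_scalar_mx scalerA addrA.
Qed.

Lemma umap_y w : y *m umap w = w.
Proof.
have s0 v : sform 0 v = 0 by rewrite /sform !mul0mx mxE.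
by rewrite umapE /= yxi !scale1r subrr s0 mulr0 scale0r !addr0.
Qed.

Lemma umap_perp w v : sform v xi = 0 ->
  v *m umap w = v + ((sform w xi)^-1 * sform v (w - y)) *: xi.
Proof. by move=> vxi; rewrite umapE vxi !scale0r subr0 add0r. Qed.

Lemma umap_sp w : sform w xi != 0 -> sp J (umap w).
Proof.
move=> w0; apply/spP => u v; rewrite !umapE.
set a := sform u xi; set b := sform v xi.
rewrite !(sformDl, sformDr, sformZl, sformZr, sformNl, sformNr) -/a -/b.
rewrite (sformC xi w) (sformC xi y) (sformC xi v) (sformC y v) (sformC w y) (sformC w v).
by rewrite !sform_self -/b yxi; field.
Qed.

(** Symplectic maps that are trivial on the quotient of the complement of [xi] by [xi]. They may
    rescale [xi], which belongs to its own complement. *)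
Definition xi_unip (A : 'M[R]_N) : Prop :=
  sp J A /\ forall v, sform v xi = 0 -> exists a, v *m A = v + a *: xi.

Lemma umap_unip w : sform w xi != 0 -> xi_unip (umap w).
Proof. by move=> w0; split; [exact: umap_sp|move=> v vx; rewrite umap_perp //; eexists]. Qed.

(** For [v] in the complement of [xi], invariance of the pairing with [y] fixes the coefficient of
    [xi] in [v A]. Hence the image of [y] determines [A]. *)
Lemma xi_unipE A : xi_unip A -> sform (y *m A) xi != 0 /\ A = umap (y *m A).
Proof.
move=> [sA hA]; have [r xiA] := hA xi (sform_self xi).
have sE u v := (spP A).1 sA u v.
have h1 : (1 + r) * sform (y *m A) xi = 1.
  by rewrite -[RHS]yxi -(sE y xi) xiA sformDr sformZr; ring.
have w0 : sform (y *m A) xi != 0.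
  by apply/eqP => e; move: h1; rewrite e mulr0 => /eqP; rewrite eq_sym oner_eq0.
split => //; apply/row_matrixP => i; rewrite !rowE; move: (delta_mx 0 i) => u.
have [u' u'xi ue] : exists2 u', sform u' xi = 0 & u = sform u xi *: y + u'.
  exists (u - sform u xi *: y); last by rewrite addrC subrK.
  by rewrite sformDl sformNl sformZl yxi mulr1 subrr.
move: (sform u xi) ue => b ->.
rewrite !mulmxDl -!scalemxAl umap_y umap_perp //; congr (_ + _).
have [a uA] := hA _ u'xi; rewrite uA; congr (_ + _ *: _).
have := sE y u'; rewrite uA sformDr sformZr => e.
rewrite sformDr sformNr (sformC u' y) (sformC u' (y *m A)) -e.
by field.
Qed.

Lemma cvg_umap (T : Type) (F : set_system T) (FF : Filter F) (w : T -> 'rV[R]_N) w0 :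
  w x @[x --> F] --> w0 -> sform w0 xi != 0 -> umap (w x) @[x --> F] --> umap w0.
Proof.
move=> ww n0.
have cs : sform (w x) xi @[x --> F] --> sform w0 xi.
  have /cvg_mxP /(_ 0 0) : w x *m J *m xi^T @[x --> F] --> w0 *m J *m xi^T.
    by apply: cvg_mulmx; [apply: cvg_mulmx => //|]; exact: cvg_cst.
  exact.
apply: cvgD; first by apply: cvg_mulmx => //; exact: cvg_cst.
apply: cvg_mulmx; first exact: cvg_cst.
apply: cvgD; first exact: cvg_cst.
apply: cvgZ; first exact: cvgV.
apply: cvg_mulmx; last exact: cvg_cst.
apply: cvg_mulmx; first exact: cvg_cst.
by apply: cvg_trmx; apply: cvgB => //; exact: cvg_cst.
Qed.

Lemma xi_unip1 : xi_unip 1%:M.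
Proof. by split; [exact: sp1|move=> v _; exists 0; rewrite mulmx1 scale0r addr0]. Qed.

Lemma umap1 : umap y = 1%:M.
Proof. by have [_] := xi_unipE xi_unip1; rewrite mulmx1. Qed.

Lemma xi_unipM A B : xi_unip A -> xi_unip B -> xi_unip (A *m B).
Proof.
move=> [sA hA] [sB hB]; split; first exact: spM.
move=> v vx; have [a va] := hA v vx.
have [|b vb] := hB (v *m A); last exists (a + b).
  by rewrite va sformDl sformZl vx sform_self mulr0 addr0.
by rewrite mulmxA vb va scalerDl addrA.
Qed.

Lemma xi_unip_xi A : xi_unip A -> exists2 r, r != 0 & xi *m A = r *: xi.
Proof.
move=> [sA hA]; have [a xa] := hA xi (sform_self xi).
have uA := sp_unit JJ sA.
exists (1 + a); last by rewrite xa scalerDl scale1r.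
apply/eqP => e; have x0 : xi = 0.
  by rewrite -[LHS](mulmxK uA) xa -[xi in xi + _]scale1r -scalerDl e scale0r mul0mx.
by move/eqP: yxi; rewrite x0 /sform trmx0 mulmx0 mxE eq_sym oner_eq0.
Qed.

Lemma xi_unipV A : xi_unip A -> xi_unip (invmx A).
Proof.
move=> hA; have [r r0 xr] := xi_unip_xi hA; have uA := sp_unit JJ hA.1.
split; first exact: spV JJ _ hA.1.
have xV : xi *m invmx A = r^-1 *: xi.
  by rewrite -[xi in LHS](scalerK r0) -xr scalemxAl mulmxK.
move=> v vx; have [a va] := hA.2 v vx.
exists (- (a / r)).
have -> : v *m invmx A = (v *m A - a *: xi) *m invmx A by rewrite va addrK.
by rewrite mulmxBl mulmxK // -scalemxAl xV scalerA scaleNr.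
Qed.

Local Notation q := (J *m xi^T).

(* [1 + b q xi] is the transvection [y |-> y + b xi]. *)
Lemma umap_shear b : umap (y + b *: xi) = 1%:M + b *: (q *m xi).
Proof.
apply/row_matrixP => i; rewrite !rowE; move: (delta_mx 0 i) => u.
rewrite umapE /= sformDl sformZl sform_self mulr0 addr0 yxi invr1 mul1r.
rewrite (addrC y) addrK sformZr sformDl sformNl sformZl yxi mulr1 subrr mulr0 scale0r addr0.
rewrite scalerDr addrAC -addrA subrK addrC mulmxDr mulmx1.
by rewrite -scalemxAr mulmxA sform_col mul_scalar_mx !scalerA mulrC.
Qed.

(** * The index of a path of transvections *)

Section Shear.
Variable P : 'M[R]_N.
Hypotheses (sP : sp J P) (xP : xi *m P = xi) (yP : y *m P = y).

Definition shear_map (b : R) : 'M[R]_N := (1%:M + b *: (q *m xi)) *m P.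
Local Notation Nb := shear_map.

Lemma shear_sp b : sp J (Nb b).
Proof.
apply: spM => //; rewrite -umap_shear; apply: umap_sp.
by rewrite sformDl sformZl sform_self mulr0 addr0 yxi oner_eq0.
Qed.

Lemma shear_mul b u : u *m Nb b = u *m P + (b * sform u xi) *: xi.
Proof.
rewrite /shear_map mulmxA mulmxDr mulmx1 -scalemxAr mulmxA sform_col mul_scalar_mx.
by rewrite scalerA mulmxDl -scalemxAl xP.
Qed.

Lemma shear_czY b : czY J (Nb b) = czY J (Nb 0) + b *: (q *m q^T).
Proof.
have e : Nb b = Nb 0 + b *: (q *m xi).
  by rewrite /shear_map scale0r addr0 mul1mx mulmxDl mul1mx -scalemxAl -(mulmxA q) xP.
rewrite /czY e opprD addrA [LHS]mulmxDl; congr (_ + _).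
by rewrite trmx_mul trmxK Jskew mulNmx -scalemxAl -(mulmxA q xi J) !mulmxN scalerN.
Qed.

(** Pairing the fixed point equation with [y], which [P] fixes, isolates [b] times the pairing of
    [u] with [xi]. *)
Lemma shear_kernel b u : b != 0 -> u *m (1%:M - Nb b) = 0 ->
  sform u xi = 0 /\ u *m (1%:M - P) = 0.
Proof.
move=> b0; rewrite mulmxBr mulmx1 shear_mul => /eqP; rewrite subr_eq0 => /eqP e.
have := congr1 (sform^~ y) e => /=.
rewrite sformDl sformZl (sformC xi y) yxi mulrN mulr1 -{2}yP ((spP P).1 sP) => h.
have s0 : sform u xi = 0.
  have : b * sform u xi = 0 by lra.
  by move/eqP; rewrite mulf_eq0 (negPf b0) => /eqP.
split=> //; rewrite mulmxBr mulmx1 {1}e s0 mulr0 scale0r addr0.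
by rewrite subrr.
Qed.

Lemma shear_rank b b' : b != 0 -> b' != 0 ->
  \rank (1%:M - Nb b) = \rank (1%:M - Nb b').
Proof.
move=> b0 b'0; have le c c' : c != 0 -> c' != 0 ->
    (\rank (kermx (1%:M - Nb c)) <= \rank (kermx (1%:M - Nb c')))%N.
  move=> c0 c'0; apply: mxrankS; apply/row_subP => i.
  have [s0 k0] : sform (row i (kermx (1%:M - Nb c))) xi = 0 /\ row i (kermx (1%:M - Nb c)) *m (1%:M - P) = 0.
    by apply: (shear_kernel c0); apply/sub_kermxP; exact: row_sub.
  apply/sub_kermxP; rewrite mulmxBr mulmx1 shear_mul s0 mulr0 scale0r addr0.
  by move: k0; rewrite mulmxBr mulmx1.
have : \rank (kermx (1%:M - Nb b)) = \rank (kermx (1%:M - Nb b')).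
  by apply/eqP; rewrite eqn_leq !le.
rewrite !mxrank_ker => e.
have := rank_leq_row (1%:M - Nb b); have := rank_leq_row (1%:M - Nb b').
by move: e; clear; lia.
Qed.

Lemma shear_derive b : is_derive b (1 : R) (fun b => czY J (Nb b)) (q *m q^T).
Proof.
rewrite (_ : (fun b => czY J (Nb b)) = fun b => czY J (Nb 0) + b *: (q *m q^T)).
  exact: is_derive_line.
by apply/funext => c; rewrite shear_czY.
Qed.

Lemma shear_continuous : continuous Nb.
Proof.
move=> b; apply: cvg_mulmx; last exact: cvg_cst.
apply: cvgD; first exact: cvg_cst.
by apply: cvgZl; exact: cvg_id.
Qed.

(** The fixed space is the same for all [b != 0], so only [b = 0] matters. There [y] is also fixed
    and the derivative of the chart form equals 1 on [y]: the signature is higher by one on the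
    right of 0 and lower by one on the left. *)
Lemma shear_pot : is_pot setT (fun b => czX (Nb b)) (fun b => czY J (Nb b))
  (fun b => 2^-1 * Num.sg b).
Proof.
have lN b := sp_lagr Jskew JJ (shear_sp b).
move=> b _; have [s hs] := good_scalar (lN b).
have [c cs] := notin_ex s; exists c%:M; have {hs} gb := hs c cs.
split=> //; first by rewrite tr_scalar_mx.
apply: near_within.
pose Q b := chart_form c%:M (czX (Nb b)) (czY J (Nb b)).
have symQ b' : (Q b')^T = Q b' by apply: chart_form_sym; [rewrite tr_scalar_mx|exact: lN].
have cX : czX (Nb b') @[b' --> b] --> czX (Nb b) by apply: cvg_czX; exact: shear_continuous.
have cY : czY J (Nb b') @[b' --> b] --> czY J (Nb b) by apply: cvg_czY; exact: shear_continuous.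
have cQ : Q b' @[b' --> b] --> Q b.
  apply: cvg_mulmx; last exact: cvg_trmx.
  by apply: cvgB; [exact: cX|apply: cvg_mulmx; [exact: cY|exact: cvg_cst]].
have ng : \forall b' \near b, good c%:M (czX (Nb b')) (czY J (Nb b')).
  have cv : czX (Nb b') - czY J (Nb b') *m c%:M @[b' --> b] -->
      czX (Nb b) - czY J (Nb b) *m c%:M.
    by apply: cvgB; [exact: cX|apply: cvg_mulmx; [exact: cY|exact: cvg_cst]].
  exact: (near_unitmx cv gb).
have rkQ b' : good c%:M (czX (Nb b')) (czY J (Nb b')) -> \rank (Q b') = \rank (czY J (Nb b')).
  by move=> g; rewrite rank_chart_form.
have potQ b' : pot c%:M (czX (Nb b')) (czY J (Nb b')) = 2^-1 * (sgn (Q b'))%:~R.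
  by rewrite potE.
have [b0|b0] := eqVneq b 0; last first.
  have sg : \forall b' \near b, 0 < b' * b.
    have cb : (b' * b @[b' --> b]) --> b * b by apply: cvgMl; exact: cvg_id.
    by apply: (cvgr_gt _ cb); rewrite -expr2 exprn_even_gt0.
  near=> b'.
  have b'0 : 0 < b' * b by near: b'.
  have nb' : b' != 0 by apply/eqP => e; move: b'0; rewrite e mul0r ltxx.
  have -> : Num.sg b' = Num.sg b.
    have := congr1 (fun z => z * Num.sg b) (gtr0_sg b'0).
    by rewrite sgrM -mulrA -expr2 sqr_sg b0 mulr1 mul1r.
  rewrite !potQ; have gb' : good c%:M (czX (Nb b')) (czY J (Nb b')) by near: b'.
  suff -> : sgn (Q b') = sgn (Q b) by [].
  have h : (Q b')^T = Q b' -> \rank (Q b') = \rank (Q b) -> sgn (Q b') = sgn (Q b).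
    by near: b'; exact: near_sgn_const.
  apply: h => //; rewrite !rkQ // /czY !mxrankMfree ?row_free_unit ?(J_unit JJ) //.
  exact: shear_rank.
subst b.
(* The derivative of [Q] at 0. Its value on [y] is 1 because [y] is killed by [czY J (Nb 0)], fixed
   by [czX (Nb 0)] and pairs to 1 with [xi]. *)
pose Q' := (2^-1 *: (q *m xi *m P) - q *m q^T *m c%:M) *m (czY J (Nb 0))^T +
  (czX (Nb 0) - czY J (Nb 0) *m c%:M) *m (q *m q^T)^T.
have yY : y *m czY J (Nb 0) = 0.
  rewrite /czY mulmxA mulmxBr mulmx1 shear_mul mul0r scale0r addr0 yP.
  by rewrite subrr mul0mx.
have yX : y *m czX (Nb 0) = y.
  rewrite /czX -scalemxAr mulmxDr mulmx1 shear_mul mul0r scale0r addr0 yP.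
  by rewrite -(mulr2n y) -(scaler_nat 2 y) scalerA mulVf ?scale1r // pnatr_eq0.
have dQ : is_derive (0 : R) (1 : R) Q Q'.
  rewrite /Q /chart_form; apply: is_derive_mulmx; last exact/is_derive_trmx/shear_derive.
  apply: is_deriveB; last exact/is_derive_mulmxr/shear_derive.
  rewrite (_ : (fun b => czX (Nb b)) = fun b => czX (Nb 0) + b *: (2^-1 *: (q *m xi *m P))).
    exact: is_derive_line.
  apply/funext => b; rewrite /czX /shear_map scale0r addr0 mul1mx mulmxDl mul1mx -scalemxAl.
  by rewrite addrA scalerDr !scalerA (mulrC b).
have qy : qf Q' y = 1.
  rewrite /qf /Q' mulmxDr mulmxDl mxE [X in X + _](_ : _ = 0); last first.
    by rewrite -!mulmxA -trmx_mul yY trmx0 !mulmx0 mxE.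
  rewrite mulmxA mulmxBr yX mulmxA yY mul0mx subr0 trmx_mul trmxK mulmxA -mulmxA -trmx_mul sform_col.
  by rewrite yxi add0r tr_scalar_mx mulmx1 mxE eqxx.
have ypos : pos_on y Q'.
  move=> u /sub_rVP[a ->]; rewrite qfZ qy mulr1.
  by rewrite scaler_eq0 negb_or => /andP[a0 _]; rewrite exprn_even_gt0.
have y0 : y != 0.
  by apply/eqP => e; move/eqP: yxi; rewrite e /sform !mul0mx mxE eq_sym oner_eq0.
have ry : \rank y = 1%N by rewrite rank_rV y0.
have yQ : (y <= kermx (Q 0))%MS.
  by apply/sub_kermxP; rewrite -symQ /Q /chart_form trmx_mul trmxK mulmxA yY mul0mx.
have [d1 /= d10 H1] := npos_jump (symQ 0) dQ yQ ypos.
have dQ2 : is_derive (0 : R) (1 : R) (fun h => - Q (0 + -1 * h)) (- (-1 *: Q')).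
  by apply: is_deriveN; exact: is_derive_affine.
have sQ2 : (- Q (0 + -1 * 0))^T = - Q (0 + -1 * 0) by rewrite linearN /= symQ.
have yQ2 : (y <= kermx (- Q (0 + -1 * 0)%R))%MS.
  apply/sub_kermxP; rewrite mulmxN mulr0 addr0; apply/eqP; rewrite oppr_eq0; apply/eqP.
  exact/sub_kermxP.
have ypos2 : pos_on y (- (-1 *: Q')) by rewrite scaleN1r opprK.
have [d2 /= d20 H2] := npos_jump sQ2 dQ2 yQ2 ypos2.
rewrite ry in H1 H2.
(* [czY J (Nb b)] depends on [b] through a matrix of rank at most one. The rank thus rises by at
   most one, which makes the lower bounds on [npos] and [nneg] exact. *)
have rk1 b' : good c%:M (czX (Nb b')) (czY J (Nb b')) -> (\rank (Q b') <= \rank (Q 0%R) + 1)%N.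
  move=> g; rewrite !rkQ // shear_czY (leq_trans (mxrank_add _ _)) // leq_add2l.
  rewrite (leq_trans (mxrank_scale _ _)) // (leq_trans (mxrankM_maxl _ _)) //.
  exact: rank_leq_col.
clearbody Q.
have n1 : \forall b' \near (0 : R), (npos (Q 0%R) <= npos (Q b'))%N by exact: (npos_lsc cQ).
have n2 : \forall b' \near (0 : R), (nneg (Q 0%R) <= nneg (Q b'))%N by exact: (nneg_lsc cQ).
have n3 : \forall b' \near (0 : R), `|b'| < d1.
  by exists d1 => //= b'; rewrite /ball_ /= sub0r normrN.
have n4 : \forall b' \near (0 : R), `|b'| < d2.
  by exists d2 => //= b'; rewrite /ball_ /= sub0r normrN.
near=> b'; rewrite !potQ sgr0 mulr0.
have gb' : good c%:M (czX (Nb b')) (czY J (Nb b')) by near: b'.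
have l1 : (npos (Q 0%R) <= npos (Q b'))%N by near: b'.
have l2 : (nneg (Q 0%R) <= nneg (Q b'))%N by near: b'.
have l3 : `|b'| < d1 by near: b'.
have l4 : `|b'| < d2 by near: b'.
have e0 := npos_nneg_rank (symQ 0); have e1 := npos_nneg_rank (symQ b').
have {}rk1 := rk1 _ gb'.
have sgnE (Z : 'M[R]_N) : sgn Z = (npos Z)%:Z - (nneg Z)%:Z by [].
have sE := sgnE (Q b'); have sE0 := sgnE (Q 0).
have [bp|bn|<-] := ltgtP 0 b'.
- have := H1 b' _ bp; rewrite /ball_ /= sub0r normrN add0r => /(_ l3) j1.
  rewrite gtr0_sg //; have -> : sgn (Q b') = sgn (Q 0) + 1.
    rewrite sE sE0; move: j1 l1 l2 e0 e1 rk1.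
    by move: (npos _) (nneg _) (npos _) (nneg _) (\rank _) (\rank _); clear; lia.
  by rewrite rmorphD /=; lra.
- have j1 : (nneg (Q 0%R) + 1 <= nneg (Q b'))%N.
    have := H2 (- b'); rewrite /ball_ /= sub0r 2!normrN => /(_ l4).
    by rewrite oppr_gt0 => /(_ bn); rewrite !add0r mulr0 mulN1r opprK.
  rewrite ltr0_sg //; have -> : sgn (Q b') = sgn (Q 0) - 1.
    rewrite sE sE0; move: j1 l1 l2 e0 e1 rk1.
    by move: (npos _) (nneg _) (npos _) (nneg _) (\rank _) (\rank _); clear; lia.
  by rewrite rmorphB /=; lra.
- by rewrite sgr0 mulr0.
Unshelve. all: by end_near. Qed.

Lemma shear_index b0 b1 :
  cz J 0 1 (fun s => Nb (b0 + s * (b1 - b0))) (2^-1 * (Num.sg b1 - Num.sg b0)).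
Proof.
pose g (s : R) := b0 + s * (b1 - b0).
have cg : cont_on (itv 0 1) g.
  apply: cont_on_continuous => s; apply: cvgD; first exact: cvg_cst.
  by apply: cvgMl; exact: cvg_id.
exists (fun s => 2^-1 * Num.sg (g s)); last first.
  by rewrite /g mul1r mul0r addr0 (addrC b0) subrK mulrBr.
have gT s : itv 0 1 s -> setT (g s) by [].
exact: (is_pot_comp cg gT shear_pot).
Qed.

End Shear.

Lemma xi_unip_conj P A : sp J P -> xi *m P = xi -> xi_unip A ->
  xi_unip (P *m A *m invmx P).
Proof.
move=> sP xP [sA hA]; have uP := sp_unit JJ sP.
split; first by apply: spM; [exact: spM|exact: (spV JJ)].
have xV : xi *m invmx P = xi by rewrite -{1}xP mulmxK.
move=> v vx; have [|a va] := hA (v *m P).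
  by have := (spP P).1 sP v xi; rewrite xP => ->.
by exists a; rewrite !mulmxA va mulmxDl mulmxK // -scalemxAl xV.
Qed.

Lemma sform_line w w' s : sform ((1 - s) *: w + s *: w') xi =
  (1 - s) * sform w xi + s * sform w' xi.
Proof. by rewrite sformDl !sformZl. Qed.

Lemma cvg_line (T : Type) (F : set_system T) (FF : Filter F) (s : T -> R)
    (w w' : T -> 'rV[R]_N) (s0 : R) (w0 w'0 : 'rV[R]_N) : s x @[x --> F] --> s0 ->
  w x @[x --> F] --> w0 -> w' x @[x --> F] --> w'0 ->
  (1 - s x) *: w x + s x *: w' x @[x --> F] --> (1 - s0) *: w0 + s0 *: w'0.
Proof.
move=> cs cw cw'; apply: cvgD; apply: cvgZ => //.
by apply: cvgB => //; exact: cvg_cst.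
Qed.

End ReparametrizedEnds.

Opaque umap.

Section IndexChange.
Context {R : realType} {N : nat}.
Variable J : 'M[R]_N.
Hypotheses (Jskew : J^T = - J) (JJ : J *m J^T = 1%:M).
Variables (xi y : 'rV[R]_N).
Hypothesis yxi : sform J y xi = 1.
Local Notation umap := (umap J xi y).
Local Notation xi_unip := (xi_unip J xi).

(* All the maps involved are [umap w *m P] with [w] in the affine hyperplane
   [sform w xi = 1], so that the path may be replaced by a transvection path
   followed by a path of conjugates. *)
Lemma cz_end_path P A y2 c c2 : sp J P -> xi *m P = xi -> y *m P = y + c *: xi ->
  xi_unip A -> xi *m (A *m P) = xi -> sform J y2 xi = 1 ->
  y2 *m (A *m P) = y2 + c2 *: xi ->
  cz J 0 1 (fun s => umap ((1 - s) *: y + s *: (y *m A)) *m P)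
    (2^-1 * (Num.sg c2 - Num.sg c)).
Proof.
move=> sP xP yP hA xA y2xi y2A.
have uP := sp_unit JJ sP.
have xA1 : xi *m A = xi by rewrite -(mulmxK uP xi) xP -{2}xA !mulmxA mulmxK // -{1}xP mulmxK.
have line1 w w' s : sform J w xi = 1 -> sform J w' xi = 1 ->
    sform J ((1 - s) *: w + s *: w') xi = 1.
  by move=> h h'; rewrite sform_line h h'; ring.
have n1 w : sform J w xi = 1 -> sform J w xi != 0 by move=> ->; exact: oner_neq0.
(* The transvection correcting the coefficient: [Q0 *m P] sends [y] to [y + c2 xi]. *)
pose Q0 := umap (y + (c2 - c) *: xi).
have Q0xi : sform J (y + (c2 - c) *: xi) xi = 1.
  by rewrite sformDl sformZl sform_self // mulr0 addr0.
(* A path of maps fixing [xi], from the identity to one that sends [y] to [y2]. *)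
pose K s := umap ((1 - s) *: y + s *: y2).
have Kxi s : sform J ((1 - s) *: y + s *: y2) xi = 1 by exact: line1.
have fix_xi w : sform J w xi = 1 -> xi *m umap w = xi.
  move=> w1; have := umap_unip Jskew yxi (n1 _ w1) => hw.
  have [r r0 xr] := xi_unip_xi Jskew JJ yxi hw.
  have := (spP J _).1 hw.1 y xi; rewrite xr umap_y // sformZr w1 yxi mulr1 => e.
  by rewrite e scale1r.
have hK s : xi_unip (K s) by exact: (umap_unip Jskew yxi (n1 _ (Kxi s))).
have hQ0 : xi_unip Q0 by exact: (umap_unip Jskew yxi (n1 _ Q0xi)).
have uK s : K s \in unitmx by exact: (sp_unit JJ (hK s).1).
have K0 : K 0 = 1%:M by rewrite /K subr0 scale1r scale0r addr0 umap1.
have K1 : y *m K 1 = y2 by rewrite /K subrr scale0r scale1r add0r umap_y.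
have xK s : xi *m K s = xi by exact: fix_xi.
have cK : continuous K.
  move=> s; apply: cvg_umap; last exact: (n1 _ (Kxi s)).
  apply: (@cvg_line R N); [exact: cvg_id|exact: cvg_cst|exact: cvg_cst].
have xQ0 : xi *m Q0 = xi by exact: fix_xi.
have yQ0 : y *m Q0 = y + (c2 - c) *: xi by exact: umap_y.
move: K Q0 {Kxi} hK uK K0 K1 xK cK hQ0 xQ0 yQ0 => K Q0 hK uK K0 K1 xK cK hQ0 xQ0 yQ0.
(* Chosen so that [W s *m P] is the conjugate of [Q0 *m P] by [K s], while [W s] stays trivial
   modulo [xi]. At [s = 1] both [W s *m P] and [A *m P] add [c2 xi] to [y2], which forces
   [W 1 = A]. *)
pose W s := invmx (K s) *m Q0 *m (P *m K s *m invmx P).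
have hW s : xi_unip (W s).
  apply: (xi_unipM Jskew); last by apply: xi_unip_conj.
  by apply: (xi_unipM Jskew) => //; exact: (xi_unipV Jskew JJ yxi).
have WP s : W s *m P = invmx (K s) *m (Q0 *m P) *m K s.
  by rewrite /W !mulmxA mulmxKV.
have xW s : xi *m W s = xi.
  have xKV : xi *m invmx (K s) = xi by rewrite -{1}(xK s) mulmxK.
  rewrite /W !mulmxA xKV xQ0 xP xK.
  by rewrite -{1}xP mulmxK.
have yW s : sform J (y *m W s) xi = 1.
  by have := (spP J _).1 (hW s).1 y xi; rewrite xW yxi.
have W0 : W 0 = Q0 by rewrite /W K0 invmx1 mul1mx mulmx1 mulmxV // mulmx1.
have cW : continuous W.
  move=> s; apply: cvg_mulmx.
    by apply: cvg_mulmx; [apply: cvg_invmx; [exact: cK|exact: uK]|exact: cvg_cst].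
  apply: cvg_mulmx; last exact: cvg_cst.
  by apply: cvg_mulmx; [exact: cvg_cst|exact: cK].
move: W hW WP xW yW W0 cW => W hW WP xW yW W0 cW.
have W1 : W 1 = A.
  have e : y2 *m W 1 = y2 *m A.
    rewrite -[LHS](mulmxK uP) -[RHS](mulmxK uP) -(mulmxA y2 (W 1) P) -(mulmxA y2 A P).
    rewrite WP y2A; congr (_ *m _).
    rewrite -{1}K1 !mulmxA mulmxK // yQ0 mulmxDl yP -scalemxAl xP.
    by rewrite -addrA -scalerDl (addrC c) subrK mulmxDl K1 -scalemxAl xK.
  have uA := sp_unit JJ hA.1.
  have hB : xi_unip (W 1 *m invmx A).
    by apply: (xi_unipM Jskew) => //; exact: (xi_unipV Jskew JJ yxi).
  have [_] := xi_unipE Jskew y2xi hB.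
  by rewrite mulmxA e mulmxK // (umap1 Jskew y2xi) => E; rewrite -[W 1](mulmxKV uA) E mul1mx.
pose h (p : R * R) := umap ((1 - p.2) *: y + p.2 *: (y *m W p.1)) *m P.
have hxi p : sform J ((1 - p.2) *: y + p.2 *: (y *m W p.1)) xi = 1 by exact: line1.
have sh : sp_on J (rect 0 1 0 1) h.
  split=> [p _|p _]; last first.
    by apply: spM => //; exact: (umap_unip Jskew yxi (n1 _ (hxi p))).1.
  apply: cvg_within_filter; apply: cvg_mulmx; last exact: cvg_cst.
  apply: cvg_umap; last exact: (n1 _ (hxi p)).
  apply: (@cvg_line R N); [exact: cvg_snd|exact: cvg_cst|].
  apply: cvg_mulmx; first exact: cvg_cst.
  by apply: (@cvg_comp _ _ _ fst W _ (nbhs p.1)); [exact: cvg_fst|exact: cW].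
(* Removing the coefficient [c] from [P] leaves a map that fixes [y] and [xi]; the edge [W 0 = Q0]
   is then a transvection path with parameter from [c] to [c2]. *)
pose P0 := umap (y - c *: xi) *m P.
have P0xi : sform J (y - c *: xi) xi = 1.
  by rewrite sformDl sformNl sformZl sform_self // mulr0 oppr0 addr0.
have sP0 : sp J P0 by apply: spM => //; exact: (umap_unip Jskew yxi (n1 _ P0xi)).1.
have xP0 : xi *m P0 = xi by rewrite mulmxA fix_xi.
have yP0 : y *m P0 = y by rewrite mulmxA umap_y // mulmxBl yP -scalemxAl xP addrK.
have bot : cz J 0 1 (fun t => h (0, t)) (2^-1 * (Num.sg c2 - Num.sg c)).
  apply: cz_eq (shear_index Jskew JJ yxi sP0 xP0 yP0 c c2) => t _.
  rewrite /h /shear_map /P0 /= W0 yQ0 scalerDr addrA -scalerDl subrK scale1r.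
  rewrite scalerA !umap_shear // -scaleNr umap_shear // mulmxA; congr (_ *m _).
  rewrite mulmxDr mulmx1 mulmxDl mul1mx.
  have z : (J *m xi^T *m xi) *m (J *m xi^T *m xi) = 0.
    rewrite mulmxA -(mulmxA (J *m xi^T) xi (J *m xi^T)) sform_col sform_self //.
    by rewrite raddf0 mulmx0 mul0mx.
  rewrite -!scalemxAl -scalemxAr z !scaler0 addr0 -addrA -scalerDl; congr (_ + _ *: _).
  ring.
have i01 : itv 0 1 (1 : R) by rewrite /itv /= lexx ler01.
have i00 : itv 0 1 (0 : R) by rewrite /itv /= lexx ler01.
have left0 : cz J 0 1 (fun s => h (s, 0)) 0.
  apply: (cz_const_rank Jskew JJ (sp_on_line2 i00 sh)) => s t _ _.
  by rewrite /h /= !subr0 !scale0r.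
have right0 : cz J 0 1 (fun s => h (s, 1)) 0.
  apply: (cz_const_rank Jskew JJ (sp_on_line2 i01 sh)).
  suff rk s : \rank (1%:M - h (s, 1)) = \rank (1%:M - Q0 *m P) by move=> s t _ _; exact: etrans (rk s) (esym (rk t)).
  rewrite /h /= subrr scale0r scale1r add0r -(xi_unipE Jskew yxi (hW s)).2 WP.
  have -> : 1%:M - invmx (K s) *m (Q0 *m P) *m K s = invmx (K s) *m (1%:M - Q0 *m P) *m K s.
    by rewrite mulmxBr mulmx1 mulmxBl mulVmx.
  rewrite mxrankMfree ?row_free_unit //.
  by rewrite (eqmxMfull _ _) // row_full_unit unitmx_inv.
have top : cz J 0 1 (fun t => h (1, t)) (2^-1 * (Num.sg c2 - Num.sg c)).
  have [mu hmu] := cz_exists Jskew JJ ler01 (sp_on_line1 i01 sh).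
  have := cz_square Jskew JJ ler01 ler01 sh bot hmu left0 right0.
  by rewrite addr0 add0r => ->.
by apply: cz_eq top => t _; rewrite /h /= W1.
Qed.

Theorem cz_index_change tau lam A y2 c c2 mu : 0 <= tau ->
  sp_on J (itv 0 tau) lam -> lam 0 = 1%:M -> cont_on (itv 0 tau) A ->
  (forall t, itv 0 tau t -> xi_unip (A t) /\ 0 < sform J (y *m A t) xi) ->
  A 0 = 1%:M -> xi *m lam tau = xi -> y *m lam tau = y + c *: xi ->
  xi *m (A tau *m lam tau) = xi -> sform J y2 xi = 1 ->
  y2 *m (A tau *m lam tau) = y2 + c2 *: xi ->
  cz J 0 tau lam mu ->
  cz J 0 tau (fun t => A t *m lam t) (mu + 2^-1 * (Num.sg c2 - Num.sg c)).
Proof.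
move=> t0 [cl sl] l0 cA hA A0 xl yl xA y2xi y2A hmu.
have i0 : itv 0 tau 0 by rewrite /itv /= lexx t0.
have i1 : itv 0 tau tau by rewrite /itv /= lexx t0.
have i01 : itv 0 1 (1 : R) by rewrite /itv /= lexx ler01.
pose h (p : R * R) := umap ((1 - p.1) *: y + p.1 *: (y *m A p.2)) *m lam p.2.
(* Convexity of the half space: the segment from [y] to [y A(t)] keeps a positive pairing with [xi],
   so [umap] is defined and symplectic along it. *)
have wpos p : rect 0 1 0 tau p -> sform J ((1 - p.1) *: y + p.1 *: (y *m A p.2)) xi != 0.
  move=> [/andP[s0 s1] /hA[_ ap]]; rewrite sform_line yxi mulr1.
  move: ap; set z := sform J _ _ => ap; apply: lt0r_neq0.
  have [->|s00] := eqVneq p.1 0; first by rewrite subr0 mul0r addr0 ltr01.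
  have : 0 < p.1 * z by rewrite mulr_gt0 // lt_def s00.
  by move: s1; lra.
have sh : sp_on J (rect 0 1 0 tau) h.
  split=> p Dp; last by apply: spM; [exact: (umap_sp Jskew yxi (wpos p Dp))|exact/sl/Dp.2].
  have c2' (f : R -> 'M[R]_N) : cont_on (itv 0 tau) f ->
      f q.2 @[q --> within (rect 0 1 0 tau) (nbhs p)] --> f p.2.
    move=> cf; apply: (cont_on_comp (D := itv 0 tau) (D' := rect 0 1 0 tau) (g := snd) _ _ cf) => //.
      by apply: cont_on_continuous => q; exact: cvg_snd.
    by move=> q [].
  apply: cvg_mulmx; last exact: c2'.
  apply: cvg_umap; last exact: wpos.
  apply: (@cvg_line R N).
  - by apply: cvg_within_filter; exact: cvg_fst.
  - exact: cvg_cst.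
  - by apply: cvg_mulmx; [exact: cvg_cst|exact: c2'].
have bot : cz J 0 tau (fun t => h (0, t)) mu.
  by apply: cz_eq hmu => t _; rewrite /h /= subr0 scale1r scale0r addr0 umap1 // mul1mx.
have left0 : cz J 0 1 (fun s => h (s, 0)) 0.
  apply: (cz_const_rank Jskew JJ (sp_on_line2 i0 sh)) => s t _ _.
  by rewrite /h /= A0 mulmx1 -!scalerDl !subrK.
have right' : cz J 0 1 (fun s => h (s, tau)) (2^-1 * (Num.sg c2 - Num.sg c)).
  exact: (cz_end_path (sl _ i1) xl yl (hA _ i1).1 xA y2xi y2A).
have [nu hnu] := cz_exists Jskew JJ t0 (sp_on_line1 i01 sh).
have := cz_square Jskew JJ ler01 t0 sh bot hnu left0 right'.
rewrite add0r => ->; apply: cz_eq hnu => t ti.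
by rewrite /h /= subrr scale0r scale1r add0r -(xi_unipE Jskew yxi (hA t ti).1).2.
Qed.

End IndexChange.

(** * Paths from the identity to matrices of positive determinant *)

Section PositiveDeterminant.
Context {R : realType}.

Lemma cvg_block_mx (T : Type) (F : set_system T) {FF : Filter F} m1 m2 n1 n2
    (A : T -> 'M[R]_(m1, n1)) (B : T -> 'M[R]_(m1, n2)) (C : T -> 'M[R]_(m2, n1))
    (D : T -> 'M[R]_(m2, n2)) (a : 'M[R]_(m1, n1)) (b : 'M[R]_(m1, n2)) (c : 'M[R]_(m2, n1))
    (d : 'M[R]_(m2, n2)) :
  A x @[x --> F] --> a -> B x @[x --> F] --> b -> C x @[x --> F] --> c -> D x @[x --> F] --> d ->
  block_mx (A x) (B x) (C x) (D x) @[x --> F] --> block_mx a b c d.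
Proof. by move=> ? ? ? ?; apply: cvg_col_mx; exact: cvg_row_mx. Qed.

Definition isotopic n (A : 'M[R]_n) := exists P : R -> 'M[R]_n,
  [/\ continuous P, P 0 = 1%:M, P 1 = A & forall t, P t \in unitmx].

Lemma isotopicM n (A B : 'M[R]_n) : isotopic A -> isotopic B -> isotopic (A *m B).
Proof.
move=> [P [cP P0 P1 uP]] [Q [cQ Q0 Q1 uQ]]; exists (fun t => P t *m Q t); split.
- by move=> t; apply: cvg_mulmx; [exact: cP|exact: cQ].
- by rewrite P0 Q0 mul1mx.
- by rewrite P1 Q1.
- by move=> t; rewrite unitmx_mul uP uQ.
Qed.

Lemma isotopicV n (A : 'M[R]_n) : isotopic A -> isotopic (invmx A).
Proof.
move=> [P [cP P0 P1 uP]]; exists (fun t => invmx (P t)); split.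
- by move=> t; apply: cvg_invmx; [exact: cP|exact: uP].
- by rewrite P0 invmx1.
- by rewrite P1.
- by move=> t; rewrite unitmx_inv.
Qed.

Lemma isotopic_upper n1 n2 (u : 'M[R]_(n1, n2)) : isotopic (block_mx 1%:M u 0 1%:M).
Proof.
exists (fun t => block_mx 1%:M (t *: u) 0 1%:M); split.
- move=> t; apply: cvg_block_mx; [exact: cvg_cst| |exact: cvg_cst|exact: cvg_cst].
  by apply: cvgZr_tmp; exact: cvg_id.
- by rewrite scale0r -scalar_mx_block.
- by rewrite scale1r.
- by move=> t; rewrite unitmxE det_ublock !det1 mulr1 unitr1.
Qed.

Lemma isotopic_lower n1 n2 (u : 'M[R]_(n2, n1)) : isotopic (block_mx 1%:M 0 u 1%:M).
Proof.
exists (fun t => block_mx 1%:M 0 (t *: u) 1%:M); split.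
- move=> t; apply: cvg_block_mx; [exact: cvg_cst|exact: cvg_cst| |exact: cvg_cst].
  by apply: cvgZr_tmp; exact: cvg_id.
- by rewrite scale0r -scalar_mx_block.
- by rewrite scale1r.
- by move=> t; rewrite unitmxE det_lblock !det1 mulr1 unitr1.
Qed.

Lemma isotopic_diag n (a : R) (S : 'M[R]_n) : 0 < a -> isotopic S ->
  isotopic (block_mx (a%:M : 'M[R]_1) 0 0 S).
Proof.
move=> a0 [P [cP P0 P1 uP]].
exists (fun t => block_mx ((expR (t * ln a)) *: (1%:M : 'M[R]_1)) 0 0 (P t)); split.
- move=> t; apply: cvg_block_mx; [|exact: cvg_cst|exact: cvg_cst|exact: cP].
  apply: cvgZr_tmp; apply: (@cvg_comp _ _ _ (fun s => s * ln a) expR _ (nbhs (t * ln a))).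
    by apply: cvgM; [exact: cvg_id|exact: cvg_cst].
  exact: continuous_expR.
- by rewrite mul0r expR0 scale1r P0 -scalar_mx_block.
- by rewrite mul1r lnK ?posrE // P1 scalemx1.
- move=> t; rewrite unitmxE det_ublock unitrM -!unitmxE (uP t) andbT.
  by rewrite scalemx1 unitmxE det_scalar1 unitfE gt_eqF // expR_gt0.
Qed.

(** Block elimination at a positive corner entry: triangular factors deform linearly to the
    identity, and the Schur complement has positive determinant again. *)
Lemma isotopic_pivot n (A : 'M[R]_(1 + n)) : 0 < \det A -> 0 < ulsubmx A 0 0 ->
  (forall S : 'M[R]_n, 0 < \det S -> isotopic S) -> isotopic A.
Proof.
move=> dA a0 IH; pose a := ulsubmx A 0 0; have ane : a != 0 by rewrite gt_eqF.
pose b := ursubmx A; pose c := dlsubmx A.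
pose S := drsubmx A - a^-1 *: (c *m b).
have e : A = block_mx 1%:M 0 (a^-1 *: c) 1%:M *m block_mx (a%:M : 'M[R]_1) 0 0 S *m
    block_mx 1%:M (a^-1 *: b) 0 1%:M.
  rewrite !mulmx_block !(mulmx0, mul0mx, mulmx1, mul1mx, addr0, add0r).
  rewrite mul_mx_scalar mul_scalar_mx !scalerA !divff // !scale1r -scalemxAr /S subrKC -[LHS]submxK; congr block_mx.
  by rewrite [LHS]mx11_scalar.
have dS : \det A = a * \det S.
  by rewrite e !det_mulmx det_lblock !det_ublock !det1 !mul1r !mulr1 det_scalar1.
rewrite e; apply: isotopicM (isotopic_upper _); apply: isotopicM; first exact: isotopic_lower.
by apply: isotopic_diag => //; apply: IH; rewrite dS pmulr_rgt0 in dA.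
Qed.

Lemma isotopic_elim n (E A : 'M[R]_n) : isotopic E -> E \in unitmx ->
  isotopic (E *m A) -> isotopic A.
Proof. by move=> iE uE /(isotopicM (isotopicV iE)); rewrite mulKmx. Qed.

Lemma isotopic_det n (A : 'M[R]_n) : 0 < \det A -> isotopic A.
Proof.
elim: n A => [|n IH] A dA.
  by exists (fun=> 1%:M); split=> //; [exact: cst_continuous|rewrite [A]flatmx0 [LHS]flatmx0|rewrite unitmx1].
pose B : 'M[R]_(1 + n) := A; change (isotopic B); have {dA} dB : 0 < \det B by [].
have main (C : 'M[R]_(1 + n)) : 0 < \det C -> (exists k, dlsubmx C k 0 != 0) -> isotopic C.
  move=> dC [k ck]; pose a := ulsubmx C 0 0.
  (* The multiple of a lower row which, added to the first one, makes the corner entry equal to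
     1. *)
  pose u : 'rV[R]_n := ((1 - a) / dlsubmx C k 0) *: delta_mx 0 k.
  have uE : block_mx (1%:M : 'M[R]_1) u 0 1%:M \in unitmx.
    by rewrite unitmxE det_ublock !det1 mulr1 unitr1.
  apply: (isotopic_elim (isotopic_upper u) uE); apply: isotopic_pivot => //.
    by rewrite det_mulmx det_ublock !det1 !mul1r.
  rewrite -[C]submxK mulmx_block block_mxKul mul1mx -scalemxAl -rowE.
  rewrite [X in 0 < X](_ : _ = 1) ?ltr01 //.
  by rewrite mxE [X in _ + X]mxE [row _ _ _ _]mxE divfK // subrKC.
have [a0|a0] := ltP 0 (ulsubmx B 0 0); first exact: isotopic_pivot.
have [|nc] := pselect (exists k, dlsubmx B k 0 != 0); first exact: main.
have c0 : dlsubmx B = 0.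
  apply/matrixP => k j; rewrite ord1 [RHS]mxE; apply/eqP; apply: contrapT => /negP h.
  by apply: nc; exists k.
have dE : \det B = ulsubmx B 0 0 * \det (drsubmx B).
  by rewrite -[B in LHS]submxK c0 det_ublock [ulsubmx B in LHS]mx11_scalar det_scalar1.
case: n => [|n] in A B dB main a0 nc c0 dE IH *.
  by move: dB; rewrite dE (det_mx00 (drsubmx B)) mulr1 ltNge a0.
have uE : block_mx (1%:M : 'M[R]_1) 0 (delta_mx 0 0 : 'cV[R]_n.+1) 1%:M \in unitmx.
  by rewrite unitmxE det_lblock !det1 mulr1 unitr1.
(* In the remaining case the corner is not positive and the entries below it vanish. Adding the
   first row to the next one puts the corner, nonzero by the determinant, below itself. *)
apply: (isotopic_elim (isotopic_lower (delta_mx 0 0 : 'cV[R]_n.+1)) uE); apply: main.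
  by rewrite det_mulmx det_lblock !det1 !mul1r.
exists 0; rewrite -[B]submxK mulmx_block block_mxKdl c0 mulmx0 addr0.
rewrite mxE big_ord1 [delta_mx _ _ _ _]mxE !eqxx mul1r.
by apply/negP => /eqP h; move: dB; rewrite dE h mul0r ltxx.
Qed.

End PositiveDeterminant.

(** A vertical-preserving map is given by its block [A] and the symmetric matrix [A^-1 B]: the first
    is joined to the identity by [isotopic_det], the second is scaled linearly. *)
Lemma vp_path {R : realType} n (g : 'M[R]_(n + n)) (tau : R) : tau != 0 -> vp g ->
  0 < \det (ulsubmx g) -> exists G : R -> 'M[R]_(n + n),
  [/\ continuous G, G 0 = 1%:M, G tau = g & forall t, vp (G t)].
Proof.
move=> t0 vg dA; have [gE AD Bs] := vp_block vg.
move: (ulsubmx g) (ursubmx g) (drsubmx g) gE AD Bs dA => A B D gE AD Bs dA.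
have uA : A \in unitmx by rewrite unitmxE unitfE gt_eqF.
have DE : D = (invmx A)^T by rewrite -[D]trmxK -[D^T](mulKmx uA) AD mulmx1.
have [P [cP P0 P1 uP]] := isotopic_det dA.
have bs : (invmx A *m B)^T = invmx A *m B.
  rewrite trmx_mul -[LHS](mulKmx uA) (mulmxA A) -Bs -mulmxA -trmx_mul mulVmx //.
  by rewrite trmx1 mulmx1.
exists (fun t => block_mx (P (t / tau)) ((t / tau) *: (P (t / tau) *m (invmx A *m B))) 0
   (invmx (P (t / tau)))^T); split.
- move=> t.
  have ct : s / tau @[s --> t] --> t / tau by apply: cvgM; [exact: cvg_id|exact: cvg_cst].
  have cPt : P (s / tau) @[s --> t] --> P (t / tau).
    by apply: (@cvg_comp _ _ _ (fun s : R => s / tau) P _ (nbhs (t / tau))); [exact: ct|exact: cP].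
  apply: cvg_block_mx => //; [|exact: cvg_cst|].
    by apply: cvgZ => //; apply: cvg_mulmx => //; exact: cvg_cst.
  by apply: cvg_trmx; exact: cvg_invmx.
- by rewrite mul0r P0 scale0r invmx1 trmx1 -scalar_mx_block.
- by rewrite divff // P1 scale1r mulKVmx // -DE.
- move=> t; apply: block_vp; first by rewrite trmxK mulmxV.
  rewrite -scalemxAl linearZ /= -scalemxAr; congr (_ *: _).
  by rewrite trmx_mul bs !mulmxA.
Qed.

(** * Differential calculus and flows *)

Section CkClosure.
Context {R : realType}.
Implicit Types E F : normedModType R.

Lemma Ck_cont E F k (A : set E) (f : E -> F) : Ck k A f ->
  forall a, A a -> {for a, continuous f}.
Proof. by case: k => [[]|k []]. Qed.

Lemma Ck_derivable E F k (A : set E) (f : E -> F) v : Ck k.+1 A f ->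
  forall a, A a -> derivable f a v.
Proof. by case=> _ /(_ v)[]. Qed.

Lemma Ck_derive E F k (A : set E) (f : E -> F) v : Ck k.+1 A f ->
  Ck k A (fun a => 'D_v f a).
Proof. by case=> _ /(_ v)[]. Qed.

Lemma CkW E F k (A : set E) (f : E -> F) : Ck k.+1 A f -> Ck k A f.
Proof.
elim: k f => [|k IH] f [c H]; first by [].
by split=> // v; have [d h] := H v; split=> //; exact: IH.
Qed.

Lemma Ck_eq E F k (A : set E) (f g : E -> F) : open A ->
  (forall a, A a -> f a = g a) -> Ck k A f -> Ck k A g.
Proof.
move=> oA; elim: k f g => [|k IH] f g fg [c H].
all: have ne a : A a -> \forall b \near a, f b = g b
  by move=> Aa; apply: filterS fg _; exact: open_nbhs_nbhs.
all: have cg a : A a -> {for a, continuous g}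
  by move=> Aa; rewrite /prop_for /continuous_at -(fg a Aa);
     apply: cvg_trans (c a Aa); apply: near_eq_cvg; exact: ne.
  by split.
split=> // v; have [d h] := H v; split=> [a Aa|].
  by apply: near_eq_derivable (d a Aa); exact: ne.
apply: IH h => a Aa; apply: near_eq_derive; exact: ne.
Qed.

Lemma Ck_cst E F k (A : set E) (c : F) : Ck k A (fun=> c).
Proof.
elim: k c => [|k IH] c; first by split=> // a _; exact: cvg_cst.
split=> [a _|v]; first exact: cvg_cst.
split=> [a _|]; first exact: derivable_cst.
have e0 : 'D_v (fun=> c) = (fun=> (0 : F)) by apply/funext => a; exact: derive_cst.
by rewrite e0; exact: IH.
Qed.

Lemma CkD E F k (A : set E) (f g : E -> F) : open A -> Ck k A f -> Ck k A g ->
  Ck k A (fun x => f x + g x).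
Proof.
move=> oA; elim: k f g => [|k IH] f g [cf Hf] [cg Hg].
  by split=> // a Aa; apply: cvgD; [exact: cf|exact: cg].
split=> [a Aa|v]; first by apply: cvgD; [exact: cf|exact: cg].
have [df hf] := Hf v; have [dg hg] := Hg v.
split=> [a Aa|]; first by apply: derivableD; [exact: df|exact: dg].
apply: (Ck_eq oA _ (IH _ _ hf hg)) => a Aa.
by rewrite -deriveD //; [exact: df|exact: dg].
Qed.

Lemma CkM E k (A : set E) (f g : E -> R) : open A -> Ck k A f -> Ck k A g ->
  Ck k A (fun x => f x * g x).
Proof.
move=> oA; elim: k f g => [|k IH] f g Hf Hg.
  by split=> // a Aa; apply: cvgM; [exact: (Ck_cont Hf)|exact: (Ck_cont Hg)].
split=> [a Aa|v]; first by apply: cvgM; [exact: (Ck_cont Hf)|exact: (Ck_cont Hg)].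
have df := Ck_derivable (v := v) Hf; have dg := Ck_derivable (v := v) Hg.
split=> [a Aa|]; first by apply: derivableM; [exact: df|exact: dg].
have h := CkD oA (IH _ _ (CkW Hf) (Ck_derive v Hg)) (IH _ _ (CkW Hg) (Ck_derive v Hf)).
apply: (Ck_eq oA _ h) => a Aa.
by rewrite (_ : (fun x => f x * g x) = f * g) // deriveM //; [exact: df|exact: dg].
Qed.

Lemma Ck_sum E k (A : set E) (I : Type) (r : seq I) (f : I -> E -> R) : open A ->
  (forall i, Ck k A (f i)) -> Ck k A (fun x => \sum_(i <- r) f i x).
Proof.
move=> oA Hf; elim: r => [|i r IH].
  by under eq_fun do rewrite big_nil; exact: Ck_cst.
by under eq_fun do rewrite big_cons; exact: CkD.
Qed.

Lemma Ck_entry E k (A : set E) m n (f : E -> 'M[R]_(m, n)) i j : open A ->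
  Ck k A f -> Ck k A (fun x => f x i j).
Proof.
move=> oA; elim: k f => [|k IH] f [cf Hf].
  split=> // a Aa; have /cvg_mxP : f x @[x --> a] --> f a by exact: cf.
  exact.
split=> [a Aa|v].
  by have /cvg_mxP : f x @[x --> a] --> f a by [exact: cf]; exact.
have [df hf] := Hf v; split=> [a Aa|]; first exact: ((derivable_mxP f a v).1 (df a Aa) i j).
apply: (Ck_eq oA _ (IH _ hf)) => a Aa; rewrite derive_mx ?mxE //; exact: df.
Qed.

Lemma Ck_lin E E' F k (A : set E) (l : {linear E' -> E}) (g : E -> F) :
  continuous l -> Ck k A g -> Ck k (l @^-1` A) (g \o l).
Proof.
move=> cl; elim: k g => [|k IH] g [cg Hg].
  by split=> // a Aa; apply: continuous_comp; [exact: cl|exact: cg].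
split=> [a Aa|v]; first by apply: continuous_comp; [exact: cl|exact: cg].
have E1 a : (fun h : R => h^-1 *: ((g \o l) (h *: v + a) - (g \o l) a)) =
    fun h => h^-1 *: (g (h *: l v + l a) - g (l a)).
  by apply/funext => h /=; rewrite linearP.
have [dg hg] := Hg (l v); split=> [a Aa|].
  by rewrite /derivable E1; exact: dg.
rewrite (_ : (fun a => _) = (fun b => 'D_(l v) g b) \o l); first exact: IH.
by apply/funext => a; rewrite /derive E1.
Qed.

Lemma smooth_Ck E F (A : set E) (f : E -> F) k : smooth A f -> Ck k A f.
Proof. exact. Qed.

End CkClosure.

Section MatrixNorm.
Context {R : realType}.

Lemma mx_norm_le m n (A : 'M[R]_(m, n)) c : 0 <= c ->
  (forall i j, `|A i j| <= c) -> `|A| <= c.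
Proof.
move=> c0 H; rewrite /Num.norm /=; have [->//|/mx_norm_neq0[[i j] ->]] := eqVneq (mx_norm A) 0.
exact: H.
Qed.

Lemma entry_le_norm m n (A : 'M[R]_(m, n)) i j : `|A i j| <= `|A|.
Proof.
rewrite [in leRHS]/Num.norm /= mx_normrE.
by apply: (le_trans _ (le_bigmax _ _ (i, j))).
Qed.

Lemma norm_mulmx m n p (A : 'M[R]_(m, n)) (B : 'M[R]_(n, p)) :
  `|A *m B| <= n%:R * `|A| * `|B|.
Proof.
apply: mx_norm_le => [|i j]; first by rewrite !mulr_ge0.
rewrite mxE (le_trans (ler_norm_sum _ _ _)) //.
rewrite (@le_trans _ _ (\sum_(k < n) `|A| * `|B|)) //.
  by apply: ler_sum => k _; rewrite normrM ler_pM // entry_le_norm.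
by rewrite sumr_const card_ord -mulrA mulr_natl.
Qed.

Lemma rowD_coord m (u v : 'rV[R]_m) (G : 'cV[R]_m) :
  ((u - v) *m G) 0 0 = \sum_k (u 0 k - v 0 k) * G k 0.
Proof. by rewrite mxE; apply: eq_bigr => k _; rewrite !mxE. Qed.

End MatrixNorm.

Lemma near_rV {R : realType} m (a : 'rV[R]_m) (P : 'rV[R]_m -> Prop) :
  (\forall u \near a, P u) <-> exists2 r : R, 0 < r & forall u, `|u - a| < r -> P u.
Proof.
split=> [/nbhs_ballP[r /= r0 h]|[r r0 h]]; last apply/nbhs_ballP; exists r => // u ur.
  by apply: h; rewrite -ball_normE /ball_ /= distrC.
by apply: h; move: ur; rewrite -ball_normE /ball_ /= distrC.
Qed.

Section Differentials.
Context {R : realType}.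

Lemma diff_mk (V W : normedModType R) (f : V -> W) (df : {linear V -> W}) a :
  continuous df ->
  (forall e : R, 0 < e -> \forall h \near 0, `|f (h + a) - f a - df h| <= e * `|h|) ->
  differentiable f a /\ 'd f a = df :> (V -> W).
Proof.
move=> cl H; have fo : f \o shift a = cst (f a) + df +o_ 0 id.
  apply/eqaddoP => e e0; apply: filterS (H e e0) => h.
  by rewrite -addrA -opprD.
have e := diff_unique cl fo; split=> //.
apply/diff_locallyP; rewrite e.
by split.
Qed.

Lemma diff_eps (V W : normedModType R) (f : V -> W) a : differentiable f a ->
  forall e : R, 0 < e -> \forall h \near 0, `|f (h + a) - f a - 'd f a h| <= e * `|h|.
Proof.
move=> /diff_locallyP[_ /eqaddoP H] e e0; apply: filterS (H e e0) => h.
by rewrite -addrA -opprD.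
Qed.

(** Frechet differentiability at a single point, with a matrix acting on the right. It can be
    verified for a flow map by direct estimates, before any smoothness of that map is known. *)
Definition hasd m n (f : 'rV[R]_m -> 'rV[R]_n) (a : 'rV[R]_m) (L : 'M[R]_(m, n)) :=
  forall e : R, 0 < e -> exists2 d : R, 0 < d & forall u, `|u - a| < d ->
    `|f u - f a - (u - a) *m L| <= e * `|u - a|.

Definition hasds m (f : 'rV[R]_m -> R) (a : 'rV[R]_m) (G : 'cV[R]_m) :=
  forall e : R, 0 < e -> exists2 d : R, 0 < d & forall u, `|u - a| < d ->
    `|f u - f a - ((u - a) *m G) 0 0| <= e * `|u - a|.

Lemma hasdP m n (f : 'rV[R]_m -> 'rV[R]_n) a L :
  hasd f a L <-> forall j, hasds (fun u => f u 0 j) a (col j L).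
Proof.
split=> [H j e e0|H e e0].
  have [d d0 Hd] := H e e0; exists d => // u ud.
  apply: le_trans (Hd u ud); apply: le_trans (entry_le_norm _ 0 j).
  by rewrite !mxE le_eqVlt; apply/orP; left; apply/eqP; congr `|_ - _|;
     apply: eq_bigr => k _; rewrite !mxE.
have HH j : exists d : R, 0 < d /\ forall u, `|u - a| < d ->
    `|f u 0 j - f a 0 j - ((u - a) *m col j L) 0 0| <= e * `|u - a|.
  by have [d d0 Hd] := H j e e0; exists d.
have [d Hd] := choice HH.
exists (\big[Num.min/1]_j d j).
  apply: (big_ind (fun x => 0 < x)) => // [x z x0 z0|j _]; first by rewrite lt_min x0.
  by have [] := Hd j.
move=> u ud; apply: mx_norm_le => [|i j]; first by rewrite mulr_ge0 // ltW.
have [_ /(_ u)] := Hd j; rewrite ord1 => HHj.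
have -> : (f u - f a - (u - a) *m L) 0 j = f u 0 j - f a 0 j - ((u - a) *m col j L) 0 0.
  by rewrite !mxE; congr (_ - _); apply: eq_bigr => k _; rewrite !mxE.
by apply: HHj; apply: lt_le_trans ud _; exact: bigmin_le_cond.
Qed.

Lemma hasd_lip m n (f : 'rV[R]_m -> 'rV[R]_n) a L : hasd f a L ->
  exists2 K, 0 < K & exists2 d : R, 0 < d & forall u, `|u - a| < d ->
    `|f u - f a| <= K * `|u - a|.
Proof.
move=> H; have [d d0 Hd] := H 1 ltr01.
exists (1 + m%:R * `|L|); first by rewrite ltr_pwDl // mulr_ge0.
exists d => // u ud; rewrite mulrDl mul1r.
rewrite -[f u - f a](subrK ((u - a) *m L)).
rewrite (le_trans (ler_normD _ _)) // lerD //; first by have := Hd u ud; rewrite mul1r.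
by rewrite (le_trans (norm_mulmx _ _)) // mulrAC.
Qed.

Lemma hasd_comp m n p (f : 'rV[R]_m -> 'rV[R]_n) (g : 'rV[R]_n -> 'rV[R]_p) a L L' :
  hasd f a L -> hasd g (f a) L' -> hasd (g \o f) a (L *m L').
Proof.
move=> Hf Hg e e0; have [K K0 [d1 d10 H1]] := hasd_lip Hf.
have eK : 0 < e / 2 / K by rewrite !divr_gt0.
have [d2 d20 H2] := Hg _ eK.
have c0 : 0 < 1 + n%:R * `|L'| by rewrite ltr_pwDl // mulr_ge0.
have ec : 0 < e / 2 / (1 + n%:R * `|L'|) by rewrite !divr_gt0.
have [d3 d30 H3] := Hf _ ec.
exists (Num.min d1 (Num.min (d2 / K) d3)).
  by rewrite !lt_min d10 d30 divr_gt0.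
move=> u; rewrite !lt_min => /andP[u1 /andP[u2 u3]] /=.
have h1 := H1 u u1.
have h2 : `|f u - f a| < d2.
  by apply: le_lt_trans h1 _; rewrite mulrC -ltr_pdivlMr.
have -> : g (f u) - g (f a) - (u - a) *m (L *m L') =
    (g (f u) - g (f a) - (f u - f a) *m L') + (f u - f a - (u - a) *m L) *m L'.
  by rewrite [(f u - f a - _) *m L']mulmxBl mulmxA addrA subrK.
rewrite (le_trans (ler_normD _ _)) // [e in leRHS]splitr mulrDl lerD //.
  rewrite (le_trans (H2 _ h2)) // -mulrA ler_wpM2l ?divr_ge0 ?(ltW e0) //.
  by rewrite ler_pdivrMl.
rewrite (le_trans (norm_mulmx _ _)) // mulrAC (le_trans (ler_wpM2l _ (H3 u u3))) ?mulr_ge0 //.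
rewrite mulrA ler_wpM2r // mulrCA -[leRHS]mulr1 ler_wpM2l ?divr_ge0 ?(ltW e0) //.
by rewrite ler_pdivrMr // mul1r lerDr ler01.
Qed.

Lemma hasd_differentiable m n (f : 'rV[R]_m -> 'rV[R]_n) a L : hasd f a L ->
  differentiable f a /\ 'd f a = mulmxr L :> (_ -> _).
Proof.
move=> H; have cl : continuous (mulmxr L : 'rV[R]_m -> 'rV[R]_n).
  move=> u; have h : (fun v : 'rV[R]_m => v *m L) @ nbhs u --> u *m L.
    by apply: cvg_mulmx; [exact: cvg_id|exact: cvg_cst].
  exact: h.
apply: diff_mk cl _ => e e0; have [d d0 Hd] := H e e0.
apply/near_rV; exists d => // u; rewrite subr0 => ud.
by have := Hd (u + a); rewrite addrK => /(_ ud).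
Qed.

Lemma hasd_jac m n (f : 'rV[R]_m -> 'rV[R]_n) a L : hasd f a L -> 'J f a = L.
Proof.
move=> /hasd_differentiable[_ e]; apply/row_matrixP => i.
by rewrite !rowE /jacobian mul_rV_lin1 /= e.
Qed.

Lemma hasd_near_eq m n (f g : 'rV[R]_m -> 'rV[R]_n) a L :
  (\forall u \near a, f u = g u) -> hasd f a L -> hasd g a L.
Proof.
move=> /near_rV[r r0 fg] H e e0; have [d d0 Hd] := H e e0.
exists (Num.min r d); first by rewrite lt_min r0.
move=> u; rewrite lt_min => /andP[ur ud].
by rewrite -!fg ?Hd // subrr normr0.
Qed.

Lemma hasd_derive m n (f : 'rV[R]_m -> 'rV[R]_n) a L v : hasd f a L ->
  is_derive a v f (v *m L).
Proof.
move=> H; have [df e] := hasd_differentiable H.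
by apply: DeriveDef; [exact: diff_derivable|rewrite deriveE // e].
Qed.

Lemma hasd_continuous m n (f : 'rV[R]_m -> 'rV[R]_n) a L : hasd f a L ->
  {for a, continuous f}.
Proof. by move=> /hasd_differentiable[/differentiable_continuous]. Qed.

Lemma hasd_curve m n (f : 'rV[R]_m -> 'rV[R]_n) (c : R -> 'rV[R]_m) t d L :
  hasd f (c t) L -> is_derive t (1 : R) c d -> is_derive t (1 : R) (f \o c) (d *m L).
Proof.
move=> H [dc <-]; have [df e] := hasd_differentiable H.
have Dc := (@derivable1_diffP _ _ c t).1 dc.
have Dfc : differentiable (f \o c) t by exact: differentiable_comp.
apply: DeriveDef; first exact/derivable1_diffP.
by rewrite deriveE // diff_comp // deriveE //= e.
Qed.

Lemma hasd_id m a : hasd (fun u : 'rV[R]_m => u) a 1%:M.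
Proof.
by move=> e e0; exists 1 => // u _; rewrite mulmx1 subrr normr0 mulr_ge0 // ltW.
Qed.

End Differentials.

Section MeanValue.
Context {R : realType}.

Lemma mvt_between (g dg : R -> R) (x y : R) :
  (forall s, Num.min x y <= s <= Num.max x y -> is_derive s (1 : R) g (dg s)) ->
  exists2 c, Num.min x y <= c <= Num.max x y & g y - g x = dg c * (y - x).
Proof.
have seg (a b : R) : a <= b -> (forall s : R, a <= s <= b -> is_derive s (1 : R) g (dg s)) ->
    exists2 c, a <= c <= b & g b - g a = dg c * (b - a).
  move=> ab H; have [||c cab e] := MVT_segment ab (f := g) (df := dg).
  - by move=> s; rewrite in_itv /= => /andP[h1 h2]; apply: H; rewrite !ltW.
  - apply: continuous_in_subspaceT => s; rewrite inE /= in_itv /= => sab.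
    exact: (is_derive_continuous (H s sab)).
  by exists c => //; move: cab; rewrite in_itv.
have [xy|yx] := leP x y => H; first exact: seg.
have [c cab e] := seg _ _ (ltW yx) H; exists c => //.
by rewrite -[LHS]opprB e -mulrN opprB.
Qed.

Lemma line_derive (E F : normedModType R) (f : E -> F) (a v : E) (t : R) :
  derivable f (a + t *: v) v ->
  is_derive t (1 : R) (fun s => f (a + s *: v)) ('D_v f (a + t *: v)).
Proof.
have e : (fun h : R => h^-1 *: (f (a + (h *: 1 + t) *: v) - f (a + t *: v))) =
    fun h => h^-1 *: (f (h *: v + (a + t *: v)) - f (a + t *: v)).
  apply/funext => h; congr (_ *: (f _ - _)).
  by rewrite scalerDl addrCA [h *: 1]mulr1.
by move=> d; apply: DeriveDef; rewrite /derivable /derive e.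
Qed.

Lemma mx_norm_lt m n (A : 'M[R]_(m, n)) c : 0 < c ->
  (forall i j, `|A i j| < c) -> `|A| < c.
Proof.
move=> c0 H; rewrite /Num.norm /=; have [->//|/mx_norm_neq0[[i j] ->]] := eqVneq (mx_norm A) 0.
exact: H.
Qed.

Local Notation "'e_' k" := (delta_mx 0 k : 'rV[R]__) (at level 0, k at level 0).

Lemma near_forall_rV (I : finType) m (a : 'rV[R]_m) (P : I -> 'rV[R]_m -> Prop) :
  (forall k, \forall u \near a, P k u) -> \forall u \near a, forall k, P k u.
Proof.
move=> H; have H1 k : exists d : R, 0 < d /\ forall u, `|u - a| < d -> P k u.
  by have [d d0 Hd] := (near_rV _ _).1 (H k); exists d.
have [d Hd] := choice H1; apply/near_rV; exists (\big[Num.min/1]_k d k).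
  apply: (big_ind (fun x => 0 < x)) => // [x z x0 z0|j _]; first by rewrite lt_min x0.
  by have [] := Hd j.
move=> u ud k; have [_] := Hd k; apply.
by apply: lt_le_trans ud _; exact: bigmin_le_cond.
Qed.

Lemma continuous_le (V : normedModType R) m (f : 'rV[R]_m -> V) a e :
  {for a, continuous f} -> 0 < e ->
  exists2 d : R, 0 < d & forall u, `|u - a| < d -> `|f u - f a| <= e.
Proof.
move=> c e0; apply/near_rV; have /cvgr_dist_le := c => /(_ _ e0).
by apply: filterS => u; rewrite distrC.
Qed.

(** Coordinates of [v] are replaced one by one by those of [u]. In the maximum norm the intermediate
    points stay in the ball, and the mean value theorem handles each coordinate. *)
Lemma telescope_mvt m (f : 'rV[R]_m -> R) (a : 'rV[R]_m) (r : R) (u v : 'rV[R]_m) :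
  (forall w, `|w - a| < r -> forall k, derivable f w (delta_mx 0 k)) ->
  `|u - a| < r -> `|v - a| < r ->
  exists2 z : 'I_m -> 'rV[R]_m,
    forall k, `|z k - a| < r /\ `|z k - v| <= `|u - v| &
    f u - f v = \sum_k (u 0 k - v 0 k) * 'D_(delta_mx 0 k) f (z k).
Proof.
move=> df ua va; have r0 : 0 < r by apply: le_lt_trans ua; exact: normr_ge0.
pose hyb k : 'rV[R]_m := \row_i (if (i < k)%N then u 0 i else v 0 i).
have step (k : 'I_m) : exists z : 'rV[R]_m, [/\ `|z - a| < r, `|z - v| <= `|u - v| &
    f (hyb k.+1) - f (hyb k) = (u 0 k - v 0 k) * 'D_(delta_mx 0 k) f z].
  pose w s : 'rV[R]_m := hyb k + s *: delta_mx 0 k.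
  have wE s i : w s 0 i = if i == k then v 0 k + s else if (i < k)%N then u 0 i else v 0 i.
    rewrite !mxE eqxx /=; have [->|ik] := eqVneq i k; first by rewrite ltnn mulr1.
    by rewrite mulr0 addr0.
  have ent (x y : 'rV[R]_m) i : `|x - y| < r -> `|x 0 i - y 0 i| < r.
    by apply: le_lt_trans; have := entry_le_norm (x - y) 0 i; rewrite !mxE.
  have w1 s : Num.min 0 (u 0 k - v 0 k) <= s <= Num.max 0 (u 0 k - v 0 k) -> `|w s - a| < r.
    move=> hs; apply: mx_norm_lt => // i0 i; rewrite ord1 !mxE -[X in `|X - _|]/(_ + _).
    have := wE s i; rewrite !mxE => ->.
    case: ifP => [/eqP->|_]; last by case: ifP => _; exact: ent.
    have := ent u a k ua; have := ent v a k va; rewrite !ltr_norml.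
    by move: hs; case: (leP 0 (u 0 k - v 0 k)) => ?; lra.
  have w2 s : Num.min 0 (u 0 k - v 0 k) <= s <= Num.max 0 (u 0 k - v 0 k) -> `|w s - v| <= `|u - v|.
    move=> hs; apply: mx_norm_le => // i0 i; rewrite ord1 mxE wE [X in _ + X]mxE.
    apply: le_trans (entry_le_norm _ 0 i); rewrite !mxE.
    case: ifP => [/eqP->|_]; last by case: ifP => _; rewrite ?subrr ?normr0.
    rewrite addrAC subrr add0r.
    by move: hs; case: (leP 0 (u 0 k - v 0 k)) => ? ?; [rewrite !ger0_norm|rewrite !ler0_norm]; lra.
  have [c cb] := @mvt_between (fun s => f (w s)) (fun s => 'D_(delta_mx 0 k) f (w s))
    0 (u 0 k - v 0 k) (fun s hs => line_derive (df _ (w1 s hs) k)).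
  rewrite subr0 mulrC => e; exists (w c); split; [exact: w1|exact: w2|].
  rewrite -e; congr (f _ - f _); last by rewrite /w scale0r addr0.
  apply/rowP => i; rewrite wE mxE ltnS.
  have [->|ik] := eqVneq i k; first by rewrite leqnn addrC subrK.
  by rewrite leq_eqVlt (negPf (ik : val i != val k)).
have [z Hz] := choice step.
exists z => [k|]; first by have [] := Hz k.
under eq_bigr => k _ do rewrite -(let: And3 _ _ e := Hz k in e).
rewrite -(big_mkord xpredT (fun k => f (hyb k.+1) - f (hyb k))) telescope_sumr //.
by congr (f _ - f _); apply/rowP => i; rewrite mxE // ltn_ord.
Qed.

Definition grad m (f : 'rV[R]_m -> R) (a : 'rV[R]_m) : 'cV[R]_m :=
  \col_k 'D_(delta_mx 0 k) f a.

Lemma open_rV m (A : set 'rV[R]_m) a : open A -> A a ->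
  exists2 r : R, 0 < r & forall u, `|u - a| < r -> A u.
Proof. by move=> oA Aa; apply/near_rV; exact: open_nbhs_nbhs. Qed.

Lemma Ck1_lipschitz m (A : set 'rV[R]_m) (f : 'rV[R]_m -> R) a : open A -> A a ->
  Ck 1 A f -> exists r K : R, [/\ 0 < r, 0 <= K, forall u, `|u - a| < r -> A u &
    forall u v, `|u - a| < r -> `|v - a| < r -> `|f u - f v| <= K * `|u - v|].
Proof.
move=> oA Aa Cf; have [r1 r10 H1] := open_rV oA Aa.
have /near_rV[r2 r20 H2] : \forall u \near a, forall k : 'I_m,
    `|'D_(delta_mx 0 k) f u| <= `|'D_(delta_mx 0 k) f a| + 1.
  apply: near_forall_rV => k; apply/near_rV.
  have [d d0 Hd] := continuous_le (Ck_cont (Ck_derive (delta_mx 0 k) Cf) Aa) ltr01.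
  exists d => // u ud; rewrite -lerBlDl; apply: le_trans (Hd u ud).
  exact: lerB_dist.
exists (Num.min r1 r2), (\sum_k (`|'D_(delta_mx 0 k) f a| + 1)).
have m1 u : `|u - a| < Num.min r1 r2 -> `|u - a| < r1 by rewrite lt_min => /andP[].
have m2 u : `|u - a| < Num.min r1 r2 -> `|u - a| < r2 by rewrite lt_min => /andP[].
split=> [|||u v ua va]; first by rewrite lt_min r10.
- by apply: sumr_ge0 => k _; rewrite addr_ge0.
- by move=> u /m1; exact: H1.
have [z Hz ->] := telescope_mvt (fun w wr k => Ck_derivable Cf (H1 w (m1 w wr))) ua va.
rewrite (le_trans (ler_norm_sum _ _ _)) // mulr_suml ler_sum // => k _.
rewrite normrM mulrC ler_pM //; first exact/H2/m2/(Hz k).1.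
by have := entry_le_norm (u - v) 0 k; rewrite !mxE.
Qed.

Lemma telescope_remainder m (f : 'rV[R]_m -> R) (a u v : 'rV[R]_m) (r b : R) :
  (forall w, `|w - a| < r -> forall k, derivable f w (delta_mx 0 k)) ->
  `|u - a| < r -> `|v - a| < r ->
  (forall w k, `|w - a| < r -> `|w - v| <= `|u - v| ->
    `|'D_(delta_mx 0 k) f w - 'D_(delta_mx 0 k) f v| <= b) ->
  `|f u - f v - ((u - v) *m grad f v) 0 0| <= m%:R * b * `|u - v|.
Proof.
move=> df ua va H; have [z Hz ->] := telescope_mvt df ua va.
rewrite rowD_coord -sumrB (le_trans (ler_norm_sum _ _ _)) //.
rewrite -mulrA mulr_natl -[X in _ *+ X]card_ord -sumr_const ler_sum // => k _.
rewrite mxE -mulrBr normrM mulrC ler_pM //; first by apply: H; have [] := Hz k.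
by have := entry_le_norm (u - v) 0 k; rewrite !mxE.
Qed.

(** The partial derivatives are Lipschitz, so the remainder is quadratic uniformly in both points;
    [local_flow] uses this along a whole orbit. *)
Lemma Ck2_quadratic m (A : set 'rV[R]_m) (f : 'rV[R]_m -> R) a : open A -> A a ->
  Ck 2 A f -> exists r C : R, [/\ 0 < r, 0 <= C, forall u, `|u - a| < r -> A u &
    forall u v, `|u - a| < r -> `|v - a| < r ->
      `|f u - f v - ((u - v) *m grad f v) 0 0| <= C * `|u - v| ^+ 2].
Proof.
move=> oA Aa Cf; have [r0 r00 H0] := open_rV oA Aa.
have H1 k := Ck1_lipschitz oA Aa (Ck_derive (delta_mx 0 k) Cf).
have [r Hr] := choice H1; have [K HK] := choice Hr.
pose r1 := \big[Num.min/r0]_k r k; pose K1 := \sum_k K k.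
have r10 : 0 < r1.
  apply: (big_ind (fun x => 0 < x)) => // [x z x0 z0|j _]; first by rewrite lt_min x0.
  by have [] := HK j.
have K0 k : 0 <= K k by have [] := HK k.
have m0 u : `|u - a| < r1 -> `|u - a| < r0.
  by move=> h; apply: lt_le_trans h _; exact: bigmin_le_id.
have mk u k : `|u - a| < r1 -> `|u - a| < r k.
  by move=> h; apply: lt_le_trans h _; exact: bigmin_le_cond.
exists r1, (m%:R * K1); split=> //; first by rewrite mulr_ge0 // sumr_ge0.
  by move=> u /m0; exact: H0.
move=> u v ua va; rewrite expr2 mulrA -[m%:R * K1 * _]mulrA.
apply: (telescope_remainder (r := r1) (a := a)) => // [w wr k|w k wr wv].
  exact: (Ck_derivable Cf (H0 w (m0 w wr))).
have [_ _ _ /(_ w v (mk w k wr) (mk v k va)) h] := HK k.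
apply: le_trans h _; rewrite ler_pM // /K1 (bigD1 k) //= lerDl sumr_ge0 //.
Qed.

(** [Ck] speaks of directional derivatives. Their continuity, inserted in the telescoping formula,
    yields a differential. *)
Lemma Ck1_hasds m (A : set 'rV[R]_m) (f : 'rV[R]_m -> R) a : open A -> A a ->
  Ck 1 A f -> hasds f a (grad f a).
Proof.
move=> oA Aa Cf e e0; have [r1 r10 H1] := open_rV oA Aa.
have em : 0 < e / m.+1%:R by rewrite divr_gt0.
have /near_rV[r2 r20 H2] : \forall u \near a, forall k : 'I_m,
    `|'D_(delta_mx 0 k) f u - 'D_(delta_mx 0 k) f a| <= e / m.+1%:R.
  apply: near_forall_rV => k; apply/near_rV.
  exact: (continuous_le (Ck_cont (Ck_derive (delta_mx 0 k) Cf) Aa) em).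
exists (Num.min r1 r2); first by rewrite lt_min r10.
have m1 u : `|u - a| < Num.min r1 r2 -> `|u - a| < r1 by rewrite lt_min => /andP[].
have m2 u : `|u - a| < Num.min r1 r2 -> `|u - a| < r2 by rewrite lt_min => /andP[].
move=> u ua.
have aa : `|a - a| < Num.min r1 r2 by rewrite subrr normr0 lt_min r10.
have := @telescope_remainder m f a u a _ (e / m.+1%:R) _ ua aa _.
move=> h; apply: le_trans (h _ _) _.
- by move=> w /m1 wr k; exact: (Ck_derivable Cf (H1 w wr)).
- by move=> w k /m2 wr _; exact: H2.
rewrite ler_wpM2r // mulrCA -[leRHS]mulr1 ler_wpM2l ?(ltW e0) //.
by rewrite ler_pdivrMr // mul1r ler_nat.
Qed.

Lemma continuous_eq_close m (P Q : 'rV[R]_m -> R) a : {for a, continuous P} ->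
  {for a, continuous Q} ->
  (forall d, 0 < d -> exists p q, [/\ `|p - a| < d, `|q - a| < d & P p = Q q]) ->
  P a = Q a.
Proof.
move=> cP cQ H; apply/eqP; rewrite -subr_eq0 -normr_eq0 eq_le normr_ge0 andbT.
apply/ler_addgt0Pl => e e0; rewrite addr0; have e2 : 0 < e / 2 by rewrite divr_gt0.
have [d1 d10 H1] := continuous_le cP e2; have [d2 d20 H2] := continuous_le cQ e2.
have [|p [q [pd qd pq]]] := H (Num.min d1 d2); first by rewrite lt_min d10.
move: pd qd; rewrite !lt_min => /andP[p1 _] /andP[_ q2].
have := H1 p p1; have := H2 q q2; rewrite pq.
by move: (P a) (Q a) (Q q) => x y z; rewrite !ler_norml; lra.
Qed.

Lemma second_difference m (A : set 'rV[R]_m) (f : 'rV[R]_m -> R) (a : 'rV[R]_m)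
    (v' w' : 'rV[R]_m) (r h : R) :
  Ck 2 A f -> (forall u, `|u - a| < r -> A u) ->
  0 < h -> h * (`|v'| + `|w'|) < r -> exists2 p : 'rV[R]_m,
    `|p - a| <= h * (`|v'| + `|w'|) &
    f (a + h *: v' + h *: w') - f (a + h *: v') - f (a + h *: w') + f a =
      h ^+ 2 * 'D_w' (fun x => 'D_v' f x) p.
Proof.
move=> Cf Hr.
move=> h0 hr; have n0 : 0 <= `|v'| + `|w'| by rewrite addr_ge0.
have inA s s' : 0 <= s <= h -> 0 <= s' <= h ->
    `|(a + s *: v' + s' *: w') - a| <= h * (`|v'| + `|w'|).
  move=> /andP[s0 sh] /andP[s'0 s'h]; rewrite -(addrA a) (addrC a) addrK.
  rewrite (le_trans (ler_normD _ _)) // !normrZ !ger0_norm // mulrDr lerD // ler_wpM2r //.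
have inA' s s' : 0 <= s <= h -> 0 <= s' <= h -> A (a + s *: v' + s' *: w').
  by move=> hs hs'; apply: Hr; apply: le_lt_trans hr; exact: inA.
have hh : 0 <= h <= h by rewrite lexx ltW.
have h00 : 0 <= (0 : R) <= h by rewrite lexx ltW.
have dv s s' : 0 <= s <= h -> 0 <= s' <= h ->
    is_derive s (1 : R) (fun s => f (a + s *: v' + s' *: w')) ('D_v' f (a + s *: v' + s' *: w')).
  move=> hs hs'; have := @line_derive _ _ f (a + s' *: w') v' s.
  rewrite (_ : (fun s => f (a + s' *: w' + s *: v')) = fun s => f (a + s *: v' + s' *: w')).
    rewrite addrAC; apply; exact: (Ck_derivable Cf (inA' s s' hs hs')).
  by apply/funext => z; rewrite addrAC.
pose g s := f (a + s *: v' + h *: w') - f (a + s *: v').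
pose dg s := 'D_v' f (a + s *: v' + h *: w') - 'D_v' f (a + s *: v').
have [|c cb ge] := @mvt_between g dg 0 h.
  rewrite (min_idPl (ltW h0)) (max_idPr (ltW h0)) => s hs; apply: is_deriveB; first exact: dv.
  have := dv s 0 hs h00; rewrite scale0r addr0.
  by rewrite (_ : (fun s => f (a + s *: v' + 0)) = fun s => f (a + s *: v')) //;
     apply/funext => z; rewrite addr0.
rewrite (min_idPl (ltW h0)) (max_idPr (ltW h0)) in cb.
have [|c' cb' ge'] := @mvt_between (fun s => 'D_v' f (a + c *: v' + s *: w'))
   (fun s => 'D_w' (fun x => 'D_v' f x) (a + c *: v' + s *: w')) 0 h.
  rewrite (min_idPl (ltW h0)) (max_idPr (ltW h0)) => s hs; apply: line_derive.
  exact: (Ck_derivable (Ck_derive v' Cf) (inA' c s cb hs)).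
rewrite (min_idPl (ltW h0)) (max_idPr (ltW h0)) in cb'.
exists (a + c *: v' + c' *: w'); first exact: inA.
move: ge; rewrite /dg; move: ge'; rewrite scale0r addr0 subr0 => ->.
rewrite /g scale0r !addr0 => e; rewrite expr2 mulrC mulrA -e.
by rewrite opprB addrA addrAC.
Qed.

(** The second difference is symmetric in the two directions and equals [h^2] times either mixed
    derivative at some nearby point; both mixed derivatives are continuous. *)
Lemma Ck2_schwarz m (A : set 'rV[R]_m) (f : 'rV[R]_m -> R) a (v w : 'rV[R]_m) :
  open A -> A a -> Ck 2 A f ->
  'D_v (fun x => 'D_w f x) a = 'D_w (fun x => 'D_v f x) a.
Proof.
move=> oA Aa Cf; have [r r0 Hr] := open_rV oA Aa.
have cP := Ck_cont (Ck_derive v (Ck_derive w Cf)) Aa.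
have cQ := Ck_cont (Ck_derive w (Ck_derive v Cf)) Aa.
have S v' w' h := @second_difference m A f a v' w' r h Cf Hr.
apply: (continuous_eq_close cP cQ) => d d0.
pose c := `|v| + `|w| + 1; have cp : 0 < c by rewrite ltr_pwDr // addr_ge0.
pose h := Num.min r d / 2 / c.
have h0 : 0 < h by rewrite !divr_gt0 // lt_min r0.
have hle : h * (`|v| + `|w|) < Num.min r d.
  apply: (@le_lt_trans _ _ (Num.min r d / 2)).
    rewrite /h -mulrA ler_piMr //; first by rewrite divr_ge0 // le_min !ltW.
    by rewrite mulrC ler_pdivrMr // mul1r lerDl.
  by rewrite ltr_pdivrMr // mulr2n mulrDr mulr1 ltrDl lt_min r0.
move: (hle); rewrite lt_min => /andP[hr hd].
have [p pa pe] := S v w h h0 hr.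
have [|q qa qe] := S w v h h0; first by rewrite (addrC `|w|).
exists q, p; split.
- by apply: le_lt_trans hd; rewrite (addrC `|v|).
- exact: le_lt_trans hd.
apply: (@mulfI _ (h ^+ 2)); first by rewrite expf_neq0 // gt_eqF.
rewrite -[LHS]qe -[RHS]pe [a + h *: w + h *: v]addrAC; congr (_ + _).
exact: addrAC.
Qed.

Lemma Ck1_hasd m n (A : set 'rV[R]_m) (f : 'rV[R]_m -> 'rV[R]_n) a : open A -> A a ->
  Ck 1 A f -> hasd f a ('J f a).
Proof.
move=> oA Aa Cf.
have h : hasd f a (\matrix_(k, j) 'D_(delta_mx 0 k) (fun u => f u 0 j) a).
  apply/hasdP => j; have := Ck1_hasds oA Aa (Ck_entry 0 j oA Cf).
  by congr hasds; apply/colP => k; rewrite !mxE.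
by rewrite (hasd_jac h).
Qed.

End MeanValue.

(** * Primitives, Gronwall estimate and Picard iteration *)

Section RealLemmas.
Context {R : realType}.

Lemma geometric_limit (u : nat -> R) (M : R) :
  (forall n, `|u n.+1 - u n| <= M / 2 ^+ n) ->
  exists l, forall n, `|u n - l| <= 2 * M / 2 ^+ n.
Proof.
move=> H.
pose a n := u n + 2 * M / 2 ^+ n; pose b n := u n - 2 * M / 2 ^+ n.
have p2 n : (2 ^+ n.+1)^-1 = (2 ^+ n)^-1 / 2 :> R by rewrite exprSr invfM.
have M0 n : 0 <= M / 2 ^+ n by apply: le_trans (H n).
have ba n : b n <= a n by rewrite /a /b; have := M0 n; rewrite -!mulrA; lra.
have aS n : a n.+1 <= a n.
  by rewrite /a p2; have := H n; have := M0 n; rewrite ler_norml; lra.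
have bS n : b n <= b n.+1.
  by rewrite /b p2; have := H n; have := M0 n; rewrite ler_norml; lra.
have am n k : a (n + k)%N <= a n.
  by elim: k => [|k IH]; rewrite ?addn0 // addnS; apply: le_trans IH.
have bm n k : b n <= b (n + k)%N.
  by elim: k => [|k IH]; rewrite ?addn0 // addnS; apply: le_trans IH _.
have bab n k : b n <= a k.
  by apply: le_trans (bm n k) _; apply: le_trans (ba _) _; rewrite addnC.
pose l := sup [set b n | n in setT].
have hs : has_sup [set b n | n in setT].
  by split; [exists (b 0%N), 0%N | exists (a 0%N) => _ [n _ <-]].
have bl n : b n <= l by apply: ub_le_sup; [exact: hs.2|exists n].
have la n : l <= a n by apply: ge_sup; [exact: hs.1|move=> _ [k _ <-]].
by exists l => n; have := bl n; have := la n; rewrite /a /b ler_norml; lra.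
Qed.

Lemma half_pow_small (C e : R) : 0 < e -> exists n : nat, C / 2 ^+ n <= e.
Proof.
move=> e0; exists (Num.truncn (`|C| / e)).+1; set n := Num.truncn _.
have p0 : (0 : R) < 2 ^+ n.+1 by rewrite exprn_gt0.
rewrite ler_pdivrMr // mulrC -ler_pdivrMr //.
have h1 : `|C| / e < n.+1%:R by rewrite truncnS_gt.
have h2 : (n.+1%:R : R) <= 2 ^+ n.+1 by rewrite -natrX ler_nat ltnW // ltn_expl.
apply: le_trans h2; apply: le_trans (ltW h1).
by rewrite ler_pM2r ?invr_gt0 // ler_norm.
Qed.

Lemma derive_zero_const (f : R -> R) (a b : R) :
  (forall t, a < t < b -> is_derive t (1 : R) f 0) ->
  forall s t, a < s < b -> a < t < b -> f s = f t.
Proof.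
move=> H s t /andP[s1 s2] /andP[t1 t2].
have [|c _] := @mvt_between R f (fun=> 0) s t; last by move/eqP; rewrite mul0r subr_eq0 => /eqP.
move=> c; have [st|ts] := leP s t => /andP[c1 c2]; apply: H; lra.
Qed.

(** Integrals give a primitive on each bounded window. Normalized to vanish at 0 these agree on
    overlaps, and at time [t] the window of half-width [|t| + 1] is used. *)
Lemma primitive (g : R -> R) : continuous g ->
  exists2 G : R -> R, (forall t, is_derive t (1 : R) G (g t)) & G 0 = 0.
Proof.
move=> cg.
have win (b : R) : exists G : R -> R,
    (0 < b -> forall t, - b < t < b -> is_derive t (1 : R) G (g t)) /\ G 0 = 0.
  pose F x := Rintegral lebesgue_measure `[- b, x] g.
  exists (fun x => F x - F 0); split=> [b0 t /andP[t1 t2]|]; last by rewrite subrr.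
  have ig : lebesgue_measure.-integrable `[- b, b] (EFin \o g).
    apply: continuous_compact_integrable; first exact: segment_compact.
    exact: continuous_subspaceT.
  have [dF F'] := continuous_FTC1_closed t2 ig t1 (cg t).
  have h : is_derive t (1 : R) F (g t).
    by apply: DeriveDef; [exact: dF|rewrite -derive1E; exact: F'].
  by have := is_deriveB h (is_derive_cst (F 0) t (1 : R)); rewrite subr0.
have [G HG] := choice win.
have agree b c t : 0 < b -> b <= c -> - b < t < b -> G b t = G c t.
  move=> b0 bc tb; have c0 : 0 < c by apply: lt_le_trans bc.
  have /derive_zero_const z : forall s, - b < s < b ->
      is_derive s (1 : R) (fun s => G b s - G c s) 0.
    move=> s /andP[s1 s2]; rewrite -(subrr (g s)); apply: is_deriveB.
      by have [/(_ b0) + _] := HG b; apply; rewrite s1 s2.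
    by have [/(_ c0) + _] := HG c; apply; lra.
  have : G b t - G c t = G b 0 - G c 0 by apply: z => //; lra.
  by rewrite (HG b).2 (HG c).2 subrr => /eqP; rewrite subr_eq0 => /eqP.
exists (fun t => G (`|t| + 1) t) => [t|]; last by rewrite (HG _).2.
have b0 : 0 < `|t| + 2 by rewrite ltr_pwDr.
have h : is_derive t (1 : R) (G (`|t| + 2)) (g t).
  by have [/(_ b0) + _] := HG (`|t| + 2); apply; have := ler_norm t; have := ler_norm (- t); rewrite normrN; lra.
apply: near_eq_is_derive h.
exists 1 => //= s; rewrite /ball_ /= => st.
symmetry; apply: agree.
- by rewrite ltr_pwDr.
- by have := lerB_dist s t; rewrite distrC; lra.
- by have := ler_norm s; have := ler_norm (- s); rewrite normrN; lra.
Qed.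

End RealLemmas.

Section Curves.
Context {R : realType} {p q : nat}.
Local Notation E := 'M[R]_(p, q).

Lemma mx_primitive (g : R -> E) : continuous g ->
  exists2 G : R -> E, (forall t, is_derive t (1 : R) G (g t)) & G 0 = 0.
Proof.
move=> cg.
have H (ij : 'I_p * 'I_q) : exists G : R -> R,
    (forall t, is_derive t (1 : R) G (g t ij.1 ij.2)) /\ G 0 = 0.
  have [|G dG G0] := @primitive R (fun t => g t ij.1 ij.2); last by exists G.
  by move=> t; have /cvg_mxP : g s @[s --> t] --> g t by [exact: cg]; exact.
have [G HG] := choice H.
exists (fun t => \matrix_(i, j) G (i, j) t) => [t|].
  by apply/is_derive_mxP => i j; under eq_fun do rewrite mxE; have [] := HG (i, j).
by apply/matrixP => i j; rewrite !mxE; have [] := HG (i, j).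
Qed.

Lemma mean_value_bound (f d : R -> E) (x y M : R) : 0 <= M ->
  (forall s, Num.min x y <= s <= Num.max x y ->
     is_derive s (1 : R) f (d s) /\ `|d s| <= M) ->
  `|f y - f x| <= M * `|y - x|.
Proof.
move=> M0 H; apply: mx_norm_le => [|i j]; first by rewrite mulr_ge0.
have [s sb|c cb] := @mvt_between R (fun t => f t i j) (fun t => d t i j) x y.
  by have [/is_derive_mxP] := H s sb.
rewrite !mxE => ->; rewrite normrM ler_wpM2r //.
exact: le_trans (entry_le_norm _ _ _) (H c cb).2.
Qed.

(* Valid on time intervals so short that [K * T <= 1 / 2]. *)
Lemma short_gronwall (u u' : R -> E) (T K e : R) : 0 <= K -> 0 <= e ->
  K * T <= 2^-1 ->
  (forall t, `|t| < T -> is_derive t (1 : R) u (u' t) /\ `|u' t| <= K * `|u t| + e) ->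
  forall t, `|t| < T -> `|u t| <= 2 * (`|u 0| + e * T).
Proof.
move=> K0 e0 KT H t tT.
have T0 : 0 < T by apply: le_lt_trans tT.
have lt_T s : - `|t| <= s <= `|t| -> `|s| < T.
  by move=> st; apply: le_lt_trans tT; rewrite ler_norml.
have [||c cin Hc] := @EVT_max R (fun s => `|u s|) (- `|t|) `|t|.
- by apply: le_trans (normr_ge0 t); rewrite oppr_le0.
- apply: continuous_in_subspaceT => s; rewrite inE /= in_itv /= => sin.
  apply: cvg_norm; exact: (is_derive_continuous (H s (lt_T s sin)).1).
rewrite in_itv /= in cin.
have cT := lt_T c cin.
have bnd : `|u c - u 0| <= (K * `|u c| + e) * `|c - 0|.
  apply: (mean_value_bound (d := u')); first by rewrite addr_ge0 // mulr_ge0.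
  move=> s sb; have sin : - `|t| <= s <= `|t|.
    by move: sb cin; case: (leP 0 c) => ? ?; lra.
  have [h1 h2] := H s (lt_T s sin); split=> //.
  by apply: le_trans h2 _; rewrite lerD2r ler_wpM2l //; apply: Hc; rewrite in_itv.
rewrite subr0 in bnd.
have h1 : (K * `|u c| + e) * `|c| <= 2^-1 * `|u c| + e * T.
  rewrite mulrDl lerD //.
    rewrite mulrAC ler_wpM2r // (le_trans _ KT) // ler_wpM2l // ltW //.
  by rewrite ler_wpM2l // ltW.
have h2 : `|u c| <= `|u 0| + (2^-1 * `|u c| + e * T).
  rewrite -[u c in leLHS](subrK (u 0)) addrC (le_trans (ler_normD _ _)) // lerD2l.
  exact: le_trans bnd h1.
have h3 : `|u t| <= `|u c| by apply: Hc; rewrite in_itv /= -ler_norml.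
by move: h2 h3; move: (`|u c|) (`|u 0|) (`|u t|) (e * T) => x1 x2 x3 x4; lra.
Qed.

Lemma picard (F : R -> E -> E) (T K B : R) (z : E) : 0 < T -> 0 <= K -> 0 <= B ->
  K * T <= 2^-1 ->
  (forall t x y, `|F t x - F t y| <= K * `|x - y|) ->
  (forall x : R -> E, continuous x -> continuous (fun t => F t (x t))) ->
  (forall t, `|F t z| <= B) ->
  exists x : R -> E, [/\ continuous x, x 0 = z &
    forall t, `|t| < T -> is_derive t (1 : R) x (F t (x t))].
Proof.
move=> T0 K0 B0 KT FL Fc FB.
(* With time clamped to [[- T, T]], the iteration contracts by one half on functions of the whole
   line. *)
pose cl (t : R) := Num.max (- T) (Num.min T t).
have ccl : continuous cl.
  move=> t; apply: (@continuous_max _ _ (fun=> - T) (Num.min T)); first exact: cvg_cst.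
  by apply: (@continuous_min _ _ (fun=> T) id); [exact: cvg_cst|exact: cvg_id].
have clT t : `|cl t| <= T.
  by rewrite ler_norml /cl le_max lexx /= ge_max ge_min lexx /= andbT; lra.
have clid t : `|t| < T -> cl t = t.
  rewrite ltr_norml => /andP[h1 h2].
  by rewrite /cl (min_idPr (ltW h2)) (max_idPr (ltW h1)).
have pr (x : R -> E) : exists G : R -> E, continuous x ->
    (forall t, is_derive t (1 : R) G (F t (x t))) /\ G 0 = 0.
  have [cx|ncx] := pselect (continuous x); last by exists (fun=> 0).
  by have [G dG G0] := mx_primitive (Fc x cx); exists G.
have [pr_ Hpr] := choice pr.
pose P (x : R -> E) t := z + pr_ x (cl t).
have cP x : continuous x -> continuous (P x).
  move=> cx t; apply: cvgD; first exact: cvg_cst.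
  apply: (@cvg_comp _ _ _ cl (pr_ x) _ (nbhs (cl t))); first exact: ccl.
  exact: (is_derive_continuous ((Hpr x cx).1 (cl t))).
have contr x y M : continuous x -> continuous y -> 0 <= M ->
    (forall t, `|x t - y t| <= M) -> forall t, `|P x t - P y t| <= M / 2.
  move=> cx cy M0 xy t; rewrite /P opprD addrACA subrr add0r.
  have [dx x0] := Hpr x cx; have [dy y0] := Hpr y cy.
  have h : `|(pr_ x (cl t) - pr_ y (cl t)) - (pr_ x 0 - pr_ y 0)| <= K * M * `|cl t - 0|.
    apply: (mean_value_bound (f := fun s => pr_ x s - pr_ y s)
      (d := fun s => F s (x s) - F s (y s))); first by rewrite mulr_ge0.
    move=> s _; split; first exact: is_deriveB.
    by apply: le_trans (FL _ _ _) _; rewrite ler_wpM2l.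
  move: h; rewrite x0 y0 subrr !subr0 => h; apply: le_trans h _.
  rewrite (@le_trans _ _ (K * M * T)) // ?ler_wpM2l ?mulr_ge0 //.
  by rewrite mulrAC mulrC ler_wpM2l.
pose x_ n := iter n P (fun=> z).
have cx n : continuous (x_ n).
  by elim: n => [|n IH] /=; [move=> t; exact: cvg_cst|exact: cP].
have BT : 0 <= B * T by rewrite mulr_ge0 // ltW.
have dx n t : `|x_ n.+1 t - x_ n t| <= B * T / 2 ^+ n.
  elim: n t => [|n IH] t.
    rewrite expr0 divr1 /= /P addrC addKr.
    have [d x0] := Hpr _ (cx 0%N).
    have : `|pr_ (x_ 0%N) (cl t) - pr_ (x_ 0%N) 0| <= B * `|cl t - 0|.
      by apply: (mean_value_bound (d := fun s => F s (x_ 0%N s))) => // s _; split.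
    rewrite x0 !subr0 => h; apply: le_trans h _; exact: ler_wpM2l.
  rewrite exprSr invfM mulrA; apply: contr => //; first exact: (cx n.+1).
  by rewrite mulr_ge0 // invr_ge0 exprn_ge0.
have lim t : exists l : E, forall n, `|x_ n t - l| <= 2 * (B * T) / 2 ^+ n.
  have H (ij : 'I_p * 'I_q) : exists l : R, forall n, `|x_ n t ij.1 ij.2 - l| <= 2 * (B * T) / 2 ^+ n.
    apply: geometric_limit => n; apply: le_trans (dx n t).
    by have := entry_le_norm (x_ n.+1 t - x_ n t) ij.1 ij.2; rewrite !mxE.
  have [l Hl] := choice H; exists (\matrix_(i, j) l (i, j)) => n.
  apply: mx_norm_le => [|i j]; first by rewrite mulr_ge0 ?invr_ge0 ?exprn_ge0 // mulr_ge0.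
  by rewrite !mxE; exact: (Hl (i, j)).
have [x Hx] := choice lim.
have cxx : continuous x.
  move=> t; apply/cvgrPdist_le => e e0.
  have e3 : 0 < e / 3 by rewrite divr_gt0.
  have [n Hn] := half_pow_small (2 * (B * T)) e3.
  have /cvgrPdist_le /(_ _ e3) := cx n t.
  apply: filterS => s hs.
  have -> : x t - x s = (x_ n t - x_ n s) - (x_ n t - x t) + (x_ n s - x s).
    by rewrite opprB [x_ n t - x_ n s + _]addrC !addrA !subrK.
  apply: le_trans (ler_normD _ _) _; apply: (@le_trans _ _ (e / 3 + e / 3 + e / 3)); last lra.
  apply: lerD; last exact: le_trans (Hx s n) Hn.
  apply: le_trans (ler_normB _ _) _; apply: lerD => //; exact: le_trans (Hx t n) Hn.
have fixP t : x t = P x t.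
  apply/eqP; rewrite -subr_eq0 -normr_eq0 eq_le normr_ge0 andbT.
  apply/ler_addgt0Pl => e e0; rewrite addr0.
  have [n Hn] := half_pow_small (2 * (B * T)) e0.
  have h1 := Hx t n.+1.
  have M0 : 0 <= 2 * (B * T) / 2 ^+ n by rewrite mulr_ge0 ?invr_ge0 ?exprn_ge0 // mulr_ge0.
  have h2 := contr (x_ n) x _ (cx n) cxx M0 (Hx^~ n) t.
  rewrite -[P (x_ n)]/(x_ n.+1) in h2.
  have -> : x t - P x t = (x_ n.+1 t - P x t) - (x_ n.+1 t - x t) by rewrite opprB [RHS]addrC addrA subrK.
  apply: le_trans (ler_normB _ _) _.
  have E1 : 2 * (B * T) / 2 ^+ n.+1 = 2 * (B * T) / 2 ^+ n / 2 by rewrite exprSr invfM [LHS]mulrA.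
  rewrite E1 in h1; move: h1 h2 Hn.
  move: (2 * (B * T) / 2 ^+ n) => y; move: (`|x_ n.+1 t - x t|) (`|_ - P x t|) => a b; lra.
have [dp p0] := Hpr x cxx.
exists x; split=> // [|t tT].
  by rewrite fixP /P clid ?normr0 // p0 addr0.
have h : is_derive t (1 : R) (fun s => z + pr_ x s) (F t (x t)).
  by have := is_deriveD (is_derive_cst z t (1 : R)) (dp t); rewrite add0r.
apply: near_eq_is_derive h.
have ts : \forall s \near t, `|s| < T.
  exists (T - `|t|) => /= [|s]; first by rewrite subr_gt0.
  by rewrite /ball_ /= distrC; have := lerB_dist s t; lra.
by apply: filterS ts => s sT; rewrite fixP /P clid.
Unshelve. all: by end_near. Qed.

End Curves.

Lemma le_continuous {R : realType} (V : normedModType R) m (f : 'rV[R]_m -> V) a :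
  (forall e : R, 0 < e -> exists2 d : R, 0 < d & forall u, `|u - a| < d -> `|f u - f a| <= e) ->
  {for a, continuous f}.
Proof.
move=> H; apply/(@cvgrPdist_le _ _ _ (nbhs a)) => e e0; apply/near_rV.
by have [d d0 Hd] := H e e0; exists d => // u ud; rewrite distrC Hd.
Qed.

(** * Local flows and their linearization *)

Section LocalFlow.
Context {R : realType} {N : nat}.
Local Notation E := 'rV[R]_N.
Variables (X : E -> E) (A : E -> 'M[R]_N) (a : E) (r K K' C : R).
Hypotheses (r0 : 0 < r) (K0 : 0 <= K) (K'0 : 0 <= K') (C0 : 0 <= C).
Hypothesis XL : forall u v, `|u - a| < r -> `|v - a| < r -> `|X u - X v| <= K * `|u - v|.
Hypothesis XA : forall u v, `|u - a| < r -> `|v - a| < r ->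
  `|X u - X v - (u - v) *m A v| <= C * `|u - v| ^+ 2.
Hypothesis AK : forall u, `|u - a| < r -> `|A u| <= K'.
Hypothesis cA : forall u, `|u - a| < r -> {for u, continuous A}.

(** Projection onto a cube, which is 1-Lipschitz in the maximum norm: composing with it makes the
    field bounded and globally Lipschitz without altering it near [a]. *)
Let clamp (x : R) := Num.max (- (r / 2)) (Num.min (r / 2) x).
Let proj (u : E) : E := a + \row_i clamp ((u - a) 0 i).

Let clamp_lip x y : `|clamp x - clamp y| <= `|x - y|.
Proof.
rewrite /clamp; have h : 0 < r / 2 by rewrite divr_gt0.
by rewrite ler_norml; have := ler_norm (x - y); have := ler_norm (- (x - y)); rewrite normrN;
   move: h; move: (r / 2) (`|x - y|) => c d;
   case: (leP c x); case: (leP c y) => ? ?; repeat (case: (leP (- c) _) => ?); lra.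
Qed.

Let proj_lip u v : `|proj u - proj v| <= `|u - v|.
Proof.
rewrite /proj opprD addrACA subrr add0r; apply: mx_norm_le => // i j.
rewrite !mxE; apply: le_trans (clamp_lip _ _) _.
rewrite opprB addrA subrK.
by have := entry_le_norm (u - v) 0 j; rewrite !mxE.
Qed.

Let proj_in u : `|proj u - a| < r.
Proof.
rewrite /proj addrC addKr; apply: (@le_lt_trans _ _ (r / 2)); last by rewrite ltr_pdivrMr // mulr2n mulrDr mulr1 ltrDl.
have h : 0 < r / 2 by rewrite divr_gt0.
apply: mx_norm_le => [|i j]; first exact: ltW.
by rewrite mxE ler_norml /clamp le_max lexx /= ge_max ge_min lexx /= andbT; lra.
Qed.

Let proj_id u : `|u - a| <= r / 2 -> proj u = u.
Proof.
move=> ur; rewrite /proj; apply/rowP => i; rewrite [LHS]mxE [(\row__ _) _ _]mxE.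
have : `|(u - a) 0 i| <= r / 2 by apply: le_trans ur; exact: entry_le_norm.
rewrite ler_norml => /andP[h1 h2].
by rewrite /clamp (min_idPr h2) (max_idPr h1) !mxE addrC subrK.
Qed.

Let cproj : continuous proj.
Proof.
move=> u; apply: le_continuous => e e0; exists e => // v ve.
by apply: le_trans (proj_lip _ _) _; exact: ltW.
Qed.

Let X' u := X (proj u).

Let X'L u v : `|X' u - X' v| <= K * `|u - v|.
Proof. by apply: le_trans (XL (proj_in _) (proj_in _)) _; rewrite ler_wpM2l. Qed.

Let cX' : continuous X'.
Proof.
move=> u; apply: le_continuous => e e0.
exists (e / (K + 1)); first by rewrite divr_gt0 // ltr_pwDr.
move=> v ve; apply: le_trans (X'L _ _) _.
move: ve; rewrite ltr_pdivlMr ?ltr_pwDr // mulrDr mulr1 mulrC => /ltW.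
by apply: le_trans; rewrite lerDl.
Qed.

Let B := `|X a| + K * r.

Let X'B u : `|X' u| <= B.
Proof.
rewrite -[X' u](subrK (X a)) addrC (le_trans (ler_normD _ _)) // lerD2l.
have aa : `|a - a| < r by rewrite subrr normr0.
apply: le_trans (XL (proj_in u) aa) _.
by rewrite ler_wpM2l // ltW // proj_in.
Qed.

Lemma local_flow : exists (d rho : R) (phi : R -> E -> E), [/\ 0 < d, 0 < rho &
  forall z, `|z - a| < rho -> [/\ phi 0 z = z,
    (forall t, `|t| < d -> `|phi t z - a| < r /\
       is_derive t (1 : R) (fun t => phi t z) (X (phi t z))) &
    exists L : R -> 'M[R]_N, L 0 = 1%:M /\
      forall t, `|t| < d -> hasd (phi t) z (L t) /\
        is_derive t (1 : R) L (L t *m A (phi t z))]].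
Proof.
pose K2 := K + N%:R * K'.
have K20 : 0 <= K2 by rewrite addr_ge0 // mulr_ge0.
have B0 : 0 <= B by rewrite addr_ge0 // mulr_ge0 // ltW.
(* The first bound is the short time condition for the field and for the variational equation alike.
   The second keeps orbits starting within [r / 4] of [a] in the cube where the projection is the
   identity. *)
pose d := Num.min (2^-1 / (K2 + 1)) (r / 4 / (B + 1)).
have d0 : 0 < d by rewrite lt_min !divr_gt0 // ?invr_gt0 // ltr_pwDr.
have dK : K2 * d <= 2^-1.
  apply: (@le_trans _ _ ((K2 + 1) * d)); first by rewrite ler_wpM2r ?lerDl // ltW.
  by rewrite mulrC -ler_pdivlMr ?ltr_pwDr // ge_min lexx.
have dB : B * d <= r / 4.
  apply: (@le_trans _ _ ((B + 1) * d)); first by rewrite ler_wpM2r ?lerDl // ltW.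
  by rewrite mulrC -ler_pdivlMr ?ltr_pwDr // ge_min lexx orbT.
have KK2 : K <= K2 by rewrite lerDl mulr_ge0.
have NK2 : N%:R * K' <= K2 by rewrite lerDr.
have dK1 : K * d <= 2^-1 by apply: le_trans dK; rewrite ler_wpM2r // ltW.
have dK3 : N%:R * K' * d <= 2^-1 by apply: le_trans dK; rewrite ler_wpM2r // ltW.
have sol z : exists x : R -> E, [/\ continuous x, x 0 = z &
    forall t, `|t| < d -> is_derive t (1 : R) x (X' (x t))].
  apply: (picard (F := fun _ => X') d0 K0 B0 dK1) => // x cx t.
  by apply: (@cvg_comp _ _ _ x X' _ (nbhs (x t))); [exact: cx|exact: cX'].
have [phi Hphi] := choice sol.
have near_z z t : `|z - a| < r / 4 -> `|t| < d -> `|phi z t - a| <= r / 2.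
  move=> za td; have [cx x0 dx] := Hphi z.
  have h : `|phi z t - phi z 0| <= B * `|t - 0|.
    apply: (mean_value_bound (d := fun s => X' (phi z s))) => // s sb; split=> //.
    apply: dx; move: sb (td); rewrite !ltr_norml; case: (leP 0 t) => ? /andP[? ?] /andP[? ?]; lra.
  rewrite subr0 x0 in h; rewrite -[phi z t](subrK z) -addrA (le_trans (ler_normD _ _)) //.
  have : B * `|t| <= r / 4 by apply: le_trans dB; rewrite ler_wpM2l // ltW.
  by move: h za; move: (`|phi z t - z|) (`|z - a|) (B * `|t|) => x1 x2 x3; lra.
have lip z z' t : `|t| < d -> `|phi z' t - phi z t| <= 2 * `|z' - z|.
  have [cx x0 dx] := Hphi z; have [cx' x0' dx'] := Hphi z' => td.
  have := @short_gronwall R 1 N (fun s => phi z' s - phi z s)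
    (fun s => X' (phi z' s) - X' (phi z s)) d K 0 K0 (lexx 0) dK1 _ t td.
  rewrite mul0r addr0 x0 x0'; apply=> s sd; split; first exact: is_deriveB (dx' s sd) (dx s sd).
  by rewrite addr0.
exists d, (r / 4), (fun t z => phi z t); split; rewrite ?divr_gt0 // => z za.
have [cx x0 dx] := Hphi z; split=> //.
  move=> t td; have h := near_z z t za td; split.
    by apply: le_lt_trans h _; rewrite ltr_pdivrMr // mulr2n mulrDr mulr1 ltrDl.
  by have := dx t td; rewrite /X' proj_id.
pose A' t := A (proj (phi z t)).
have A'K t : `|A' t| <= K' by apply: AK; exact: proj_in.
have cA' : continuous A'.
  move=> t; apply: (@cvg_comp _ _ _ (fun t => proj (phi z t)) A _ (nbhs (proj (phi z t)))).
    by apply: (@cvg_comp _ _ _ (phi z) proj _ (nbhs (phi z t))); [exact: cx|exact: cproj].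
  by apply: cA; exact: proj_in.
have mulA' t (M : 'M[R]_N) : `|M *m A' t| <= N%:R * K' * `|M|.
  apply: le_trans (norm_mulmx _ _) _; rewrite [leRHS]mulrAC ler_wpM2l // mulr_ge0 //.
have NK'0 : 0 <= N%:R * K' by rewrite mulr_ge0.
have B1 : 0 <= N%:R * K' * `|1%:M : 'M[R]_N| by rewrite mulr_ge0.
have [L [cL L0 dL]] : exists L : R -> 'M[R]_N, [/\ continuous L, L 0 = 1%:M &
    forall t, `|t| < d -> is_derive t (1 : R) L (L t *m A' t)].
  apply: (picard (F := fun t M => M *m A' t) d0 NK'0 B1 dK3) => [t x y|x cx' t|t //].
  - by rewrite -mulmxBl.
  - by apply: cvg_mulmx; [exact: cx'|exact: cA'].
exists L; split=> // t td.
have A'E s : `|s| < d -> A' s = A (phi z s) by move=> sd; rewrite /A' proj_id // near_z.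
split; last by have := dL t td; rewrite A'E.
move=> e e0; pose C8 := 2 * (C * 4 * d).
have C80 : 0 <= C8 by rewrite !mulr_ge0 // ltW.
have zr : 0 < r / 4 - `|z - a| by rewrite subr_gt0.
exists (Num.min (r / 4 - `|z - a|) (e / (C8 + 1))).
  by rewrite lt_min zr divr_gt0 // ltr_pwDr.
move=> z'; rewrite lt_min => /andP[z'r z'e].
have z'a : `|z' - a| < r / 4.
  rewrite -[z'](subrK z) -addrA (le_lt_trans (ler_normD _ _)) //.
  by rewrite -ltrBrDr.
have [cx' x0' dx'] := Hphi z'.
(* The error of the linear approximation. It satisfies the variational equation up to a term
   quadratic in [z' - z], so the Gronwall estimate makes it quadratic too. *)
pose u s := phi z' s - phi z s - (z' - z) *m L s.
pose u' s := X' (phi z' s) - X' (phi z s) - (z' - z) *m (L s *m A' s).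
have C40 : 0 <= C * (2 * `|z' - z|) ^+ 2 by rewrite mulr_ge0 // exprn_ge0 // mulr_ge0.
have u0 : u 0 = 0 by rewrite /u x0 x0' L0 mulmx1 subrr.
have := @short_gronwall R 1 N u u' d (N%:R * K') (C * (2 * `|z' - z|) ^+ 2) NK'0 C40 dK3 _ t td.
rewrite u0 normr0 add0r => h.
have {}h : `|u t| <= 2 * (C * (2 * `|z' - z|) ^+ 2 * d).
  apply: h => s sd; split.
    apply: is_deriveB; first exact: is_deriveB (dx' s sd) (dx s sd).
    exact: is_derive_mulmxl (dL s sd).
  have -> : u' s = (X' (phi z' s) - X' (phi z s) - (phi z' s - phi z s) *m A' s) + u s *m A' s.
    by rewrite /u' /u [(_ - (z' - z) *m L s) *m _]mulmxBl addrA subrK mulmxA.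
  rewrite addrC (le_trans (ler_normD _ _)) // lerD //.
    rewrite (le_trans (norm_mulmx _ _)) // [leRHS]mulrAC ler_wpM2l ?mulr_ge0 //.
  have p1 : `|phi z' s - a| < r.
    by apply: le_lt_trans (near_z z' s z'a sd) _; rewrite ltr_pdivrMr // mulr2n mulrDr mulr1 ltrDl.
  have p2 : `|phi z s - a| < r.
    by apply: le_lt_trans (near_z z s za sd) _; rewrite ltr_pdivrMr // mulr2n mulrDr mulr1 ltrDl.
  rewrite A'E // /X' !proj_id ?near_z //.
  apply: le_trans (XA p1 p2) _; rewrite ler_wpM2l //.
  by rewrite lerXn2r ?nnegrE ?mulr_ge0 // lip.
rewrite -/(u t); apply: le_trans h _.
have -> : 2 * (C * (2 * `|z' - z|) ^+ 2 * d) = C8 * `|z' - z| * `|z' - z|.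
  by rewrite /C8 exprMn expr2; ring.
rewrite ler_wpM2r //.
move: z'e; rewrite ltr_pdivlMr ?ltr_pwDr // mulrDr mulr1 mulrC => /ltW.
by apply: le_trans; rewrite lerDl.
Qed.

End LocalFlow.

Section SmoothField.
Context {R : realType} {N : nat}.
Local Notation E := 'rV[R]_N.

Theorem smooth_local_flow (X : E -> E) (U : set E) (a : E) : open U -> U a ->
  Ck 2 U X -> exists (d rho : R) (phi : R -> E -> E), [/\ 0 < d, 0 < rho &
  forall z, `|z - a| < rho -> [/\ phi 0 z = z,
    (forall t, `|t| < d -> U (phi t z) /\
       is_derive t (1 : R) (fun t => phi t z) (X (phi t z))) &
    exists L : R -> 'M[R]_N, L 0 = 1%:M /\
      forall t, `|t| < d -> hasd (phi t) z (L t) /\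
        is_derive t (1 : R) L (L t *m 'J X (phi t z))]].
Proof.
move=> oU Ua CX.
have Cj j := Ck_entry 0 j oU CX.
have H1 j := Ck1_lipschitz oU Ua (CkW (Cj j)).
have H2 j := Ck2_quadratic oU Ua (Cj j).
have [r1 Hr1] := choice H1; have [K1 HK1] := choice Hr1.
have [r2 Hr2] := choice H2; have [C1 HC1] := choice Hr2.
have [rU rU0 HU] := open_rV oU Ua.
have JE u : U u -> 'J X u = \matrix_(k, j) grad (fun u => X u 0 j) u k 0.
  move=> Uu; apply: hasd_jac; apply/hasdP => j.
  have := Ck1_hasds oU Uu (CkW (Cj j)).
  by congr hasds; apply/colP => k; rewrite !mxE.
have cJ u : U u -> {for u, continuous (fun u => 'J X u)}.
  move=> Uu.
  have H : \forall v \near u, (\matrix_(k, j) grad (fun u => X u 0 j) v k 0) = 'J X v.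
    apply/near_rV; have [d d0 Hd] := open_rV oU Uu.
    by exists d => // v /Hd Uv; rewrite JE.
  have cG : (\matrix_(k, j) grad (fun u => X u 0 j) v k 0) @[v --> nbhs u] -->
      (\matrix_(k, j) grad (fun u => X u 0 j) u k 0 : 'M[R]_N).
    apply/cvg_mxP => k j; rewrite mxE.
    under eq_fun do rewrite mxE /grad mxE; rewrite /grad mxE.
    exact: (Ck_cont (Ck_derive (delta_mx 0 k) (Cj j)) Uu).
  rewrite /prop_for /continuous_at JE //; apply: cvg_trans cG; exact: near_eq_cvg H.
have [r3 r30 H3] := continuous_le (cJ a Ua) (@ltr01 R).
pose r := Num.min (Num.min rU r3) (Num.min (\big[Num.min/1]_j r1 j) (\big[Num.min/1]_j r2 j)).
have r0 : 0 < r.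
  rewrite !lt_min rU0 r30 /=; apply/andP; split;
    apply: (big_ind (fun x => 0 < x)) => // [x z x0 z0|j _]; rewrite ?lt_min ?x0 //.
    by have [] := HK1 j.
  by have [] := HC1 j.
have rr u : `|u - a| < r -> [/\ U u, `|u - a| < r3, forall j, `|u - a| < r1 j &
    forall j, `|u - a| < r2 j].
  rewrite !lt_min => /andP[/andP[h1 h2] /andP[h3 h4]]; split=> // [|j|j]; first exact: HU.
    by apply: lt_le_trans h3 _; exact: bigmin_le_cond.
  by apply: lt_le_trans h4 _; exact: bigmin_le_cond.
have K10 j : 0 <= K1 j by have [] := HK1 j.
have C10 j : 0 <= C1 j by have [] := HC1 j.
pose K := \sum_j K1 j; pose C := \sum_j C1 j.
have K0 : 0 <= K by exact: sumr_ge0.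
have C0 : 0 <= C by exact: sumr_ge0.
have leK j : K1 j <= K by rewrite /K (bigD1 j) //= lerDl sumr_ge0.
have leC j : C1 j <= C by rewrite /C (bigD1 j) //= lerDl sumr_ge0.
have XL u v : `|u - a| < r -> `|v - a| < r -> `|X u - X v| <= K * `|u - v|.
  move=> /rr[_ _ u1 _] /rr[_ _ v1 _]; apply: mx_norm_le => [|i j]; first by rewrite mulr_ge0.
  rewrite ord1 !mxE; have [_ _ _ /(_ u v (u1 j) (v1 j)) h] := HK1 j.
  by apply: le_trans h _; rewrite ler_wpM2r.
have XA u v : `|u - a| < r -> `|v - a| < r ->
    `|X u - X v - (u - v) *m 'J X v| <= C * `|u - v| ^+ 2.
  move=> /rr[_ _ _ u2] /rr[Uv _ _ v2]; apply: mx_norm_le => [|i j].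
    by rewrite mulr_ge0 // exprn_ge0.
  have [_ _ _ /(_ u v (u2 j) (v2 j)) h] := HC1 j.
  apply: (@le_trans _ _ (C1 j * `|u - v| ^+ 2)); last by rewrite ler_wpM2r // exprn_ge0.
  apply: le_trans h; rewrite ord1 JE // !mxE le_eqVlt; apply/orP; left; apply/eqP.
  by congr `|_ - _|; apply: eq_bigr => k _; rewrite !mxE.
have AK u : `|u - a| < r -> `|'J X u| <= `|'J X a| + 1.
  by move=> /rr[_ u3 _ _]; rewrite -lerBlDl; exact: le_trans (lerB_dist _ _) (H3 u u3).
have K'0 : 0 <= `|'J X a| + 1 by rewrite addr_ge0.
have cA u : `|u - a| < r -> {for u, continuous (fun u => 'J X u)} by move=> /rr[Uu _ _ _]; exact: cJ.
have [d [rho [phi [d0 rho0 H]]]] := local_flow r0 K0 K'0 C0 XL XA AK cA.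
exists d, rho, phi; split=> // z za; have [h1 h2 h3] := H z za; split=> // t td.
by have [h h'] := h2 t td; split=> //; have [] := rr _ h.
Qed.

End SmoothField.

(** * Charts and curves in the cotangent bundle *)

Section ScalarDifferentials.
Context {R : realType} {m : nat}.
Local Notation E := 'rV[R]_m.
Implicit Types (f g : E -> R) (F G : 'cV[R]_m).

Lemma hasds_hasd f a F : hasds f a F -> hasd (fun u => (f u)%:M : 'rV[R]_1) a F.
Proof.
move=> H; apply/hasdP => j e e0; have [d d0 Hd] := H e e0; exists d => // u ud.
have := Hd u ud; rewrite !ord1 !mxE eqxx !mulr1n.
by rewrite (_ : \sum_k _ = \sum_j (u - a) 0 j * col 0 F j 0) //; apply: eq_bigr => k _; rewrite !mxE.
Qed.

Lemma hasds_derive f a F v : hasds f a F -> is_derive a v f ((v *m F) 0 0).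
Proof.
move=> /hasds_hasd /(hasd_derive v) /is_derive_mxP /(_ 0 0).
by under eq_fun do rewrite mxE eqxx mulr1n.
Qed.

Lemma hasds_unique f a F G : hasds f a F -> hasds f a G -> F = G.
Proof. by move=> /hasds_hasd /hasd_jac <- /hasds_hasd /hasd_jac <-. Qed.

Lemma hasds_continuous f a F : hasds f a F -> {for a, continuous f}.
Proof.
move=> /hasds_hasd /hasd_continuous c.
have /cvg_mxP /(_ 0 0) : (f u)%:M @[u --> a] --> ((f a)%:M : 'rV[R]_1) by exact: c.
by under eq_fun do rewrite mxE eqxx mulr1n; rewrite mxE eqxx mulr1n.
Qed.

Lemma hasds_near_eq f g a F : (\forall u \near a, f u = g u) -> hasds f a F -> hasds g a F.
Proof.
move=> /near_rV[r r0 fg] H e e0; have [d d0 Hd] := H e e0.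
exists (Num.min r d); first by rewrite lt_min r0.
move=> u; rewrite lt_min => /andP[ur ud].
by rewrite -!fg ?Hd // subrr normr0.
Qed.

Lemma hasds_cst (c : R) (a : E) : hasds (fun=> c) a 0.
Proof.
by move=> e e0; exists 1 => // u _; rewrite mulmx0 mxE subrr subr0 normr0 mulr_ge0 // ltW.
Qed.

Lemma hasds_coord j a : hasds (fun u : E => u 0 j) a (delta_mx j 0).
Proof.
move=> e e0; exists 1 => // u _; rewrite -colE !mxE subrr normr0.
by rewrite mulr_ge0 // ltW.
Qed.

Lemma hasdsD f g a F G : hasds f a F -> hasds g a G ->
  hasds (fun u => f u + g u) a (F + G).
Proof.
move=> Hf Hg e e0; have e2 : 0 < e / 2 by rewrite divr_gt0.
have [d1 d10 H1] := Hf _ e2; have [d2 d20 H2] := Hg _ e2.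
exists (Num.min d1 d2); first by rewrite lt_min d10.
move=> u; rewrite lt_min => /andP[u1 u2].
rewrite mulmxDr [((u - a) *m F + _) 0 0]mxE [e]splitr mulrDl.
apply: le_trans (lerD (H1 u u1) (H2 u u2)).
apply: le_trans (ler_normD _ _); rewrite le_eqVlt; apply/orP; left; apply/eqP.
by congr `|_|; ring.
Qed.

Lemma hasdsM f g a F G : hasds f a F -> hasds g a G ->
  hasds (fun u => f u * g u) a (g a *: F + f a *: G).
Proof.
move=> Hf Hg e e0.
have [K K0 [d0 d00 H0]] := hasd_lip (hasds_hasd Hf).
have {}H0 u : `|u - a| < d0 -> `|f u - f a| <= K * `|u - a|.
  move=> /H0; apply: le_trans; have := entry_le_norm ((f u)%:M - (f a)%:M : 'rV[R]_1) 0 0.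
  by rewrite !mxE eqxx !mulr1n.
have cg : 0 < e / 3 / K by rewrite !divr_gt0.
have [d1 d10 H1] := continuous_le (hasds_continuous Hg) cg.
have p (x : R) : 0 < `|x| + 1 by rewrite ltr_pwDr.
have e2 : 0 < e / 3 / (`|f a| + 1) by rewrite !divr_gt0.
have e3 : 0 < e / 3 / (`|g a| + 1) by rewrite !divr_gt0.
have [d2 d20 H2] := Hg _ e2; have [d3 d30 H3] := Hf _ e3.
exists (Num.min (Num.min d0 d1) (Num.min d2 d3)); first by rewrite !lt_min d00 d10 d20.
move=> u; rewrite !lt_min => /andP[/andP[u0 u1] /andP[u2 u3]].
have -> : ((u - a) *m (g a *: F + f a *: G)) 0 0 =
    g a * ((u - a) *m F) 0 0 + f a * ((u - a) *m G) 0 0.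
  have ent (A B : 'M[R]_1) (c d : R) : (c *: A + d *: B) 0 0 = c * A 0 0 + d * B 0 0.
    by rewrite !mxE.
  by rewrite mulmxDr -!scalemxAr ent.
have := H0 u u0; have := H1 u u1; have := H2 u u2; have := H3 u u3.
move: (((u - a) *m F) 0 0) (((u - a) *m G) 0 0) `|u - a| (normr_ge0 (u - a)) => x y z z0 h3 h2 h1 h0.
have -> : f u * g u - f a * g a - (g a * x + f a * y) =
  (f u - f a) * (g u - g a) + f a * (g u - g a - y) + g a * (f u - f a - x) by ring.
have E3 : e * z = e / 3 * z + e / 3 * z + e / 3 * z by field.
have q c : 0 <= c -> c * (e / 3 / (c + 1) * z) <= e / 3 * z.
  move=> c0; rewrite mulrA ler_wpM2r // mulrCA ler_piMr //; first by rewrite divr_ge0 // ltW.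
  by rewrite ler_pdivrMr ?mul1r ?lerDl // ltr_pwDr.
rewrite E3 (le_trans (ler_normD _ _)) // lerD //; last first.
  rewrite normrM; apply: le_trans (q `|g a| _) => //; exact: ler_wpM2l.
rewrite (le_trans (ler_normD _ _)) // lerD //; last first.
  rewrite normrM; apply: le_trans (q `|f a| _) => //; exact: ler_wpM2l.
rewrite normrM (le_trans (ler_pM _ _ h0 h1)) //.
by rewrite mulrAC mulrCA divff ?gt_eqF // mulr1 mulrC.
Qed.

Lemma hasds_sum (I : finType) (f : I -> E -> R) (F : I -> 'cV[R]_m) a :
  (forall i, hasds (f i) a (F i)) -> hasds (fun u => \sum_i f i u) a (\sum_i F i).
Proof.
move=> H; elim: (index_enum I) => [|i r IH].
  by rewrite big_nil; under eq_fun do rewrite big_nil; exact: hasds_cst.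
by rewrite big_cons; under eq_fun do rewrite big_cons; exact: hasdsD.
Qed.

End ScalarDifferentials.

Lemma hasds_comp {R : realType} m n (f : 'rV[R]_m -> 'rV[R]_n) (g : 'rV[R]_n -> R) a L G :
  hasd f a L -> hasds g (f a) G -> hasds (g \o f) a (L *m G).
Proof.
move=> Hf /hasds_hasd Hg; have /hasdP /(_ 0) := hasd_comp Hf Hg.
have -> : col 0 (L *m G) = L *m G by apply/colP => i; rewrite !mxE.
by under [fun u => _]eq_fun do rewrite /= mxE eqxx mulr1n.
Qed.

Lemma hasd_lin {R : realType} m n (L : 'M[R]_(m, n)) a : hasd (fun u => u *m L) a L.
Proof.
by move=> e e0; exists 1 => // u _; rewrite mulmxBl subrr normr0 mulr_ge0 // ltW.
Qed.

Lemma grad_sym {R : realType} m (A : set 'rV[R]_m) (f : 'rV[R]_m -> R) u (i j : 'I_m) :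
  open A -> A u -> Ck 2 A f ->
  grad (fun v => 'D_(delta_mx 0 i) f v) u j 0 = grad (fun v => 'D_(delta_mx 0 j) f v) u i 0.
Proof.
move=> oA Au Cf.
have E (h : 'rV[R]_m -> R) l : grad h u l 0 = 'D_(delta_mx 0 l) h u by exact: mxE.
have S := Ck2_schwarz (delta_mx 0 j) (delta_mx 0 i) oA Au Cf.
exact: (etrans (E (fun v => 'D_(delta_mx 0 i) f v) j)
  (etrans S (esym (E (fun v => 'D_(delta_mx 0 j) f v) i)))).
Qed.

Section Atlas.
Context {R : realType} {m : nat} {X : Type} (C : charts R m X).

(** The facts about an atlas on which the calculus below relies, stated for a bare set so that they
    apply to [M] and to [cotangent_charts] alike. *)
Record atlas_ok : Prop := AtlasOk {
  atlas_inj : forall (i : idx C) x y, dom i x -> dom i y -> crd i x = crd i y -> x = y;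
  atlas_open : forall i j : idx C, open (crd i @` (dom i `&` dom j));
  atlas_hasd : forall (i j : idx C) x, dom i x -> dom j x ->
    hasd (rep i (crd j)) (crd i x) (tjac i j x) }.

Arguments atlas_open _ _ _ : clear implicits.

Hypothesis ok : atlas_ok.
Implicit Types (i j k : idx C) (x : X).

Lemma rep_crd (F : normedModType R) i (f : X -> F) x : dom i x -> rep i f (crd i x) = f x.
Proof.
move=> dx; rewrite /rep /rep_on.
have : [set v | exists a, [/\ dom i a, crd i a = crd i x & f a = v]]
   (xget 0 [set v | exists a, [/\ dom i a, crd i a = crd i x & f a = v]]).
  by apply: (xgetPex 0); exists (f x), x.
by move=> [y [dy e <-]]; rewrite (atlas_inj ok dy dx e).
Qed.

Lemma overlap_near i j x : dom i x -> dom j x ->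
  \forall u \near crd i x, exists y, [/\ dom i y, dom j y & crd i y = u].
Proof.
move=> dix djx; have h : (crd i @` (dom i `&` dom j)) (crd i x) by exists x.
apply/near_rV; have [r r0 H] := open_rV (atlas_open ok i j) h.
by exists r => // u /H[y [d1 d2] <-]; exists y.
Qed.

Lemma chart_open i : open (crd i @` dom i).
Proof. by have := atlas_open ok i i; rewrite setIid. Qed.

Lemma hasd_rep_change n (f : X -> 'rV[R]_n) i j x L : dom i x -> dom j x ->
  hasd (rep j f) (crd j x) L -> hasd (rep i f) (crd i x) (tjac i j x *m L).
Proof.
move=> dix djx H; apply: (@hasd_near_eq _ _ _ (rep j f \o rep i (crd j))).
  have /near_rV[r r0 Hr] := overlap_near dix djx; apply/near_rV; exists r => // u /Hr[y [d1 d2 <-]].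
  by rewrite /= !rep_crd.
by apply: hasd_comp; [exact: atlas_hasd|rewrite rep_crd].
Qed.

Lemma hasds_rep_change (f : X -> R) i j x L : dom i x -> dom j x ->
  hasds (rep j f) (crd j x) L -> hasds (rep i f) (crd i x) (tjac i j x *m L).
Proof.
move=> dix djx H; apply: (@hasds_near_eq _ _ (rep j f \o rep i (crd j))).
  have /near_rV[r r0 Hr] := overlap_near dix djx; apply/near_rV; exists r => // u /Hr[y [d1 d2 <-]].
  by rewrite /= !rep_crd.
by apply: hasds_comp; [exact: atlas_hasd|rewrite rep_crd].
Qed.

Lemma tjacM i j k x : dom i x -> dom j x -> dom k x ->
  tjac i j x *m tjac j k x = tjac i k x.
Proof.
move=> di dj dk; rewrite [RHS]/tjac; symmetry; apply: hasd_jac.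
by apply: hasd_rep_change => //; exact: atlas_hasd.
Qed.

Lemma tjac_id i x : dom i x -> tjac i i x = 1%:M.
Proof.
move=> di; apply: hasd_jac; apply: hasd_near_eq (hasd_id _).
by have /near_rV[r r0 Hr] := overlap_near di di; apply/near_rV; exists r => // u /Hr[y [d1 _ <-]];
   rewrite rep_crd.
Qed.

Lemma tjacK i j x : dom i x -> dom j x -> tjac i j x *m tjac j i x = 1%:M.
Proof. by move=> di dj; rewrite tjacM // tjac_id. Qed.

Lemma tjac_unit i j x : dom i x -> dom j x -> tjac i j x \in unitmx.
Proof. by move=> di dj; exact: (mulmx1_unit (tjacK di dj)).1. Qed.

End Atlas.

Section ManifoldAtlas.
Context {R : realType} {n : nat} (M : manifold R n).

Lemma manifold_atlas_ok : atlas_ok (atlas M).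
Proof.
have oo (i j : idx (atlas M)) : open (crd i @` (dom i `&` dom j)).
  by apply: crd_open; [apply: openI; exact: dom_open|move=> x []].
split=> // [i x y|i j x di dj]; first exact: crd_inj.
by apply: (Ck1_hasd (oo i j)); [exists x|exact: trans_smooth].
Qed.

End ManifoldAtlas.

Arguments atlas_open {R m X C} _ _ _.

Section CotangentAtlas.
Context {R : realType} {n : nat} (M : manifold R n).
Local Notation I := (idx (atlas M)).
Local Notation CT := (cotangent_charts M).
Let okM := manifold_atlas_ok M.

Lemma cotangent_eq (z z' : cotangent M) (i : I) : dom i (base z) -> base z = base z' ->
  mom z i = mom z' i -> z = z'.
Proof.
case: z z' => [q m t o] [q' m' t' o'] /= di e; subst q' => mi.
have mm : m = m'.
  apply/funext => j; have [dj|ndj] := pselect (dom j q); last by rewrite o // o'.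
  by rewrite (t j i) // (t' j i) // mi.
subst m'; congr Cotangent; exact: Prop_irrelevance.
Qed.

Section Covector.
Variables (i : I) (q : M) (p : 'rV[R]_n).
Hypothesis dq : dom i q.

Definition covector_mom (j : I) : 'rV[R]_n :=
  if `[< dom j q >] then p *m (tjac j i q)^T else 0.

Lemma covector_momE j : dom j q -> covector_mom j = p *m (tjac j i q)^T.
Proof. by move=> dj; rewrite /covector_mom asboolT. Qed.

Lemma covector_trans j k : dom j q -> dom k q ->
  covector_mom j = covector_mom k *m (tjac j k q)^T.
Proof.
move=> dj dk; rewrite (covector_momE dj) (covector_momE dk) -mulmxA -trmx_mul.
by rewrite (tjacM okM dj dk dq).
Qed.

Lemma covector_out j : ~ dom j q -> covector_mom j = 0.
Proof. by move=> dj; rewrite /covector_mom asboolF. Qed.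

Definition covector : cotangent M := Cotangent covector_trans covector_out.

Lemma covector_crd : crd (c := CT) i covector = row_mx (crd i q) p.
Proof.
rewrite /= (covector_momE dq).
by rewrite (tjac_id okM dq) trmx1 mulmx1.
Qed.

End Covector.

Definition proj_q : 'M[R]_(n + n, n) := col_mx 1%:M 0.
Definition proj_p : 'M[R]_(n + n, n) := col_mx 0 1%:M.

Lemma proj_qE (u : 'rV[R]_(n + n)) : u *m proj_q = lsubmx u.
Proof. by rewrite -{1}(hsubmxK u) mul_row_col mulmx1 mulmx0 addr0. Qed.

Lemma proj_pE (u : 'rV[R]_(n + n)) : u *m proj_p = rsubmx u.
Proof. by rewrite -{1}(hsubmxK u) mul_row_col mulmx1 mulmx0 add0r. Qed.

Lemma mulmxr_continuous k l (A : 'M[R]_(k, l)) : continuous (mulmxr A : 'rV[R]_k -> 'rV[R]_l).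
Proof.
move=> u; have h : (fun v : 'rV[R]_k => v *m A) @ nbhs u --> u *m A.
  by apply: cvg_mulmx; [exact: cvg_id|exact: cvg_cst].
exact: h.
Qed.

Lemma cotangent_overlap (i j : I) :
  crd (c := CT) i @` (dom (c := CT) i `&` dom (c := CT) j) =
  (mulmxr proj_q) @^-1` (crd i @` (dom i `&` dom j)).
Proof.
rewrite eqEsubset; split=> u.
  by case=> z [di dj] <-; exists (base z) => //=; rewrite proj_qE row_mxKl.
case=> q [di dj] /= e; exists (covector (rsubmx u) di); first by split.
by rewrite [LHS]covector_crd e proj_qE hsubmxK.
Qed.

Lemma transition_entry (i j : I) (x : M) (l b : 'I_n) : dom i x -> dom j x ->
  tjac i j x l b = 'D_(delta_mx 0 l) (fun u => rep i (crd j) u 0 b) (crd i x).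
Proof.
move=> di dj; have /hasdP /(_ b) /(hasds_derive (delta_mx 0 l)) [_ ->] := atlas_hasd okM di dj.
by rewrite -rowE !mxE.
Qed.

Lemma transition_Ck (i j : I) k (v : 'rV[R]_n) (b : 'I_n) :
  Ck k (crd i @` (dom i `&` dom j)) (fun u => 'D_v (fun u => rep i (crd j) u 0 b) u).
Proof.
have oA := atlas_open okM i j.
have := Ck_derive v (Ck_entry 0 b oA (smooth_Ck k.+1 (@trans_smooth _ _ M i j))).
exact.
Qed.

(** [Q] is the derivative, in the base point, of the action of the transition on the momentum.
    Differentiating the identity between the two inverse base Jacobians expresses [Q] by second
    derivatives, and their symmetry gives the relation that makes the lift symplectic. *)
Lemma cotangent_transition (i j : I) (z : cotangent M) : dom i (base z) -> dom j (base z) ->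
  exists Q : 'M[R]_n,
    hasd (rep (C := CT) i (crd (c := CT) j)) (crd (c := CT) i z)
      (block_mx (tjac i j (base z)) Q 0 (tjac j i (base z))^T) /\
    Q *m (tjac i j (base z))^T = tjac i j (base z) *m Q^T.
Proof.
set x := base z => di dj.
have oij := atlas_open okM i j; have oji := atlas_open okM j i.
have xij : (crd i @` (dom i `&` dom j)) (crd i x) by exists x.
have xji : (crd j @` (dom j `&` dom i)) (crd j x) by exists x.
pose phi := rep i (crd j).
pose psi l b u := 'D_(delta_mx 0 l) (fun u => rep j (crd i) u 0 b) (phi u).
pose g d l u := 'D_(delta_mx 0 d) (fun u => rep i (crd j) u 0 l) u.
have phix y : dom i y -> phi (crd i y) = crd j y by move=> dy; rewrite /phi (rep_crd okM).
have hphi : hasd phi (crd i x) (tjac i j x) by exact: (atlas_hasd okM).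
have psiE l b y : dom i y -> dom j y -> psi l b (crd i y) = tjac j i y l b.
  by move=> diy djy; rewrite /psi phix // transition_entry.
have gE d l y : dom i y -> dom j y -> g d l (crd i y) = tjac i j y d l.
  by move=> diy djy; rewrite transition_entry.
have hpsi lb : exists G, hasds (psi lb.1 lb.2) (crd i x) G.
  exists (tjac i j x *m grad (fun u => 'D_(delta_mx 0 lb.1) (fun u => rep j (crd i) u 0 lb.2) u) (crd j x)).
  have H : hasds (fun u => 'D_(delta_mx 0 lb.1) (fun u => rep j (crd i) u 0 lb.2) u) (phi (crd i x))
      (grad (fun u => 'D_(delta_mx 0 lb.1) (fun u => rep j (crd i) u 0 lb.2) u) (crd j x)).
    by rewrite phix //; apply: (Ck1_hasds oji xji); exact: transition_Ck.
  exact: (hasds_comp hphi H).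
have [Psi HPsi] := choice hpsi.
have hg d l : hasds (g d l) (crd i x) (grad (g d l) (crd i x)).
  by apply: (Ck1_hasds oij xij); exact: transition_Ck.
pose Gam d l := grad (g d l) (crd i x).
have Gsym d a l : Gam d l a 0 = Gam a l d 0.
  have c2 : Ck 2 (crd i @` (dom i `&` dom j)) (fun u => rep i (crd j) u 0 l).
    by apply: (Ck_entry 0 l oij); exact: trans_smooth.
  exact: (grad_sym d a oij xij c2).
have {}hg d l : hasds (g d l) (crd i x) (Gam d l) by exact: hg.
clearbody Gam.
pose p := mom z i.
pose Q : 'M[R]_n := \matrix_(a, l) \sum_b p 0 b * Psi (l, b) a 0.
have inv d b : \sum_l (tjac j i x l b *: Gam d l + tjac i j x d l *: Psi (l, b)) = 0.
  have h1 : hasds (fun u => \sum_l g d l u * psi l b u) (crd i x)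
      (\sum_l (tjac j i x l b *: Gam d l + tjac i j x d l *: Psi (l, b))).
    apply: hasds_sum => l.
    have := hasdsM (hg d l) (HPsi (l, b)).
    by rewrite /= psiE // gE.
  apply: (hasds_unique h1); apply: (@hasds_near_eq _ _ (fun=> (d == b)%:R)); last exact: hasds_cst.
  have /near_rV[r r0 Hr] := overlap_near okM di dj; apply/near_rV; exists r => // u /Hr[y [d1 d2 <-]].
  have := congr1 (fun A : 'M[R]_n => A d b) (tjacK okM d1 d2); rewrite !mxE => <-.
  by apply: eq_bigr => l _; rewrite gE // psiE.
exists Q; split; last first.
  have QE a d : (Q *m (tjac i j x)^T) a d =
      - \sum_b p 0 b * \sum_l tjac j i x l b * Gam d l a 0.
    have step b : \sum_l Psi (l, b) a 0 * tjac i j x d l = - \sum_l tjac j i x l b * Gam d l a 0.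
      have := congr1 (fun A : 'cV[R]_n => A a 0) (inv d b); rewrite summxE mxE => e.
      apply/eqP; rewrite -addr_eq0 -big_split /= -[X in _ == X]e; apply/eqP.
      have ent (A B : 'cV[R]_n) (c c' : R) : (c *: A + c' *: B) a 0 = c * A a 0 + c' * B a 0.
        by rewrite !mxE.
      by apply: eq_bigr => l _; rewrite ent addrC (mulrC (Psi _ _ _)).
    rewrite mxE; under eq_bigr => l _ do rewrite [(tjac i j x)^T l d]mxE [Q a l]mxE mulr_suml.
    rewrite exchange_big /= -sumrN; apply: eq_bigr => b _.
    rewrite -mulrN -step mulr_sumr; apply: eq_bigr => l _; by rewrite mulrA.
  apply/matrixP => a d; rewrite QE -[X in _ *m X^T]trmxK.
  have -> : (tjac i j x *m Q^T^T^T) a d = (Q *m (tjac i j x)^T) d a.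
    by rewrite trmxK -[tjac i j x in LHS]trmxK -trmx_mul mxE.
  rewrite QE; congr (- _); apply: eq_bigr => b _; congr (_ * _); apply: eq_bigr => l _.
  by rewrite Gsym.
have zq : crd (c := CT) i z *m proj_q = crd i x by rewrite proj_qE row_mxKl.
apply: (@hasd_near_eq _ _ _ (fun u => row_mx (phi (u *m proj_q))
    ((u *m proj_p) *m (\matrix_(l, b) psi l b (u *m proj_q))^T))).
  have /near_rV[r r0 Hr] := overlap_near okM di dj.
  apply/near_rV; exists r => // u ur.
  have uq : `|u *m proj_q - crd i x| < r.
    have -> : u *m proj_q - crd i x = lsubmx (u - crd (c := CT) i z).
      by rewrite proj_qE -[crd i x in LHS](row_mxKl (crd i x) (mom z i)); apply/rowP => k; rewrite !mxE.
    by apply: le_lt_trans ur; apply: mx_norm_le => // a b; rewrite mxE; exact: entry_le_norm.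
  have [y [diy djy ey]] := Hr _ uq.
  have -> : u = crd (c := CT) i (covector (rsubmx u) diy).
    by rewrite covector_crd ey proj_qE hsubmxK.
  set w := covector (rsubmx u) diy.
  have bw : base w = y by [].
  have wq : crd (c := CT) i w *m proj_q = crd i y by rewrite proj_qE row_mxKl.
  have wp : crd (c := CT) i w *m proj_p = mom w i by rewrite proj_pE row_mxKr.
  rewrite wq wp phix //.
  have -> : rep (C := CT) i (crd (c := CT) j) (crd (c := CT) i w) = crd (c := CT) j w.
    rewrite /rep /rep_on; set S := [set v | _].
    have [w' [dw' e' <-]] : S (xget 0 S) by apply: (xgetPex 0); exists (crd (c := CT) j w), w.
    congr (crd _ _); move: e' => /eq_row_mx[eq em].
    by apply: (cotangent_eq (i := i)) => //; apply: (crd_inj dw').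
  have -> : \matrix_(l, b) psi l b (crd i y) = tjac j i y.
    by apply/matrixP => l b; rewrite [LHS]mxE; exact: psiE.
  by rewrite /= -(mom_trans (c := w) (i := j) (j := i) djy diy).
apply/hasdP => k.
have hq : hasd (fun u : 'rV[R]_(n + n) => u *m proj_q) (crd (c := CT) i z) proj_q by exact: hasd_lin.
have hp : hasd (fun u : 'rV[R]_(n + n) => u *m proj_p) (crd (c := CT) i z) proj_p by exact: hasd_lin.
rewrite -[k]splitK; case: (fintype.split k) => l /=.
  under eq_fun do rewrite row_mxEl.
  have /hasdP /(_ l) h : hasd (phi \o (fun u => u *m proj_q)) (crd (c := CT) i z) (proj_q *m tjac i j x).
    by apply: hasd_comp hq _; rewrite zq.
  have -> : col (lshift n l) (block_mx (tjac i j x) Q 0 (tjac j i x)^T) = col l (proj_q *m tjac i j x).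
    rewrite /proj_q mul_col_mx mul1mx mul0mx /block_mx.
    apply/colP => a; rewrite !mxE; case: (fintype.split a) => a'; by rewrite row_mxEl !mxE.
  exact: h.
have h : hasds (fun u => \sum_b (u *m proj_p) 0 b * psi l b (u *m proj_q)) (crd (c := CT) i z)
   (\sum_b (tjac j i x l b *: (proj_p *m delta_mx b 0) + p 0 b *: (proj_q *m Psi (l, b)))).
  apply: hasds_sum => b.
  have h1 : hasds (fun u => (u *m proj_p) 0 b) (crd (c := CT) i z) (proj_p *m delta_mx b 0).
    have := hasds_comp hp (hasds_coord b (crd (c := CT) i z *m proj_p)).
    exact.
  have h2 : hasds (fun u => psi l b (u *m proj_q)) (crd (c := CT) i z) (proj_q *m Psi (l, b)).
    have := HPsi (l, b); rewrite -zq => hh; exact: (hasds_comp hq hh).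
  have := hasdsM h1 h2.
  by rewrite zq psiE // proj_pE row_mxKr.
have -> : col (rshift n l) (block_mx (tjac i j x) Q 0 (tjac j i x)^T) =
   \sum_b (tjac j i x l b *: (proj_p *m delta_mx b 0) + p 0 b *: (proj_q *m Psi (l, b))).
  apply/colP => a; move: (tjac i j x) (tjac j i x) => A B; rewrite summxE [LHS]mxE /proj_p /proj_q.
  under eq_bigr => b _ do rewrite !mul_col_mx !mul0mx !mul1mx !mxE.
  rewrite mxE; case: (fintype.split a) => a'; rewrite row_mxEr !mxE.
    by apply: eq_bigr => b _; rewrite mulr0 add0r.
  rewrite (bigD1 a') //= big1 => [|b ba]; last by rewrite !mxE eq_sym (negPf ba) mulr0 mulr0 addr0.
  by rewrite !mxE !eqxx mulr1 mulr0 !addr0.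
apply: hasds_near_eq h; apply/near_rV; exists 1 => // u _.
rewrite row_mxEr mxE; apply: eq_bigr => b _; by rewrite !mxE.
Qed.

Lemma cotangent_atlas_ok : atlas_ok CT.
Proof.
split=> [i z z' di di'|i j|i j z di dj].
- move=> /eq_row_mx[eq em]; apply: (cotangent_eq (i := i)) => //; exact: (crd_inj di).
- rewrite cotangent_overlap; apply: open_comp; last exact: (atlas_open okM).
  by move=> u _; exact: mulmxr_continuous.
- have [Q [h _]] := cotangent_transition di dj.
  by rewrite /tjac (hasd_jac h).
Qed.

Lemma cotangent_tjac_symplectic (sigma : tensor2 M) (i j : I) (z : cotangent M) :
  is_tensor2 sigma -> dom i (base z) -> dom j (base z) ->
  omega sigma i z = tjac (C := CT) i j z *m omega sigma j z *m (tjac (C := CT) i j z)^T.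
Proof.
move=> [st _] di dj; have [Q [h Qs]] := cotangent_transition di dj.
have TE : tjac (C := CT) i j z = block_mx (tjac i j (base z)) Q 0 (tjac j i (base z))^T.
  exact: hasd_jac h.
rewrite TE /omega /twisted_mx (st i j _ di dj) tr_block_mx trmx0 !mulmx_block.
rewrite !(mul0mx, mulmx0, mulmx1, mul1mx, add0r, addr0, mulmxN, mulNmx, trmxK).
have := tjacK okM di dj; move: (tjac i j _) (tjac j i _) Qs => A B Qs AB.
by rewrite AB -trmx_mul AB trmx1 mulmxDl Qs addrK.
Qed.

Lemma cotangent_tjac_vertical (i j : I) (z : cotangent M) :
  dom i (base z) -> dom j (base z) ->
  [/\ ulsubmx (tjac (C := CT) i j z) = tjac i j (base z),
      dlsubmx (tjac (C := CT) i j z) = 0 &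
      drsubmx (tjac (C := CT) i j z) = (tjac j i (base z))^T].
Proof.
move=> di dj; have [Q [h _]] := cotangent_transition di dj.
have -> : tjac (C := CT) i j z = block_mx (tjac i j (base z)) Q 0 (tjac j i (base z))^T.
  exact: hasd_jac h.
by rewrite block_mxKul block_mxKdl block_mxKdr.
Qed.

End CotangentAtlas.

Lemma near_R {R : realType} (t : R) (P : R -> Prop) :
  (\forall s \near t, P s) <-> exists2 d : R, 0 < d & forall s, `|s - t| < d -> P s.
Proof.
split=> [/nbhs_ballP[r /= r0 h]|[r r0 h]]; last apply/nbhs_ballP; exists r => // u ur.
  by apply: h; rewrite -ball_normE /ball_ /= distrC.
by apply: h; move: ur; rewrite -ball_normE /ball_ /= distrC.
Qed.

Lemma is_derive_mx_comp {R : realType} m n (f : R -> 'M[R]_(m, n)) (g : R -> R) (t e : R) d :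
  is_derive (g t) (1 : R) f d -> is_derive t (1 : R) g e ->
  is_derive t (1 : R) (fun s => f (g s)) (e *: d).
Proof.
move=> /is_derive_mxP df dg; apply/is_derive_mxP => i j; rewrite mxE.
have := @is_derive1_comp _ (fun x => f x i j) g t _ _ (df i j) dg => /is_derive_eq; apply.
by rewrite mulrC.
Qed.

Lemma union_itv {R : realType} (a1 b1 a2 b2 t s : R) : a1 < t < b1 -> a2 < t < b2 ->
  Num.min a1 a2 < s < Num.max b1 b2 -> ~~ (a1 < s < b1) -> a2 < s < b2.
Proof.
move=> /andP[h1 h2] /andP[h3 h4]; rewrite gt_min lt_max negb_and -!leNgt => /andP[h5 h6] /orP[] h7.
- have a2s : a2 < s by case/orP: h5 => // h; move: (lt_le_trans h h7); rewrite ltxx.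
  by rewrite a2s (le_lt_trans h7) // (lt_trans h1).
- have sb2 : s < b2 by case/orP: h6 => // h; move: (le_lt_trans h7 h); rewrite ltxx.
  by rewrite sb2 andbT (lt_le_trans h3) // (le_trans (ltW h2)).
Qed.

Lemma is_derive_addl {R : realType} (t0 t : R) : is_derive t (1 : R) (fun s : R => t0 + s) 1.
Proof.
have : is_derive t (1 : R) (fun s : R => t0 + s) (0 + (1 : R)) by apply: is_deriveD.
by rewrite add0r.
Qed.

(** * Integral curves of fields given in charts *)

Section Curves.
Context {R : realType} {m : nat} {X : choiceType} (C : charts R m X).
Local Notation E := 'rV[R]_m.
Hypothesis ok : atlas_ok C.

Definition ccont (c : R -> X) (t : R) := forall i : idx C, dom i (c t) ->
  (\forall s \near t, dom i (c s)) /\ {for t, continuous (crd i \o c)}.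

(** The Hausdorff property tested on curves, [X] being a bare set. It makes the set of times at
    which two integral curves agree closed. *)
Definition separated := forall c1 c2 t, ccont c1 t -> ccont c2 t ->
  (forall d : R, 0 < d -> exists2 s, `|s - t| < d & c1 s = c2 s) -> c1 t = c2 t.

Variable W : idx C -> E -> E.
Hypothesis cover : forall x, exists i : idx C, dom i x.
Hypothesis sep : separated.
Hypothesis WC : forall i, Ck 2 (crd i @` dom i) (W i).
Hypothesis WT : forall i j x, dom i x -> dom j x ->
  W i (crd i x) *m tjac i j x = W j (crd j x).

(** The time-dependent factor [phi] covers constant speeds and reparametrized orbits at once, so one
    uniqueness theorem serves for both. *)
Definition gcurve (phi : R -> R) (A : set R) (c : R -> X) := forall t (i : idx C),
  A t -> dom i (c t) -> (\forall s \near t, dom i (c s)) /\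
    is_derive t (1 : R) (crd i \o c) (phi t *: W i (crd i (c t))).

Lemma gcurve_ccont phi A c t : gcurve phi A c -> A t -> ccont c t.
Proof. by move=> H At i di; have [h d] := H t i At di; split=> //; exact: is_derive_continuous d. Qed.

Lemma chart_change (c : R -> X) t (i j : idx C) d : dom i (c t) -> dom j (c t) ->
  (\forall s \near t, dom i (c s)) -> is_derive t (1 : R) (crd i \o c) d ->
  (\forall s \near t, dom j (c s)) /\ is_derive t (1 : R) (crd j \o c) (d *m tjac i j (c t)).
Proof.
move=> di dj ni dc.
have nij : \forall s \near t, dom i (c s) /\ dom j (c s).
  have cc := is_derive_continuous dc.
  have h := cc _ (overlap_near ok di dj).
  near=> s; have ds : dom i (c s) by near: s.
  have [y [yi yj e]] : exists y, [/\ dom i y, dom j y & crd i y = (crd i \o c) s] by near: s.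
  by rewrite -(atlas_inj ok yi ds e).
split; first by apply: filterS nij => s [].
have h : hasd (rep i (crd j)) ((crd i \o c) t) (tjac i j (c t)) by exact: atlas_hasd.
apply: near_eq_is_derive (hasd_curve h dc); apply: filterS nij => s [si _] /=.
exact: rep_crd.
Unshelve. all: by end_near.
Qed.

Lemma gcurve_at (phi : R -> R) (A : set R) (c : R -> X) : (forall t, A t -> exists i : idx C, [/\ dom i (c t),
    \forall s \near t, dom i (c s) &
    is_derive t (1 : R) (crd i \o c) (phi t *: W i (crd i (c t)))]) -> gcurve phi A c.
Proof.
move=> H t j At dj; have [i [di ni dc]] := H t At.
have [nj dj'] := chart_change di dj ni dc; split=> //.
by rewrite -(WT di dj) scalemxAl.
Qed.

Lemma gcurve_near phi A c c' t (i : idx C) : gcurve phi A c -> A t -> dom i (c t) ->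
  (\forall s \near t, c s = c' s) -> (\forall s \near t, dom i (c' s)) /\
    is_derive t (1 : R) (crd i \o c') (phi t *: W i (crd i (c' t))).
Proof.
move=> H At di e; have [n dc] := H t i At di; have et := nbhs_singleton e; split.
  near=> s; have <- : c s = c' s by near: s.
  by near: s.
rewrite -et; apply: near_eq_is_derive dc.
by apply: filterS e => s /= ->.
Unshelve. all: by end_near.
Qed.

Lemma gcurve_local_unique phi A c1 c2 t : {for t, continuous phi} ->
  gcurve phi A c1 -> gcurve phi A c2 -> (\forall s \near t, A s) -> c1 t = c2 t ->
  \forall s \near t, c1 s = c2 s.
Proof.
move=> cphi H1 H2 nA e; have At := nbhs_singleton nA.
have [i di] := cover (c1 t); have di2 : dom i (c2 t) by rewrite -e.
have [n1 d1] := H1 t i At di; have [n2 d2] := H2 t i At di2.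
have oA : open (crd i @` dom i) by exact: (chart_open ok).
have Ai : (crd i @` dom i) (crd i (c1 t)) by exists (c1 t).
have [r [K [r0 K0 HK]]] : exists r K : R, [/\ 0 < r, 0 <= K & forall u v,
    `|u - crd i (c1 t)| < r -> `|v - crd i (c1 t)| < r -> `|W i u - W i v| <= K * `|u - v|].
  have h l := Ck1_lipschitz oA Ai (Ck_entry 0 l oA (CkW (WC i))).
  have {h} /choice[rK h] : forall l : 'I_m, exists rK : R * R, [/\ 0 < rK.1, 0 <= rK.2 &
      forall u v, `|u - crd i (c1 t)| < rK.1 -> `|v - crd i (c1 t)| < rK.1 ->
      `|W i u 0 l - W i v 0 l| <= rK.2 * `|u - v|].
    by move=> l; have [r [K [r0 K0 _ HK]]] := h l; exists (r, K).
  have /near_rV[r r0 Hr] : \forall u \near crd i (c1 t), forall l, `|u - crd i (c1 t)| < (rK l).1.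
    by apply: near_forall_rV => l; apply/near_rV; have [r0 _ _] := h l; exists (rK l).1.
  exists r, (\sum_l (rK l).2); split=> // [|u v ur vr].
    by apply: sumr_ge0 => l _; have [] := h l.
  have K0 : 0 <= \sum_l (rK l).2 by apply: sumr_ge0 => l _; have [] := h l.
  apply: mx_norm_le => [|a l]; first exact: mulr_ge0.
  rewrite ord1 !mxE; have [_ _ hl] := h l; apply: le_trans (hl u v (Hr u ur l) (Hr v vr l)) _.
  rewrite ler_wpM2r // (bigD1 l) //= lerDl sumr_ge0 // => k _; by have [] := h k.
have nr (c : R -> X) d : crd i (c t) = crd i (c1 t) -> is_derive t (1 : R) (crd i \o c) d ->
    \forall s \near t, `|crd i (c s) - crd i (c1 t)| < r.
  move=> ec /is_derive_continuous cc.
  have h : \forall u \near crd i (c t), `|u - crd i (c1 t)| < r.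
    by rewrite ec; apply/near_rV; exists r.
  exact: cc _ h.
have /near_R[d1' d10 E1] : \forall s \near t, [/\ A s, dom i (c1 s), dom i (c2 s),
    `|phi s| < `|phi t| + 1 & `|crd i (c1 s) - crd i (c1 t)| < r /\ `|crd i (c2 s) - crd i (c1 t)| < r].
  have np : \forall s \near t, `|phi s| < `|phi t| + 1.
    have /cvg_norm cn : phi s @[s --> t] --> phi t by exact: cphi.
    by move/cvgr_lt : cn; apply; rewrite ltrDl.
  have a1 := nr c1 _ erefl d1; have a2 := nr c2 _ (congr1 (crd i) (esym e)) d2.
  near=> s; split; [by near: s|by near: s|by near: s|by near: s|split; by near: s].
pose K' := (`|phi t| + 1) * K.
have K'0 : 0 <= K' by rewrite mulr_ge0 // addr_ge0.
pose T := Num.min d1' (2^-1 / (K' + 1)).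
have p1 : 0 < K' + 1 by rewrite ltr_wpDl.
have T0 : 0 < T by rewrite lt_min d10 /= divr_gt0.
have KT : K' * T <= 2^-1.
  have T2 : T <= 2^-1 / (K' + 1) by rewrite ge_min lexx orbT.
  have := ler_wpM2l K'0 T2 => /le_trans; apply.
  rewrite mulrA ler_pdivrMr // mulrC ler_wpM2l ?invr_ge0 // lerDl ler01 //.
pose u s := crd i (c1 (t + s)) - crd i (c2 (t + s)).
pose u' s := phi (t + s) *: (W i (crd i (c1 (t + s))) - W i (crd i (c2 (t + s)))).
have Hu s : `|s| < T -> is_derive s (1 : R) u (u' s) /\ `|u' s| <= K' * `|u s| + 0.
  move=> sT; have sd : `|t + s - t| < d1' by rewrite addrAC subrr add0r (lt_le_trans sT) // ge_min lexx.
  have [As i1 i2 p [b1 b2]] := E1 _ sd; split; last first.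
    rewrite addr0 /u' /u normrZ /K' -mulrA ler_pM //; first exact: ltW.
    exact: HK.
  have := is_derive_mx_comp (H2 _ _ As i2).2 (is_derive_addl t s).
  have := is_derive_mx_comp (H1 _ _ As i1).2 (is_derive_addl t s).
  by rewrite /u' scalerBr !scale1r; exact: is_deriveB.
apply/near_R; exists T => // s sT.
have := short_gronwall K'0 (lexx 0) KT Hu sT.
rewrite /u addr0 mul0r addr0 subrKC e subrr normr0 mulr0 normr_le0 subr_eq0 => /eqP es.
have sd : `|s - t| < d1' by rewrite (lt_le_trans sT) // ge_min lexx.
by have [_ i1 i2 _ _] := E1 _ sd; exact: (atlas_inj ok i1 i2 es).
Unshelve. all: by end_near.
Qed.

(** The property that is glued says that the curves agree at both ends of an interval or at neither.
    Near a time of agreement it holds by local uniqueness, near a time of disagreement by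
    [separated]. *)
Lemma gcurve_unique phi A c1 c2 s t : continuous phi ->
  gcurve phi A c1 -> gcurve phi A c2 ->
  (forall r, Num.min s t <= r <= Num.max s t -> \forall u \near r, A u) ->
  c1 s = c2 s -> c1 t = c2 t.
Proof.
move=> cphi H1 H2.
have main a b : a <= b -> (forall r, a <= r <= b -> \forall u \near r, A u) -> c1 a = c2 a <-> c1 b = c2 b.
  move=> ab nA.
  pose Q u v := c1 u = c2 u <-> c1 v = c2 v.
  apply: (@interval_glue R Q a b ab); last by move=> u v w _ _ _ _ [? ?] [? ?]; split; tauto.
  move=> r rab; have nr := nA r rab; have [e|ne] := pselect (c1 r = c2 r).
    have /near_R[d d0 h] := gcurve_local_unique (cphi r) H1 H2 nr e.
    exists d => // u v _ uv _ ud vd; split=> _; apply: h; rewrite ltr_norml; apply/andP; split; lra.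
  have Ar := nbhs_singleton nr.
  have : ~ (forall d : R, 0 < d -> exists2 s, `|s - r| < d & c1 s = c2 s).
    by move=> h; apply: ne; apply: sep h; [exact: gcurve_ccont H1 Ar|exact: gcurve_ccont H2 Ar].
  move=> /existsNP[d /not_implyP[d0 h]]; exists d => // u v _ uv _ ud vd.
  split=> e; case: h; [exists u => //|exists v => //]; rewrite ltr_norml; apply/andP; split; lra.
have [st|ts] := leP s t => nA; first by move/(main _ _ st nA).
by move/(main _ _ (ltW ts) nA).
Qed.

(** The pattern of [flow] for an abstract field; [flow_aflow] identifies the two. *)
Definition aflow (t : R) (x : X) : X := xget x [set y | exists (a b : R) (c : R -> X),
  [/\ a < 0 < b, a < t < b, gcurve (fun=> 1) `]a, b[%classic c, c 0 = x & c t = y]].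

Definition flows (t : R) (x : X) := exists (a b : R) (c : R -> X),
  [/\ a < 0 < b, a < t < b, gcurve (fun=> 1) `]a, b[%classic c & c 0 = x].

Lemma gcurve_sub phi A A' c : A' `<=` A -> gcurve phi A c -> gcurve phi A' c.
Proof. by move=> s H t i /s; exact: H. Qed.

Lemma near_itv (a b r : R) : a < r < b -> \forall u \near r, (`]a, b[%classic : set R) u.
Proof.
move=> /andP[ar rb]; apply/near_R; exists (Num.min (r - a) (b - r)).
  by rewrite lt_min !subr_gt0 ar.
move=> s; rewrite lt_min => /andP[s1 s2] /=; rewrite in_itv /=.
move: s1 s2; rewrite !ltr_norml => /andP[? _] /andP[_ ?]; apply/andP; split; lra.
Qed.

Lemma aflow_curve a b c t : a < 0 < b -> a < t < b ->
  gcurve (fun=> 1) `]a, b[%classic c -> aflow t (c 0) = c t.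
Proof.
move=> ab0 abt Hc; rewrite /aflow; set S := [set y | _].
have [a' [b' [c' [ab0' abt' Hc' e <-]]]] : S (xget (c 0) S).
  by apply: (xgetPex (c 0)); exists (c t), a, b, c.
pose a2 := Num.max a a'; pose b2 := Num.min b b'.
have s1 : (`]a2, b2[ `<=` `]a, b[)%classic.
  by move=> s /=; rewrite !in_itv /= gt_max lt_min => /andP[/andP[-> _] /andP[-> _]].
have s2 : (`]a2, b2[ `<=` `]a', b'[)%classic.
  by move=> s /=; rewrite !in_itv /= gt_max lt_min => /andP[/andP[_ ->] /andP[_ ->]].
apply: (gcurve_unique (phi := fun=> 1) (A := `]a2, b2[%classic) (s := 0)) => //.
- by move=> x; exact: cvg_cst.
- exact: gcurve_sub Hc'.
- exact: gcurve_sub Hc.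
move=> r; move: ab0 abt ab0' abt' => /andP[? ?] /andP[? ?] /andP[? ?] /andP[? ?].
rewrite ge_min le_max => h; apply: near_itv; rewrite gt_max lt_min.
case/andP: h => /orP[] ? /orP[] ?; apply/andP; split; apply/andP; split; lra.
Qed.

Lemma gcurve_shift c a b t0 : gcurve (fun=> 1) `]a, b[%classic c ->
  gcurve (fun=> 1) `]a - t0, b - t0[%classic (fun s => c (t0 + s)).
Proof.
move=> H t i /=; rewrite in_itv /= => /andP[ta tb] di.
have At : (`]a, b[%classic : set R) (t0 + t) by rewrite /= in_itv /=; apply/andP; split; lra.
have [/near_R[d d0 n] dc] := H _ _ At di; split.
  by apply/near_R; exists d => // s st; apply: n; rewrite opprD addrACA subrr add0r.
have := is_derive_mx_comp dc (is_derive_addl t0 t).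
by rewrite !scale1r.
Qed.

Lemma flows_add t0 t x : flows t0 x -> flows t (aflow t0 x) ->
  flows (t0 + t) x /\ aflow (t0 + t) x = aflow t (aflow t0 x).
Proof.
move=> [a1 [b1 [c1 [z1 t1 H1 <-]]]]; rewrite (aflow_curve z1 t1 H1).
move=> [a2 [b2 [c2 [z2 t2 H2 e]]]].
have := gcurve_shift (t0 := - t0) H2; rewrite !opprK => H2'.
pose I1 := (`]a1, b1[%classic : set R); pose I2 := (`]a2 + t0, b2 + t0[%classic : set R).
have agree s : I1 s -> I2 s -> c1 s = c2 (- t0 + s).
  rewrite /I1 /I2 /= !in_itv /= => /andP[? ?] /andP[? ?].
  have s1 : (I1 `&` I2) `<=` I1 by move=> ? [].
  have s2 : (I1 `&` I2) `<=` I2 by move=> ? [].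
  apply: (gcurve_unique (phi := fun=> 1) (s := t0) _ (gcurve_sub s1 H1) (gcurve_sub s2 H2')).
  - by move=> ?; exact: cvg_cst.
  - move=> r; move: z1 t1 z2 t2 => /andP[? ?] /andP[? ?] /andP[? ?] /andP[? ?].
    rewrite ge_min le_max => h; apply: filterI; apply: near_itv;
    case/andP: h => /orP[] ? /orP[] ?; apply/andP; split; lra.
  - by rewrite addNr e.
pose c s := if `[< I1 s >] then c1 s else c2 (- t0 + s).
have cE1 s : I1 s -> c s = c1 s by move=> h; rewrite /c asboolT.
have cE2 s : I2 s -> c s = c2 (- t0 + s).
  by move=> h; rewrite /c; case: asboolP => // h1; exact: agree.
pose a := Num.min a1 (a2 + t0); pose b := Num.max b1 (b2 + t0).
have Hc : gcurve (fun=> 1) `]a, b[%classic c.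
  move=> s i /=; rewrite in_itv /= => sab di.
  have [h1|h1] := boolP (a1 < s < b1).
    have i1 : I1 s by rewrite /I1 /= in_itv.
    have di1 : dom i (c1 s) by rewrite -cE1.
    have ne : \forall u \near s, c1 u = c u.
      by apply: filterS (near_itv h1) => u hu; rewrite cE1.
    by have := gcurve_near H1 i1 di1 ne.
  have h2 : a2 + t0 < s < b2 + t0.
    apply: union_itv t1 _ sab h1; move/andP: z2 => [? ?]; apply/andP; split; lra.
  have i2 : I2 s by rewrite /I2 /= in_itv.
  have di2 : dom i (c2 (- t0 + s)) by rewrite -cE2.
  have ne : \forall u \near s, c2 (- t0 + u) = c u.
    by apply: filterS (near_itv h2) => u hu; rewrite cE2.
  by have := gcurve_near H2' i2 di2 ne.
have c0 : c 0 = c1 0 by rewrite cE1 // /I1 /= in_itv.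
have ct : c (t0 + t) = c2 t.
  rewrite cE2 ?addKr // /I2 /= in_itv /=; move/andP: t2 => [? ?]; apply/andP; split; lra.
have ab0 : a < 0 < b by move: z1 => /andP[? ?]; rewrite /a /b gt_min lt_max; apply/andP; split; apply/orP; left.
have abt : a < t0 + t < b.
  by move: t2 => /andP[? ?]; rewrite /a /b gt_min lt_max; apply/andP; split; apply/orP; right; lra.
split; first by exists a, b, c.
by rewrite -c0 (aflow_curve ab0 abt Hc) ct -e (aflow_curve z2 t2 H2).
Qed.

(** The local flow read in a chart. The time step is uniform for starting points near [x], so that
    it can be reused along an orbit. *)
Lemma chart_flow i x : dom i x -> exists d rho : R, [/\ 0 < d, 0 < rho &
  forall z, dom i z -> `|crd i z - crd i x| < rho ->
    (forall t, `|t| < d -> flows t z /\ dom i (aflow t z)) /\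
    exists L : R -> 'M[R]_m, L 0 = 1%:M /\ forall t, `|t| < d ->
      hasd (rep i (crd i \o aflow t)) (crd i z) (L t) /\
      is_derive t (1 : R) L (L t *m 'J (W i) (crd i (aflow t z)))].
Proof.
move=> dx; have oA : open (crd i @` dom i) by exact: (chart_open ok).
have Ai : (crd i @` dom i) (crd i x) by exists x.
have [d [rho [phi [d0 rho0 H]]]] := smooth_local_flow oA Ai (WC i).
exists d, rho; split=> //.
have Hf z : dom i z -> `|crd i z - crd i x| < rho -> forall t, `|t| < d ->
    [/\ flows t z, dom i (aflow t z) & crd i (aflow t z) = phi t (crd i z)].
  move=> dz zr; have [p0 pd _] := H _ zr.
  pose inv u := xget z [set y | dom i y /\ crd i y = u].
  have invP u : (crd i @` dom i) u -> dom i (inv u) /\ crd i (inv u) = u.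
    move=> [y dy e]; rewrite /inv; set S := [set y | _].
    by have : S (xget z S) by (apply: (xgetPex z); exists y).
  pose c t := inv (phi t (crd i z)).
  have cP t : `|t| < d -> dom i (c t) /\ crd i (c t) = phi t (crd i z).
    by move=> td; apply: invP; have [] := pd t td.
  have c0 : c 0 = z.
    have [|h1 h2] := cP 0; first by rewrite normr0.
    by apply: (atlas_inj ok h1 dz); rewrite h2 p0.
  have Hc : gcurve (fun=> 1) `](- d), d[%classic c.
    apply: gcurve_at => t /=; rewrite in_itv /= => tdd; exists i.
    have td : `|t| < d by rewrite ltr_norml.
    have [h1 h2] := cP t td.
    have nt : \forall s \near t, `|s| < d.
      by apply: filterS (near_itv tdd) => s /=; rewrite in_itv /= -ltr_norml.
    split=> //; first by apply: filterS nt => s /cP[].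
    rewrite scale1r h2; have [_ h] := pd t td; apply: near_eq_is_derive h.
    by apply: filterS nt => s /cP[_ /= ->].
  have dd0 : - d < 0 < d by rewrite oppr_lt0 d0.
  move=> t td; have tdd : - d < t < d by rewrite -ltr_norml.
  have e : aflow t z = c t by rewrite -{1}c0; exact: aflow_curve tdd Hc.
  by rewrite e; have [h1 h2] := cP t td; split=> //; exists (- d), d, c.
move=> z dz zr; split=> [t td|]; first by have [] := Hf z dz zr t td.
have [_ _ [L [L0 HL]]] := H _ zr; exists L; split=> [|t td]; first exact: L0.
have [h1 h2] := HL t td; have [_ _ ->] := Hf z dz zr t td; split; last exact: h2.
apply: hasd_near_eq h1.
have /near_rV[r r0 Hr] := overlap_near ok dz dz.
apply/near_rV; exists (Num.min r (rho - `|crd i z - crd i x|)); first by rewrite lt_min r0 subr_gt0.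
move=> u; rewrite lt_min ltrBrDr => /andP[/Hr[y [dy _ <-]] yr].
rewrite (rep_crd ok) //=; have [|_ _ ->] := Hf y dy _ t td => //.
by apply: le_lt_trans yr; rewrite -[crd i y - crd i x](subrKA (crd i z)) ler_normD.
Qed.

End Curves.

(** * Linearized flows *)

Section ChartMaps.
Context {R : realType} {m : nat} {X : Type} (C : charts R m X).
Hypothesis ok : atlas_ok C.
Implicit Types (i j k : idx C) (x w : X) (P Q : X -> Prop).

(** A neighbourhood of [x], seen through every chart around it. *)
Definition nearX x P := forall i, dom i x ->
  \forall u \near crd i x, forall w, dom i w -> crd i w = u -> P w.

Definition hasdX i j (phi : X -> X) x L := [/\ dom i x, dom j (phi x),
  nearX x (fun w => dom j (phi w)) & hasd (rep i (crd j \o phi)) (crd i x) L].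

Lemma nearX_at i x P : dom i x ->
  (\forall u \near crd i x, forall w, dom i w -> crd i w = u -> P w) -> nearX x P.
Proof.
move=> di H j dj.
have c := hasd_continuous (atlas_hasd ok dj di).
have H' : \forall v \near rep j (crd i) (crd j x), forall w, dom i w -> crd i w = v -> P w.
  by rewrite (rep_crd ok).
have h := c _ H'; have h2 := overlap_near ok dj di.
near=> u => w dw eu.
have [y [yj yi e]] : exists y, [/\ dom j y, dom i y & crd j y = u] by near: u.
have yw : y = w by apply: (atlas_inj ok yj dw); rewrite e eu.
have Hu : forall w, dom i w -> crd i w = rep j (crd i) u -> P w by near: u.
by apply: Hu; rewrite -?yw // -e (rep_crd ok).
Unshelve. all: by end_near.
Qed.

Lemma nearX_dom i x : dom i x -> nearX x (dom i).
Proof. by move=> di; apply: (nearX_at di); apply: filterE. Qed.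

Lemma nearX_and x P Q : nearX x P -> nearX x Q -> nearX x (fun w => P w /\ Q w).
Proof.
move=> HP HQ i di; have hp := HP i di; have hq := HQ i di.
by apply: filterS2 hp hq => u p q w dw e; split; [exact: p|exact: q].
Qed.

Lemma nearX_sub x P Q : (forall w, P w -> Q w) -> nearX x P -> nearX x Q.
Proof. by move=> s HP i di; apply: filterS (HP i di) => u p w dw e; apply: s; exact: p. Qed.

Lemma hasdX_near i j phi x L P : hasdX i j phi x L -> nearX (phi x) P -> nearX x (P \o phi).
Proof.
move=> [di dj nj h] HP; apply: (nearX_at di).
have c := hasd_continuous h.
have H' : \forall v \near rep i (crd j \o phi) (crd i x), forall w, dom j w -> crd j w = v -> P w.
  by rewrite (rep_crd ok) //=; exact: HP.
have h1 := c _ H'; have h2 := nj i di.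
near=> u => w dw eu.
have Hu : forall w, dom j w -> crd j w = rep i (crd j \o phi) u -> P w by near: u.
apply: Hu; last by rewrite -eu (rep_crd ok).
have dw' : forall w, dom i w -> crd i w = u -> dom j (phi w) by near: u.
exact: dw'.
Unshelve. all: by end_near.
Qed.

Lemma hasdX_eq i j phi psi x L : nearX x (fun w => phi w = psi w) ->
  hasdX i j phi x L -> hasdX i j psi x L.
Proof.
move=> e [di dj nj h]; have ex : phi x = psi x.
  by have := nbhs_singleton (e i di); exact.
split; rewrite -?ex //.
  by apply: nearX_sub (nearX_and e nj) => w [->].
apply: hasd_near_eq h; have h2 := overlap_near ok di di; apply: filterS2 (e i di) h2.
by move=> u eu [y [dy _ ey]]; rewrite -ey !(rep_crd ok) //= (eu y dy ey).
Qed.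

Lemma hasdX_comp i j k phi psi x L L' : hasdX i j phi x L -> hasdX j k psi (phi x) L' ->
  hasdX i k (psi \o phi) x (L *m L').
Proof.
move=> H [dj dk nk h']; have nk' := hasdX_near H nk; case: H => di _ nj h; split=> //.
apply: (@hasd_near_eq _ _ _ (rep j (crd k \o psi) \o rep i (crd j \o phi))).
  have h2 := overlap_near ok di di; apply: filterS2 (nj i di) h2.
  move=> u eu [y [dy _ e]]; rewrite /= -e !(rep_crd ok) //=; exact: eu.
by apply: hasd_comp h _; rewrite (rep_crd ok).
Qed.

Lemma hasdX_id i j x : dom i x -> dom j x -> hasdX i j id x (tjac i j x).
Proof. by move=> di dj; split=> //; [exact: nearX_dom|exact: atlas_hasd]. Qed.

Lemma hasdX_change i j i' j' phi x L : hasdX i j phi x L -> dom i' x -> dom j' (phi x) ->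
  hasdX i' j' phi x (tjac i' i x *m L *m tjac j j' (phi x)).
Proof.
move=> H di' dj'; have [di dj _ _] := H.
have h1 := hasdX_comp (phi := id) (hasdX_id di' di) H.
exact: (hasdX_comp (psi := id) h1 (hasdX_id dj dj')).
Qed.

Lemma hasdX_jac i j phi x L : hasdX i j phi x L -> 'J (rep i (crd j \o phi)) (crd i x) = L.
Proof. by move=> [_ _ _]; exact: hasd_jac. Qed.

Lemma hasdX_curve i j phi (c : R -> X) t L d : hasdX i j phi (c t) L ->
  (\forall s \near t, dom i (c s)) -> is_derive t (1 : R) (crd i \o c) d ->
  is_derive t (1 : R) (crd j \o (phi \o c)) (d *m L).
Proof.
move=> [di dj nj h] ni dc; have h' : hasd (rep i (crd j \o phi)) ((crd i \o c) t) L by [].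
apply: near_eq_is_derive (hasd_curve h' dc); apply: filterS ni => s ds /=.
exact: (rep_crd ok).
Qed.

End ChartMaps.

Record field_ok {R : realType} {m : nat} {X : choiceType} (C : charts R m X)
    (W : idx C -> 'rV[R]_m -> 'rV[R]_m) : Prop := FieldOk {
  field_atlas : atlas_ok C;
  field_cover : forall x, exists i : idx C, dom i x;
  field_sep : separated C;
  field_C2 : forall i : idx C, Ck 2 (crd i @` dom i) (W i);
  field_tjac : forall (i j : idx C) x, dom i x -> dom j x ->
    W i (crd i x) *m tjac i j x = W j (crd j x) }.

Section Linearization.
Context {R : realType} {m : nat} {X : choiceType} (C : charts R m X).
Implicit Types (i j k : idx C).
Variable W : idx C -> 'rV[R]_m -> 'rV[R]_m.
Hypothesis FW : field_ok W.
Let ok := field_atlas FW.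
Let cover := field_cover FW.
Let sep := field_sep FW.
Let WC := field_C2 FW.
Let WT := field_tjac FW.

Variable y : R -> X.
Hypothesis Hy : gcurve W (fun=> 1) setT y.
Local Notation fl := (aflow W).

Lemma orbit_near i s : dom i (y s) -> \forall r \near s, dom i (y r).
Proof. by move=> di; have [] := Hy (t := s) (i := i) I di. Qed.

Lemma orbit_derive i s : dom i (y s) -> is_derive s (1 : R) (crd i \o y) (W i (crd i (y s))).
Proof. by move=> di; have [_] := Hy (t := s) (i := i) I di; rewrite scale1r. Qed.

Lemma orbit_flow s t : flows W t (y s) /\ fl t (y s) = y (s + t).
Proof.
pose b := `|t| + 1.
have H1 : gcurve W (fun=> 1) `](- b), b[%classic (fun r => y (s + r)).
  have := @gcurve_shift _ _ _ C W y (s - b) (s + b) s.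
  rewrite addrAC subrr add0r addrAC subrr add0r; apply.
  exact: gcurve_sub Hy.
have b0 : - b < 0 < b by rewrite oppr_lt0 andbb ltr_wpDl.
have bt : - b < t < b by rewrite -ltr_norml ltrDl.
split; first by exists (- b), b, (fun r => y (s + r)); rewrite addr0.
by have := aflow_curve ok cover sep WC b0 bt H1; rewrite addr0.
Qed.

Lemma orbit_flowE u v : fl (v - u) (y u) = y v.
Proof. by have [_ ->] := orbit_flow u (v - u); rewrite addrC subrK. Qed.

Definition linearizable u v := nearX C (y u) (flows W (v - u)) /\
  forall i j : idx C, dom i (y u) -> dom j (y v) -> exists L, hasdX i j (fl (v - u)) (y u) L.

Lemma linearizable_at u v (i j : idx C) L : nearX C (y u) (flows W (v - u)) ->
  hasdX i j (fl (v - u)) (y u) L -> linearizable u v.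
Proof.
move=> n H; split=> // i' j' di' dj'.
by exists (tjac i' i (y u) *m L *m tjac j j' (fl (v - u) (y u))); apply: hasdX_change; rewrite ?orbit_flowE.
Qed.

Lemma linearizable_trans u v w : linearizable u v -> linearizable v w -> linearizable u w.
Proof.
move=> [n1 g1] [n2 g2]; have [i di] := cover (y u); have [j dj] := cover (y v).
have [k dk] := cover (y w).
have [L H1] := g1 i j di dj; have [L' H2] := g2 j k dj dk.
have n2' : nearX C (y u) (flows W (w - v) \o fl (v - u)).
  by apply: (hasdX_near ok H1); rewrite orbit_flowE.
have e : w - u = (v - u) + (w - v) by rewrite [RHS]addrC subrKA.
have n := nearX_and n1 n2'.
have n' : nearX C (y u) (fun x => flows W (w - u) x /\ (fl (w - v) \o fl (v - u)) x = fl (w - u) x).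
  by apply: nearX_sub n => x [a b]; rewrite e; have [? ->] := flows_add ok cover sep WC a b.
apply: (@linearizable_at u w i k (L *m L')); first by apply: nearX_sub n' => x [].
apply: (hasdX_eq ok (phi := fl (w - v) \o fl (v - u))); first by apply: nearX_sub n' => x [].
by apply: (hasdX_comp ok H1); rewrite orbit_flowE.
Qed.

Lemma linearizable_local t : exists2 d, 0 < d & forall u v, `|u - t| < d -> `|v - t| < d -> linearizable u v.
Proof.
have [k dk] := cover (y t).
have [d [rho [d0 rho0 H]]] := chart_flow ok cover sep WC WT dk.
have n1 := orbit_near dk.
have n2 : \forall s \near t, `|crd k (y s) - crd k (y t)| < rho.
  have h : \forall u \near (crd k \o y) t, `|u - crd k (y t)| < rho by apply/near_rV; exists rho.
  exact: (is_derive_continuous (orbit_derive dk)) _ h.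
have /near_R[d' d'0 Hd] : \forall s \near t, dom k (y s) /\ `|crd k (y s) - crd k (y t)| < rho.
  exact: filterI.
exists (Num.min d' (d / 2)) => [|u v]; first by rewrite lt_min d'0 divr_gt0.
rewrite !lt_min => /andP[u1 u2] /andP[v1 v2].
have [du ur] := Hd u u1; have [dv vr] := Hd v v1.
have vu : `|v - u| < d.
  by rewrite -(subrKA t) [d]splitr (le_lt_trans (ler_normD _ _)) // ltrD // distrC.
have nr : nearX C (y u) (fun w => dom k w /\ `|crd k w - crd k (y t)| < rho).
  apply: (nearX_at ok du); apply/near_rV; exists (rho - `|crd k (y u) - crd k (y t)|).
    by rewrite subr_gt0.
  move=> w wr z dz e; split=> //; rewrite ltrBrDr in wr; apply: le_lt_trans wr.
  by rewrite e -[w - crd k (y t)](subrKA (crd k (y u))) ler_normD.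
have [h1 [L [_ h2]]] := H (y u) du ur; have [hL _] := h2 _ vu.
apply: (@linearizable_at u v k k (L (v - u))).
  by apply: nearX_sub nr => w [dw wr]; have [h _] := H w dw wr; have [] := h _ vu.
split=> //; first by rewrite orbit_flowE.
by apply: nearX_sub nr => w [dw wr]; have [h _] := H w dw wr; have [] := h _ vu.
Qed.

(** Short time steps come from [chart_flow] and are composed along the orbit. Both directions of
    time are proved together because the gluing runs forward only. *)
Lemma orbit_linearizable u v : linearizable u v.
Proof.
have main a b : a <= b -> linearizable a b /\ linearizable b a.
  move=> ab; apply: (@interval_glue R (fun u v => linearizable u v /\ linearizable v u) a b ab).
    move=> r _; have [d d0 h] := linearizable_local r; exists d => // p q _ pq _ p1 q1.
    by split; apply: h; rewrite ltr_norml; apply/andP; split; lra.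
  by move=> p q r _ _ _ _ [h1 h2] [h3 h4]; split; [exact: linearizable_trans h1 h3|exact: linearizable_trans h4 h2].
by have [uv|vu] := leP u v; [have [] := main _ _ uv|have [] := main _ _ (ltW vu)].
Qed.

Definition lin i j s : 'M[R]_m := 'J (rep i (crd j \o fl s)) (crd i (y 0)).

Lemma lin_hasdX i j s : dom i (y 0) -> dom j (y s) -> hasdX i j (fl s) (y 0) (lin i j s).
Proof.
move=> di dj; have [_ g] := orbit_linearizable 0 s; have [L] := g i j di dj; rewrite subr0 => h.
by rewrite /lin (hasdX_jac h).
Qed.

Lemma lin_chart i i' j j' s : dom i (y 0) -> dom i' (y 0) -> dom j (y s) -> dom j' (y s) ->
  lin i' j' s = tjac i' i (y 0) *m lin i j s *m tjac j j' (y s).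
Proof.
move=> di di' dj dj'; apply: hasdX_jac.
have e : y s = fl s (y 0) by have := orbit_flowE 0 s; rewrite subr0.
by rewrite [in tjac j j' _]e; apply: (hasdX_change ok (lin_hasdX di dj) di'); rewrite -e.
Qed.

Lemma flow0 x : fl 0 x = x.
Proof.
have [i di] := cover x; have [d [rho [d0 rho0 H]]] := chart_flow ok cover sep WC WT di.
have [|h _] := H x di; first by rewrite subrr normr0.
have [|[a [b [c [ab _ Hc e]]]] _] := h 0; first by rewrite normr0.
by have := aflow_curve ok cover sep WC ab ab Hc; rewrite e.
Qed.

Lemma lin0 i : dom i (y 0) -> lin i i 0 = 1%:M.
Proof.
move=> di; rewrite -(tjac_id ok di); apply: hasdX_jac.
apply: (hasdX_eq ok (phi := id)); last exact: hasdX_id.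
by apply: (nearX_sub (P := dom i)) (nearX_dom ok di) => w _; rewrite flow0.
Qed.

(** Near time [s] the flow is the flow up to [s] followed by a short one in the chart of [y s],
    whose differential solves the variational equation from the identity. *)
Lemma lin_derive i j s : dom i (y 0) -> dom j (y s) ->
  is_derive s (1 : R) (lin i j) (lin i j s *m 'J (W j) (crd j (y s))).
Proof.
move=> di dj; have [d [rho [d0 rho0 H]]] := chart_flow ok cover sep WC WT dj.
have [|h1 [L [L0 h2]]] := H (y s) dj; first by rewrite subrr normr0.
have dL : is_derive s (1 : R) (fun r => lin i j s *m L (r - s)) (lin i j s *m 'J (W j) (crd j (y s))).
  apply: is_derive_mulmxl.
  have [_] := h2 0 (eq_ind_r (fun x => x < d) d0 (normr0 _)).
  rewrite L0 mul1mx; have [_ ->] := orbit_flow s 0; rewrite addr0 => dL.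
  have dL' : is_derive (- s + s) (1 : R) L ('J (W j) (crd j (y s))) by rewrite addNr.
  have := is_derive_mx_comp dL' (is_derive_addl (- s) s); rewrite scale1r.
  by have -> : (fun r => L (- s + r)) = (fun r => L (r - s)) by apply/funext => r; rewrite addrC.
apply: near_eq_is_derive dL.
have n1 := orbit_near dj.
have n2 : \forall r \near s, `|r - s| < d by apply/near_R; exists d.
apply: filterS2 n1 n2 => r dr rd; symmetry.
have hr : hasdX j j (fl (r - s)) (y s) (L (r - s)).
  have [hL _] := h2 _ rd; split=> //; first by rewrite orbit_flowE.
  have nr : nearX C (y s) (fun w => dom j w /\ `|crd j w - crd j (y s)| < rho).
    by apply: (nearX_at ok dj); apply/near_rV; exists rho => // u ur w dw ->.
  by apply: nearX_sub nr => w [dw wr]; have [h _] := H w dw wr; have [] := h _ rd.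
apply: hasdX_jac.
have es : fl s (y 0) = y s by have := orbit_flowE 0 s; rewrite subr0.
have hs := lin_hasdX di dj.
apply: (hasdX_eq ok (phi := fl (r - s) \o fl s)); last by apply: (hasdX_comp ok hs); rewrite es.
have [n3 _] := orbit_linearizable 0 s; have [n4 _] := orbit_linearizable s r.
rewrite subr0 in n3; rewrite -es in n4.
apply: nearX_sub (nearX_and n3 (hasdX_near ok hs n4)) => w [a b] /=.
by have [_] := flows_add ok cover sep WC a b; rewrite addrC subrK.
Qed.

Lemma lin_field i j s : dom i (y 0) -> dom j (y s) ->
  W i (crd i (y 0)) *m lin i j s = W j (crd j (y s)).
Proof.
move=> di dj; have h := hasdX_curve ok (lin_hasdX di dj) (orbit_near di) (orbit_derive di).
have es : fl s \o y = fun r => y (s + r).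
  by apply/funext => r; have [_ /=] := orbit_flow r s; rewrite addrC.
rewrite es in h.
have dj' : dom j (y (s + 0)) by rewrite addr0.
have := is_derive_mx_comp (orbit_derive dj') (is_derive_addl s 0); rewrite scale1r addr0.
by case: h => _ <- [_ <-].
Qed.

Lemma orbit_const p q (G : idx C -> R -> 'M[R]_(p, q)) :
  (forall i j s, dom i (y s) -> dom j (y s) -> G i s = G j s) ->
  (forall i s, dom i (y s) -> is_derive s (1 : R) (G i) 0) ->
  forall i j u v, dom i (y u) -> dom j (y v) -> G i u = G j v.
Proof.
move=> Gch Gd.
pose Q u v := forall i j, dom i (y u) -> dom j (y v) -> G i u = G j v.
have main a b : a <= b -> Q a b.
  move=> ab; apply: (@interval_glue R Q a b ab); last first.
    move=> u v w _ _ _ _ h1 h2 i j di dj; have [k dk] := cover (y v).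
    by rewrite (h1 i k) // (h2 k j).
  move=> t _; have [k dk] := cover (y t); have /near_R[d d0 hd] := orbit_near dk.
  exists d => // u v _ uv _ ud vd i j di dj.
  have dk' r : t - d < r < t + d -> dom k (y r).
    by move=> h; apply: hd; rewrite ltr_norml; apply/andP; split; lra.
  have u1 : t - d < u < t + d by apply/andP; split; lra.
  have v1 : t - d < v < t + d by apply/andP; split; lra.
  rewrite (Gch i k u di (dk' u u1)) (Gch j k v dj (dk' v v1)); apply/matrixP => a' b'.
  apply: (@derive_zero_const R (fun r => G k r a' b') (t - d) (t + d)) => // r rd.
  by have /is_derive_mxP/(_ a' b') := Gd k r (dk' r rd); rewrite mxE.
move=> i j u v di dj; have [uv|vu] := leP u v; first exact: main.
by symmetry; apply: main (ltW vu) _ _ dj di.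
Qed.

End Linearization.

(** The vanishing of the Lie derivative of the form, in coordinates: [O] is the form, [T c] its
    partial derivatives, [A] the Jacobian of the field [w], and [h] the Hessian obtained by
    differentiating [O w = dH]. Symmetry of [h] and the cyclic identity for [T] give the result. *)
Lemma lie_form_zero {R : realType} m (O A : 'M[R]_m) (T : 'I_m -> 'M[R]_m) (w : 'rV[R]_m)
    (h : 'M[R]_m) : O^T = - O ->
  (forall a b, h a b = \sum_c T a b c * w 0 c + \sum_c O b c * A a c) -> h^T = h ->
  (forall a b c, T a c b = - T a b c) ->
  (forall a b c, T a b c + T b c a + T c a b = 0) ->
  A *m O + \sum_c w 0 c *: T c + O *m A^T = 0.
Proof.
move=> Os hE hs Ts cl; apply/matrixP => a b.
have O' c : O c b = - O b c by have := congr1 (fun M : 'M[R]_m => M b c) Os; rewrite !mxE.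
have e1 : (A *m O) a b = \sum_c T a b c * w 0 c - h a b.
  rewrite hE opprD addrA subrr add0r mxE -sumrN; apply: eq_bigr => c _.
  by rewrite O' mulrN mulrC.
have e2 : (O *m A^T) a b = h b a - \sum_c T b a c * w 0 c.
  by rewrite hE addrAC subrr add0r mxE; apply: eq_bigr => c _; rewrite mxE.
have e3 : (\sum_c w 0 c *: T c) a b = \sum_c T c a b * w 0 c.
  by rewrite summxE; apply: eq_bigr => c _; rewrite mxE mulrC.
have hab : h b a = h a b by rewrite -{1}hs mxE.
have e4 : \sum_c T a b c * w 0 c + \sum_c T c a b * w 0 c - \sum_c T b a c * w 0 c = 0.
  rewrite -big_split /= -sumrB; apply: big1 => c _.
  by rewrite -mulrDl -mulrBl -Ts addrAC (cl a b c) mul0r.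
by rewrite !mxE in e1 e2 *; rewrite e1 e2 e3 hab -[RHS]e4; ring.
Qed.

Lemma Ck_mx {R : realType} (E : normedModType R) k (A : set E) p q (f : E -> 'M[R]_(p, q)) :
  open A -> (forall i j, Ck k A (fun x => f x i j)) -> Ck k A f.
Proof.
move=> oA; elim: k f => [|k IH] f H.
  by split=> // a Aa; apply/cvg_mxP => i j; exact: (Ck_cont (H i j)) a Aa.
have D v a : A a -> is_derive a v f (\matrix_(i, j) 'D_v (fun x => f x i j) a).
  move=> Aa; apply/is_derive_mxP => i j; rewrite mxE; apply: DeriveDef => //.
  exact: Ck_derivable (H i j) a Aa.
split=> [a Aa|v]; first by apply/cvg_mxP => i j; exact: (Ck_cont (H i j)) a Aa.
split=> [a Aa|]; first by have [] := D v a Aa.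
apply: (Ck_eq oA) (IH (fun a => \matrix_(i, j) 'D_v (fun x => f x i j) a) _).
  by move=> a Aa; have [_ ->] := D v a Aa.
by move=> i j; under eq_fun do rewrite mxE; exact: Ck_derive (H i j).
Qed.

Arguments chart_open {R m X C} ok i.

Lemma hasds_const {R : realType} m (f : 'rV[R]_m -> R) a (c : R) (G : 'cV[R]_m) :
  (forall u, f u = c) -> G = 0 -> hasds f a G.
Proof. by move=> e ->; have -> : f = (fun=> c) by [exact/funext]; exact: hasds_cst. Qed.

Section Pull.
Context {R : realType} {n : nat}.
Variable N : 'I_n -> 'M[R]_n.

(** Partial derivatives of the twisted form: only its position block varies, and only with the
    position. *)
Definition pull (c : 'I_(n + n)) : 'M[R]_(n + n) :=
  if fintype.split c is inl l then block_mx (N l) 0 0 0 else 0.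

Lemma pullL l : pull (lshift n l) = block_mx (N l) 0 0 0.
Proof. by rewrite /pull -/(unsplit (inl l)) unsplitK. Qed.

Lemma pullR l : pull (rshift n l) = 0.
Proof. by rewrite /pull -/(unsplit (inr l)) unsplitK. Qed.

Lemma pull_skew : (forall l, (N l)^T = - N l) -> forall a b c, pull a c b = - pull a b c.
Proof.
move=> sk a b c; have : (pull a)^T = - pull a.
  have [l ->|l ->] := split_ordP a; last by rewrite pullR trmx0 oppr0.
  by rewrite pullL tr_block_mx sk !trmx0 opp_block_mx !oppr0.
by move/(congr1 (fun K : 'M[R]_(n + n) => K b c)); rewrite !mxE.
Qed.

Lemma pull_closed : (forall a b c, N a b c + N b c a + N c a b = 0) ->
  forall a b c, pull a b c + pull b c a + pull c a b = 0.
Proof.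
move=> cl a b c.
have [a' ->|a' ->] := split_ordP a; have [b' ->|b' ->] := split_ordP b;
  have [c' ->|c' ->] := split_ordP c; rewrite ?pullL ?pullR;
  rewrite ?block_mxEul ?block_mxEur ?block_mxEdl ?block_mxEdr ?[(0 : 'M[R]_(_, _)) _ _]mxE ?addr0 //.
Qed.

End Pull.

(** * Hamiltonian fields for the twisted form *)

Section HamiltonianFields.
Context {R : realType} {n : nat} (M : manifold R n).
Local Notation CT := (cotangent_charts M).
Local Notation I := (idx CT).
Implicit Types (i j : I) (z : cotangent M).
Let okC := cotangent_atlas_ok M.

Lemma cotangent_cover (z : cotangent M) : exists i : I, dom i z.
Proof. by have [i di] := dom_cover (base z); exists i. Qed.

Lemma ccont_base (c : R -> cotangent M) t : ccont CT c t -> {for t, continuous (fun s => base (c s))}.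
Proof.
move=> H; have [i di] := cotangent_cover (c t); have [ni cc] := H i di.
move=> V /= /nbhs_interior nV; pose V' := (V^° `&` (dom (c := atlas M) i)).
have oV' : open V' by apply: openI; [exact: open_interior|exact: dom_open].
have oc := crd_open oV' (fun x (h : V' x) => h.2).
have h : (crd (c := atlas M) i @` V') (crd (c := atlas M) i (base (c t))).
  by exists (base (c t)) => //; split=> //; exact: nbhs_singleton nV.
have cq : {for t, continuous (fun s => crd (c := CT) i (c s) *m proj_q)}.
  by apply: cvg_mulmx; [exact: cc|exact: cvg_cst].
have E s : crd (c := CT) i (c s) *m proj_q = crd (c := atlas M) i (base (c s)).
  by rewrite proj_qE row_mxKl.
have nc : \forall u \near crd (c := CT) i (c t) *m proj_q, (crd (c := atlas M) i @` V') u.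
  by rewrite E; exact: open_nbhs_nbhs.
have := cq _ nc; rewrite /nbhs /=; apply: filterS2 ni => s ds [x [Vx dx]]; rewrite E => e.
have es : base (c s) = x by exact: (crd_inj ds dx (esym e)).
by rewrite /= es; exact: interior_subset Vx.
Qed.

Lemma cotangent_separated : separated CT.
Proof.
move=> c1 c2 t h1 h2 H.
have eb : base (c1 t) = base (c2 t).
  apply: contrapT => /eqP ne; have := @manifold_hausdorff _ _ M.
  rewrite open_hausdorff => /(_ _ _ ne) [[A B] /= [/set_mem A1 /set_mem B2] [oA oB AB]].
  have n1 : \forall s \near t, A (base (c1 s)) by exact: ccont_base h1 _ (open_nbhs_nbhs (conj oA A1)).
  have n2 : \forall s \near t, B (base (c2 s)) by exact: ccont_base h2 _ (open_nbhs_nbhs (conj oB B2)).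
  have n12 : \forall s \near t, A (base (c1 s)) /\ B (base (c2 s)) by exact: filterI.
  have /near_R[d d0 hd] := n12; have [s sd e] := H d d0.
  have [a b] := hd s sd; have : (A `&` B) (base (c1 s)) by split=> //; rewrite e.
  by rewrite (eqP AB).
have [i di] := cotangent_cover (c1 t); have di2 : dom (c := CT) i (c2 t) by rewrite /= -eb.
have [_ k1] := h1 i di; have [_ k2] := h2 i di2.
apply: (atlas_inj okC di di2); apply/eqP; rewrite -subr_eq0 -normr_le0; apply/ler_addgt0Pr => e e0.
rewrite add0r; have e2 : 0 < e / 2 by rewrite divr_gt0.
have b1 : \forall u \near crd (c := CT) i (c1 t), `|u - crd (c := CT) i (c1 t)| < e / 2.
  by apply/near_rV; exists (e / 2).
have b2 : \forall u \near crd (c := CT) i (c2 t), `|u - crd (c := CT) i (c2 t)| < e / 2.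
  by apply/near_rV; exists (e / 2).
have n12 : \forall s \near t, `|crd (c := CT) i (c1 s) - crd (c := CT) i (c1 t)| < e / 2 /\
    `|crd (c := CT) i (c2 s) - crd (c := CT) i (c2 t)| < e / 2.
  by apply: filterI; [exact: k1 _ b1|exact: k2 _ b2].
have /near_R[d d0 hd] := n12; have [s sd es] := H d d0.
have [/= a b] := hd s sd; rewrite -es in b.
rewrite -(subrKA (crd (c := CT) i (c1 s))) (le_trans (ler_normD _ _)) // [e]splitr lerD //.
  by rewrite distrC ltW.
exact: ltW.
Qed.

Variable sigma : tensor2 M.
Hypothesis sigma_closed : closed_2form sigma.

Definition twisted_inv (s : 'M[R]_n) : 'M[R]_(n + n) := block_mx 0 1%:M (- 1%:M) s.

Lemma twisted_mxK s : twisted_mx s *m twisted_inv s = 1%:M.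
Proof.
rewrite /twisted_mx /twisted_inv mulmx_block !(mulmx0, mul0mx, mulmx1, mul1mx, mulNmx, mulmxN).
by rewrite !(opprK, addr0, add0r) subrr -scalar_mx_block.
Qed.

Lemma twisted_invK s : twisted_inv s *m twisted_mx s = 1%:M.
Proof. exact: mulmx1C (twisted_mxK s). Qed.

Definition sigc (i : I) (u : 'rV[R]_(n + n)) : 'M[R]_n :=
  rep (C := atlas M) i (sigma ^~ i) (u *m proj_q).

Lemma sigc_crd i z : dom i z -> sigc i (crd i z) = sigma (base z) i.
Proof. by move=> di; rewrite /sigc proj_qE row_mxKl (rep_crd (manifold_atlas_ok M)). Qed.

Lemma crd_base_image (i : I) :
  crd i @` dom i = (mulmxr (@proj_q R n)) @^-1` (crd (c := atlas M) i @` dom (c := atlas M) i).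
Proof. by have := cotangent_overlap (M := M) i i; rewrite !setIid. Qed.

Lemma sig_Ck k i a b : Ck k (crd i @` dom i) (fun u => sigc i u a b).
Proof.
rewrite crd_base_image; have [[_ /(_ i)/(smooth_Ck k) s] _ _] := sigma_closed.
have oM := chart_open (manifold_atlas_ok M) i.
exact: (Ck_lin (l := mulmxr (@proj_q R n)) (@mulmxr_continuous _ _ _ _) (Ck_entry a b oM s)).
Qed.

Definition ham (H : cotangent M -> R) (i : I) (u : 'rV[R]_(n + n)) : 'rV[R]_(n + n) :=
  (twisted_inv (sigc i u) *m grad (rep i H) u)^T.

Section Field.
Variable H : cotangent M -> R.
Hypothesis Hs : smooth_fun CT H.

Lemma rep_hasds i z : dom i z -> hasds (rep i H) (crd i z) (grad (rep i H) (crd i z)).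
Proof.
move=> di; apply: (Ck1_hasds (chart_open okC i)); first by exists z.
exact: smooth_Ck (Hs i).
Qed.

Lemma ham_grad i z : dom i z ->
  omega sigma i z *m (ham H i (crd i z))^T = grad (rep i H) (crd i z).
Proof. by move=> di; rewrite /ham trmxK sigc_crd // mulmxA twisted_mxK mul1mx. Qed.

Lemma is_ham_vectorP i z X : dom i z ->
  is_ham_vector sigma H i z X <-> X = ham H i (crd i z).
Proof.
move=> di; have D v := hasds_derive v (rep_hasds di); split=> [h|-> v]; last first.
  by rewrite -mulmxA ham_grad //; have [_ ->] := D v.
have e : omega sigma i z *m X^T = grad (rep i H) (crd i z).
  apply/colP => k; have [_ d] := D (delta_mx 0 k); have := h (delta_mx 0 k).
  by rewrite d -mulmxA -!rowE !mxE.
rewrite -[X]trmxK -[X^T]mul1mx -(twisted_invK (sigma (base z) i)) -mulmxA e.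
by rewrite /ham sigc_crd.
Qed.

Lemma ham_C2 i : Ck 2 (crd i @` dom i) (ham H i).
Proof.
have oA := chart_open okC i.
apply: Ck_mx => // a k; rewrite ord1.
have -> : (fun u => ham H i u 0 k) = (fun u => \sum_l twisted_inv (sigc i u) k l *
    'D_(delta_mx 0 l) (rep i H) u).
  apply/funext => u; rewrite /ham mxE [LHS]mxE; apply: eq_bigr => l _; congr (_ * _).
  exact: mxE.
apply: Ck_sum => // l; apply: CkM => //; last by apply: Ck_derive; exact: smooth_Ck (Hs i).
rewrite /twisted_inv; have [k' ->|k' ->] := split_ordP k; have [l' ->|l' ->] := split_ordP l.
- by under eq_fun do rewrite block_mxEul; exact: Ck_cst.
- by under eq_fun do rewrite block_mxEur; exact: Ck_cst.
- by under eq_fun do rewrite block_mxEdl; exact: Ck_cst.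
- by under eq_fun do rewrite block_mxEdr; exact: sig_Ck.
Qed.

Lemma ham_tjac i j z : dom i z -> dom j z ->
  ham H i (crd i z) *m tjac i j z = ham H j (crd j z).
Proof.
move=> di dj; have [st _ _] := sigma_closed.
have g := hasds_rep_change okC di dj (rep_hasds dj).
have ge := hasds_unique (rep_hasds di) g.
have := cotangent_tjac_symplectic st di dj.
have := tjac_unit okC di dj; move: (ham_grad di) (ham_grad dj) ge; move: (tjac i j z) => T.
rewrite /omega; move: (grad _ _) (grad _ _) => gi gj; move: (ham H i _) (ham H j _) => hi hj.
move=> e1 e2 eg uT eO; rewrite eO eg -!mulmxA in e1; move/(can_inj (mulKmx uT)): e1.
rewrite -e2 -trmx_mul => /(congr1 (mulmx (twisted_inv (sigma (base z) j)))).
by rewrite !mulmxA twisted_invK !mul1mx => /(congr1 trmx); rewrite !trmxK.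
Qed.

Lemma ham_field_ok : field_ok (ham H).
Proof.
split; [exact: okC|exact: cotangent_cover|exact: cotangent_separated|exact: ham_C2|exact: ham_tjac].
Qed.

Lemma integral_curveP eta A (c : R -> cotangent M) :
  integral_curve sigma H eta A c <-> gcurve (ham H) (fun=> eta) A c.
Proof.
split=> h t i At di; have [near_t d] := h t i At di; split=> //.
  by case: d => X /(is_ham_vectorP _ di) ->.
by exists (ham H i (crd i (c t))) => //; exact/is_ham_vectorP.
Qed.

Lemma flow_aflow t z : flow sigma H t z = aflow (ham H) t z.
Proof.
rewrite /flow /aflow; congr xget; apply/seteqP; split=> z' [a [b [c [h1 h2 h3 h4 h5]]]];
  by exists a, b, c; split=> //; exact/integral_curveP.
Qed.

Lemma dflow_lin (y : R -> cotangent M) t i j : dflow sigma H t (y 0) i j = lin (ham H) y i j t.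
Proof.
by rewrite /dflow /lin; congr ('J (rep i _) _); apply/funext => z; rewrite /= flow_aflow.
Qed.

Lemma omega_skew i z : dom i z -> (omega sigma i z)^T = - omega sigma i z.
Proof.
move=> di; have [_ sk _] := sigma_closed.
rewrite /omega /twisted_mx tr_block_mx (sk _ i) // trmx1 trmx0 opp_block_mx oppr0 opprK.
by rewrite linearN /= trmx1.
Qed.

Definition dom_form (i : I) (u : 'rV[R]_(n + n)) : 'I_(n + n) -> 'M[R]_(n + n) :=
  pull (fun l => 'D_(delta_mx 0 l) (rep (C := atlas M) i (sigma ^~ i)) (u *m proj_q)).

Lemma omega_hasds i z a b : dom i z ->
  hasds (fun u => twisted_mx (sigc i u) a b) (crd i z) (\col_c dom_form i (crd i z) c a b).
Proof.
move=> di; have di' : dom (c := atlas M) i (base z) by [].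
pose s := rep (C := atlas M) i (sigma ^~ i).
have [[_ /(_ i)/(smooth_Ck 1) sm] _ _] := sigma_closed.
have oM := chart_open (manifold_atlas_ok M) i.
have xi : (crd (c := atlas M) i @` dom (c := atlas M) i) (crd (c := CT) i z *m proj_q).
  by rewrite proj_qE row_mxKl; exists (base z).
have hs a' b' : hasds (fun u => sigc i u a' b') (crd i z)
    (\col_c (if fintype.split c is inl l then ('D_(delta_mx 0 l) s (crd (c := CT) i z *m proj_q)) a' b' else 0)).
  have h := Ck1_hasds oM xi (Ck_entry a' b' oM sm).
  have := hasds_comp (hasd_lin (@proj_q R n) (crd (c := CT) i z)) h.
  have -> // : proj_q *m grad (fun x => s x a' b') (crd (c := CT) i z *m proj_q) =
    \col_c (if fintype.split c is inl l then ('D_(delta_mx 0 l) s (crd (c := CT) i z *m proj_q)) a' b' else 0).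
  have dE l : grad (fun x => s x a' b') (crd (c := CT) i z *m proj_q) l 0 =
      ('D_(delta_mx 0 l) s (crd (c := CT) i z *m proj_q)) a' b'.
    rewrite mxE; have d := Ck_derivable (v := delta_mx 0 l) sm xi.
    have /is_derive_mxP/(_ a' b')[_ ->] //: is_derive (crd (c := CT) i z *m proj_q) (delta_mx 0 l) s
      ('D_(delta_mx 0 l) s (crd (c := CT) i z *m proj_q)) by [].
  move: (grad _ _) dE => g gE; apply/colP => c; rewrite /proj_q mul_col_mx mul1mx mul0mx [RHS]mxE mxE.
  by case: (fintype.split c) => l; rewrite ?gE // mxE.
have cE (a1 b1 : 'I_(n + n)) : (\col_c dom_form i (crd i z) c a1 b1) =
   \col_c (if fintype.split c is inl l then
      (block_mx ('D_(delta_mx 0 l) s (crd (c := CT) i z *m proj_q)) 0 0 0 : 'M[R]_(n + n)) a1 b1 else 0).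
  by apply/colP => c; rewrite [LHS]mxE [RHS]mxE /dom_form /pull; case: (fintype.split c) => // l; rewrite mxE.
have zE : \col_(c < n + n) (if fintype.split c is inl _ then 0 else 0) = 0 :> 'cV[R]_(n + n).
  by apply/colP => c; rewrite !mxE; case: (fintype.split c).
rewrite cE /twisted_mx; have [a' ->|a' ->] := split_ordP a; have [b' ->|b' ->] := split_ordP b.
- have -> : (fun u => block_mx (sigc i u) (- 1%:M) 1%:M 0 (lshift n a') (lshift n b')) =
     (fun u => sigc i u a' b') by apply/funext => u; rewrite block_mxEul.
  have := hs a' b'; congr hasds; apply/colP => c; rewrite [LHS]mxE [RHS]mxE.
  by case: (fintype.split c) => // l; rewrite block_mxEul.
- apply: (@hasds_const _ _ _ _ ((- 1%:M) a' b')) => [u|]; first exact: block_mxEur.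
  by rewrite -[RHS]zE; apply/colP => c; rewrite [LHS]mxE [RHS]mxE; case: (fintype.split c) => // l; rewrite block_mxEur mxE.
- apply: (@hasds_const _ _ _ _ (1%:M a' b')) => [u|]; first exact: block_mxEdl.
  by rewrite -[RHS]zE; apply/colP => c; rewrite [LHS]mxE [RHS]mxE; case: (fintype.split c) => // l; rewrite block_mxEdl mxE.
- apply: (@hasds_const _ _ _ _ 0) => [u|]; first by rewrite block_mxEdr mxE.
  by rewrite -[RHS]zE; apply/colP => c; rewrite [LHS]mxE [RHS]mxE; case: (fintype.split c) => // l; rewrite block_mxEdr mxE.
Qed.

Lemma sigma_derive i z l : dom i z -> is_derive (crd i z *m proj_q) (delta_mx 0 l)
  (rep (C := atlas M) i (sigma ^~ i))
  ('D_(delta_mx 0 l) (rep (C := atlas M) i (sigma ^~ i)) (crd i z *m proj_q)).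
Proof.
move=> di; have [[_ /(_ i)/(smooth_Ck 1) sm] _ _] := sigma_closed.
apply: DeriveDef => //; apply: (Ck_derivable sm).
by rewrite proj_qE row_mxKl; exists (base z).
Qed.

Lemma dom_form_skew i z a b c : dom i z ->
  dom_form i (crd i z) a c b = - dom_form i (crd i z) a b c.
Proof.
move=> di; apply: pull_skew => l; have d := sigma_derive l di; have [_ sk _] := sigma_closed.
have dT := is_derive_trmx d; have dN := is_deriveN d.
have e : \forall u \near crd i z *m proj_q,
    (rep (C := atlas M) i (sigma ^~ i) u)^T = (- rep (C := atlas M) i (sigma ^~ i)) u.
  have := overlap_near (manifold_atlas_ok M) (i := i) (j := i) di di.
  rewrite proj_qE row_mxKl; apply: filterS => u [x [dx _ <-]].
  by rewrite /= opprfctE (rep_crd (manifold_atlas_ok M)) // sk.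
have dT' := near_eq_is_derive e dT.
by case: dT' dN => _ <- [_ <-].
Qed.

Lemma dom_form_closed i z a b c : dom i z -> let T := dom_form i (crd i z) in
  T a b c + T b c a + T c a b = 0.
Proof.
move=> di; apply: pull_closed => a' b' c'; have [_ _ cl] := sigma_closed.
by have := cl (base z) i a' b' c' di; rewrite /= proj_qE row_mxKl.
Qed.

Lemma lie_ham i z : dom i z ->
  'J (ham H i) (crd i z) *m omega sigma i z
  + \sum_c ham H i (crd i z) 0 c *: dom_form i (crd i z) c
  + omega sigma i z *m ('J (ham H i) (crd i z))^T = 0.
Proof.
move=> di; have oA := chart_open okC i.
have zi : (crd i @` dom i) (crd i z) by exists z.
pose h : 'M[R]_(n + n) := \matrix_(a, b) grad (fun u => 'D_(delta_mx 0 b) (rep i H) u) (crd i z) a 0.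
have sH := smooth_Ck 2 (Hs i).
have hJ : hasd (ham H i) (crd i z) ('J (ham H i) (crd i z)) by apply: Ck1_hasd oA zi (CkW (@ham_C2 i)).
move: ('J (ham H i) (crd i z)) hJ => A hA.
apply: (@lie_form_zero _ _ _ _ _ _ h).
- exact: omega_skew.
- move=> a b; rewrite mxE.
  have h1 : hasds (fun u => 'D_(delta_mx 0 b) (rep i H) u) (crd i z)
      (grad (fun u => 'D_(delta_mx 0 b) (rep i H) u) (crd i z)).
    by apply: (Ck1_hasds oA zi); exact: Ck_derive sH.
  have h2 : hasds (fun u => \sum_c twisted_mx (sigc i u) b c * ham H i u 0 c) (crd i z)
     (\sum_c (ham H i (crd i z) 0 c *: (\col_c' dom_form i (crd i z) c' b c)
       + twisted_mx (sigc i (crd i z)) b c *: col c A)).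
    apply: hasds_sum => c; apply: hasdsM; first exact: omega_hasds.
    by move/hasdP: hA; exact.
  have h3 := hasds_near_eq _ h2.
  have e : grad (fun u => 'D_(delta_mx 0 b) (rep i H) u) (crd i z) =
     \sum_c (ham H i (crd i z) 0 c *: (\col_c' dom_form i (crd i z) c' b c)
       + twisted_mx (sigc i (crd i z)) b c *: col c A).
    apply: (hasds_unique h1); apply: h3.
    have := overlap_near okC di di; apply: filterS => u [z' [dz' _ <-]].
    have := congr1 (fun K : 'cV[R]_(n + n) => K b 0) (ham_grad dz').
    rewrite sigc_crd // [X in _ = X]mxE => <-; rewrite mxE /omega.
    by apply: eq_bigr => c _; rewrite [_^T c 0]mxE.
  move: (grad _ _) e => g ->; rewrite sigc_crd // /omega summxE -big_split /=.
  by apply: eq_bigr => c _; rewrite !mxE mulrC.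
- apply/matrixP => a b; rewrite mxE [LHS]mxE [RHS]mxE.
  exact: (grad_sym a b oA zi sH).
- by move=> a b c; exact: dom_form_skew.
- by move=> a b c; exact: dom_form_closed.
Qed.

Section Orbit.
Variable y : R -> cotangent M.
Hypothesis Hy : gcurve (ham H) (fun=> 1) setT y.

(** The form transported by the linearized flow is independent of the chart, the transitions being
    symplectic, and its derivative vanishes by the variational equation and [lie_ham]. *)
Lemma lin_omega i j s : dom i (y 0) -> dom j (y s) ->
  lin (ham H) y i j s *m omega sigma j (y s) *m (lin (ham H) y i j s)^T = omega sigma i (y 0).
Proof.
move=> di dj; have FW := ham_field_ok; have [st _ _] := sigma_closed.
pose G k r := lin (ham H) y i k r *m twisted_mx (sigc k (crd k (y r))) *m (lin (ham H) y i k r)^T.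
have GE k r : dom k (y r) ->
    G k r = lin (ham H) y i k r *m omega sigma k (y r) *m (lin (ham H) y i k r)^T.
  by move=> dk; rewrite /G sigc_crd.
have Gch k k' r : dom k (y r) -> dom k' (y r) -> G k r = G k' r.
  move=> dk dk'.
  have core : lin (ham H) y i k r *m omega sigma k (y r) *m (lin (ham H) y i k r)^T =
      lin (ham H) y i k' r *m omega sigma k' (y r) *m (lin (ham H) y i k' r)^T; last first.
    exact: (etrans (GE k r dk) (etrans core (esym (GE k' r dk')))).
  have e : lin (ham H) y i k' r = lin (ham H) y i k r *m tjac k k' (y r).
    have := lin_chart FW Hy di di dk dk'; rewrite (tjac_id okC di) mul1mx; exact.
  have := cotangent_tjac_symplectic st dk dk'; rewrite e.
  move: (lin _ _ _ _ _) (tjac _ _ _) => D T ->; by rewrite trmx_mul !mulmxA.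
have Gd k r : dom k (y r) -> is_derive r (1 : R) (G k) 0.
  move=> dk; have dl := lin_derive FW Hy di dk.
  have dO : is_derive r (1 : R) (fun r => twisted_mx (sigc k (crd k (y r))))
      (\sum_c ham H k (crd k (y r)) 0 c *: dom_form k (crd k (y r)) c).
    apply/is_derive_mxP => a b.
    have h1 : hasd (fun u => (twisted_mx (sigc k u) a b)%:M : 'rV[R]_1) ((crd k \o y) r)
        (\col_c dom_form k (crd k (y r)) c a b) by exact: hasds_hasd (omega_hasds a b dk).
    have /is_derive_mxP/(_ 0 0) := hasd_curve h1 (orbit_derive Hy dk).
    under [X in is_derive _ _ X]eq_fun do rewrite /= mxE eqxx mulr1n.
    move/is_derive_eq; apply; rewrite mxE summxE.
    by apply: eq_bigr => c _; rewrite !mxE.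
  have := is_derive_mulmx (is_derive_mulmx dl dO) (is_derive_trmx dl).
  move/is_derive_eq; apply.
  have := lie_ham dk; rewrite /omega -(sigc_crd dk).
  move: (lin _ _ _ _ _) ('J _ _) (twisted_mx _) (\sum_c _) => D A O S e.
  have -> : (D *m A *m O + D *m S) *m D^T + D *m O *m (D *m A)^T =
      D *m (A *m O + S + O *m A^T) *m D^T by rewrite trmx_mul !mulmxDr !mulmxDl !mulmxA.
  by rewrite e mulmx0 mul0mx.
have e := esym (etrans (esym (orbit_const FW Hy Gch Gd dj di)) (GE j s dj)).
rewrite e; have g0 := GE i 0 di; rewrite g0 (lin0 FW di) mul1mx trmx1; exact: mulmx1.
Qed.

End Orbit.

End Field.
End HamiltonianFields.

(** * Periodic frames *)

Lemma continuous_glue {R : realType} {V : topologicalType} (f g : R -> V) (v : R) :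
  {for v, continuous f} -> {for v, continuous g} -> f v = g v ->
  {for v, continuous (fun t => if t <= v then f t else g t)}.
Proof.
move=> cf cg e A /=; rewrite lexx => nA.
have nf : \forall t \near v, A (f t) by exact: cf.
have ng : \forall t \near v, A (g t) by apply: cg; rewrite -e.
have : \forall t \near v, A (if t <= v then f t else g t).
  by apply: filterS2 nf ng => t a b; case: ifP.
exact.
Qed.

Lemma near_eq_continuous {R : realType} {V : topologicalType} (f g : R -> V) (t : R) :
  (\forall s \near t, f s = g s) -> {for t, continuous f} -> {for t, continuous g}.
Proof.
move=> e cf A; rewrite -(nbhs_singleton e) => nA.
have nf : \forall s \near t, A (f s) by exact: cf.
have : \forall s \near t, A (g s) by apply: filterS2 nf e => s a <-.
exact.
Qed.

Lemma sign_ratio {R : realType} (c c' e : bool) (a b : R) :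
  0 < (-1) ^+ (c (+) e) * (a * b) -> 0 < (-1) ^+ (c' (+) e) * b -> 0 < (-1) ^+ (c (+) c') * a.
Proof. by case: c c' e => [] [] []; rewrite !mulr_sign /= => h1 h2; nra. Qed.

Lemma sign_prod {R : realType} (c c' e : bool) (a b : R) :
  0 < (-1) ^+ (c (+) c') * a -> 0 < (-1) ^+ (c' (+) e) * b -> 0 < (-1) ^+ (c (+) e) * (a * b).
Proof. by case: c c' e => [] [] []; rewrite !mulr_sign /= => h1 h2; nra. Qed.

Section Frames.
Context {R : realType} {n : nat} (M : manifold R n).
Local Notation CT := (cotangent_charts M).
Local Notation I := (idx CT).
Implicit Types (i j k : I).
Let okC := cotangent_atlas_ok M.
Variables (sigma : tensor2 M) (H : cotangent M -> R) (eps : idx (atlas M) -> M -> bool).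
Hypothesis sigma_closed : closed_2form sigma.
Hypothesis Hs : smooth_fun CT H.
Hypothesis eps_near : forall (i : idx (atlas M)) (x : M), dom i x -> \forall y \near x, eps i y = eps i x.
Hypothesis eps_det : forall (i j : idx (atlas M)) (x : M), dom i x -> dom j x ->
  0 < (-1) ^+ (eps i x (+) eps j x) * \det (tjac i j x).
Variable y : R -> cotangent M.
Hypothesis Hy : gcurve (ham sigma H) (fun=> 1) setT y.
Let FW := ham_field_ok sigma_closed Hs.

Lemma lin_continuous i j s : dom i (y 0) -> dom j (y s) ->
  {for s, continuous (lin (ham sigma H) y i j)}.
Proof. by move=> di dj; exact: is_derive_continuous (lin_derive FW Hy di dj). Qed.

Lemma omega_unit i z : omega sigma i z \in unitmx.
Proof. exact: (mulmx1_unit (twisted_mxK (sigma (base z) i))).1. Qed.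

Lemma lin_unit i j s : dom i (y 0) -> dom j (y s) -> lin (ham sigma H) y i j s \in unitmx.
Proof.
move=> di dj; have := omega_unit i (y 0).
by rewrite -(lin_omega sigma_closed Hs Hy di dj) !unitmx_mul => /andP[/andP[-> _] _].
Qed.

(* The variational flow supplies continuity of the Jacobians along the orbit
   without differentiating the cotangent lift of the transition maps. *)
Lemma orbit_tjac_continuous j k s : dom j (y s) -> dom k (y s) ->
  {for s, continuous (fun r => tjac (C := CT) j k (y r))}.
Proof.
move=> dj dk; have [i di] := cotangent_cover (y 0).
have lc r : dom j (y r) -> dom k (y r) ->
    lin (ham sigma H) y i k r = lin (ham sigma H) y i j r *m tjac j k (y r).
  move=> djr dkr; have := lin_chart FW Hy di di djr dkr.
  by rewrite (tjac_id okC di) mul1mx.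
apply: (@near_eq_continuous _ _ (fun r => invmx (lin (ham sigma H) y i j r) *m lin (ham sigma H) y i k r)).
  apply: filterS2 (orbit_near Hy dj) (orbit_near Hy dk) => r djr dkr.
  by rewrite (lc r djr dkr) (mulKmx (lin_unit di djr)).
apply: cvg_mulmx; last exact: lin_continuous di dk.
by apply: cvg_invmx; [exact: lin_continuous di dj|exact: lin_unit].
Qed.

Definition frame_at (Fr : R -> I -> 'M[R]_(n + n)) (t : R) :=
  (forall i j, dom i (y t) -> dom j (y t) -> Fr t j = Fr t i *m tjac i j (y t)) /\
  forall i, dom i (y t) -> [/\ {for t, continuous (fun s => Fr s i)},
    Fr t i *m omega sigma i (y t) *m (Fr t i)^T = omega0 & dlsubmx (Fr t i) = 0].

(** The upper left block of a vertical-preserving frame projects to a frame of [M] along the base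
    curve; [c] records the orientation of that frame. *)
Definition frame_sgn (c : bool) (Fr : R -> I -> 'M[R]_(n + n)) (t : R) := forall i, dom i (y t) ->
  0 < (-1) ^+ (c (+) eps i (base (y t))) * \det (ulsubmx (Fr t i)).

Lemma orbit_eps i t : dom i (y t) -> \forall s \near t, eps i (base (y s)) = eps i (base (y t)).
Proof.
move=> di; have cy : ccont CT y t by exact: gcurve_ccont Hy Logic.I.
have cb := ccont_base cy; exact: cb _ (eps_near di).
Qed.

Lemma dlsub_mul (A B : 'M[R]_(n + n)) : dlsubmx A = 0 -> dlsubmx B = 0 ->
  dlsubmx (A *m B) = 0 /\ ulsubmx (A *m B) = ulsubmx A *m ulsubmx B.
Proof.
move=> a b; rewrite -[A]submxK -[B]submxK a b mulmx_block block_mxKdl block_mxKul.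
by rewrite !(block_mxKul, mul0mx, mulmx0, addr0).
Qed.

(** A shear of the momenta by half the magnetic matrix; acting from both sides it cancels the
    magnetic term. *)
Definition untwist (s : 'M[R]_n) : 'M[R]_(n + n) := block_mx 1%:M (- (2^-1 *: s)) 0 1%:M.

Lemma untwist_omega (s : 'M[R]_n) : s^T = - s -> untwist s *m twisted_mx s *m (untwist s)^T = omega0.
Proof.
move=> sk; rewrite /untwist /twisted_mx /omega0 /twisted_mx tr_block_mx !mulmx_block.
rewrite !(trmx0, trmx1, mul1mx, mulmx1, mul0mx, mulmx0, addr0, add0r).
have e : - (1%:M : 'M[R]_n) *m (- (2^-1 *: s))^T = - (2^-1 *: s).
  by rewrite mulNmx mul1mx -scaleNr linearZ /= sk scalerN scaleNr opprK.
rewrite e; congr block_mx; rewrite -addrA -opprD -scalerDl.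
by rewrite (_ : 2^-1 + 2^-1 = 1) ?scale1r ?subrr //; field.
Qed.

Lemma frame_local t : exists2 d, 0 < d & exists c Fr,
  forall s, `|s - t| < d -> frame_at Fr s /\ frame_sgn c Fr s.
Proof.
have [k dk] := cotangent_cover (y t); have [st sk _] := sigma_closed.
have /near_R[d d0 hd] : \forall s \near t, dom k (y s) /\ eps k (base (y s)) = eps k (base (y t)).
  exact: filterI (orbit_near Hy dk) (orbit_eps dk).
exists d => //; exists (eps k (base (y t))), (fun s j => untwist (sigc sigma k (crd k (y s))) *m tjac k j (y s)).
move=> s sd; have [dks es] := hd s sd.
have sks : (sigc sigma k (crd k (y s)))^T = - sigc sigma k (crd k (y s)).
  by rewrite sigc_crd //; exact: sk.
have dls : dlsubmx (untwist (sigc sigma k (crd k (y s)))) = 0 by rewrite block_mxKdl.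
split; last first.
  move=> i di; have [ul dl _] := cotangent_tjac_vertical dks di.
  have [_ ->] := dlsub_mul dls dl; rewrite /untwist block_mxKul mul1mx ul -es; exact: eps_det.
split=> [i j di dj|i di]; first by rewrite -mulmxA (tjacM okC dks di dj).
have [ul dl _] := cotangent_tjac_vertical dks di.
have [p1 p2] := dlsub_mul dls dl; split.
- apply: cvg_mulmx; last exact: orbit_tjac_continuous.
  apply: cvg_block_mx; [exact: cvg_cst| |exact: cvg_cst|exact: cvg_cst].
  apply: cvgN; apply: cvgZl_tmp; apply/cvg_mxP => a b.
  have ks : (crd k @` dom k) ((crd k \o y) s) by exists (y s).
  have c1 := Ck_cont (sig_Ck sigma_closed 0 k a b) ks.
  exact: (continuous_comp (is_derive_continuous (orbit_derive Hy dks)) c1).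
- have := cotangent_tjac_symplectic st dks di; have := untwist_omega sks.
  have -> : omega sigma k (y s) = twisted_mx (sigc sigma k (crd k (y s))) by rewrite (sigc_crd sigma dks).
  move: (untwist _) (twisted_mx _) (tjac _ _ _) (omega _ _ _) => S O T O' e1 e2.
  by rewrite trmx_mul -e1 e2 !mulmxA.
- exact: p1.
Qed.

Lemma frame_unit Fr v i : frame_at Fr v -> dom i (y v) -> Fr v i \in unitmx.
Proof.
move=> [_ h] di; have [_ s2 _] := h i di.
have : (omega0 : 'M[R]_(n + n)) \in unitmx by exact: (mulmx1_unit omega0K).1.
by rewrite -s2 !unitmx_mul => /andP[/andP[->]].
Qed.

Lemma vp_ratio (A B O : 'M[R]_(n + n)) : B \in unitmx -> A *m O *m A^T = omega0 ->
  B *m O *m B^T = omega0 -> dlsubmx A = 0 -> dlsubmx B = 0 ->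
  vp (A *m invmx B) /\ ulsubmx (A *m invmx B) *m ulsubmx B = ulsubmx A.
Proof.
move=> uB s1 s2 d1 d2.
have dB : drsubmx B \in unitmx.
  by move: uB; rewrite -{1}[B]submxK d2 unitmxE det_ublock unitrM -!unitmxE => /andP[].
have dV : dlsubmx (invmx B) = 0.
  have := mulmxV uB; rewrite -{1}[B]submxK -{1}[invmx B]submxK mulmx_block d2.
  rewrite !mul0mx !add0r (scalar_mx_block n n) => /eq_block_mx[_ _ b _].
  by rewrite -(mulKmx dB (dlsubmx (invmx B))) b mulmx0.
have [p1 _] := dlsub_mul d1 dV; split; first split=> //.
  rewrite /sp -[in LHS]s2 trmx_mul !mulmxA (mulmxKV uB).
  have -> : A *m O *m B^T *m (invmx B)^T = A *m O.
    by rewrite -mulmxA -trmx_mul mulVmx // trmx1 mulmx1.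
  exact: s1.
by have [_ <-] := dlsub_mul p1 d2; rewrite mulmxKV.
Qed.

Lemma frame_vp Fr Fr' v i : frame_at Fr v -> frame_at Fr' v -> dom i (y v) ->
  vp (Fr v i *m invmx (Fr' v i)) /\
  forall c c', frame_sgn c Fr v -> frame_sgn c' Fr' v ->
    0 < (-1) ^+ (c (+) c') * \det (ulsubmx (Fr v i *m invmx (Fr' v i))).
Proof.
move=> h h' di; have uB := frame_unit h' di.
have [_ s1 d1] := h.2 i di; have [_ s2 d2] := h'.2 i di.
have [v1 v2] := vp_ratio uB s1 s2 d1 d2; split=> // c c' /(_ i di) e1 /(_ i di) e2.
by move: e1; rewrite -v2 det_mulmx => e1; exact: sign_ratio e1 e2.
Qed.

Lemma frame_scale (P : R -> 'M[R]_(n + n)) Fr t : {for t, continuous P} -> vp (P t) ->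
  frame_at Fr t -> frame_at (fun s j => P s *m Fr s j) t.
Proof.
move=> cP [sP dP] [h1 h2]; split=> [i j di dj|i di]; first by rewrite (h1 i j di dj) mulmxA.
have [c s d] := h2 i di; split; [by apply: cvg_mulmx| |by have [] := dlsub_mul dP d].
by rewrite trmx_mul !mulmxA -(mulmxA (P t)) -(mulmxA (P t)) s.
Qed.

Lemma frame_near Fr Fr' t : (\forall s \near t, forall j, Fr s j = Fr' s j) ->
  frame_at Fr t -> frame_at Fr' t.
Proof.
move=> e [h1 h2]; have et := nbhs_singleton e; split=> [i j di dj|i di]; first by rewrite -!et; exact: h1.
have [c s d] := h2 i di; rewrite -et; split=> //; apply: near_eq_continuous c.
by apply: filterS e => s' ->.
Qed.

Lemma frame_glue Fr Fr' v : frame_at Fr v -> frame_at Fr' v ->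
  (forall j, dom j (y v) -> Fr v j = Fr' v j) ->
  frame_at (fun t j => if t <= v then Fr t j else Fr' t j) v.
Proof.
move=> [h1 h2] [h1' h2'] e; split=> [i j di dj|i di]; rewrite lexx; first exact: h1.
have [c s d] := h2 i di; have [c' _ _] := h2' i di; split=> //.
by apply: continuous_glue => //; exact: e.
Qed.

(** Two frames differ at the junction by a constant matrix in [vp]. Multiplying the second frame by
    it restores continuity, and the orientation signs combine by [sign_prod]. *)
Lemma frame_exists a b : a <= b -> exists d c Fr, 0 < d /\
  forall t, a - d < t < b + d -> frame_at Fr t /\ frame_sgn c Fr t.
Proof.
move=> ab.
pose Q u v := exists d c Fr, 0 < d /\ forall t, u - d < t < v + d -> frame_at Fr t /\ frame_sgn c Fr t.
apply: (@interval_glue R Q a b ab).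
  move=> t _; have [d d0 [c [Fr h]]] := frame_local t; exists (d / 2); first by rewrite divr_gt0.
  move=> u v _ uv _ ud vd; exists (d / 2), c, Fr; split; first by rewrite divr_gt0.
  move=> s /andP[s1 s2]; apply: h; rewrite ltr_norml; apply/andP; split; lra.
move=> u v w _ uv vw _ [d [c [Fr [d0 h]]]] [d' [c' [Fr' [d'0 h']]]].
have vI : u - d < v < v + d by apply/andP; split; lra.
have vI' : v - d' < v < w + d' by apply/andP; split; lra.
have [f1 s1] := h v vI; have [f2 s2] := h' v vI'.
have [i di] := cotangent_cover (y v).
have [vg /(_ _ _ s1 s2) dg] := frame_vp f1 f2 di.
pose g := Fr v i *m invmx (Fr' v i).
have ge j : dom j (y v) -> Fr v j = g *m Fr' v j.
  by move=> dj; rewrite (f1.1 i j di dj) (f2.1 i j di dj) /g mulmxA mulmxKV //; exact: frame_unit.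
have fg t : v - d' < t < w + d' -> frame_at (fun s j => g *m Fr' s j) t.
  move=> ht; have [ft _] := h' t ht.
  have cg : {for t, continuous (fun _ : R => g)} by exact: cst_continuous.
  exact: (frame_scale cg vg ft).
have sg t : v - d' < t < w + d' -> frame_sgn c (fun s j => g *m Fr' s j) t.
  move=> ht j dj; have [[_ /(_ j dj)[_ _ dl]] /(_ j dj)] := h' t ht.
  have [_ ->] := dlsub_mul vg.2 dl; rewrite det_mulmx => h3.
  exact: sign_prod dg h3.
exists (Num.min d d'), c, (fun t j => if t <= v then Fr t j else g *m Fr' t j).
split; first by rewrite lt_min d0.
move=> t /andP[t1 t2]; have m1 : Num.min d d' <= d by rewrite ge_min lexx.
have m2 : Num.min d d' <= d' by rewrite ge_min lexx orbT.
split; last first.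
  move=> j dj; have [tv|vt] := leP t v.
    by have [|_ s] := h t; [apply/andP; split; lra|exact: s].
  by apply: sg => //; apply/andP; split; lra.
have [tv|vt|->] := ltgtP t v.
- have [|f _] := h t; first by apply/andP; split; lra.
  apply: frame_near f; apply/near_R; exists (v - t); first by rewrite subr_gt0.
  by move=> s; rewrite ltr_norml => /andP[_ ?] j; rewrite ifT //; lra.
- have f : frame_at (fun s j => g *m Fr' s j) t by apply: fg; apply/andP; split; lra.
  apply: frame_near f; apply/near_R; exists (t - v); first by rewrite subr_gt0.
  by move=> s; rewrite ltr_norml => /andP[? _] j; rewrite ifF //; apply/negbTE; rewrite -ltNge; lra.
- exact: (frame_glue f1 (fg v vI') ge).
Qed.

Lemma frame_shift (d : R) Fr t : (forall s, y (s - d) = y s) -> frame_at Fr (t - d) ->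
  frame_at (fun s => Fr (s - d)) t.
Proof.
move=> yd [h1 h2]; rewrite yd in h1 h2; split=> [|i di]; first exact: h1.
have [c s e] := h2 i di; split; [|exact: s|exact: e].
apply: (@continuous_comp _ _ _ (fun s : R => s - d) (fun s => Fr s i)) => //.
by apply: cvgB; [exact: cvg_id|exact: cvg_cst].
Qed.

(** After one period the frame returns up to a matrix [g] whose upper left block has positive
    determinant, because the orientation signs at both ends agree. The path from the identity to [g]
    given by [vp_path] absorbs this mismatch. *)
Lemma periodic_frame (tau : R) : 0 < tau -> (forall t, y (t + tau) = y t) ->
  exists Om, (forall t, frame_at Om t) /\ forall t j, Om (t + tau) j = Om t j.
Proof.
move=> t0 yp; have [d [c [Fr [d0 h]]]] := frame_exists (ltW t0).
have ym (m : int) s : y (s - tau * m%:~R) = y s.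
  have yn (k : nat) r : y (r + tau * k%:R) = y r.
    elim: k => [|k IH]; first by rewrite mulr0 addr0.
    by rewrite -natr1 mulrDr mulr1 addrA yp.
  case: m => k; first by rewrite -[in RHS](subrK (tau * k%:R) s) yn.
  by rewrite NegzE mulrNz mulrN opprK yn.
have I0 : 0 - d < 0 < tau + d by apply/andP; split; lra.
have I1 : 0 - d < tau < tau + d by apply/andP; split; lra.
have [f0 s0] := h 0 I0; have [f1 s1] := h tau I1.
have y1 : y tau = y 0 by rewrite -[tau]add0r yp.
pose Fr1 := fun t => Fr (t + tau).
have f1' : frame_at Fr1 0.
  rewrite /Fr1; have -> : (fun t => Fr (t + tau)) = (fun t => Fr (t - - tau)) by apply/funext => t; rewrite opprK.
  have yo s : y (s - - tau) = y s by rewrite opprK yp.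
  by apply: (frame_shift yo); rewrite opprK add0r.
have s1' : frame_sgn c Fr1 0 by move=> j dj; rewrite /Fr1 add0r -y1; apply: s1; rewrite y1.
have [i di] := cotangent_cover (y 0).
have [vg /(_ _ _ s0 s1')] := frame_vp f0 f1' di; rewrite addbb expr0 mul1r => dg.
have [G [cG G0 G1 vG]] := vp_path (lt0r_neq0 t0) vg dg.
pose F2 t j := G t *m Fr t j.
have f2 t : 0 - d < t < tau + d -> frame_at F2 t.
  move=> ht; have [ft _] := h t ht.
  have cg : {for t, continuous G} by exact: cG.
  exact: (frame_scale cg (vG t) ft).
have F2e j : dom j (y 0) -> F2 tau j = F2 0 j.
  move=> dj; rewrite /F2 G0 mul1mx G1; have := f1'.1 i j di dj; rewrite /Fr1 add0r => ->.
  by rewrite mulmxA mulmxKV ?(f0.1 i j di dj) //; have := frame_unit f1' di; rewrite /Fr1 add0r.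
(* [cl t] numbers the period [(tau (m - 1), tau m]] that contains [t], so [F2] is evaluated in
   [(0, tau]]. Continuity at the multiples of [tau] is the equality [F2e]. *)
pose cl (t : R) := Num.ceil (t / tau).
have clP t m : (cl t == m) = (tau * (m%:~R - 1) < t <= tau * m%:~R).
  have e : (tau * (m%:~R - 1) < t <= tau * m%:~R) = ((m - 1)%:~R < t / tau <= m%:~R).
    by rewrite rmorphB /= ltr_pdivlMr // ler_pdivrMr // mulrC (mulrC m%:~R).
  rewrite e; apply/eqP/idP => [<-|/ceil_def //]; exact: ceil_itv.
pose Om t j := F2 (t - tau * (cl t - 1)%:~R) j.
have OmE t m : cl t == m -> Om t = F2 (t - tau * (m - 1)%:~R) by move=> /eqP <-.
exists Om; split; last first.
  move=> t j; have /OmE -> : cl (t + tau) == cl t + 1.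
    have := clP t (cl t); rewrite eqxx clP => /esym; rewrite rmorphD /= !mulrBr mulrDr !mulr1 => /andP[? ?].
    by apply/andP; split; lra.
  by rewrite addrK /Om; congr (F2 _ j); rewrite rmorphB /= mulrBr mulr1; lra.
move=> t; have := clP t (cl t); rewrite eqxx => /esym /andP[]; move: (cl t) => m t1.
have mB : (m - 1)%:~R = m%:~R - 1 :> R by rewrite rmorphB.
rewrite le_eqVlt => /orP[/eqP tm|t2]; last first.
  have f : frame_at (fun s => F2 (s - tau * (m - 1)%:~R)) t.
    apply: (frame_shift (ym (m - 1))); apply: f2.
    by rewrite mB; rewrite mulrBr mulr1 in t1 *; apply/andP; split; lra.
  apply: frame_near f.
  have tI : tau * (m%:~R - 1) < t < tau * m%:~R by rewrite t1.
  apply: filterS (near_itv tI) => s; rewrite /= in_itv /= => /andP[s1'' s2] j.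
  by rewrite (OmE s m) // clP s1'' ltW.
have e1 : t - tau * (m - 1)%:~R = tau by rewrite mB tm mulrBr mulr1; lra.
have e2 : t - tau * m%:~R = 0 by rewrite tm subrr.
have f : frame_at (fun s j => if s <= t then F2 (s - tau * (m - 1)%:~R) j else F2 (s - tau * m%:~R) j) t.
  have g1 : frame_at F2 (t - tau * (m - 1)%:~R) by rewrite e1; exact: f2.
  have g2 : frame_at F2 (t - tau * m%:~R) by rewrite e2; exact: f2.
  have ge j : dom j (y t) -> F2 (t - tau * (m - 1)%:~R) j = F2 (t - tau * m%:~R) j.
    by move=> dj; rewrite e1 e2; apply: F2e; rewrite -e2 ym.
  exact: (frame_glue (frame_shift (ym (m - 1)) g1) (frame_shift (ym m) g2) ge).
apply: frame_near f; apply/near_R; exists tau => // s; rewrite ltr_norml => /andP[s1'' s2] j.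
rewrite mulrBr mulr1 in t1; have [st|ts] := leP s t.
  by rewrite (OmE s m) // clP mulrBr mulr1; apply/andP; split; lra.
by rewrite (OmE s (m + 1)) ?addrK // clP rmorphD /= addrK mulrDr mulr1; apply/andP; split; lra.
Qed.

End Frames.

(** * Monodromy of orbit cylinders *)

(** It replaces a parametrization of the level set. The point [a + t w] is moved back to the level
    along a transverse direction [nu], by an amount of at most [e t]; vanishing of [g] there bounds
    [dg(w)] by a multiple of [e]. *)
Lemma level_tangent {R : realType} m (h g : 'rV[R]_m -> R) a (w : 'rV[R]_m) Gh Gg :
  hasds h a Gh -> hasds g a Gg -> Gh != 0 ->
  (\forall u \near a, {for u, continuous h} /\ (h u = h a -> g u = 0)) ->
  (w *m Gh) 0 0 = 0 -> (w *m Gg) 0 0 = 0.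
Proof.
move=> Hh Hg Gh0 /near_rV[r r0 Hr] wh.
have [nu nu1] : exists nu : 'rV[R]_m, (nu *m Gh) 0 0 = 1.
  have [k hk] : exists k, Gh k 0 != 0.
    apply: contrapT => nk; move/negP: Gh0; apply; apply/eqP/colP => k; rewrite mxE.
    by apply: contrapT => /eqP h0; apply: nk; exists k.
  by exists ((Gh k 0)^-1 *: delta_mx 0 k); rewrite -scalemxAl mxE -rowE mxE mulVf.
set p := (w *m Gg) 0 0; pose q := (nu *m Gg) 0 0.
have main e : 0 < e -> e <= 1 -> `|p| <= e * (1 + `|q|).
  move=> e0 e1; pose B := `|w| + `|nu| + 1.
  have B0 : 0 < B by rewrite ltr_wpDl // addr_ge0.
  have e'0 : 0 < e / (2 * B) by rewrite divr_gt0 // mulr_gt0.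
  have [d1 d10 H1] := Hh _ e'0; have [d2 d20 H2] := Hg _ e'0.
  pose D := Num.min r (Num.min d1 d2).
  have D0 : 0 < D by rewrite !lt_min r0 d10.
  have [t t0 tB] : exists2 t : R, 0 < t & t * B = D / 2.
    exists (D / (2 * B)); first by rewrite divr_gt0 // mulr_gt0.
    by field; rewrite gt_eqF.
  pose u s := a + t *: w + s *: nu.
  have ud s : u s - a = t *: w + s *: nu by rewrite /u -(addrA a) addrAC subrr add0r.
  have uB s : `|s| <= e * t -> `|u s - a| <= t * B.
    move=> se; rewrite ud /B; apply: le_trans (ler_normD _ _) _; rewrite !normrZ (gtr0_norm t0).
    have st : `|s| <= t by apply: le_trans se _; rewrite ler_piMl // ltW.
    have := ler_wpM2r (normr_ge0 nu) st; move: (normr_ge0 w) (normr_ge0 nu) => ? ? ?; nra.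
  have uD s : `|s| <= e * t -> `|u s - a| < D by move=> /uB/le_lt_trans; apply; rewrite tB; lra.
  have err s : `|s| <= e * t -> e / (2 * B) * `|u s - a| <= e * t / 2.
    move=> se; apply: le_trans (ler_wpM2l (ltW e'0) (uB s se)) _.
    by rewrite le_eqVlt; apply/orP; left; apply/eqP; field; rewrite gt_eqF.
  have lin2 (G : 'cV[R]_m) s : ((u s - a) *m G) 0 0 = t * (w *m G) 0 0 + s * (nu *m G) 0 0.
    by rewrite ud mulmxDl -!scalemxAl !mxE.
  have uh s : `|s| <= e * t -> `|h (u s) - h a - s| <= e * t / 2.
    move=> se; have := H1 (u s) _; rewrite lin2 wh mulr0 add0r nu1 mulr1 => h1.
    apply: le_trans (h1 _) (err s se); apply: lt_le_trans (uD s se) _.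
    by rewrite /D !ge_min lexx orbT.
  have et0 : 0 < e * t by rewrite mulr_gt0.
  have ab : - (e * t) <= e * t by lra.
  have sab s : s \in `[- (e * t), e * t] -> `|s| <= e * t by rewrite in_itv /= ler_norml.
  (* [h] changes at [a + t w + s nu] at rate 1 in [s] up to an error [e t / 2], so the level is
     attained for some [s] between [- e t] and [e t]. *)
  have [s0 s0I hs0] : exists2 s, s \in `[- (e * t), e * t] & h (u s) = h a.
    apply: (@IVT R (h \o u)) => //.
      apply: continuous_in_subspaceT => s /set_mem; rewrite /= => sI.
      have se : `|s| <= e * t by apply: sab.
      have [ch _] : {for u s, continuous h} /\ (h (u s) = h a -> g (u s) = 0).
        by apply: Hr; apply: lt_le_trans (uD s se) _; rewrite /D ge_min lexx.
      apply: (@continuous_comp _ _ _ u h) => //.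
      by apply: cvgD; [exact: cvg_cst|apply: cvgZr_tmp; exact: cvg_id].
    have h1 := uh (e * t); have h2 := uh (- (e * t)); rewrite normrN gtr0_norm // in h2.
    rewrite gtr0_norm // in h1; have := h1 (lexx _); have := h2 (lexx _).
    rewrite !ler_norml ge_min le_max /= => /andP[? ?] /andP[? ?].
    by apply/andP; split; apply/orP; [left|right]; lra.
  have se := sab s0 s0I.
  have [_ gu] : {for u s0, continuous h} /\ (h (u s0) = h a -> g (u s0) = 0).
    by apply: Hr; apply: lt_le_trans (uD s0 se) _; rewrite /D ge_min lexx.
  have [_ ga] : {for a, continuous h} /\ (h a = h a -> g a = 0).
    by apply: Hr; rewrite subrr normr0.
  have := H2 (u s0) _; rewrite (gu hs0) (ga erefl) lin2 -/p -/q => h2.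
  have {h2} h2 : `|t * p + s0 * q| <= e * t / 2.
    have ud2 : `|u s0 - a| < d2 by apply: lt_le_trans (uD s0 se) _; rewrite /D !ge_min lexx !orbT.
    by have := h2 ud2; rewrite subrr sub0r normrN => /le_trans; apply; exact: err.
  have h3 : t * `|p| <= e * t / 2 + e * t * `|q|.
    have -> : t * `|p| = `|t * p| by rewrite normrM gtr0_norm.
    have -> : t * p = (t * p + s0 * q) - s0 * q by rewrite addrK.
    apply: le_trans (ler_normB _ _) _; apply: lerD h2 _; rewrite normrM.
    by apply: ler_wpM2r.
  by rewrite -(ler_pM2l t0); apply: le_trans h3 _; nra.
apply/eqP; rewrite -normr_le0; apply/ler_addgt0Pr => x x0; rewrite add0r.
pose e := Num.min 1 (x / (1 + `|q|)).
have q0 : 0 < 1 + `|q| by rewrite ltr_pwDl.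
have e0 : 0 < e by rewrite lt_min ltr01 divr_gt0.
apply: le_trans (main e e0 _) _; first by rewrite ge_min lexx.
by rewrite -ler_pdivlMr // ge_min lexx orbT.
Qed.

Lemma near_norm {R : realType} (V : normedModType R) (a : V) (P : V -> Prop) :
  (\forall u \near a, P u) -> exists2 r : R, 0 < r & forall u, `|u - a| < r -> P u.
Proof.
move=> /nbhs_ballP[r /= r0 h]; exists r => // u ur.
by apply: h; rewrite -ball_normE /ball_ /= distrC.
Qed.

Lemma is_derive_small {R : realType} (f : R -> R) :
  f 0 = 0 -> (forall e : R, 0 < e -> \forall s \near 0, `|f s| <= e * `|s|) -> is_derive (0 : R) (1 : R) f 0.
Proof.
move=> f0 H.
pose z : {linear R -> R} := \0.
have [|e e0|df dE] := @diff_mk R R R f z 0.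
- by move=> x; exact: cvg_cst.
- by apply: filterS (H e e0) => s; rewrite addr0 f0 !subr0.
- by apply: DeriveDef; [exact: diff_derivable|rewrite deriveE // dE].
Qed.

Lemma norm_between0 {R : realType} (a t : R) : Num.min 0 a <= t <= Num.max 0 a -> `|t| <= `|a|.
Proof.
rewrite ge_min le_max => /andP[h1 h2].
have [a0|a0] := ger0P a; rewrite ler_norml;
  case/orP: h1 => ?; case/orP: h2 => ?; apply/andP; split; lra.
Qed.

Lemma mean_value_remainder {R : realType} (a c w d x : R) :
  a - c = w * (d - 0) -> a - c - d * x = (w - x) * d.
Proof. by rewrite subr0 => ->; ring. Qed.

Section Cylinder.
Context {R : realType} {n : nat} (M : manifold R n).
Local Notation CT := (cotangent_charts M).
Local Notation I := (idx CT).
Implicit Types (i j k : I).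
Let okC := cotangent_atlas_ok M.
Variables (sigma : tensor2 M) (H : cotangent M -> R).
Hypothesis sigma_closed : closed_2form sigma.
Hypothesis Hs : smooth_fun CT H.
Let FW := ham_field_ok sigma_closed Hs.

(** [v] is the velocity of the cylinder in the energy parameter, and differentiating the energy
    gives the first claim. For the second, periodicity shows that the flow at the fixed time [e tau]
    sends [Y s 0] to [Y s (del s)]; the shift [del] contributes its derivative times the field. *)
Lemma cylinder_monodromy (k tau ep : R) y Y T (e : R) (i : I) :
  orbit_cylinder sigma H k y tau ep Y T -> e = 1 \/ e = - 1 -> dom i (y 0) ->
  exists v : 'rV[R]_(n + n), (v *m grad (rep i H) (crd i (y 0))) 0 0 = 1 /\
    v *m lin (ham sigma H) y i i (e * tau) =
      v - (e * derive1 T k) *: ham sigma H i (crd i (y 0)).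
Proof.
move=> [ep0 Ts Ys [Y0 Tk] HY] e1 di; subst y.
have ep00 : - ep < 0 < ep by rewrite oppr_lt0 ep0.
have cur s : - ep < s < ep -> gcurve (ham sigma H) (fun=> 1) setT (Y s).
  by move=> /HY[_ _ /(integral_curveP sigma Hs) c _].
have eper s t : - ep < s < ep -> Y s (t + e * T (k + s)) = Y s t.
  move=> hs; have [_ per _ _] := HY s hs; case: e1 => ->; first by rewrite mul1r per.
  by rewrite -[in RHS](subrK (T (k + s)) t) per mulN1r.
have c0 := cur 0 ep00.
have [B [oB B0 Bd Bs]] := Ys (0, 0) i ep00 di.
pose f (p : R * R) := crd i (Y p.1 p.2).
have fC : Ck 1 B f := smooth_Ck 1 Bs.
pose v := 'D_(1 : R, 0 : R) f (0, 0).
pose c s := crd i (Y s 0).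
have dc : is_derive (0 : R) (1 : R) c v.
  have df : derivable f ((0, 0) + (0 : R) *: (1 : R, 0 : R)) (1 : R, 0 : R).
    by rewrite scale0r addr0; exact: (Ck_derivable fC).
  have := line_derive df; rewrite scale0r addr0.
  have -> // : (fun s : R => f ((0, 0) + s *: (1 : R, 0 : R))) = c.
  by apply/funext => s; rewrite /f /c /= !add0r [s *: _]mulr1 [s *: _]mulr0.
have nB := open_nbhs_nbhs (conj oB B0).
have [rB rB0 HB] := near_norm nB.
have inB s t : `|s| < rB -> `|t| < rB -> B (s, t).
  by move=> h1 h2; apply: HB; rewrite prod_normE /= !subr0 gt_max h1.
have ndom : \forall s \near (0 : R), dom i (Y s 0).
  apply/near_R; exists rB => // s; rewrite subr0 => sr.
  by apply: (Bd (s, 0)); apply: inB => //; rewrite normr0.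
have nep : \forall s \near (0 : R), - ep < s < ep.
  by apply: filterS (near_itv ep00) => s /=; rewrite in_itv.
exists v; split.
  have h1 : hasd (fun u => (rep i H u)%:M : 'rV[R]_1) (c 0) (grad (rep i H) (c 0)).
    exact: hasds_hasd (rep_hasds Hs di).
  have /is_derive_mxP/(_ 0 0) := hasd_curve h1 dc.
  have d2 : is_derive (0 : R) (1 : R) (fun s : R => k + s) 1 by exact: is_derive_addl.
  have d3 : is_derive (0 : R) (1 : R) (fun s => ((fun u => (rep i H u)%:M : 'rV[R]_1) \o c) s 0 0) 1.
    apply: near_eq_is_derive d2; apply: filterS2 ndom nep => s ds hs.
    by rewrite /= mxE eqxx mulr1n /c (rep_crd okC) //; have [_ _ _ ->] := HY s hs.
  by move=> [_ e4]; case: d3 => _ e3; exact: (etrans (esym e4) e3).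
pose X := ham sigma H i (crd i (Y 0 0)).
have ktau : k - ep < k < k + ep by apply/andP; split; lra.
have kI : (`]k - ep, k + ep[%classic : set R) k by rewrite /= in_itv.
pose T' := derive1 T k.
have dT : is_derive k (1 : R) T T'.
  by rewrite /T' derive1E; apply: DeriveDef => //; exact: (Ck_derivable (smooth_Ck 1 Ts) kI).
pose del s := e * (T k - T (k + s)).
have ddel : is_derive (0 : R) (1 : R) del (- (e * T')).
  have dTs : is_derive (0 : R) (1 : R) (fun s => T (k + s)) T'.
    have dk : is_derive (k + 0) (1 : R) T T' by rewrite addr0.
    have := is_derive1_comp dk (is_derive_addl k 0) => /is_derive_eq; apply.
    by rewrite mul1r || by rewrite mulr1.
  have := is_deriveZ e (is_deriveB (is_derive_cst (T k) (0 : R) (1 : R)) dTs) => /is_derive_eq; apply.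
  by rewrite sub0r [e *: _]mulrN.
have del0 : del 0 = 0 by rewrite /del addr0 subrr mulr0.
have per0 : Y 0 (e * tau) = Y 0 0.
  by have := eper 0 0 ep00; rewrite addr0 Tk add0r.
have di' : dom i (Y 0 (e * tau)) by rewrite per0.
have main : is_derive (0 : R) (1 : R) (fun s => crd i (Y s (del s))) (v - (e * T') *: X).
  apply/is_derive_mxP => a b; rewrite (ord1 a) => {a}.
  (* The remainder of the chain rule along [(s, del s)]. The mean value theorem in the time variable
     and continuity of the field make it small compared with [s]. *)
  pose r s := (f (s, del s)) 0 b - c s 0 b - del s * X 0 b.
  have dr : is_derive (0 : R) (1 : R) r 0.
    apply: is_derive_small => [|x x0]; first by rewrite /r del0 /c /f /= subrr mul0r subrr.
    pose g (p : R * R) := ham sigma H i (f p) 0 b.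
    have cg : {for (0, 0), continuous g}.
      have cf : {for (0, 0), continuous f} by exact: (Ck_cont fC).
      have fi : (crd i @` dom i) (f (0, 0)) by exists (Y 0 0).
      have oA := chart_open okC i.
      have ch := Ck_cont (Ck_entry 0 b oA (ham_C2 sigma_closed Hs i)) fi.
      exact: (continuous_comp cf ch).
    have [K K0 nK] : exists2 K, 0 < K & \forall s \near (0 : R), `|del s| <= K * `|s|.
      have dd := (@derivable1_diffP _ _ del 0).1 (let: DeriveDef d _ := ddel in d).
      have := diff_eps dd ltr01; set L := 'd del 0 => hd.
      have LE (s : R) : L s = s * - (e * T').
        have [d1 d2] := ddel; rewrite -d2 deriveE // -/L -[s in LHS]mulr1.
        by rewrite /L -[s * 1]/(s *: (1 : R)) linearZ.
      exists (`|e * T'| + 1); first by rewrite ltr_wpDl.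
      apply: filterS hd => s; rewrite addr0 del0 subr0 LE mul1r => hs.
      rewrite -[del s](subrK (s * - (e * T'))) (le_trans (ler_normD _ _)) //.
      by rewrite normrM normrN mulrDl mul1r addrC lerD // mulrC.
    have xK : 0 < x / K by rewrite divr_gt0.
    have [d d0 Hd] : exists2 d : R, 0 < d & forall p, `|p - (0, 0)| < d -> `|g p - X 0 b| <= x / K.
      have n1 : \forall p \near ((0 : R), (0 : R)), `|g (0, 0) - g p| <= x / K.
        have /cvgrPdist_le c1 : g p @[p --> ((0 : R), (0 : R))] --> g (0, 0) by exact: cg.
        exact: c1 _ xK.
      have [d d0 h] := near_norm n1; exists d; first exact: d0.
      move=> p pd; have hp := h p pd; rewrite distrC in hp; exact: hp.
    pose dm := Num.min d rB.
    have dm0 : 0 < dm by rewrite lt_min d0.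
    have nd : \forall s \near (0 : R), `|del s| < dm.
      have cd := is_derive_continuous ddel.
      have : \forall t \near del 0, `|t| < dm.
        by rewrite del0; apply/near_R; exists dm => // t; rewrite subr0.
      exact: cd.
    have ns : \forall s \near (0 : R), `|s| < dm by apply/near_R; exists dm => // s; rewrite subr0.
    near=> s.
    have hs : - ep < s < ep by near: s.
    have sd : `|s| < dm by near: s.
    have dd : `|del s| < dm by near: s.
    have hK : `|del s| <= K * `|s| by near: s.
    have seg t : Num.min 0 (del s) <= t <= Num.max 0 (del s) ->
        is_derive t (1 : R) (fun t => f (s, t) 0 b) (g (s, t)) /\ `|g (s, t) - X 0 b| <= x / K.
      move=> ht; have td : `|t| < dm.
        exact: le_lt_trans (norm_between0 ht) dd.
      have dst : dom i (Y s t).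
        apply: (Bd (s, t)); apply: inB; first by apply: lt_le_trans sd _; rewrite ge_min lexx orbT.
        by apply: lt_le_trans td _; rewrite ge_min lexx orbT.
      split; first by have /is_derive_mxP/(_ 0 b) := orbit_derive (cur s hs) dst.
      apply: Hd; rewrite prod_normE /= !subr0 gt_max.
      by rewrite (lt_le_trans sd) ?(lt_le_trans td) // ge_min lexx.
    have [t ht et] := mvt_between (fun t ht => (seg t ht).1).
    have [_ bt] := seg t ht.
    have -> : r s = (g (s, t) - X 0 b) * del s.
      exact: (mean_value_remainder _ et).
    rewrite normrM; apply: le_trans (ler_pM _ _ bt hK) _ => //.
    by rewrite mulrA divfK ?gt_eqF.
  have /is_derive_mxP/(_ 0 b) dcb := dc.
  have := is_deriveD (is_deriveD dr dcb) (is_deriveZ (X 0 b) ddel).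
  rewrite (_ : _ + _ = (v - (e * T') *: X) 0 b); last by rewrite !mxE add0r [_ *: _]mulrN mulrC.
  congr is_derive; apply/funext => s; rewrite !fctE /r /f /= [_ *: _]mulrC; ring.
have h2 := hasdX_curve okC (lin_hasdX FW c0 di di') ndom dc.
have h3 : is_derive (0 : R) (1 : R) (crd i \o (aflow (ham sigma H) (e * tau) \o (Y ^~ 0))) (v - (e * T') *: X).
  apply: near_eq_is_derive main; apply: filterS nep => s hs /=; congr (crd i _).
  have [_ ->] := orbit_flow FW (cur s hs) 0 (e * tau); rewrite add0r.
  by rewrite -(eper s (del s) hs) /del Tk; congr (Y s _); ring.
by case: h2 => _ <-; case: h3 => _ <-.
Unshelve. all: by end_near.
Qed.

End Cylinder.

(** * Proportional Hamiltonian fields *)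

Lemma is_derive_invmx {R : realType} m (A : R -> 'M[R]_m) (t : R) A' : is_derive t (1 : R) A A' ->
  A t \in unitmx ->
  is_derive t (1 : R) (fun s => invmx (A s)) (- (invmx (A t) *m A' *m invmx (A t))).
Proof.
move=> dA uA; have cA := is_derive_continuous dA.
have nu : \forall s \near t, A s \in unitmx by exact: near_unitmx cA uA.
have C : (fun h => h^-1 *: (invmx (A (h *: 1 + t)) - invmx (A t))) @ 0^'
    --> - (invmx (A t) *m A' *m invmx (A t)).
  have cs : h *: (1 : R) + t @[h --> 0^'] --> t.
    apply: cvg_within_filter.
    have h0 : h *: (1 : R) + t @[h --> 0] --> (0 : R) *: (1 : R) + t.
      by apply: cvgD; [apply: cvgZr_tmp; exact: cvg_id|exact: cvg_cst].
    by rewrite scale0r add0r in h0.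
  have cq : h^-1 *: (A (h *: 1 + t) - A t) @[h --> 0^'] --> A' by case: dA => d <-; exact: d.
  have cAs : A (h *: 1 + t) @[h --> 0^'] --> A t.
    by apply: (@cvg_comp _ _ _ (fun h : R => h *: 1 + t) A _ (nbhs t)); [exact: cs|exact: cA].
  have nus : \forall h \near 0^', A (h *: 1 + t) \in unitmx by exact: near_unitmx cAs uA.
  have ne : {near 0^', (fun h => - (invmx (A (h *: 1 + t)) *m (h^-1 *: (A (h *: 1 + t) - A t)) *m invmx (A t)))
      =1 (fun h => h^-1 *: (invmx (A (h *: 1 + t)) - invmx (A t)))}.
    apply: filterS nus => h; move: (A (h *: 1 + t)) => B uB.
    rewrite -scalemxAr -scalemxAl -scalerN; congr (_ *: _).
    by rewrite mulmxBr mulmxBl mulVmx // mul1mx mulmxK // opprB.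
  apply: cvg_trans (near_eq_cvg ne) _; apply: cvgN.
  apply: cvg_mulmx; last exact: cvg_cst.
  by apply: cvg_mulmx => //; exact: cvg_invmx.
by apply: DeriveDef; [exact: (cvgP _ C)|exact: cvg_lim C].
Qed.

Section Transport.
Context {R : realType} {n : nat} (M : manifold R n).
Local Notation CT := (cotangent_charts M).
Local Notation I := (idx CT).
Implicit Types (i j : I).
Let okC := cotangent_atlas_ok M.
Variable sigma : tensor2 M.
Hypothesis sigma_closed : closed_2form sigma.

Lemma lin_grad (K : cotangent M -> R) (Ks : smooth_fun CT K) y i j s :
  gcurve (ham sigma K) (fun=> 1) setT y -> dom i (y 0) -> dom j (y s) ->
  lin (ham sigma K) y i j s *m grad (rep j K) (crd j (y s)) = grad (rep i K) (crd i (y 0)).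
Proof.
move=> Hy di dj; have FW := ham_field_ok sigma_closed Ks.
rewrite -(ham_grad sigma K dj) -(ham_grad sigma K di) -(lin_field FW Hy di dj).
rewrite -(lin_omega sigma_closed Ks Hy di dj); by rewrite trmx_mul !mulmxA.
Qed.

Variables (H F f : cotangent M -> R) (k : R).
Hypothesis Hs : smooth_fun CT H.
Hypothesis Fs : smooth_fun CT F.
Hypothesis k_regular : regular_value H k.
Hypothesis f_smooth : smooth_on_subset CT (level H k) f.
Hypothesis f_pos : forall z, level H k z -> 0 < f z.
Hypothesis X_proportional : proportional_on sigma (level H k) H F f.

Lemma ham_prop z i : level H k z -> dom i z ->
  ham sigma H i (crd i z) = f z *: ham sigma F i (crd i z).
Proof.
move=> Lz di; have hF : is_ham_vector sigma F i z (ham sigma F i (crd i z)) by exact/is_ham_vectorP.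
by have /(is_ham_vectorP sigma Hs _ di) := X_proportional Lz di hF.
Qed.

Lemma grad_prop z i : level H k z -> dom i z ->
  grad (rep i H) (crd i z) = f z *: grad (rep i F) (crd i z).
Proof.
move=> Lz di; rewrite -(ham_grad sigma H di) -(ham_grad sigma F di) ham_prop //.
by rewrite linearZ /= scalemxAr.
Qed.

Lemma grad_neq0 z i : level H k z -> dom i z -> grad (rep i H) (crd i z) != 0.
Proof.
move=> Lz di; have [v] := k_regular Lz di; have [_ ->] := hasds_derive v (rep_hasds Hs di).
by apply: contraNneq => ->; rewrite mulmx0 mxE.
Qed.

Lemma field_hasds (K : cotangent M -> R) (Ks : smooth_fun CT K) z i (m : 'cV[R]_(n + n)) : dom i z ->
  hasds (fun u => (ham sigma K i u *m m) 0 0) (crd i z) ('J (ham sigma K i) (crd i z) *m m).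
Proof.
move=> di; have zi : (crd i @` dom i) (crd i z) by exists z.
have hJ := Ck1_hasd (chart_open okC i) zi (CkW (ham_C2 sigma_closed Ks i)).
have /hasdP/(_ 0) := hasd_comp hJ (hasd_lin m _).
have -> // : col 0 ('J (ham sigma K i) (crd i z) *m m) = 'J (ham sigma K i) (crd i z) *m m.
by move: ('J _ _ *m m) => c; apply/colP => a; rewrite mxE.
Qed.

(** The relation between the fields may be differentiated in a direction [w] tangent to the level.
    The derivative of [f] then adds a multiple of the field, which [m] annihilates. [level_tangent]
    is applied with a local smooth extension [hh] of [f]. *)
Lemma ham_jac_prop z i (w : 'rV[R]_(n + n)) (m : 'cV[R]_(n + n)) : level H k z -> dom i z ->
  (w *m grad (rep i H) (crd i z)) 0 0 = 0 -> (ham sigma H i (crd i z) *m m) 0 0 = 0 ->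
  (w *m 'J (ham sigma H i) (crd i z) *m m) 0 0 = f z * (w *m 'J (ham sigma F i) (crd i z) *m m) 0 0.
Proof.
move=> Lz di wH Xm; have fz := f_pos Lz.
have XFm : (ham sigma F i (crd i z) *m m) 0 0 = 0.
  move: Xm; rewrite ham_prop // -scalemxAl mxE => /eqP; rewrite mulf_eq0 gt_eqF //=.
  by move/eqP.
have [B [hh [oB Bz hhs fhh]]] := f_smooth Lz di.
have h1 := field_hasds Hs m di; have h2 := field_hasds Fs m di.
have h3 : hasds hh (crd i z) (grad hh (crd i z)) by exact: (Ck1_hasds oB Bz (smooth_Ck 1 hhs)).
have h4 := hasdsM (hasds_cst (-1) (crd i z)) (hasdsM h3 h2).
have h5 := hasdsD h1 h4; rewrite XFm scale0r add0r scaler0 add0r scaleN1r in h5.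
have hz : hh (crd i z) = f z by rewrite (fhh z).
have nz : \forall u \near crd i z, {for u, continuous (rep i H)} /\ (rep i H u = rep i H (crd i z) ->
    (ham sigma H i u *m m) 0 0 + -1 * (hh u * (ham sigma F i u *m m) 0 0) = 0).
  have n1 := overlap_near okC di di; have n2 := open_nbhs_nbhs (conj oB Bz).
  apply: filterS2 n1 n2 => u [y [dy _ <-]] By; split; first exact: hasds_continuous (rep_hasds Hs dy).
  rewrite !(rep_crd okC) // => Hy; have Ly : level H k y by rewrite /level /= Hy.
  have ent (a : R) (N : 'M[R]_1) : (a *: N) 0 0 = a * N 0 0 by rewrite mxE.
  by rewrite ham_prop // -scalemxAl -(fhh y) // ent mulN1r subrr.
have := level_tangent (rep_hasds Hs di) h5 (grad_neq0 Lz di) nz wH.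
rewrite hz; move: ('J (ham sigma H i) _) ('J (ham sigma F i) _) (f z) => AH AF c.
have -> : w *m (AH *m m - c *: (AF *m m)) = w *m AH *m m - c *: (w *m AF *m m).
  by rewrite mulmxBr -scalemxAr !mulmxA.
move: (w *m _ *m m) (w *m _ *m m) => a b; rewrite !mxE => /eqP; rewrite subr_eq0 => /eqP.
exact.
Qed.

Variables (z zF : R -> cotangent M).
Hypothesis Hz : gcurve (ham sigma H) (fun=> 1) setT z.
Hypothesis HzF : gcurve (ham sigma F) (fun=> 1) setT zF.
Hypothesis Lz : forall t, level H k (z t).
Hypothesis z0 : zF 0 = z 0.
Let FH := ham_field_ok sigma_closed Hs.
Let FF := ham_field_ok sigma_closed Fs.

Lemma f_continuous : continuous (fun t => f (z t)).
Proof.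
move=> t; have [i di] := cotangent_cover (z t).
have [B [hh [oB Bz hhs fhh]]] := f_smooth (Lz t) di.
have ch : {for crd i (z t), continuous hh} by exact: (Ck_cont (smooth_Ck 0 hhs)).
have cz : {for t, continuous (crd i \o z)} by exact: is_derive_continuous (orbit_derive Hz di).
have nB : \forall s \near t, B (crd i (z s)) by exact: cz _ (open_nbhs_nbhs (conj oB Bz)).
have cc : {for t, continuous (hh \o (crd i \o z))} by exact: continuous_comp.
move=> V; rewrite /= (fhh (z t) (Lz t) di Bz) => nV.
have n1 : \forall s \near t, V (hh (crd i (z s))) by exact: cc.
have : \forall s \near t, V (f (z s)).
  by apply: filterS3 (orbit_near Hz di) nB n1 => s ds Bs; rewrite -fhh.
exact.
Qed.

Variable beta : R -> R.
Hypothesis dbeta : forall t, is_derive t (1 : R) beta (f (z t)).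
Hypothesis beta0 : beta 0 = 0.

(** Both sides solve the equation with field [X_F] and speed [f (z t)], and they agree at time 0. *)
Lemma reparam_orbit t : zF (beta t) = z t.
Proof.
have c1 : gcurve (ham sigma F) (fun t => f (z t)) setT z.
  move=> s i _ di; have ns := orbit_near Hz di; split; first exact: ns.
  by have d := orbit_derive Hz di; rewrite (ham_prop (Lz s) di) in d; exact: d.
have c2 : gcurve (ham sigma F) (fun t => f (z t)) setT (fun t => zF (beta t)).
  move=> s i _ di; split; last exact: is_derive_mx_comp (orbit_derive HzF di) (dbeta s).
  exact: (is_derive_continuous (dbeta s)) _ (orbit_near HzF di).
apply: (gcurve_unique okC (@cotangent_cover _ _ M) (@cotangent_separated _ _ M)
  (ham_C2 sigma_closed Fs) f_continuous c2 c1 (s := 0)); last by rewrite beta0.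
by move=> r _; exact: filterT.
Qed.

(** The left-hand side has zero derivative in [s]: the linearized flow of [F] keeps [v] tangent,
    that of [H] keeps [m] annihilating the field, and [ham_jac_prop] cancels the two variational
    terms. At [s = 0] both flows are the identity. *)
Lemma transport_unip i j s (v : 'rV[R]_(n + n)) (m : 'cV[R]_(n + n)) :
  dom i (z 0) -> dom j (z s) ->
  (v *m grad (rep i H) (crd i (z 0))) 0 0 = 0 -> (ham sigma H i (crd i (z 0)) *m m) 0 0 = 0 ->
  v *m (lin (ham sigma F) zF i j (beta s) *m invmx (lin (ham sigma H) z i j s)) *m m = v *m m.
Proof.
move=> di dj vH Xm; have diF : dom i (zF 0) by rewrite z0.
have djF (l : I) r : dom l (z r) -> dom l (zF (beta r)) by rewrite reparam_orbit.
pose G l r := v *m (lin (ham sigma F) zF i l (beta r) *m invmx (lin (ham sigma H) z i l r)) *m m.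
have Gch l l' r : dom l (z r) -> dom l' (z r) -> G l r = G l' r.
  move=> dl dl'; apply: (congr1 (fun K => v *m K *m m)).
  have eF := lin_chart FF HzF diF diF (djF l r dl) (djF l' r dl').
  have eH := lin_chart FH Hz di di dl dl'.
  rewrite (tjac_id okC diF) mul1mx reparam_orbit in eF; rewrite (tjac_id okC di) mul1mx in eH.
  have uT := tjac_unit okC dl dl'; have uH := lin_unit sigma_closed Hs Hz di dl.
  rewrite eF eH; move: (lin _ _ _ _ _) (lin _ _ _ _ _) (tjac _ _ _) uT uH => A D T uT uD.
  have -> : A *m T = A *m invmx D *m (D *m T) by rewrite mulmxA mulmxKV.
  by rewrite mulmxK // unitmx_mul uD.
have Gd l r : dom l (z r) -> is_derive r (1 : R) (G l) 0.
  move=> dl; have dlF := djF l r dl.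
  have dF := is_derive_mx_comp (lin_derive FF HzF diF dlF) (dbeta r).
  have uH := lin_unit sigma_closed Hs Hz di dl.
  have dI := is_derive_invmx (lin_derive FH Hz di dl) uH.
  have := is_derive_mulmxr m (is_derive_mulmxl v (is_derive_mulmx dF dI)).
  move/is_derive_eq; apply.
  rewrite reparam_orbit in dlF *.
  have w0 : (v *m lin (ham sigma F) zF i l (beta r) *m grad (rep l H) (crd l (z r))) 0 0 = 0.
    have e := lin_grad Fs HzF diF (djF l r dl); rewrite reparam_orbit z0 in e.
    rewrite grad_prop // -scalemxAr -mulmxA e mxE.
    move: vH; rewrite (grad_prop (Lz 0) di) -scalemxAr mxE => /eqP.
    by rewrite mulf_eq0 gt_eqF ?f_pos //= => /eqP ->; rewrite mulr0.
  have m0 : (ham sigma H l (crd l (z r)) *m (invmx (lin (ham sigma H) z i l r) *m m)) 0 0 = 0.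
    by rewrite -(lin_field FH Hz di dl) mulmxA mulmxK.
  have J := ham_jac_prop (Lz r) dl w0 m0; clear -J uH.
  move: (lin (ham sigma F) zF i l _) (lin (ham sigma H) z i l _) ('J (ham sigma F l) _)
    ('J (ham sigma H l) _) uH J => DF DH AF AH uH J.
  have -> : v *m (f (z r) *: (DF *m AF) *m invmx DH + DF *m - (invmx DH *m (DH *m AH) *m invmx DH)) *m m =
     f (z r) *: (v *m DF *m AF *m (invmx DH *m m)) - v *m DF *m AH *m (invmx DH *m m).
    by rewrite mulKmx // mulmxN mulmxBr mulmxBl -!scalemxAl -!scalemxAr -!scalemxAl !mulmxA.
  move: (_ *m _) (_ *m _) J => a b J; apply/matrixP => a' b'; rewrite !ord1.
  have ent (c : R) (N N' : 'M[R]_1) : (c *: N - N') 0 0 = c * N 0 0 - N' 0 0 by rewrite !mxE.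
  by rewrite ent J subrr mxE.
have := orbit_const FH Hz Gch Gd dj di; rewrite /G beta0 => ->.
have e1 : lin (ham sigma F) zF i i 0 = 1%:M by exact: (lin0 (y := zF) FF diF).
by rewrite e1 (lin0 FH di) invmx1 mulmx1 mulmx1.
Qed.

End Transport.

Lemma cont_on_near {R : realType} (V : topologicalType) (D : set R) (f : R -> V) :
  (forall t, D t -> exists g : R -> V, {for t, continuous g} /\ \forall s \near t, D s -> f s = g s) ->
  cont_on D f.
Proof.
move=> H t Dt A nA; have [g [cg n]] := H t Dt.
rewrite (nbhs_singleton n Dt) in nA.
have ng : \forall s \near t, A (g s) by exact: cg.
have : \forall s \near t, D s -> A (f s) by apply: filterS2 n ng => s e a Ds; rewrite e.
exact.
Qed.

Lemma continuous_cont_on {R : realType} (V : topologicalType) (D : set R) (f : R -> V) :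
  continuous f -> cont_on D f.
Proof. by move=> cf; apply: cont_on_near => t _; exists f; split; [exact: cf|exact: filterE]. Qed.

(** * The index read in a moving frame *)

Section Trivializations.
Context {R : realType} {n : nat} (M : manifold R n).
Local Notation CT := (cotangent_charts M).
Local Notation I := (idx CT).
Local Notation w0 := (omega0 : 'M[R]_(n + n)).
Implicit Types (i j : I).
Let okC := cotangent_atlas_ok M.
Variable sigma : tensor2 M.
Hypothesis sigma_closed : closed_2form sigma.

Lemma vert_mulmx (A : 'M[R]_(n + n)) :
  (row_mx 0 1%:M : 'M[R]_(n, n + n)) *m A = row_mx (dlsubmx A) (drsubmx A).
Proof. by rewrite -[A in LHS]submxK mul_row_block !mul0mx !mul1mx !add0r. Qed.

Lemma frame_triv (y : R -> cotangent M) tau Om : (forall t, frame_at sigma y Om t) ->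
  (forall t j, Om (t + tau) j = Om t j) -> vertical_trivialization sigma y tau Om.
Proof.
move=> h per; split.
- by move=> t i j di dj; exact: (h t).1.
- by move=> t i di; have [] := (h t).2 i di.
- by move=> t i _; exact: per.
- by move=> t i di; have [] := (h t).2 i di.
- move=> t i di; have u := frame_unit (h t) di; have [_ _ dl] := (h t).2 i di.
  rewrite vert_mulmx dl; move: u; rewrite -{1}[Om t i]submxK dl unitmxE det_ublock unitrM -!unitmxE.
  move=> /andP[_ u]; apply/andP; split; apply/submxP.
    by exists (drsubmx (Om t i)); rewrite mul_mx_row mulmx0 mulmx1.
  by exists (invmx (drsubmx (Om t i))); rewrite mul_mx_row mulmx0 mulVmx.
Qed.

Lemma triv_frame (y : R -> cotangent M) tau Om : vertical_trivialization sigma y tau Om ->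
  forall t, frame_at sigma y Om t.
Proof.
move=> [h1 h2 _ h4 h5] t; split=> [i j di dj|i di]; first exact: h1.
split; [exact: h2|exact: h4|].
have /andP[/submxP[D e] _] := h5 t i di.
by move: e; rewrite vert_mulmx mul_mx_row mulmx0 => /eq_row_mx[].
Qed.

Lemma frame_comp (y : R -> cotangent M) Fr (b : R -> R) t : {for t, continuous b} ->
  frame_at sigma y Fr (b t) -> frame_at sigma (fun s => y (b s)) (fun s => Fr (b s)) t.
Proof.
move=> cb [h1 h2]; split=> [i j di dj|i di]; first exact: h1.
have [c s d] := h2 i di; split; [|exact: s|exact: d].
exact: (@continuous_comp _ _ _ b (fun s => Fr s i)).
Qed.

Lemma sp_conj (A B D O O' : 'M[R]_(n + n)) : B \in unitmx -> A *m O *m A^T = w0 ->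
  B *m O' *m B^T = w0 -> D *m O' *m D^T = O -> sp w0 (A *m D *m invmx B).
Proof.
move=> uB a b d; rewrite /sp -[X in _ *m X *m _]b !trmx_mul !mulmxA mulmxKV //.
have -> : A *m D *m O' *m B^T *m (invmx B)^T = A *m D *m O'.
  by rewrite -mulmxA -trmx_mul mulVmx // trmx1 mulmx1.
by rewrite -(mulmxA A) -(mulmxA A) d a.
Qed.

Section Path.
Variable K : cotangent M -> R.
Hypothesis Ks : smooth_fun CT K.
Variable w : R -> cotangent M.
Hypothesis Hw : gcurve (ham sigma K) (fun=> 1) setT w.
Variable e : R.
Let FK := ham_field_ok sigma_closed Ks.

(** The linearized flow in the frame [Ref], traversed in the direction [e] and with time changed by
    [b]. The time change lets the path of [F] run over the time interval of [H]. *)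
Definition represents (b : R -> R) (Ref : R -> I -> 'M[R]_(n + n)) (Lam : R -> 'M[R]_(n + n)) :=
  forall t i j, dom i (w 0) -> dom j (w (e * b t)) ->
    Lam t = Ref 0 i *m lin (ham sigma K) w i j (e * b t) *m invmx (Ref t j).

Section Reference.
Variables (b : R -> R) (Ref : R -> I -> 'M[R]_(n + n)).
Hypothesis cb : continuous b.
Hypothesis b0 : b 0 = 0.
Hypothesis Ref_frame : forall t, frame_at sigma (fun t => w (e * b t)) Ref t.

Lemma ref0 i : dom i (w 0) -> dom i (w (e * b 0)).
Proof. by rewrite b0 mulr0. Qed.

Lemma represents_exists : exists Lam, represents b Ref Lam.
Proof.
have [i0 di0] := cotangent_cover (w 0).
have [j0 hj0] := choice (fun t => cotangent_cover (w (e * b t))).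
exists (fun t => Ref 0 i0 *m lin (ham sigma K) w i0 (j0 t) (e * b t) *m invmx (Ref t (j0 t))).
move=> t i j di dj.
have r0 := (Ref_frame 0).1 i0 i (ref0 di0) (ref0 di); have r1 := (Ref_frame t).1 (j0 t) j (hj0 t) dj.
have uT := tjac_unit okC (hj0 t) dj; have uR := frame_unit (Ref_frame t) (hj0 t).
have l := lin_chart FK Hw di0 di (hj0 t) dj.
have T1 := tjacK okC (ref0 di0) (ref0 di).
rewrite r0 r1 l; rewrite b0 mulr0 in T1 *.
move: (lin _ _ _ _ _) (tjac _ _ _) (tjac i0 i _) (tjac i i0 _) T1 uT (Ref 0 i0) (Ref t (j0 t)) uR.
move=> D T S S' T1 uT P Q uQ.
have -> : P *m S *m (S' *m D *m T) = P *m D *m invmx Q *m (Q *m T).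
  by rewrite !mulmxA -(mulmxA P S S') T1 mulmx1 mulmxKV.
by rewrite mulmxK // unitmx_mul uQ.
Qed.

Variable Lam : R -> 'M[R]_(n + n).
Hypothesis Lam_rep : represents b Ref Lam.

Lemma represents_sp t : sp w0 (Lam t).
Proof.
have [i di] := cotangent_cover (w 0); have [j dj] := cotangent_cover (w (e * b t)).
rewrite (Lam_rep di dj); have [_ s0 _] := (Ref_frame 0).2 i (ref0 di).
rewrite b0 mulr0 in s0; have [_ s1 _] := (Ref_frame t).2 j dj.
exact: (sp_conj (frame_unit (Ref_frame t) dj) s0 s1 (lin_omega sigma_closed Ks Hw di dj)).
Qed.

Lemma represents0 : Lam 0 = 1%:M.
Proof.
have [i di] := cotangent_cover (w 0); rewrite (Lam_rep di (ref0 di)) b0 mulr0.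
by rewrite (lin0 FK di) mulmx1 mulmxV // (frame_unit (Ref_frame 0) (ref0 di)).
Qed.

Lemma represents_continuous : continuous Lam.
Proof.
move=> t; have [i di] := cotangent_cover (w 0); have [j dj] := cotangent_cover (w (e * b t)).
have ceb : {for t, continuous (fun s => e * b s)} by apply: cvgM; [exact: cvg_cst|exact: cb].
have nj : \forall s \near t, dom j (w (e * b s)) by exact: ceb _ (orbit_near Hw dj).
apply: (@near_eq_continuous _ _ (fun s => Ref 0 i *m lin (ham sigma K) w i j (e * b s) *m invmx (Ref s j))).
  by apply: filterS nj => s dsj; rewrite (Lam_rep di dsj).
have cl := lin_continuous sigma_closed Ks Hw di dj.
apply: cvg_mulmx; last first.
  by apply: cvg_invmx; [have [] := (Ref_frame t).2 j dj|exact: frame_unit (Ref_frame t) dj].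
apply: cvg_mulmx; first exact: cvg_cst.
exact: (@continuous_comp _ _ _ (fun s => e * b s) (lin (ham sigma K) w i j)).
Qed.

Lemma represents_sp_on D : sp_on w0 D Lam.
Proof. by split; [exact: continuous_cont_on represents_continuous|move=> t _; exact: represents_sp]. Qed.

Lemma represents_unit t : Lam t \in unitmx.
Proof. have s := represents_sp t; exact: (sp_unit omega0K s). Qed.

End Reference.

(** Two frames along the orbit differ by a loop in [vp], after reparametrization by [b];
    [cz_trivialization] and [cz_reparam] remove both differences. *)
Lemma represents_cz (b : R -> R) Ref Lam Ref1 Lam1 tau tau1 mu : 0 <= tau -> 0 <= tau1 ->
  continuous b -> b 0 = 0 -> b tau = tau1 -> (forall t, itv 0 tau t -> itv 0 tau1 (b t)) ->
  (forall t, frame_at sigma (fun t => w (e * b t)) Ref t) -> represents b Ref Lam ->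
  (forall t, frame_at sigma (fun t => w (e * t)) Ref1 t) -> represents id Ref1 Lam1 ->
  w (e * tau1) = w 0 -> (forall j, dom j (w 0) -> Ref tau j = Ref 0 j) ->
  (forall j, dom j (w 0) -> Ref1 tau1 j = Ref1 0 j) ->
  cz w0 0 tau Lam mu -> cz w0 0 tau1 Lam1 mu.
Proof.
move=> t0 t10 cb b0 b1 bI fR rR fR1 rR1 wt perR perR1 hmu.
have fRb t : frame_at sigma (fun t => w (e * b t)) (fun t => Ref1 (b t)) t.
  exact: (frame_comp (y := fun t => w (e * t)) (cb t) (fR1 (b t))).
have dw0 i : dom i (w 0) -> dom i (w (e * b 0)) by rewrite b0 mulr0.
have [j0 hj0] := choice (fun t => cotangent_cover (w (e * b t))).
pose G t := Ref1 (b t) (j0 t) *m invmx (Ref t (j0 t)).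
have GE t j : dom j (w (e * b t)) -> G t = Ref1 (b t) j *m invmx (Ref t j).
  move=> dj; have r1 := (fR t).1 (j0 t) j (hj0 t) dj; have r2 := (fRb t).1 (j0 t) j (hj0 t) dj.
  rewrite /G r1 r2; have uT := tjac_unit okC (hj0 t) dj; have uR := frame_unit (fR t) (hj0 t).
  move: (tjac _ _ _) (Ref1 _ _) (Ref t (j0 t)) uT uR => T P Q uT uQ.
  have -> : P *m T = P *m invmx Q *m (Q *m T) by rewrite mulmxA mulmxKV.
  by rewrite mulmxK // unitmx_mul uQ.
have vG t : vp (G t) by have [] := frame_vp (fun _ _ => false) (fRb t) (fR t) (hj0 t).
have cG : continuous G.
  move=> t; have [j dj] := cotangent_cover (w (e * b t)).
  have ceb : {for t, continuous (fun s => e * b s)} by apply: cvgM; [exact: cvg_cst|exact: cb].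
  have nj : \forall s \near t, dom j (w (e * b s)) by exact: ceb _ (orbit_near Hw dj).
  apply: (@near_eq_continuous _ _ (fun s => Ref1 (b s) j *m invmx (Ref s j))).
    by apply: filterS nj => s dsj; rewrite (GE s j dsj).
  apply: cvg_mulmx; first by have [] := (fRb t).2 j dj.
  by apply: cvg_invmx; [have [] := (fR t).2 j dj|exact: frame_unit (fR t) dj].
have Gper : G tau = G 0.
  have [i di] := cotangent_cover (w 0).
  have di1 : dom i (w (e * b tau)) by rewrite b1 wt.
  by rewrite (GE tau i di1) (GE 0 i (dw0 i di)) b1 b0 (perR i di) (perR1 i di).
have sL := represents_sp_on cb b0 fR rR.
have sL1 := represents_sp_on (b := id) (fun t => cvg_id) erefl fR1 rR1.
have h1 := cz_trivialization t0 (sL (itv 0 tau)) (continuous_cont_on cG) (fun t _ => vG t) Gper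
  (represents0 b0 fR rR) hmu.
have [mu1 hmu1] := cz_exists omega0_skew omega0K t10 (sL1 (itv 0 tau1)).
have h2 := cz_reparam (continuous_cont_on cb (D := itv 0 tau)) bI b0 b1 hmu1.
have h3 : cz w0 0 tau (Lam1 \o b) mu.
  apply: cz_eq h1 => t _ /=.
  have [i di] := cotangent_cover (w 0); have [j dj] := cotangent_cover (w (e * b t)).
  rewrite (rR1 (b t) i j di dj) (rR t i j di dj) (GE t j dj) (GE 0 i (dw0 i di)) b0.
  have u1 := frame_unit (fRb t) dj; have u2 := frame_unit (fR t) dj; have u3 := frame_unit (fR 0) (dw0 i di).
  move: (lin _ _ _ _ _) (Ref1 _ i) (Ref1 _ j) (Ref 0 i) (Ref t j) u1 u2 u3 => D P1 Q1 P Q u1 u2 u3.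
  have -> : P1 *m invmx P *m (P *m D *m invmx Q) = P1 *m D *m invmx Q1 *m (Q1 *m invmx Q).
    by rewrite !mulmxA mulmxKV // mulmxKV.
  by rewrite mulmxK // unitmx_mul u1 unitmx_inv.
have sLb : sp_on w0 (itv 0 tau) (Lam1 \o b).
  split; last by move=> t _; exact: (represents_sp (b := id) erefl fR1 rR1).
  apply: continuous_cont_on => t; apply: continuous_comp; first exact: cb.
  exact: (represents_continuous (b := id) (fun t => cvg_id) fR1 rR1).
by rewrite (cz_unique omega0_skew omega0K t0 sLb h3 h2).
Qed.

End Path.

Section Value.
Variable K : cotangent M -> R.
Hypothesis Ks : smooth_fun CT K.
Variables (w x : R -> cotangent M) (eta tau : R).
Hypothesis Hw : gcurve (ham sigma K) (fun=> 1) setT w.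
Let e := Num.sg eta.
Hypothesis tau0 : 0 < tau.
Hypothesis etaE : `|eta| = tau.
Hypothesis xw : forall t, x (t / tau) = w (e * t).
Hypothesis wper : w (e * tau) = w 0.

(** It resolves the choice in [conley_zehnder]: the periodic frame [Ref1] shows that an admissible
    trivialization exists, and [represents_cz] shows that each one gives the value computed in
    [Ref]. *)
Lemma conley_zehnder_value (b : R -> R) Ref Lam Ref1 sig0 mu : 0 <= sig0 ->
  continuous b -> b 0 = 0 -> b sig0 = tau -> (forall t, itv 0 sig0 t -> itv 0 tau (b t)) ->
  (forall t, frame_at sigma (fun t => w (e * b t)) Ref t) -> represents K w e b Ref Lam ->
  (forall j, dom j (w 0) -> Ref sig0 j = Ref 0 j) ->
  (forall t, frame_at sigma (fun t => w (e * t)) Ref1 t) ->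
  (forall t j, Ref1 (t + tau) j = Ref1 t j) ->
  cz w0 0 sig0 Lam mu -> conley_zehnder sigma K x eta = mu.
Proof.
move=> s0 cb b0 b1 bI fR rR perR fR1 perR1 hmu.
rewrite /conley_zehnder etaE -/e.
have -> : (fun t => x (t / tau)) = (fun t => w (e * t)) by apply/funext => t; exact: xw.
have lp Om lam : represents K w e id Om lam -> linearized_path sigma K e (fun t => w (e * t)) tau Om lam.
  move=> r t i j _; rewrite mulr0 => di dj.
  by rewrite (r t i j di dj) (dflow_lin sigma Ks).
have lp2 Om lam Lam2 : linearized_path sigma K e (fun t => w (e * t)) tau Om lam ->
    represents K w e id Om Lam2 -> forall t, itv 0 tau t -> Lam2 t = lam t.
  move=> l r t ht; have [i di] := cotangent_cover (w 0); have [j dj] := cotangent_cover (w (e * t)).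
  have := l t i j ht; rewrite mulr0 => /(_ di dj) ->.
  by rewrite (r t i j di dj) (dflow_lin sigma Ks).
set S := [set m | _].
have [Om [lam [vt l ->]]] : S (xget 0 S).
  apply: (xgetPex 0).
  have [Lam1 rL1] := represents_exists Ks Hw (b := id) erefl fR1.
  exists (conley_zehnder_path tau Lam1), Ref1, Lam1; split=> //; last exact: lp.
  exact: frame_triv.
have fO := triv_frame vt; have [_ _ perO _ _] := vt.
have [Lam2 rL2] := represents_exists Ks Hw (b := id) erefl fO.
have perO' j : dom j (w 0) -> Om tau j = Om 0 j.
  by move=> dj; rewrite -[tau]add0r perO // mulr0.
have h := represents_cz Ks Hw s0 (ltW tau0) cb b0 b1 bI fR rR fO rL2 wper perR perO' hmu.
have E := lp2 _ _ _ l rL2.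
have sl : sp_on w0 (itv 0 tau) lam.
  split.
    apply: cont_on_near => t ht; exists Lam2; split; last by apply: filterE => s /E.
    exact: (represents_continuous (b := id) Ks Hw (fun t => cvg_id) fO rL2).
  by move=> t /E <-; exact: (represents_sp (b := id) Ks Hw erefl fO rL2).
exact: (conley_zehnder_path_cz tau0 sl (cz_eq E h)).
Qed.

End Value.

End Trivializations.

Lemma underlying_curve {R : realType} {n : nat} (M : manifold R n) (sigma : tensor2 M)
    (K : cotangent M -> R) (Ks : smooth_fun (cotangent_charts M) K) (x : R -> cotangent M) (eta : R) :
  eta != 0 -> integral_curve sigma K eta [set: R] x ->
  gcurve (ham sigma K) (fun=> 1) setT (underlying x eta).
Proof.
move=> eta0 /(integral_curveP sigma Ks) Hx t i _ di.
have dt : is_derive t (1 : R) (fun t : R => t / eta) eta^-1.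
  have := @is_deriveM R R id (fun=> eta^-1) t 1 _ _ (is_derive_id t 1) (is_derive_cst (eta^-1) t 1).
  by move/is_derive_eq; apply; rewrite scaler0 add0r [_ *: _]mulr1.
have [nx dx] := Hx (t / eta) i Logic.I di.
split; first exact: (is_derive_continuous dt) _ nx.
have := is_derive_mx_comp (f := crd i \o x) (g := fun t : R => t / eta) dx dt.
by rewrite scalerA mulVf.
Qed.

Lemma underlying_periodic {R : realType} {n : nat} (M : manifold R n) (x : R -> cotangent M) (eta : R) :
  eta != 0 -> (forall t, x (t + 1) = x t) ->
  forall t, underlying x eta (t + `|eta|) = underlying x eta t.
Proof.
move=> eta0 xp t; rewrite /underlying mulrDl.
have [e|e] : `|eta| / eta = 1 \/ `|eta| / eta = - 1.
  have [h|h] := ger0P eta; first by left; rewrite divff.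
  by right; rewrite mulNr divff.
  by rewrite e xp.
by rewrite e -[in RHS](subrK 1 (t / eta)) xp.
Qed.

Lemma sg_pm1 {R : realType} (eta : R) : eta != 0 -> Num.sg eta = 1 \/ Num.sg eta = - 1.
Proof.
by move=> h; have [e|e|e] := ltgtP eta 0; [right; rewrite ltr0_sg|left; rewrite gtr0_sg|rewrite e eqxx in h].
Qed.

Lemma integral_primitive {R : realType} (g G : R -> R) (a : R) : continuous g ->
  (forall t, is_derive t (1 : R) G (g t)) -> 0 < a ->
  Rintegral lebesgue_measure `[0, a]%classic g = G a - G 0.
Proof.
move=> cg dG a0; rewrite /Rintegral.
have dGd t : derivable G t 1 by case: (dG t).
have cG : continuous G by move=> t; exact: is_derive_continuous (dG t).
rewrite (@continuous_FTC2 _ g G 0 a) //.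
- exact: continuous_subspaceT.
- split=> [t _||]; first exact: dGd.
    by apply: cvg_at_right_filter; exact: cG.
  by apply: cvg_at_left_filter; exact: cG.
- by move=> t _; rewrite derive1E; case: (dG t).
Qed.

Lemma increasing_primitive {R : realType} (g G : R -> R) (s t : R) :
  (forall t, is_derive t (1 : R) G (g t)) -> (forall t, 0 < g t) -> s < t -> G s < G t.
Proof.
move=> dG gp st; have [r _ e] := @mvt_between R G g s t (fun r _ => dG r).
by rewrite -subr_gt0 e mulr_gt0 // subr_gt0.
Qed.

Lemma annihilator_line {R : realType} N (x u : 'rV[R]_N) :
  (forall m : 'cV[R]_N, (x *m m) 0 0 = 0 -> (u *m m) 0 0 = 0) -> exists a, u = a *: x.
Proof.
move=> h; apply/sub_rVP; rewrite submxE; apply/eqP/rowP => j.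
have E (w : 'rV[R]_N) : w *m col j (cokermx x) = col j (w *m cokermx x) by rewrite !colE mulmxA.
have := h (col j (cokermx x)); rewrite !E mulmx_coker.
move: (u *m cokermx x) => w; rewrite (_ : col j 0 = 0) ?[in X in X -> _]mxE; last by apply/colP => a; rewrite !mxE.
by move=> /(_ erefl); rewrite !mxE.
Qed.

Lemma sform_conj {R : realType} N (J Om P : 'M[R]_N) (a b : 'rV[R]_N) : P \in unitmx ->
  P *m Om *m P^T = J ->
  sform J (a *m invmx P) (b *m invmx P) = (a *m Om *m b^T) 0 0.
Proof.
move=> uP <-; rewrite /sform trmx_mul !mulmxA mulmxKV //.
by rewrite -(mulmxA (a *m Om)) -trmx_mul mulVmx // trmx1 mulmx1.
Qed.

Lemma conj_mulmx_eq {R : realType} N (P D L : 'M[R]_N) (a x : 'rV[R]_N) (b : R) : P \in unitmx ->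
  L = P *m D *m invmx P -> a *m D = a + b *: x ->
  a *m invmx P *m L = a *m invmx P + b *: (x *m invmx P).
Proof. by move=> uP -> e; rewrite !mulmxA mulmxKV // e mulmxDl scalemxAl. Qed.

Lemma conj_mulmx_fix {R : realType} N (P D L : 'M[R]_N) (a : 'rV[R]_N) : P \in unitmx ->
  L = P *m D *m invmx P -> a *m D = a -> a *m invmx P *m L = a *m invmx P.
Proof. by move=> uP -> e; rewrite !mulmxA mulmxKV // e. Qed.

Lemma mulmx_rescale {R : realType} N (D : 'M[R]_N) (a w x : 'rV[R]_N) (b r : R) : r != 0 ->
  a *m D = a - b *: w -> x = r *: w ->
  (r^-1 *: a) *m D = r^-1 *: a + (- b / r ^+ 2) *: x.
Proof.
move=> r0 e ->; rewrite -scalemxAl e scalerBr -scaleNr !scalerA; congr (_ + _ *: _).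
by field.
Qed.

(** Passage from a chart to the frame [P]. The positivity follows from [xi U = r xi]: invariance of
    the pairing gives [r] times the value in question equal to 1. *)
Lemma conj_xi_unip {R : realType} N (J Om P U A : 'M[R]_N) (xi v : 'rV[R]_N) (g : 'cV[R]_N) (r : R) :
  P \in unitmx -> P *m Om *m P^T = J -> Om *m xi^T = g -> A = P *m U *m invmx P -> sp J A ->
  0 < r -> xi *m U = r *: xi ->
  (forall (u : 'rV[R]_N) (m : 'cV[R]_N), (u *m g) 0 0 = 0 -> (xi *m m) 0 0 = 0 -> u *m U *m m = u *m m) ->
  (v *m g) 0 0 = 1 ->
  xi_unip J (xi *m invmx P) A /\ 0 < sform J (v *m invmx P *m A) (xi *m invmx P).
Proof.
move=> uP PP Og AE sA r0 xU hU vg.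
have sE a : sform J (a *m invmx P) (xi *m invmx P) = (a *m g) 0 0.
  by rewrite (sform_conj _ _ uP PP) -mulmxA Og.
split; last first.
  have xA : xi *m invmx P *m A = r *: (xi *m invmx P) by rewrite AE !mulmxA mulmxKV // xU scalemxAl.
  have := (spP J A).1 sA (v *m invmx P) (xi *m invmx P).
  rewrite xA sformZr sE vg => h.
  by rewrite -(pmulr_rgt0 _ r0) h.
split=> // u; rewrite -[u](mulmxK uP) sE => ug.
have [a ua] : exists a, u *m P *m U - u *m P = a *: xi.
  apply: annihilator_line => m xm; rewrite mulmxBl (hU _ _ ug xm).
  by rewrite subrr mxE.
exists a; rewrite AE !mulmxA !mulmxKV // -[u *m P *m U](subrK (u *m P)) ua.
by rewrite mulmxDl -scalemxAl addrC.
Qed.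

(** * Two Hamiltonians along a common characteristic *)

Section Comparison.
Context {R : realType} {n : nat} (M : manifold R n).
Local Notation CT := (cotangent_charts M).
Local Notation I := (idx CT).
Local Notation w0 := (omega0 : 'M[R]_(n + n)).
Implicit Types (i j : I).
Let okC := cotangent_atlas_ok M.
Variable sigma : tensor2 M.
Hypothesis sigma_closed : closed_2form sigma.

Variables (H F f : cotangent M -> R) (k : R).
Hypothesis Hs : smooth_fun CT H.
Hypothesis Fs : smooth_fun CT F.
Hypothesis k_regular : regular_value H k.
Hypothesis f_smooth : smooth_on_subset CT (level H k) f.
Hypothesis f_pos : forall z, level H k z -> 0 < f z.
Hypothesis X_proportional : proportional_on sigma (level H k) H F f.
Hypothesis M_orientable : orientable M.
Variables (z zF : R -> cotangent M).
Hypothesis Hz : gcurve (ham sigma H) (fun=> 1) setT z.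
Hypothesis HzF : gcurve (ham sigma F) (fun=> 1) setT zF.
Hypothesis Lz : forall t, level H k (z t).
Hypothesis z0 : zF 0 = z 0.
Variables (beta : R -> R) (e tau tauF : R).
Hypothesis dbeta : forall t, is_derive t (1 : R) beta (f (z t)).
Hypothesis beta0 : beta 0 = 0.
Hypothesis e1 : e = 1 \/ e = - 1.
Hypothesis tau0 : 0 < tau.
Hypothesis tauF0 : 0 < tauF.
Hypothesis zper : forall t, z (t + tau) = z t.
Hypothesis zFper : forall t, zF (t + tauF) = zF t.
Hypothesis beta_tau : beta tau = tauF.

Lemma ee : e * e = 1.
Proof. by case: e1 => ->; rewrite ?mulr1 // mulrNN mulr1. Qed.

Lemma periodic_e (T : Type) (g : R -> T) (p : R) : (forall t, g (t + p) = g t) ->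
  forall t, g (e * (t + p)) = g (e * t).
Proof.
move=> gp t; case: e1 => ->; first by rewrite !mul1r gp.
by rewrite !mulN1r -[in RHS](subrK p (- t)) gp opprD.
Qed.

(** The time change between the two orbits, both traversed in the direction [e]. *)
Let b (t : R) := e * beta (e * t).

Lemma db t : is_derive t (1 : R) b (f (z (e * t))).
Proof.
have d1 : is_derive t (1 : R) (fun t : R => e * t) e.
  have d : is_derive t (1 : R) (fun t : R => e * t) (e *: 1) by exact: is_deriveZ.
  by rewrite [_ *: _]mulr1 in d.
have d2 := is_derive1_comp (dbeta (e * t)) d1.
have d3 : is_derive t (1 : R) b (e *: (f (z (e * t)) * e)) by exact: is_deriveZ.
by apply: (is_derive_eq d3); rewrite [e *: _]mulrCA ee mulr1.
Qed.

Lemma b_continuous : continuous b.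
Proof. by move=> t; exact: is_derive_continuous (db t). Qed.

Lemma b_zero : b 0 = 0. Proof. by rewrite /b mulr0 beta0 mulr0. Qed.

(** For [e = - 1] the claim is [beta (- tau) = - beta tau], which comes from the periodicity of [f]
    along the orbit. *)
Lemma b_tau : b tau = tauF.
Proof.
rewrite /b; case: e1 => ->; first by rewrite !mul1r.
have d t : is_derive t (1 : R) (fun t => beta (tau + t) - beta t) 0.
  have h := is_derive1_comp (dbeta (tau + t)) (is_derive_addl tau t).
  have := is_deriveB h (dbeta t) => /is_derive_eq; apply.
  by rewrite mulr1 addrC (addrC tau) zper addNr || by rewrite mulr1 (addrC tau) zper subrr.
have t0 := tau0; have tI : - tau - 1 < - tau < 1 by apply/andP; split; lra.
have oI : - tau - 1 < (0 : R) < 1 by apply/andP; split; lra.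
have := derive_zero_const (fun t _ => d t) tI oI; rewrite subrr addr0 beta0 !mulN1r subr0 sub0r.
by move=> ->.
Qed.

Lemma b_range t : itv 0 tau t -> itv 0 tauF (b t).
Proof.
have inc s r := increasing_primitive (s := s) (t := r) db (fun t => f_pos (Lz (e * t))).
move=> /= /andP[h1 h2]; rewrite -b_zero -b_tau; apply/andP; split.
  by move: h1; rewrite le_eqVlt => /orP[/eqP ->|/inc/ltW].
by move: h2; rewrite le_eqVlt => /orP[/eqP ->|/inc/ltW].
Qed.

Lemma reparam t : zF (e * b t) = z (e * t).
Proof.
rewrite /b mulrA ee mul1r.
exact: (reparam_orbit sigma_closed Hs Fs f_smooth X_proportional Hz HzF Lz z0 dbeta beta0).
Qed.

Lemma ze_tau : z (e * tau) = z 0.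
Proof. by have := periodic_e zper 0; rewrite add0r mulr0. Qed.

Lemma zFe_tau : zF (e * tauF) = zF 0.
Proof. by have := periodic_e zFper 0; rewrite add0r mulr0. Qed.

Variables (x x' : R -> cotangent M) (eta eta' : R).
Hypothesis etaE : `|eta| = tau.
Hypothesis eta'E : `|eta'| = tauF.
Hypothesis sg_eta : Num.sg eta = e.
Hypothesis sg_eta' : Num.sg eta' = e.
Hypothesis xz : forall t, x (t / tau) = z (e * t).
Hypothesis xz' : forall t, x' (t / tauF) = zF (e * t).

Lemma conley_zehnder_change i (v v2 : 'rV[R]_(n + n)) (c cF : R) : dom i (z 0) ->
  (v *m grad (rep i H) (crd i (z 0))) 0 0 = 1 ->
  v *m lin (ham sigma H) z i i (e * tau) = v - c *: ham sigma H i (crd i (z 0)) ->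
  (v2 *m grad (rep i F) (crd i (z 0))) 0 0 = 1 ->
  v2 *m lin (ham sigma F) zF i i (e * tauF) = v2 - cF *: ham sigma F i (crd i (z 0)) ->
  conley_zehnder sigma F x' eta' =
    conley_zehnder sigma H x eta + 2^-1 * (Num.sg (- cF) - Num.sg (- c)).
Proof.
move=> di vH vD v2F v2D.
have FH := ham_field_ok sigma_closed Hs; have FF := ham_field_ok sigma_closed Fs.
have [eps [eps_near eps_det]] := M_orientable.
have [OmH [fOmH pOmH]] := periodic_frame sigma_closed Hs eps_near eps_det Hz tau0 zper.
have [OmF [fOmF pOmF]] := periodic_frame sigma_closed Fs eps_near eps_det HzF tauF0 zFper.
have ce : continuous (fun t : R => e * t).
  by move=> t; apply: cvgM; [exact: cvg_cst|exact: cvg_id].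
pose Ref t := OmH (e * t); pose RefF t := OmF (e * t).
have fRef t : frame_at sigma (fun t => z (e * t)) Ref t.
  exact: (frame_comp (ce t) (fOmH (e * t))).
have fRefF t : frame_at sigma (fun t => zF (e * t)) RefF t.
  exact: (frame_comp (ce t) (fOmF (e * t))).
(* The [F]-path is read in the frame built for [H], at corresponding times, so that the two paths
   differ by left multiplication by [A]. *)
have fRefb t : frame_at sigma (fun t => zF (e * b t)) Ref t.
  have -> : (fun t => zF (e * b t)) = (fun t => z (e * t)) by apply/funext => s; exact: reparam.
  exact: fRef.
have pRef t j : Ref (t + tau) j = Ref t j.
  exact: (periodic_e (g := fun t => OmH t j) (fun t => pOmH t j)).
have pRefF t j : RefF (t + tauF) j = RefF t j.
  exact: (periodic_e (g := fun t => OmF t j) (fun t => pOmF t j)).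
have pRef0 j : Ref tau j = Ref 0 j by rewrite -[tau]add0r pRef.
have [LH rLH] := represents_exists sigma_closed Hs Hz (b := id) erefl fRef.
have [LF rLF] := represents_exists sigma_closed Fs HzF b_zero fRefb.
have cid : continuous (id : R -> R) by move=> t; exact: cvg_id.
have sLH := represents_sp_on sigma_closed Hs Hz (b := id) cid erefl fRef rLH.
have sLF := represents_sp_on sigma_closed Fs HzF b_continuous b_zero fRefb rLF.
have uLH := represents_unit sigma_closed Hs Hz (b := id) erefl fRef rLH.
have [mu hmu] := cz_exists omega0_skew omega0K (ltW tau0) (sLH (itv 0 tau)).
have -> : conley_zehnder sigma H x eta = mu.
  have := @conley_zehnder_value _ _ _ _ sigma_closed _ Hs z x eta tau Hz tau0 etaE.
  rewrite sg_eta => /(_ xz ze_tau id Ref LH Ref tau mu (ltW tau0) cid erefl erefl); apply=> //.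
pose A t := LF t *m invmx (LH t).
have diF : dom i (zF 0) by rewrite z0.
pose P := Ref 0 i.
have di0 : dom i (z (e * 0)) by rewrite mulr0.
have uP : P \in unitmx := frame_unit (fRef 0) di0.
have PP : P *m omega sigma i (z 0) *m P^T = w0.
  by have [_ s _] := (fRef 0).2 i di0; rewrite mulr0 in s.
have gpos t := f_pos (Lz t).
pose xi := ham sigma H i (crd i (z 0)).
have xiF : xi = f (z 0) *: ham sigma F i (crd i (z 0)) := ham_prop Hs Fs X_proportional (Lz 0) di.
have gradH : omega sigma i (z 0) *m xi^T = grad (rep i H) (crd i (z 0)) := ham_grad sigma H di.
have gradF : grad (rep i H) (crd i (z 0)) = f (z 0) *: grad (rep i F) (crd i (z 0)).
  exact: (grad_prop Hs Fs X_proportional (Lz 0) di).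
pose xh := xi *m invmx P; pose yh := v *m invmx P.
(* On the hypersurface [dH = f dF], so [v2] is divided by [f] to pair to 1 with the field of [H].
   The monodromy coefficient is thereby divided by [f^2], which keeps its sign. *)
pose y2 := ((f (z 0))^-1 *: v2) *m invmx P.
have sfE (a : 'rV[R]_(n + n)) : sform w0 (a *m invmx P) xh = (a *m grad (rep i H) (crd i (z 0))) 0 0.
  by rewrite /xh (sform_conj _ _ uP PP) -mulmxA gradH.
have AE t j : dom j (z (e * t)) ->
    A t = P *m (lin (ham sigma F) zF i j (beta (e * t)) *m invmx (lin (ham sigma H) z i j (e * t))) *m invmx P.
  move=> dj; have djF : dom j (zF (e * b t)) by rewrite reparam.
  rewrite /A (rLF t i j diF djF) (rLH t i j di dj) /= -/P.
  have -> : e * b t = beta (e * t) by rewrite /b mulrA ee mul1r.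
  have uR := frame_unit (fRef t) dj; have uD := lin_unit sigma_closed Hs Hz di dj.
  move: (lin _ _ _ _ _) (lin _ _ _ _ _) (Ref t j) uR uD => DF D Q uR uD.
  have -> : P *m DF *m invmx Q = P *m (DF *m invmx D) *m invmx P *m (P *m D *m invmx Q).
    by rewrite !mulmxA mulmxKV // mulmxKV.
  by rewrite mulmxK // !unitmx_mul unitmx_inv uP uD.
have xiU j s : dom j (z s) -> xi *m (lin (ham sigma F) zF i j (beta s) *m invmx (lin (ham sigma H) z i j s)) =
    (f (z 0) / f (z s)) *: xi.
  move=> dj; have rs : zF (beta s) = z s.
    exact: (reparam_orbit sigma_closed Hs Fs f_smooth X_proportional Hz HzF Lz z0 dbeta beta0).
  have djF : dom j (zF (beta s)) by rewrite rs.
  have l1 := lin_field FF HzF diF djF; have l2 := lin_field FH Hz di dj.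
  have uD := lin_unit sigma_closed Hs Hz di dj.
  rewrite rs z0 in l1; rewrite mulmxA {1}xiF -scalemxAl l1 -scalemxAl.
  have -> : ham sigma F j (crd j (z s)) = (f (z s))^-1 *: (xi *m lin (ham sigma H) z i j s).
    by rewrite l2 (ham_prop Hs Fs X_proportional (Lz s) dj) scalerA mulVf ?scale1r // gt_eqF.
  move: (lin (ham sigma H) z i j s) uD => D uD; clearbody xi.
  by rewrite -scalemxAl mulmxK // scalerA.
have hxi : sform w0 yh xh = 1 by rewrite sfE.
have AU t : xi_unip w0 xh (A t) /\ 0 < sform w0 (yh *m A t) xh.
  have [j dj] := cotangent_cover (z (e * t)).
  have sA : sp w0 (A t) by apply: spM; [exact: (sLF setT).2|apply: (spV omega0K); exact: (sLH setT).2].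
  have U := transport_unip sigma_closed Hs Fs k_regular f_smooth f_pos X_proportional Hz HzF Lz z0
    dbeta beta0 di dj.
  have fr : 0 < f (z 0) / f (z (e * t)) by rewrite divr_gt0.
  exact: (conj_xi_unip uP PP gradH (AE t j dj) sA fr (xiU j _ dj) (fun v m h1 h2 => U v m h1 h2) vH).
have dit : dom i (z (e * tau)) by rewrite ze_tau.
have ditF : dom i (zF (e * b tau)) by rewrite b_tau zFe_tau.
have xiLH : xh *m LH tau = xh.
  apply: (conj_mulmx_fix (D := lin (ham sigma H) z i i (e * tau)) uP).
    by rewrite (rLH tau i i di dit) pRef0.
  by have := lin_field FH Hz di dit; rewrite ze_tau.
have yLH : yh *m LH tau = yh + (- c) *: xh.
  apply: (conj_mulmx_eq (D := lin (ham sigma H) z i i (e * tau)) uP).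
    by rewrite (rLH tau i i di dit) pRef0.
  exact: (etrans vD (congr1 (fun w => v + w) (esym (scaleNr c xi)))).
have LFt : LF tau = P *m lin (ham sigma F) zF i i (e * tauF) *m invmx P.
  by rewrite (rLF tau i i diF ditF) pRef0 b_tau.
have ALt t : A t *m LH t = LF t by rewrite /A mulmxKV.
have xiLF : xh *m (A tau *m LH tau) = xh.
  rewrite ALt; apply: (conj_mulmx_fix uP LFt).
  have dieF : dom i (zF (e * tauF)) by rewrite zFe_tau.
  have := lin_field FF HzF diF dieF; rewrite zFe_tau z0 xiF => h.
  by rewrite -scalemxAl; exact: (congr1 ( *:%R (f (z 0))) h).
have yLF : y2 *m (A tau *m LH tau) = y2 + (- cF / f (z 0) ^+ 2) *: xh.
  rewrite ALt; apply: (conj_mulmx_eq uP LFt).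
  exact: (mulmx_rescale (lt0r_neq0 (gpos 0)) v2D xiF).
have s2 : sform w0 y2 xh = 1.
  rewrite sfE gradF -scalemxAl -scalemxAr scalerA mulVf ?scale1r //.
  exact: (lt0r_neq0 (gpos 0)).
have cA : cont_on (itv 0 tau) A.
  have cLH := represents_continuous sigma_closed Hs Hz (b := id) cid fRef rLH.
  have cLF := represents_continuous sigma_closed Fs HzF b_continuous fRefb rLF.
  apply: continuous_cont_on => t; apply: cvg_mulmx; first exact: cLF.
  by apply: cvg_invmx; [exact: cLH|exact: uLH].
have lH0 : LH 0 = 1%:M := represents0 sigma_closed Hs (b := id) erefl fRef rLH.
have lF0 : LF 0 = 1%:M := represents0 sigma_closed Fs b_zero fRefb rLF.
have A0 : A 0 = 1%:M by rewrite /A lH0 lF0 invmx1 mulmx1.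
have := cz_index_change omega0_skew omega0K hxi (ltW tau0) (sLH (itv 0 tau)) lH0 cA
  (fun t _ => AU t) A0 xiLH yLH xiLF s2 yLF hmu.
have -> : Num.sg (- cF / f (z 0) ^+ 2) = Num.sg (- cF).
  by rewrite sgrM (gtr0_sg (_ : 0 < (f (z 0) ^+ 2)^-1)) ?mulr1 // invr_gt0 exprn_gt0.
move/(cz_eq (fun t _ => ALt t)) => hLF.
have := @conley_zehnder_value _ _ _ _ sigma_closed _ Fs zF x' eta' tauF HzF tauF0 eta'E.
rewrite sg_eta' => /(_ xz' zFe_tau b Ref LF RefF tau _ (ltW tau0) b_continuous b_zero b_tau b_range
  fRefb rLF (fun j _ => pRef0 j) fRefF pRefF hLF).
exact.
Qed.

End Comparison.

Theorem proposition1p8 (R : realType) (n : nat) (M : manifold R n)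
    (g sigma : tensor2 M)
    (M_compact : compact [set: M])
    (M_connected : connected [set: M])
    (M_orientable : orientable M)
    (g_metric : riemannian_metric g)
    (sigma_closed : closed_2form sigma)
    (sigma_bounded : lift_has_bounded_primitive g sigma)
    (H F f : cotangent M -> R) (k : R)
    (H_tonelli : tonelli g H)
    (k_regular : regular_value H k)
    (F_smooth : smooth_fun (cotangent_charts M) F)
    (F_level : level F k = level H k)
    (f_smooth : smooth_on_subset (cotangent_charts M) (level H k) f)
    (f_pos : forall z, level H k z -> 0 < f z)
    (X_proportional : proportional_on sigma (level H k) H F f)
    (x : R -> cotangent M) (eta : R) (x' : R -> cotangent M) (eta' : R)
    (eta_neq0 : eta != 0)
    (x_critical : rabinowitz_critical sigma H k x eta)
    (x'_critical : rabinowitz_critical sigma F k x' eta')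
    (x_x' : corresponding f x eta x' eta')
    (x_cylinder : nondegenerate_cylinder sigma H k x eta)
    (x'_cylinder : nondegenerate_cylinder sigma F k x' eta') :
  mu_rab sigma H k x eta = mu_rab sigma F k x' eta'.
Proof.
have [Hs _ _] := H_tonelli; have Fs := F_smooth.
have [xp _ xc Lx] := x_critical; have [xp' _ xc' Lx'] := x'_critical.
pose e := Num.sg eta; pose tau := `|eta|.
pose z := underlying x eta; pose zF := underlying x' eta'.
have e1 : e = 1 \/ e = - 1 by exact: sg_pm1.
have tau0 : 0 < tau by rewrite normr_gt0.
have Hz : gcurve (ham sigma H) (fun=> 1) setT z by exact: underlying_curve.
have Lz t : level H k (z t) by exact: Lx.
have cf := f_continuous f_smooth Hz Lz.
have [beta dbeta beta0] := primitive cf.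
have alphaE a : 0 < a ->
    Rintegral lebesgue_measure `[0, a]%classic (fun s => f (z s)) = beta a.
  by move=> a0; rewrite (integral_primitive cf dbeta a0) beta0 subr0.
have [etaE' orbE] := x_x'.
have eta'bE : eta' = e * beta tau by rewrite etaE' alphaE.
have tauF0 : 0 < beta tau.
  by rewrite -beta0; exact: increasing_primitive dbeta (fun t => f_pos _ (Lz t)) tau0.
have [sg' abs'] : Num.sg eta' = e /\ `|eta'| = beta tau.
  rewrite eta'bE sgrM normrM (gtr0_sg tauF0) (gtr0_norm tauF0) mulr1.
  by case: e1 => ->; rewrite ?sgrN ?normrN sgr1 normr1 mul1r.
have eta'0 : eta' != 0 by rewrite -normr_gt0 abs'.
have HzF : gcurve (ham sigma F) (fun=> 1) setT zF by exact: underlying_curve.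
have z0 : zF 0 = z 0.
  (* At time 0 the integral over a single point vanishes, so both orbits start at the same point. *)
  have := orbE 0; rewrite lexx ltW // => /(_ isT).
  by rewrite set_itv1 Rintegral_set1.
have zper t : z (t + tau) = z t by exact: underlying_periodic.
have zFper t : zF (t + beta tau) = zF t by rewrite -abs'; exact: underlying_periodic.
have scale (r : R) t : r != 0 -> Num.sg r * t / r = t / `|r|.
  by move=> r0; rewrite [`|r|]normrEsg; case: (sg_pm1 r0) => ->; rewrite ?mul1r // !mulN1r invrN mulrN mulNr.
have xz t : x (t / tau) = z (e * t) by rewrite /z /underlying scale.
have xz' t : x' (t / beta tau) = zF (e * t) by rewrite /zF /underlying -sg' scale // abs'.
(* The values selected by [correction] come with cylinders of their own, and the monodromy formula
   is applied to exactly these. *)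
have [epsH [YH [TH [cylH _ cE]]]] := xgetPex 0 x_cylinder.
have [epsF [YF [TF [cylF _ cFE]]]] := xgetPex 0 x'_cylinder.
have [i di] := cotangent_cover (z 0).
have [v [vH vD]] := cylinder_monodromy sigma_closed Hs cylH e1 di.
have diF : dom i (zF 0) by rewrite z0.
have [v2 [v2F v2D]] := cylinder_monodromy sigma_closed Fs cylF e1 diF.
rewrite /mu_rab /correction cE cFE -/e sg'.
rewrite -/zF abs' z0 in v2F v2D.
(* The direction [e] enters the monodromy coefficient of the traversed orbit and the sign of the
   correction term in the same way, so the two differences cancel for backward orbits as well. *)
have sgE (T : R) : Num.sg (- (e * T)) = e * Num.sg (- T).
  by rewrite -mulrN sgrM; congr (_ * _); exact: sgr_id.
rewrite (conley_zehnder_change sigma_closed Hs Fs k_regular f_smooth f_pos X_proportional M_orientable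
  Hz HzF Lz z0 dbeta beta0 e1 tau0 tauF0 zper zFper erefl erefl abs' erefl sg' xz xz' di vH vD v2F v2D).
by rewrite !sgE; ring.
Qed.
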